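(* Let $1<\alpha\le 5/2$, $\sigma^2>0$, and let $n=n_p$ be positive integers with $p/n_p\to\phi_n\in(1,\infty)$ as $p\to\infty$. Let $\mathsf{W2SG}_p^{\mathrm{DE}}$ be the finite-$p$ deterministic-equivalent gain (with power-law eigenvalues $\lambda_i=i^{-\alpha}$) and let $\gamma_T,c_T,G_m,\sigma_c^2,\sigma_{\mathrm{safe}}^2,J_\alpha$ be as defined in the context. **(a) Proportional regime.** Let $m=m_p\to\infty$ with $p/m_p\to\phi_m\in(1,\infty)$, and let $\mathsf{W2SG}^{\mathrm{DE}}:=\lim_{p\to\infty}\mathsf{W2SG}_p^{\mathrm{DE}}$. (i) If $1<\alpha\le2$, then $\mathsf{W2SG}^{\mathrm{DE}}>0$ for every $\phi_m>1$. (ii) If $2<\alpha\le1+\sqrt2$, there is a unique critical ratio $\phi_{m,\mathrm{crit}}>1$ (depending only on $\alpha,\phi_n$ and $\sigma^2$, with no restriction on $\sigma^2>0$; it is $\phi_{m,\mathrm{crit}}=\left[\int_0^1\frac{dx}{1+s_{\mathrm{crit}}x^\alpha}\right]^{-1}$ with $s_{\mathrm{crit}}>0$ the unique zero of $s\mapsto J_\alpha(s)$) such that $\mathsf{W2SG}^{\mathrm{DE}}>0$ if and only if $\phi_m<\phi_{m,\mathrm{crit}}$, equivalently $\lim_p m_p/p>1/\phi_{m,\mathrm{crit}}$. **(b) Fixed-sample regime.** For each fixed integer $m\ge1$, $\mathsf{W2SG}_p^{\mathrm{DE}}\to G_m$ as $p\to\infty$. (i) Let $1<\alpha<2$. If $\sigma^2<\sigma_c^2$,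 then $G_1<0$. Moreover $G_m\to(2-\alpha)\sigma^2\gamma_T/(1-\gamma_T)>0$ as $m\to\infty$ (real $m$); hence for $\sigma^2<\sigma_c^2$ there is at least one real $m_*>1$ with $G_{m_*}=0$. There is a threshold $\sigma_0^2\in(0,\sigma_c^2)$ (one may take $\sigma_0^2=M\tau_M/c_T$ for any $M\ge1$ such that $q_m>0$ and $K_m<0$ for all real $m\ge M$; such an $M$ exists) such that for $0<\sigma^2<\sigma_0^2$ this zero $m_*=:m_{\mathrm{crit}}^{\mathrm{HP}}$ is unique in $(1,\infty)$, $G_m>0$ for every $m>m_{\mathrm{crit}}^{\mathrm{HP}}$, and, with $\alpha,\phi_n$ fixed, as $\sigma^2\downarrow0$, $$m_{\mathrm{crit}}^{\mathrm{HP}}\sim\left[\frac{c_\alpha(1-\gamma_T)}{(2-\alpha)\sigma^2\gamma_T}\right]^{\frac1{\alpha-1}},\qquad c_\alpha:=\left[\frac{\pi}{\alpha}\csc\frac{\pi}{\alpha}\right]^\alpha .$$ (ii) Let $2<\alpha\le5/2$. If $\sigma^2\le\sigma_{\mathrm{safe}}^2$, then $G_m\le0$ for every integer $m\ge1$.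
   Context: **Finite-$p$ deterministic-equivalent gain.** For integers $1\le n<p$, $1\le m<p$ and $\lambda_i=i^{-\alpha}$ ($1\le i\le p$), let $\tau_T,\tau_S>0$ be the unique solutions of $\sum_{i=1}^p\frac{\lambda_i}{\lambda_i+\tau_T}=n$ and $\sum_{i=1}^p\frac{\lambda_i}{\lambda_i+\tau_S}=m$; put $\gamma_{T,p}=\frac1n\sum_{i=1}^p\frac{\lambda_i^2}{(\lambda_i+\tau_T)^2}$, $\gamma_{S,p}=\frac1m\sum_{i=1}^p\frac{\lambda_i^2}{(\lambda_i+\tau_S)^2}$, and $$\mathsf{W2SG}_p^{\mathrm{DE}}=-\frac{\tau_S^2}{1-\gamma_{S,p}}\sum_{i=1}^p\frac{\lambda_i^2}{(\lambda_i+\tau_S)^2(\lambda_i+\tau_T)}+\frac{2\sigma^2\tau_S}{n(1-\gamma_{T,p})}\sum_{i=1}^p\frac{\lambda_i^2}{(\lambda_i+\tau_S)(\lambda_i+\tau_T)^2}-\frac{\sigma^2\tau_S^2}{n(1-\gamma_{T,p})(1-\gamma_{S,p})}\sum_{i=1}^p\frac{\lambda_i^2}{(\lambda_i+\tau_S)^2(\lambda_i+\tau_T)^2}.$$ (This is the deterministic equivalent of teacher risk minus student risk for two-stage ridgeless linear regression, with $n$ labeled samples of noise variance $\sigma^2$ in Stage I and $m$ teacher-labeled samples in Stage II.) **Teacher constants.** $s_T>0$ is the unique solution of $\int_0^1\frac{dx}{1+s_Tx^\alpha}=\frac1{\phi_n}$; $\gamma_T:=\phi_n\int_0^1\frac{dx}{(1+s_Tx^\alpha)^2}\in(0,1)$;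 $c_T:=\gamma_T/(1-\gamma_T)$. **Function $J_\alpha$.** For $s>0$: $F(s)=\int_0^1\frac{dx}{1+sx^\alpha}$, $\gamma(s)=\frac1{F(s)}\int_0^1\frac{dx}{(1+sx^\alpha)^2}$, $A_y(s)=\int_0^1\frac{x^{y\alpha}}{(1+sx^\alpha)^2(1+s_Tx^\alpha)^2}dx$, and $J_\alpha(s)=2A_1(s)+\left(2-\frac1{1-\gamma(s)}\right)sA_2(s)$. **Fixed-$m$ quantities.** For real $m>0$, $\tau_m>0$ is the unique solution of $\sum_{i=1}^\infty\frac1{1+\tau_mi^\alpha}=m$. With $a_i=\frac1{1+\tau_mi^\alpha}$: $\gamma_m=\frac1m\sum_ia_i^2$, $\eta_m=\frac1m\sum_ia_i^3$, $q_m=\frac{1-2\gamma_m}{1-\gamma_m}$, $K_m=\gamma_m^2(2-\gamma_m)-\eta_m$, and $G_m=-m\tau_m+q_m\sigma^2c_T$. **Thresholds.** $\sigma_c^2:=\frac{\tau_1}{c_Tq_1}$ (one has $q_1>0$ for $1<\alpha\le5/2$). With $C_\alpha:=\int_0^\infty\frac{dx}{1+x^\alpha}=\frac{\pi}{\alpha\sin(\pi/\alpha)}$ (so $c_\alpha=C_\alpha^\alpha$), for $2<\alpha\le 5/2$: $\sigma_{\mathrm{safe}}^2:=\min\left\{\sigma_c^2,\ \frac{C_\alpha^\alpha}{c_T}\,\frac{\alpha+12}{3^{\alpha+1}(4-\alpha)}\right\}$. *)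

(* Defs.v *)
From Stdlib Require Import Reals ClassicalEpsilon.
From Coquelicot Require Import Coquelicot.
Open Scope R_scope.

(* "The unique solution of P".  The value is arbitrary when P has no solution,
   so nothing can be proved about it without proving solvability. *)
Definition solution (P : R -> Prop) : R := epsilon (inhabits 0) P.

(* Real power on [0, +oo) with 0 ^ a = 0; Stdlib's [Rpower 0 a] equals 1. *)
Definition rpow (x a : R) : R := if Rlt_dec 0 x then Rpower x a else 0.

Definition lambda (alpha : R) (i : nat) : R := Rpower (INR i) (- alpha).

(* tau_p alpha p n is tau_T, and tau_p alpha p m is tau_S. *)
Definition tau_p (alpha : R) (p k : nat) : R :=
  solution (fun t => 0 < t /\
    sum_n_m (fun i => lambda alpha i / (lambda alpha i + t)) 1 p = INR k).

Definition gamma_p (alpha : R) (p k : nat) : R :=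
  / INR k * sum_n_m (fun i =>
    lambda alpha i ^ 2 / (lambda alpha i + tau_p alpha p k) ^ 2) 1 p.

Definition W2SG_p (alpha sigma2 : R) (p n m : nat) : R :=
  let l := lambda alpha in
  let tT := tau_p alpha p n in
  let tS := tau_p alpha p m in
  let gT := gamma_p alpha p n in
  let gS := gamma_p alpha p m in
  - (tS ^ 2 / (1 - gS)
       * sum_n_m (fun i => l i ^ 2 / ((l i + tS) ^ 2 * (l i + tT))) 1 p)
  + 2 * sigma2 * tS / (INR n * (1 - gT))
       * sum_n_m (fun i => l i ^ 2 / ((l i + tS) * (l i + tT) ^ 2)) 1 p
  - sigma2 * tS ^ 2 / (INR n * (1 - gT) * (1 - gS))
       * sum_n_m (fun i => l i ^ 2 / ((l i + tS) ^ 2 * (l i + tT) ^ 2)) 1 p.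

Definition F (alpha s : R) : R :=
  RInt (fun x => / (1 + s * rpow x alpha)) 0 1.

Definition s_T (alpha phin : R) : R :=
  solution (fun s => 0 < s /\ F alpha s = / phin).

Definition gamma_T (alpha phin : R) : R :=
  phin * RInt (fun x => / (1 + s_T alpha phin * rpow x alpha) ^ 2) 0 1.

Definition c_T (alpha phin : R) : R :=
  gamma_T alpha phin / (1 - gamma_T alpha phin).

Definition gamma (alpha s : R) : R :=
  / F alpha s * RInt (fun x => / (1 + s * rpow x alpha) ^ 2) 0 1.

Definition A (alpha phin y s : R) : R :=
  RInt (fun x => rpow x (y * alpha)
    / ((1 + s * rpow x alpha) ^ 2
       * (1 + s_T alpha phin * rpow x alpha) ^ 2)) 0 1.

Definition J (alpha phin s : R) : R :=
  2 * A alpha phin 1 s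
  + (2 - / (1 - gamma alpha s)) * s * A alpha phin 2 s.

(* Series are indexed from k = 0, the k-th term being the one of index k + 1. *)
Definition a_term (alpha t : R) (k : nat) : R :=
  / (1 + t * Rpower (INR (S k)) alpha).

Definition tau (alpha m : R) : R :=
  solution (fun t => 0 < t /\ is_series (a_term alpha t) m).

Definition gamma_m (alpha m : R) : R :=
  / m * Series (fun k => a_term alpha (tau alpha m) k ^ 2).

Definition eta_m (alpha m : R) : R :=
  / m * Series (fun k => a_term alpha (tau alpha m) k ^ 3).

Definition q_m (alpha m : R) : R :=
  (1 - 2 * gamma_m alpha m) / (1 - gamma_m alpha m).

Definition K_m (alpha m : R) : R :=
  gamma_m alpha m ^ 2 * (2 - gamma_m alpha m) - eta_m alpha m.

Definition G_m (alpha phin sigma2 m : R) : R :=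
  - (m * tau alpha m) + q_m alpha m * sigma2 * c_T alpha phin.

Definition sigma_c2 (alpha phin : R) : R :=
  tau alpha 1 / (c_T alpha phin * q_m alpha 1).

Definition C_alpha (alpha : R) : R :=
  RInt_gen (fun x => / (1 + rpow x alpha))
    (at_point 0) (Rbar_locally p_infty).

Definition c_alpha (alpha : R) : R :=
  Rpower (PI / alpha * / sin (PI / alpha)) alpha.

Definition sigma_safe2 (alpha phin : R) : R :=
  Rmin (sigma_c2 alpha phin)
    (Rpower (C_alpha alpha) alpha / c_T alpha phin
       * ((alpha + 12) / (Rpower 3 (alpha + 1) * (4 - alpha)))).

Definition teacher_sizes (n : nat -> nat) (phin : R) : Prop :=
  (forall p, (1 <= n p)%nat) /\
  is_lim_seq (fun p => INR p / INR (n p)) phin.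

Definition student_sizes (m : nat -> nat) (phim : R) : Prop :=
  is_lim_seq (fun p => INR (m p)) p_infty /\
  is_lim_seq (fun p => INR p / INR (m p)) phim.

Definition critical_ratio
    (alpha sigma2 : R) (n : nat -> nat) (c : R) : Prop :=
  1 < c /\
  forall (m : nat -> nat) (phim : R), 1 < phim -> student_sizes m phim ->
  exists L r : R,
    is_lim_seq (fun p => W2SG_p alpha sigma2 p (n p) (m p)) L /\
    is_lim_seq (fun p => INR (m p) / INR p) r /\
    (0 < L <-> phim < c) /\
    (0 < L <-> / c < r).

Definition admissible_M (alpha M : R) : Prop :=
  1 <= M /\ forall m : R, M <= m -> 0 < q_m alpha m /\ K_m alpha m < 0.

(* m_HP is the critical sample size as a function of the noise variance. *)
Definition HP_threshold (alpha phin sigma02 : R) : Prop :=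
  0 < sigma02 < sigma_c2 alpha phin /\
  exists m_HP : R -> R,
    (forall sigma2 : R, 0 < sigma2 < sigma02 ->
       unique (fun m => 1 < m /\ G_m alpha phin sigma2 m = 0) (m_HP sigma2) /\
       forall m : R, m_HP sigma2 < m -> 0 < G_m alpha phin sigma2 m) /\
    filterlim
      (fun sigma2 => m_HP sigma2 /
         Rpower (c_alpha alpha * (1 - gamma_T alpha phin)
                   / ((2 - alpha) * sigma2 * gamma_T alpha phin))
                (/ (alpha - 1)))
      (at_right 0) (locally 1).

(* Main.v *)
(* Write b_s(x) = 1/(1 + s x^alpha), with b_T the case s = s_T. In the proportional regime the
   sums are Riemann sums and the gain tends to a positive multiple of J(s), where s is determined
   by F(s) = 1/phi_m. With N1(s) = \int x^alpha b_s b_T^2, the sign of J is that of the derivative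
   of N1/F^2. For alpha <= 2 it is positive by the Chebyshev and Jensen inequalities. For alpha > 2
   both N1 and F^2 = 2 \int x b_s(x) k(x) dx are integrals of b_s against fixed kernels, and the
   quotient of the two kernels is quasi-convex, so at a zero s0 of J the difference of the kernels,
   scaled to cancel at s0, changes sign exactly twice, at x1 < x2. The second-order expansion in s
   of (1 + s x1^alpha)(1 + s x2^alpha) b_s then shows that s0 is a strict global maximum point of
   N1/F^2; hence J has at most one zero. Its sign near 0 and near infinity gives existence for
   2 < alpha <= 1 + sqrt 2.

   For fixed m the sums converge to series by dominated convergence. The function x -> b(1 - b)
   is unimodal with maximum 1/4, so alpha m (1 - gamma_m) differs from C_alpha tau_m^(-1/alpha) by
   at most alpha/4, and m from C_alpha tau_m^(-1/alpha) by at most 1; all asymptotics in m follow.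
   G_m vanishes where m tau_m / q_m equals sigma^2 c_T, and K_m < 0 makes that ratio decreasing.
   The closed form of C_alpha comes from the Dirichlet kernel and the partial fraction expansion
   of 1/sin. *)

Require Import Defs.
From Stdlib Require Import ZArith Reals Lra Lia Classical_Prop.
From Coquelicot Require Import Coquelicot.
Open Scope R_scope.

(** * Real powers and integrals *)

(** Uniqueness rests on the functional g -> integral of x^alpha g b_T^2 minus 2 c times the integral
    of x g k, with c = N1(s0) / F(s0)^2. At a zero s0 of J it annihilates b_{s0}, by the choice of
    c, and x^alpha b_{s0}^2, because J(s0) = 0 says that N1 - c F^2 is stationary at s0. These are
    the two lower terms of the expansion, so only the quadratic remainder, a multiple of (x^alpha -
    x1^alpha)(x^alpha - x2^alpha) b_{s0}^2 b_s, survives, and its sign is that of the kernel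
    difference. The obstacle is that k has a logarithmic singularity at x = 1: integrals are taken
    with the kernel frozen beyond some r < 1, identities hold up to errors that vanish as r tends to
    1, and strict inequalities need gains that do not depend on r. The number 1 + sqrt 2 is the
    larger root of (alpha + 1)^2 = 2 (2 alpha + 1), the condition under which Chebyshev's inequality
    gives a positive sign at s = 0. For fixed m, continuity and monotonicity in m are obtained in
    the variable t = tau_m, in which the series are explicit. *)

Lemma rpow_pos (x a : R) : 0 < x -> rpow x a = Rpower x a.
Proof. intros h; unfold rpow; destruct (Rlt_dec 0 x); [reflexivity | lra]. Qed.

Lemma rpow_nonpos (x a : R) : x <= 0 -> rpow x a = 0.
Proof. intros h; unfold rpow; destruct (Rlt_dec 0 x); [lra | reflexivity]. Qed.

Lemma Rpower_pos (x a : R) : 0 < Rpower x a.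
Proof. apply exp_pos. Qed.

Lemma rpow_ge0 (x a : R) : 0 <= rpow x a.
Proof.
  unfold rpow; destruct (Rlt_dec 0 x); [apply Rlt_le, Rpower_pos | lra].
Qed.

Lemma rpow_gt0 (x a : R) : 0 < x -> 0 < rpow x a.
Proof. intros h; rewrite rpow_pos by easy; apply Rpower_pos. Qed.

Lemma Rpower_1_l (a : R) : Rpower 1 a = 1.
Proof. unfold Rpower; rewrite ln_1, Rmult_0_r; apply exp_0. Qed.

Lemma rpow_1_l (a : R) : rpow 1 a = 1.
Proof. rewrite rpow_pos by lra; apply Rpower_1_l. Qed.

Lemma rpow_le (a x z : R) : 0 <= a -> x <= z -> rpow x a <= rpow z a.
Proof.
  intros ha hxz; destruct (Rle_dec x 0) as [h|h].
  - rewrite (rpow_nonpos x) by easy; apply rpow_ge0.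
  - rewrite !rpow_pos by lra; apply Rle_Rpower_l; lra.
Qed.

Lemma rpow_lt (a x z : R) : 0 < a -> 0 <= x < z -> rpow x a < rpow z a.
Proof.
  intros ha hxz; destruct (Rle_dec x 0) as [h|h].
  - rewrite (rpow_nonpos x) by easy; apply rpow_gt0; lra.
  - rewrite !rpow_pos by lra; apply Rlt_Rpower_l; lra.
Qed.

Lemma rpow_le1 (a x : R) : 0 <= a -> x <= 1 -> rpow x a <= 1.
Proof. intros ha hx; rewrite <- (rpow_1_l a); now apply rpow_le. Qed.

Lemma rpow_lt1 (a x : R) : 0 < a -> x < 1 -> rpow x a < 1.
Proof.
  intros ha hx; destruct (Rle_dec x 0).
  - rewrite rpow_nonpos by easy; lra.
  - rewrite <- (rpow_1_l a); apply rpow_lt; lra.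
Qed.

Lemma rpow_mult_l (a x z : R) :
  0 <= x -> 0 <= z -> rpow (x * z) a = rpow x a * rpow z a.
Proof.
  intros hx hz; destruct (Req_dec x 0) as [->|hx0].
  - rewrite Rmult_0_l, !(rpow_nonpos 0) by lra; ring.
  - destruct (Req_dec z 0) as [->|hz0].
    + rewrite Rmult_0_r, !(rpow_nonpos 0) by lra; ring.
    + rewrite !rpow_pos by (try apply Rmult_lt_0_compat; lra).
      symmetry; apply Rpower_mult_distr; lra.
Qed.

Lemma rpow_plus (x a b : R) : rpow x (a + b) = rpow x a * rpow x b.
Proof.
  destruct (Rle_dec x 0) as [h|h].
  - rewrite !rpow_nonpos by easy; ring.
  - rewrite !rpow_pos by lra; apply Rpower_plus.
Qed.

Lemma rpow_1_r (x : R) : 0 <= x -> rpow x 1 = x.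
Proof.
  intros h; destruct (Req_dec x 0) as [->|h0].
  - apply rpow_nonpos; lra.
  - rewrite rpow_pos, Rpower_1 by lra; reflexivity.
Qed.

Lemma rpow_S (x a : R) : 0 <= x -> x * rpow x a = rpow x (a + 1).
Proof. intros h; rewrite rpow_plus, rpow_1_r by easy; ring. Qed.

Lemma rpow_double (x a : R) : rpow x (2 * a) = rpow x a ^ 2.
Proof. replace (2 * a) with (a + a) by ring; rewrite rpow_plus; ring. Qed.

Lemma is_derive_rpow_pos (a x : R) :
  0 < x -> is_derive (fun u => rpow u a) x (a * rpow x (a - 1)).
Proof.
  intros hx; rewrite rpow_pos by easy.
  apply is_derive_ext_loc with (fun u => Rpower u a).
  - exists (mkposreal x hx); intros u hu; symmetry; apply rpow_pos.
    unfold ball in hu; simpl in hu; unfold AbsRing_ball, abs, minus, plus, opp in hu.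
    simpl in hu; apply Rabs_def2 in hu; lra.
  - apply is_derive_Reals, derivable_pt_lim_power, hx.
Qed.

Lemma rpow_small (a eps : R) :
  0 < a -> 0 < eps -> exists d, 0 < d /\ forall x, x < d -> rpow x a < eps.
Proof.
  intros ha he; exists (Rpower eps (/ a)); split; [apply Rpower_pos|].
  intros x hx; destruct (Rle_dec x 0).
  - rewrite rpow_nonpos by easy; easy.
  - replace eps with (rpow (Rpower eps (/ a)) a).
    + apply rpow_lt; lra.
    + rewrite rpow_pos by apply Rpower_pos.
      rewrite Rpower_mult, Rinv_l, Rpower_1; lra.
Qed.

Lemma continuous_rpow (a x : R) : 0 < a -> continuous (fun u => rpow u a) x.
Proof.
  intros ha; destruct (Rtotal_order x 0) as [h|[->|h]].
  - apply continuous_ext_loc with (fun _ => 0); [|apply continuous_const].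
    assert (hx : 0 < - x) by lra.
    exists (mkposreal _ hx); intros u hu; symmetry; apply rpow_nonpos.
    unfold ball in hu; simpl in hu; unfold AbsRing_ball, abs, minus, plus, opp in hu.
    simpl in hu; apply Rabs_def2 in hu; lra.
  - apply continuity_pt_filterlim; intros e he.
    destruct (rpow_small a e ha he) as [d [hd h]].
    exists d; split; [easy|]; intros u [_ hu].
    unfold R_met, R_dist in *; simpl in *.
    rewrite (rpow_nonpos 0), Rminus_0_r, Rabs_pos_eq by (try apply rpow_ge0; lra).
    apply h; apply Rabs_def2 in hu; lra.
  - apply (ex_derive_continuous (K:=R_AbsRing) (V:=R_NormedModule)).
    eexists; now apply is_derive_rpow_pos.
Qed.

(** For [a > 1] the two branches meet at [0] with zero derivative, so the formula holds on the whole
    line and the fundamental theorem applies with no condition on the domain. *)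
Lemma is_derive_rpow (a x : R) :
  1 < a -> is_derive (fun u => rpow u a) x (a * rpow x (a - 1)).
Proof.
  intros ha; destruct (Rtotal_order x 0) as [h|[->|h]].
  - rewrite rpow_nonpos, Rmult_0_r by lra.
    apply is_derive_ext_loc with (fun _ => 0);
      [|apply is_derive_Reals, derivable_pt_lim_const].
    assert (hx : 0 < - x) by lra.
    exists (mkposreal _ hx); intros u hu; symmetry; apply rpow_nonpos.
    unfold ball in hu; simpl in hu; unfold AbsRing_ball, abs, minus, plus, opp in hu.
    simpl in hu; apply Rabs_def2 in hu; lra.
  - rewrite (rpow_nonpos 0), Rmult_0_r by lra; apply is_derive_Reals; intros e he.
    destruct (rpow_small (a - 1) e) as [d [hd h]]; [lra|easy|].
    exists (mkposreal d hd); intros u hu0 hu; simpl in hu.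
    rewrite Rplus_0_l, (rpow_nonpos 0), !Rminus_0_r by lra.
    destruct (Rle_dec u 0) as [hu1|hu1].
    + rewrite rpow_nonpos by easy; unfold Rdiv; rewrite Rmult_0_l, Rabs_R0; easy.
    + replace a with (a - 1 + 1) by ring; rewrite <- rpow_S by lra.
      replace (u * rpow u (a - 1) / u) with (rpow u (a - 1)) by (field; lra).
      rewrite Rabs_pos_eq by apply rpow_ge0.
      apply h; apply Rabs_def2 in hu; lra.
  - now apply is_derive_rpow_pos.
Qed.

Lemma ex_RInt_cont (f : R -> R) (a b : R) :
  (forall x, continuous f x) -> ex_RInt f a b.
Proof. intros h; apply (@ex_RInt_continuous R_CompleteNormedModule); intros; apply h. Qed.

(* Coquelicot states these with [plus] and [scal], on which [ring] and [lra] are stuck. *)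
Lemma RInt_plus_R (f g : R -> R) (a b : R) : ex_RInt f a b -> ex_RInt g a b ->
  RInt (fun x => f x + g x) a b = RInt f a b + RInt g a b.
Proof. intros hf hg; exact (RInt_plus f g a b hf hg). Qed.

Lemma RInt_minus_R (f g : R -> R) (a b : R) : ex_RInt f a b -> ex_RInt g a b ->
  RInt (fun x => f x - g x) a b = RInt f a b - RInt g a b.
Proof. intros hf hg; exact (RInt_minus f g a b hf hg). Qed.

Lemma RInt_scal_R (f : R -> R) (a b c : R) : ex_RInt f a b ->
  RInt (fun x => c * f x) a b = c * RInt f a b.
Proof. intros hf; exact (RInt_scal f a b c hf). Qed.

Lemma RInt_const_R (a b c : R) : RInt (fun _ => c) a b = (b - a) * c.
Proof. exact (RInt_const a b c). Qed.

Lemma RInt_Chasles_R (f : R -> R) (a b c : R) : ex_RInt f a b -> ex_RInt f b c ->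
  RInt f a c = RInt f a b + RInt f b c.
Proof. intros h1 h2; symmetry; exact (RInt_Chasles f a b c h1 h2). Qed.

(** The factor [u] stands on the left so that [u = 0] is covered; [Eint_split] uses the substitution
    on [0, v] with [v] possibly 0. *)
Lemma RInt_scale (f : R -> R) (u a b : R) : ex_RInt f (u * a) (u * b) ->
  u * RInt (fun x => f (u * x)) a b = RInt f (u * a) (u * b).
Proof.
  intros h; destruct (Req_dec u 0) as [->|hu].
  - rewrite (Rmult_0_l a), (Rmult_0_l b), (Rmult_0_l (RInt _ _ _)).
    symmetry; exact (RInt_point 0 f).
  - assert (e : RInt (fun x => scal u (f (u * x + 0))) a b = RInt f (u * a + 0) (u * b + 0))
      by (apply (RInt_comp_lin f u 0 a b); rewrite 2!Rplus_0_r; exact h).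
    rewrite 2!Rplus_0_r in e; rewrite <- e.
    transitivity (RInt (fun x => u * f (u * x)) a b);
      [|apply RInt_ext; intros x _; rewrite Rplus_0_r; reflexivity].
    symmetry; apply RInt_scal_R.
    assert (h1 : ex_RInt (fun x => scal u (f (u * x + 0))) a b)
      by (apply (ex_RInt_comp_lin f u 0 a b); rewrite 2!Rplus_0_r; exact h).
    assert (h2 := ex_RInt_scal (V := R_NormedModule) _ a b (/ u) h1).
    refine (ex_RInt_ext _ _ a b _ h2).
    intros x _; rewrite Rplus_0_r; change (/ u * (u * f (u * x)) = f (u * x)); field; easy.
Qed.

Lemma RInt_ftc (f df : R -> R) (a b : R) :
  (forall x, is_derive f x (df x)) -> (forall x, continuous df x) ->
  RInt df a b = f b - f a.
Proof.
  intros h1 h2; apply is_RInt_unique.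
  apply (is_RInt_derive f df a b); intros; [apply h1|apply h2].
Qed.

Lemma cont_plus (f g : R -> R) x : continuous f x -> continuous g x ->
  continuous (fun u => f u + g u) x.
Proof. intros; now apply (continuous_plus f g). Qed.

Lemma cont_minus (f g : R -> R) x : continuous f x -> continuous g x ->
  continuous (fun u => f u - g u) x.
Proof. intros; now apply (continuous_minus f g). Qed.

Lemma cont_opp (f : R -> R) x : continuous f x -> continuous (fun u => - f u) x.
Proof. intros; now apply (continuous_opp f). Qed.

Lemma cont_mult (f g : R -> R) x : continuous f x -> continuous g x ->
  continuous (fun u => f u * g u) x.
Proof. intros; now apply (continuous_mult f g). Qed.

Lemma cont_inv (f : R -> R) x : continuous f x -> f x <> 0 ->
  continuous (fun u => / f u) x.
Proof.
  intros h h0; apply continuity_pt_filterlim, continuity_pt_inv; [|easy].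
  now apply continuity_pt_filterlim.
Qed.

Lemma cont_div (f g : R -> R) x : continuous f x -> continuous g x -> g x <> 0 ->
  continuous (fun u => f u / g u) x.
Proof. intros; unfold Rdiv; apply cont_mult; [easy|now apply cont_inv]. Qed.

Lemma cont_pow (f : R -> R) n x : continuous f x -> continuous (fun u => f u ^ n) x.
Proof.
  intros h; induction n as [|n IH]; simpl; [apply continuous_const|now apply cont_mult].
Qed.

Lemma cont_comp_rpow (f : R -> R) a x : 0 < a -> continuous f x ->
  continuous (fun u => rpow (f u) a) x.
Proof.
  intros ha h; apply (continuous_comp f (fun u => rpow u a)); [easy|].
  now apply continuous_rpow.
Qed.

Ltac pos := first [assumption | lra | lazymatch goal with
  | |- 0 <= rpow _ _ => apply rpow_ge0
  | |- 0 < Rpower _ _ => apply Rpower_pos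
  | |- 0 <= Rpower _ _ => apply Rlt_le, Rpower_pos
  | |- 0 < _ * _ => apply Rmult_lt_0_compat; pos
  | |- 0 <= _ * _ => apply Rmult_le_pos; pos
  | |- 0 < _ + _ => first [apply Rplus_lt_le_0_compat; pos | apply Rplus_le_lt_0_compat; pos]
  | |- 0 <= _ + _ => apply Rplus_le_le_0_compat; pos
  | |- 0 < _ ^ _ => apply pow_lt; pos
  | |- 0 <= _ ^ _ => apply pow_le; pos
  | |- 0 < / _ => apply Rinv_0_lt_compat; pos
  | |- 0 <= / _ => apply Rlt_le, Rinv_0_lt_compat; pos
  | |- 0 < _ / _ => apply Rdiv_lt_0_compat; pos
  | |- 0 <= _ / _ => apply Rle_mult_inv_pos; pos
  | |- 0 <= INR _ => apply pos_INR
  end].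
Ltac nz := apply Rgt_not_eq; unfold Rgt; pos.
Ltac cont1 := match goal with
  | h : forall _, continuous ?f _ |- continuous ?f _ => apply h
  | |- continuous (fun _ => ?c) _ => apply continuous_const
  | |- continuous (fun x => x) _ => apply continuous_id
  | |- continuous (fun x => @?f x + @?g x) _ => apply (cont_plus f g)
  | |- continuous (fun x => @?f x - @?g x) _ => apply (cont_minus f g)
  | |- continuous (fun x => - @?f x) _ => apply (cont_opp f)
  | |- continuous (fun x => @?f x * @?g x) _ => apply (cont_mult f g)
  | |- continuous (fun x => @?f x / @?g x) _ => apply (cont_div f g); [| |try nz]
  | |- continuous (fun x => / @?f x) _ => apply (cont_inv f); [|try nz]
  | |- continuous (fun x => @?f x ^ ?n) _ => apply (cont_pow f n)
  | |- continuous (fun x => rpow x ?a) _ => apply continuous_rpow; lra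
  | |- continuous (fun x => rpow (@?f x) ?a) _ => apply (cont_comp_rpow f a); [lra|]
  | h : forall _, continuous ?f _ |- continuous (fun x => ?f x) _ => apply h
  end.
Ltac cont := intros; repeat cont1.

Ltac toR := lazymatch goal with |- @eq _ ?a ?b => change (@eq R a b) end.

Lemma RInt_rpow (a v : R) : 0 < a -> 0 <= v ->
  RInt (fun x => rpow x a) 0 v = rpow v (a + 1) / (a + 1).
Proof.
  intros ha hv.
  rewrite (RInt_ftc (fun x => / (a + 1) * rpow x (a + 1))).
  - rewrite (rpow_nonpos 0) by lra; toR; field; lra.
  - intros x; evar_last.
    + apply (is_derive_scal (fun u => rpow u (a + 1))), is_derive_rpow; lra.
    + change (/ (a + 1) * ((a + 1) * rpow x (a + 1 - 1)) = rpow x a).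
      replace (a + 1 - 1) with a by ring; field; lra.
  - cont.
Qed.

(** * The functions F and gamma *)

(** At an integer [x] with [s = tau] this is the shrinkage factor lambda / (lambda + tau) of the
    eigenvalue of index [x] (see [lambda_frac]); at [x] in [0, 1] it is the same factor after
    rescaling. One function thus serves both regimes. *)
Definition bfun (a s x : R) : R := / (1 + s * rpow x a).

(** Minus the derivative of [F] in [s]; by [one_sub_gamma] it also carries 1 - gamma. *)
Definition Fd (a s : R) : R := RInt (fun x => rpow x a * bfun a s x ^ 2) 0 1.

Lemma den_pos (a s x : R) : 0 <= s -> 0 < 1 + s * rpow x a.
Proof. intros h; pos. Qed.

Lemma bfun_pos (a s x : R) : 0 <= s -> 0 < bfun a s x.
Proof. intros h; apply Rinv_0_lt_compat, den_pos, h. Qed.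

Lemma bfun_le1 (a s x : R) : 0 <= s -> bfun a s x <= 1.
Proof.
  intros h; rewrite <- Rinv_1; apply Rinv_le_contravar; [lra|].
  assert (0 <= s * rpow x a) by pos; lra.
Qed.

Lemma bfun_lt1 (a s x : R) : 0 < s -> 0 < x -> bfun a s x < 1.
Proof.
  intros h hx; rewrite <- Rinv_1; apply Rinv_lt_contravar.
  - assert (0 <= s * rpow x a) by pos; lra.
  - assert (0 < s * rpow x a) by (apply Rmult_lt_0_compat; [|apply rpow_gt0]; lra); lra.
Qed.

Lemma bfun_eq (a s x : R) : 0 <= s -> bfun a s x + s * rpow x a * bfun a s x = 1.
Proof. intros h; unfold bfun; field; apply Rgt_not_eq, den_pos, h. Qed.

Lemma cont_bfun (a s x : R) : 0 < a -> 0 <= s -> continuous (bfun a s) x.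
Proof. intros ha hs; unfold bfun; cont. Qed.

(** The resolvent identity; under the integral it gives the Lipschitz and Taylor estimates of [F],
    and termwise the monotonicity of [bsum]. *)
Lemma bfun_diff (a s t x : R) : 0 <= s -> 0 <= t ->
  bfun a t x = bfun a s x - (t - s) * (rpow x a * (bfun a s x * bfun a t x)).
Proof.
  intros hs ht; unfold bfun; field; split; apply Rgt_not_eq, den_pos; easy.
Qed.

Lemma bfun_lip (a s t x : R) : 0 < a -> x <= 1 -> 0 <= s -> 0 <= t ->
  Rabs (bfun a t x - bfun a s x) <= Rabs (t - s).
Proof.
  intros ha hx hs ht; rewrite (bfun_diff a s t) by easy.
  replace (_ - _) with (- ((t - s) * (rpow x a * (bfun a s x * bfun a t x)))) by ring.
  rewrite Rabs_Ropp, Rabs_mult; apply Rle_trans with (Rabs (t - s) * 1); [|lra].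
  apply Rmult_le_compat_l; [apply Rabs_pos|].
  assert (h1 := bfun_pos a s x hs); assert (h2 := bfun_pos a t x ht).
  assert (h3 := bfun_le1 a s x hs); assert (h4 := bfun_le1 a t x ht).
  assert (h5 := rpow_ge0 x a); assert (h6 := rpow_le1 a x (Rlt_le _ _ ha) hx).
  rewrite Rabs_pos_eq by pos.
  assert (bfun a s x * bfun a t x <= 1) by nra.
  assert (0 < bfun a s x * bfun a t x) by pos; nra.
Qed.

Ltac contb := cont; repeat (match goal with
  | |- continuous (fun x => bfun ?a ?s x) _ => apply (cont_bfun a s); lra
  | |- continuous (bfun ?a ?s) _ => apply (cont_bfun a s); lra end).

Lemma RInt_le01 (f g : R -> R) :
  (forall x, continuous f x) -> (forall x, continuous g x) ->
  (forall x, 0 < x < 1 -> f x <= g x) -> RInt f 0 1 <= RInt g 0 1.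
Proof. intros; apply RInt_le; try apply ex_RInt_cont; easy || lra. Qed.

Lemma RInt_lt01 (f g : R -> R) :
  (forall x, continuous f x) -> (forall x, continuous g x) ->
  (forall x, 0 < x < 1 -> f x < g x) -> RInt f 0 1 < RInt g 0 1.
Proof. intros; apply RInt_lt; try lra; intros; auto. Qed.

Lemma RInt_pos01 (f : R -> R) :
  (forall x, continuous f x) -> (forall x, 0 < x < 1 -> 0 < f x) -> 0 < RInt f 0 1.
Proof. intros; apply RInt_gt_0; try lra; intros; auto. Qed.

Lemma RInt_abs01 (f : R -> R) (M : R) :
  (forall x, continuous f x) -> (forall x, 0 <= x <= 1 -> Rabs (f x) <= M) ->
  Rabs (RInt f 0 1) <= M.
Proof.
  intros hc h; replace M with ((1 - 0) * M) by ring.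
  apply abs_RInt_le_const; [lra|now apply ex_RInt_cont|easy].
Qed.

Lemma F_bfun (a s : R) : F a s = RInt (bfun a s) 0 1.
Proof. reflexivity. Qed.

Lemma F_gt0 (a s : R) : 0 < a -> 0 <= s -> 0 < F a s.
Proof.
  intros; rewrite F_bfun; apply RInt_pos01; [contb|].
  intros; now apply bfun_pos.
Qed.

Lemma F_lt1 (a s : R) : 0 < a -> 0 < s -> F a s < 1.
Proof.
  intros; replace 1 with (RInt (fun _ => 1) 0 1) by (rewrite RInt_const_R; toR; ring).
  rewrite F_bfun; apply RInt_lt01; [contb|cont|intros; apply bfun_lt1; lra].
Qed.

Lemma F_0 (a : R) : F a 0 = 1.
Proof.
  rewrite F_bfun, (RInt_ext _ (fun _ => 1)); [rewrite RInt_const_R; toR; ring|].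
  intros; unfold bfun; toR; field; lra.
Qed.

Lemma Fd_gt0 (a s : R) : 0 < a -> 0 <= s -> 0 < Fd a s.
Proof.
  intros; apply RInt_pos01; [contb|].
  intros; apply Rmult_lt_0_compat; [apply rpow_gt0; lra|].
  apply pow_lt, bfun_pos; lra.
Qed.

Lemma Fd_le1 (a s : R) : 0 < a -> 0 <= s -> Fd a s <= 1.
Proof.
  intros; replace 1 with (RInt (fun _ => 1) 0 1) by (rewrite RInt_const_R; toR; ring).
  apply RInt_le01; [contb|cont|intros x hx].
  assert (h1 := bfun_pos a s x); assert (h2 := bfun_le1 a s x).
  assert (h3 := rpow_ge0 x a); assert (h4 := rpow_le1 a x).
  assert (bfun a s x ^ 2 <= 1) by (simpl; nra).
  assert (0 <= bfun a s x ^ 2) by apply pow2_ge_0; nra.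
Qed.

Lemma F_sub_F2 (a s : R) : 0 < a -> 0 <= s ->
  F a s - RInt (fun x => bfun a s x ^ 2) 0 1 = s * Fd a s.
Proof.
  intros; rewrite F_bfun; unfold Fd.
  rewrite <- RInt_minus_R, <- RInt_scal_R by (apply ex_RInt_cont; contb).
  apply RInt_ext; intros x _; toR.
  assert (e := bfun_eq a s x ltac:(lra)).
  transitivity (bfun a s x * (1 - bfun a s x)); [ring|].
  replace (1 - bfun a s x) with (s * rpow x a * bfun a s x) by lra; ring.
Qed.

(** Integration by parts: the derivative of x b_s(x) is b - a s x^a b^2, with boundary value 1 / (1
    + s) at 1. This identity eliminates [Fd] in the sign arguments. *)
Lemma F_parts (a s : R) : 1 < a -> 0 <= s ->
  F a s - / (1 + s) = a * s * Fd a s.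
Proof.
  intros ha hs.
  assert (h : RInt (fun x => bfun a s x - a * s * (rpow x a * bfun a s x ^ 2)) 0 1
              = / (1 + s)).
  { rewrite (RInt_ftc (fun x => x * bfun a s x)).
    - unfold bfun; rewrite rpow_1_l, (rpow_nonpos 0) by lra; toR; field; lra.
    - intros x; unfold bfun; evar_last.
      + apply (is_derive_mult (fun x => x) (fun x => / (1 + s * rpow x a))).
        * apply is_derive_id.
        * apply is_derive_inv; [|apply Rgt_not_eq, den_pos, hs].
          apply (is_derive_plus (fun _ => 1) (fun x => s * rpow x a)).
          -- apply is_derive_Reals, derivable_pt_lim_const.
          -- apply (is_derive_scal (fun u => rpow u a)), is_derive_rpow; lra.
        * intros; apply Rmult_comm.
      + unfold plus, mult, one, scal; simpl; unfold mult; simpl.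
        assert (hd := den_pos a s x hs).
        assert (e : x * rpow x (a - 1) = rpow x a).
        { destruct (Rle_dec x 0).
          - rewrite !rpow_nonpos by easy; ring.
          - rewrite rpow_S by lra; f_equal; ring. }
        rewrite <- e in *; field; lra.
    - contb. }
  rewrite RInt_minus_R, RInt_scal_R in h by (apply ex_RInt_cont; contb).
  rewrite F_bfun; unfold Fd; lra.
Qed.

Lemma F_diff (a s t : R) : 0 < a -> 0 <= s -> 0 <= t ->
  F a t = F a s - (t - s) * RInt (fun x => rpow x a * (bfun a s x * bfun a t x)) 0 1.
Proof.
  intros; rewrite !F_bfun, <- RInt_scal_R, <- RInt_minus_R by (apply ex_RInt_cont; contb).
  apply RInt_ext; intros; apply bfun_diff; lra.
Qed.

Lemma F_decr (a s t : R) : 0 < a -> 0 <= s < t -> F a t < F a s.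
Proof.
  intros ha hst; rewrite (F_diff a s t) by lra.
  assert (0 < RInt (fun x => rpow x a * (bfun a s x * bfun a t x)) 0 1); [|nra].
  apply RInt_pos01; [contb|intros].
  apply Rmult_lt_0_compat; [apply rpow_gt0; lra|].
  apply Rmult_lt_0_compat; apply bfun_pos; lra.
Qed.

Lemma F_lip (a s t : R) : 0 < a -> 0 <= s -> 0 <= t ->
  Rabs (F a t - F a s) <= Rabs (t - s).
Proof.
  intros; rewrite !F_bfun, <- RInt_minus_R by (apply ex_RInt_cont; contb).
  apply RInt_abs01; [contb|intros; apply bfun_lip; lra].
Qed.

Lemma F_taylor (a s t : R) : 0 < a -> 0 <= s -> 0 <= t ->
  Rabs (F a t - F a s + (t - s) * Fd a s) <= (t - s) ^ 2.
Proof.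
  intros ha hs ht; rewrite (F_diff a s t) by lra.
  replace (_ - _ + _) with ((t - s) *
    (Fd a s - RInt (fun x => rpow x a * (bfun a s x * bfun a t x)) 0 1)) by ring.
  rewrite Rabs_mult, <- (pow2_abs (t - s)); simpl; rewrite Rmult_1_r.
  apply Rmult_le_compat_l; [apply Rabs_pos|].
  unfold Fd; rewrite <- RInt_minus_R by (apply ex_RInt_cont; contb).
  apply RInt_abs01; [contb|intros x hx].
  replace (_ - _) with (- (rpow x a * bfun a s x * (bfun a t x - bfun a s x))) by ring.
  rewrite Rabs_Ropp, Rabs_mult, <- (Rmult_1_l (Rabs (t - s))).
  assert (h1 := bfun_pos a s x hs); assert (h2 := bfun_le1 a s x hs).
  assert (h3 := rpow_ge0 x a); assert (h4 := rpow_le1 a x).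
  apply Rmult_le_compat; try apply Rabs_pos.
  - rewrite Rabs_pos_eq by pos.
    specialize (h4 ltac:(lra) ltac:(lra)); nra.
  - apply bfun_lip; lra.
Qed.

(** A quadratic remainder yields the derivative. It is asked only for [y > x / 2], which keeps [y]
    positive, the range where the estimates on integrals and series hold. *)
Lemma is_derive_quad (f : R -> R) (x l C : R) : 0 < x -> 0 <= C ->
  (forall y, x / 2 < y -> Rabs (f y - f x - (y - x) * l) <= C * (y - x) ^ 2) ->
  is_derive f x l.
Proof.
  intros hx hC h; apply is_derive_Reals; intros e he.
  assert (hd : 0 < Rmin (x / 2) (e / (C + 1))) by (apply Rmin_pos; [lra|apply Rdiv_lt_0_compat; lra]).
  exists (mkposreal _ hd); intros u hu0 hu; simpl in hu.
  assert (hux : Rabs u < x / 2) by (eapply Rlt_le_trans; [apply hu|apply Rmin_l]).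
  assert (hue : Rabs u < e / (C + 1)) by (eapply Rlt_le_trans; [apply hu|apply Rmin_r]).
  specialize (h (x + u)); replace (x + u - x) with u in h by ring.
  assert (hxu : x / 2 < x + u) by (apply Rabs_def2 in hux; lra).
  specialize (h hxu).
  replace ((f (x + u) - f x) / u - l) with ((f (x + u) - f x - u * l) / u) by (field; easy).
  unfold Rdiv; rewrite Rabs_mult, Rabs_inv.
  assert (hu1 : 0 < Rabs u) by now apply Rabs_pos_lt.
  apply Rmult_lt_reg_r with (Rabs u); [easy|].
  rewrite Rmult_assoc, Rinv_l, Rmult_1_r by lra.
  rewrite <- (pow2_abs u) in h; eapply Rle_lt_trans; [apply h|].
  assert (Rabs u * (C + 1) < e).
  { apply Rmult_lt_reg_r with (/ (C + 1)); [apply Rinv_0_lt_compat; lra|].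
    rewrite Rmult_assoc, Rinv_r, Rmult_1_r by lra; easy. }
  nra.
Qed.

Lemma is_derive_F (a s : R) : 0 < a -> 0 < s -> is_derive (F a) s (- Fd a s).
Proof.
  intros ha hs; apply is_derive_quad with 1; [easy|lra|].
  intros t ht; rewrite Rmult_1_l.
  replace (_ - _ - _) with (F a t - F a s + (t - s) * Fd a s) by ring.
  apply F_taylor; lra.
Qed.

Lemma F_small (a e : R) : 0 < a -> 0 < e -> exists S, 0 < S /\ forall s, S <= s -> F a s < e.
Proof.
  intros ha he.
  (* Below [h] the integrand is at most 1 and contributes at most e / 2; above [h] it is at most
     b(h), which the choice of the threshold makes smaller than e / 2. *)
  set (h := Rmin 1 (e / 2)).
  assert (h0 : 0 < h) by (apply Rmin_pos; lra).
  assert (h1 : h <= 1) by apply Rmin_l.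
  assert (h2 : h <= e / 2) by apply Rmin_r.
  assert (hh := rpow_gt0 h a h0).
  exists (2 / (e * rpow h a)); split; [apply Rdiv_lt_0_compat; pos|].
  intros s hs.
  assert (hs0 : 0 < s) by (eapply Rlt_le_trans; [|apply hs]; apply Rdiv_lt_0_compat; pos).
  rewrite F_bfun, (RInt_Chasles_R _ 0 h 1) by (apply ex_RInt_cont; contb).
  assert (RInt (bfun a s) 0 h <= (h - 0) * 1).
  { rewrite <- RInt_const_R; apply RInt_le; try (apply ex_RInt_cont; contb); [lra|].
    intros; apply bfun_le1; lra. }
  assert (RInt (bfun a s) h 1 < (1 - h) * (e / 2) + e / 2 * h); [|lra].
  assert (hb : bfun a s h < e / 2).
  { unfold bfun; replace (e / 2) with (/ (2 / e)) by (field; lra).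
    apply Rinv_lt_contravar; [apply Rmult_lt_0_compat; [apply Rdiv_lt_0_compat; lra|apply den_pos; lra]|].
    assert (2 / (e * rpow h a) * rpow h a <= s * rpow h a) by (apply Rmult_le_compat_r; lra).
    replace (2 / (e * rpow h a) * rpow h a) with (2 / e) in H0 by (field; lra); lra. }
  assert (RInt (bfun a s) h 1 <= (1 - h) * (e / 2)); [|nra].
  rewrite <- RInt_const_R; apply RInt_le; try (apply ex_RInt_cont; contb); [lra|].
  intros x hx; eapply Rle_trans; [|apply Rlt_le, hb].
  apply Rinv_le_contravar; [apply den_pos; lra|].
  apply Rplus_le_compat_l, Rmult_le_compat_l; [lra|apply rpow_le; lra].
Qed.

(** * Solvability of the equation that defines [s_T] *)

Lemma solution_spec (P : R -> Prop) : (exists x, P x) -> P (solution P).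
Proof. intros h; unfold solution; now apply ClassicalEpsilon.epsilon_spec. Qed.

(** Continuity is assumed only on the segment; clamping the argument to [a, b] extends the function
    continuously to the line. *)
Lemma IVT_dec (f : R -> R) (a b v : R) : a <= b ->
  (forall x, a <= x <= b -> continuous f x) -> f b <= v <= f a ->
  exists x, a <= x <= b /\ f x = v.
Proof.
  intros hab hc hv.
  set (g := fun x => f (Rmax a (Rmin b x))).
  assert (hg : forall x, a <= Rmax a (Rmin b x) <= b).
  { intros x; split; [apply Rmax_l|apply Rmax_lub; [easy|apply Rmin_l]]. }
  assert (hga : g a = f a) by (unfold g; rewrite Rmin_right, Rmax_left; lra).
  assert (hgb : g b = f b) by (unfold g; rewrite Rmin_left, Rmax_right; lra).
  destruct (IVT_gen g a b v) as [x [hx hx']].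
  - intros x; apply continuity_pt_filterlim.
    apply (continuous_comp (fun x => Rmax a (Rmin b x)) f); [|apply hc, hg].
    apply continuity_pt_filterlim.
    apply continuity_pt_filterlim.
    apply (filterlim_locally (F := locally x)); intros e.
    exists e; intros y hy; unfold ball in *; simpl in *; unfold AbsRing_ball, abs, minus, plus, opp in *.
    simpl in *; revert hy; unfold Rmax, Rmin; repeat destruct Rle_dec; intros hy;
      apply Rabs_def2 in hy; apply Rabs_def1; lra.
  - rewrite hga, hgb, Rmin_right, Rmax_left; lra.
  - exists (Rmax a (Rmin b x)); split; [apply hg|exact hx'].
Qed.

Lemma F_inverse (a v : R) : 0 < a -> 0 < v < 1 -> exists s, 0 < s /\ F a s = v.
Proof.
  intros ha hv; destruct (F_small a v ha) as [S [hS h]]; [lra|].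
  (* [F] starts at 1 and is 1-Lipschitz, so it is still at least [v] at [1 - v]; this provides a
     positive left end. *)
  destruct (IVT_dec (F a) (1 - v) (Rmax S (1 - v)) v) as [s [hs e]].
  - apply Rmax_r.
  - intros x hx; apply (ex_derive_continuous (K:=R_AbsRing) (V:=R_NormedModule)).
    eexists; apply is_derive_F; lra.
  - split; [apply Rlt_le, h, Rmax_l|].
    assert (hl := F_lip a 0 (1 - v) ha); rewrite F_0 in hl.
    specialize (hl ltac:(lra) ltac:(lra)).
    rewrite Rminus_0_r, (Rabs_pos_eq (1 - v)) in hl by lra.
    apply Rabs_le_between in hl; lra.
  - exists s; split; [lra|easy].
Qed.

Lemma s_T_spec (a phin : R) : 0 < a -> 1 < phin ->
  0 < s_T a phin /\ F a (s_T a phin) = / phin.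
Proof.
  intros ha hp; apply (solution_spec (fun s => 0 < s /\ F a s = / phin)).
  apply F_inverse; [easy|]; split; [apply Rinv_0_lt_compat; lra|].
  rewrite <- Rinv_1; apply Rinv_lt_contravar; lra.
Qed.

Lemma inv_pow2 (u : R) : / u ^ 2 = (/ u) ^ 2.
Proof. symmetry; apply pow_inv. Qed.

Lemma F2_bfun (a s : R) :
  RInt (fun x => / (1 + s * rpow x a) ^ 2) 0 1 = RInt (fun x => bfun a s x ^ 2) 0 1.
Proof. apply RInt_ext; intros; unfold bfun; apply inv_pow2. Qed.

(** From b - b^2 = s x^a b^2 under the integral. The explicit factor [s] is what later makes J
    regular at 0. *)
Lemma one_sub_gamma (a s : R) : 0 < a -> 0 <= s -> 1 - gamma a s = s * Fd a s / F a s.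
Proof.
  intros ha hs; unfold gamma; rewrite F2_bfun.
  assert (h := F_gt0 a s ha hs); rewrite <- F_sub_F2 by easy; field; lra.
Qed.

Lemma gamma_T_eq (a phin : R) : 0 < a -> 1 < phin -> gamma_T a phin = gamma a (s_T a phin).
Proof.
  intros ha hp; unfold gamma_T, gamma; destruct (s_T_spec a phin ha hp) as [_ ->].
  now rewrite Rinv_inv.
Qed.

Lemma gamma_bounds (a s : R) : 0 < a -> 0 < s -> 0 < gamma a s < 1.
Proof.
  intros ha hs; split.
  - unfold gamma; rewrite F2_bfun; apply Rmult_lt_0_compat.
    + apply Rinv_0_lt_compat, F_gt0; lra.
    + apply RInt_pos01; [contb|]; intros; apply pow_lt, bfun_pos; lra.
  - assert (h := one_sub_gamma a s ha ltac:(lra)).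
    assert (0 < s * Fd a s / F a s); [|lra].
    apply Rdiv_lt_0_compat; [apply Rmult_lt_0_compat; [easy|apply Fd_gt0; lra]|apply F_gt0; lra].
Qed.

Lemma gamma_T_bounds (a phin : R) : 0 < a -> 1 < phin -> 0 < gamma_T a phin < 1.
Proof.
  intros ha hp; rewrite gamma_T_eq by easy; apply gamma_bounds; [easy|].
  now apply s_T_spec.
Qed.

Lemma c_T_pos (a phin : R) : 0 < a -> 1 < phin -> 0 < c_T a phin.
Proof.
  intros ha hp; destruct (gamma_T_bounds a phin ha hp); unfold c_T.
  apply Rdiv_lt_0_compat; lra.
Qed.

(** * Finite sums and Riemann sums *)

Definition ssum (f : nat -> R) (p : nat) : R := sum_n_m f 1 p.

Lemma ssum_0 (f : nat -> R) : ssum f 0 = 0.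
Proof. unfold ssum; rewrite sum_n_m_zero by lia; reflexivity. Qed.

Lemma ssum_S (f : nat -> R) (p : nat) : ssum f (S p) = ssum f p + f (S p).
Proof. unfold ssum; rewrite sum_n_Sm by lia; reflexivity. Qed.

Lemma ssum_ext (f g : nat -> R) (p : nat) :
  (forall i, (1 <= i <= p)%nat -> f i = g i) -> ssum f p = ssum g p.
Proof. intros h; unfold ssum; apply sum_n_m_ext_loc, h. Qed.

Lemma ssum_le (f g : nat -> R) (p : nat) :
  (forall i, (1 <= i <= p)%nat -> f i <= g i) -> ssum f p <= ssum g p.
Proof.
  induction p as [|p IH]; intros h; [rewrite !ssum_0; lra|].
  rewrite !ssum_S; apply Rplus_le_compat; [apply IH; intros; apply h; lia|apply h; lia].
Qed.

Lemma ssum_lt (f g : nat -> R) (p : nat) : (1 <= p)%nat ->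
  (forall i, (1 <= i <= p)%nat -> f i < g i) -> ssum f p < ssum g p.
Proof.
  intros hp h; destruct p as [|p]; [lia|rewrite !ssum_S].
  apply Rplus_le_lt_compat; [apply ssum_le; intros; apply Rlt_le, h; lia|apply h; lia].
Qed.

Lemma ssum_minus (f g : nat -> R) (p : nat) :
  ssum (fun i => f i - g i) p = ssum f p - ssum g p.
Proof. induction p as [|p IH]; rewrite ?ssum_0, ?ssum_S, ?IH; ring. Qed.

Lemma ssum_scal (c : R) (f : nat -> R) (p : nat) :
  ssum (fun i => c * f i) p = c * ssum f p.
Proof. induction p as [|p IH]; rewrite ?ssum_0, ?ssum_S, ?IH; ring. Qed.

Lemma ssum_const (c : R) (p : nat) : ssum (fun _ => c) p = INR p * c.
Proof. induction p as [|p IH]; rewrite ?ssum_0, ?ssum_S, ?IH, ?S_INR; simpl; ring. Qed.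

Lemma ssum_abs (f : nat -> R) (p : nat) : Rabs (ssum f p) <= ssum (fun i => Rabs (f i)) p.
Proof.
  induction p as [|p IH]; rewrite ?ssum_0, ?ssum_S; [rewrite Rabs_R0; lra|].
  eapply Rle_trans; [apply Rabs_triang|lra].
Qed.

Lemma continuous_ssum (f : nat -> R -> R) (p : nat) (x : R) :
  (forall i, (1 <= i <= p)%nat -> continuous (f i) x) ->
  continuous (fun t => ssum (fun i => f i t) p) x.
Proof.
  induction p as [|p IH]; intros h.
  - apply continuous_ext with (fun _ => 0); [intros; now rewrite ssum_0|apply continuous_const].
  - apply continuous_ext with (fun t => ssum (fun i => f i t) p + f (S p) t).
    + intros; now rewrite ssum_S.
    + apply cont_plus; [apply IH; intros; apply h; lia|apply h; lia].
Qed.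

(** The increments of [V] bound the one-sided oscillation of [k] over each unit interval and
    telescope, so the error stays controlled as [p] grows. For decreasing [k] one takes [V = 0] here
    and [V = - k] in the reverse comparison. *)
Lemma ssum_sub_RInt_le (k : R -> R) (V : nat -> R) (p : nat) :
  (forall x, continuous k x) ->
  (forall i u, (i < p)%nat -> INR i <= u <= INR (S i) -> k (INR (S i)) - k u <= V (S i) - V i) ->
  ssum (fun i => k (INR i)) p - RInt k 0 (INR p) <= V p - V 0%nat.
Proof.
  intros hc; induction p as [|p IH]; intros h.
  - rewrite ssum_0; simpl; rewrite RInt_point; unfold zero; simpl; lra.
  - rewrite ssum_S, (RInt_Chasles_R k 0 (INR p)) by now apply ex_RInt_cont.
    assert (IH' := IH ltac:(intros; apply h; [lia|easy])).
    assert (h1 : RInt (fun _ => k (INR (S p)) - (V (S p) - V p)) (INR p) (INR (S p))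
                 <= RInt k (INR p) (INR (S p))).
    { apply RInt_le; try (apply ex_RInt_cont; easy || cont).
      - rewrite S_INR; lra.
      - intros u hu; specialize (h p u ltac:(lia) ltac:(lra)); lra. }
    rewrite RInt_const_R in h1.
    replace (INR (S p) - INR p) with 1 in h1 by (rewrite S_INR; ring); lra.
Qed.

Lemma RInt_sub_ssum_le (k : R -> R) (V : nat -> R) (p : nat) :
  (forall x, continuous k x) ->
  (forall i u, (i < p)%nat -> INR i <= u <= INR (S i) -> k u - k (INR (S i)) <= V (S i) - V i) ->
  RInt k 0 (INR p) - ssum (fun i => k (INR i)) p <= V p - V 0%nat.
Proof.
  intros hc h.
  assert (h' := ssum_sub_RInt_le (fun x => - 1 * k x) V p ltac:(cont)).
  rewrite RInt_scal_R, ssum_scal in h' by now apply ex_RInt_cont.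
  eapply Rle_trans; [|apply h'; intros i u hi hu; specialize (h i u hi hu); lra]; lra.
Qed.

(* [h] is Lipschitz as a function of [x ^ a]; the error telescopes. *)
Lemma riemann_sum (a L : R) (h : R -> R) (p : nat) :
  0 < a -> 0 <= L -> (1 <= p)%nat -> (forall x, continuous h x) ->
  (forall x z, 0 <= x <= z -> z <= 1 -> Rabs (h x - h z) <= L * (rpow z a - rpow x a)) ->
  Rabs (/ INR p * ssum (fun i => h (INR i / INR p)) p - RInt h 0 1) <= L / INR p.
Proof.
  intros ha hL hp hc hh.
  assert (hp0 : 0 < INR p) by (apply lt_0_INR; lia).
  set (k := fun u => h (/ INR p * u)).
  set (V := fun i : nat => L * rpow (INR i / INR p) a).
  assert (e1 : ssum (fun i => h (INR i / INR p)) p = ssum (fun i => k (INR i)) p).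
  { apply ssum_ext; intros; unfold k; f_equal; field; lra. }
  assert (kc : forall x, continuous k x).
  { intros; unfold k; apply (continuous_comp (fun u => / INR p * u) h); [cont|apply hc]. }
  assert (e2 : RInt h 0 1 = / INR p * RInt k 0 (INR p)).
  { unfold k; rewrite RInt_scale by now apply ex_RInt_cont.
    now rewrite Rmult_0_r, Rinv_l by lra. }
  assert (hV : forall i u, (i < p)%nat -> INR i <= u <= INR (S i) ->
     Rabs (k u - k (INR (S i))) <= V (S i) - V i).
  { intros i u hi hu; unfold k, V.
    assert (hi0 := pos_INR i).
    assert (hSi : INR (S i) <= INR p) by (apply le_INR; lia).
    rewrite !(Rmult_comm (/ INR p)).
    fold (u / INR p); fold (INR (S i) / INR p).
    eapply Rle_trans; [apply hh|].
    - split; [apply Rdiv_le_0_compat; lra|].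
      apply Rmult_le_compat_r; [apply Rlt_le, Rinv_0_lt_compat; lra|lra].
    - apply (Rle_div_l _ 1); lra.
    - rewrite <- Rmult_minus_distr_l; apply Rmult_le_compat_l; [easy|].
      apply Rplus_le_compat_l, Ropp_le_contravar, rpow_le; [lra|].
      apply Rmult_le_compat_r; [apply Rlt_le, Rinv_0_lt_compat; lra|lra]. }
  assert (hVp : V p - V 0%nat <= L).
  { unfold V; rewrite Rdiv_diag, rpow_1_l by lra.
    assert (h0 := rpow_ge0 (INR 0 / INR p) a); nra. }
  rewrite e1, e2, <- Rmult_minus_distr_l, Rabs_mult, Rabs_pos_eq
    by (apply Rlt_le, Rinv_0_lt_compat; lra).
  unfold Rdiv; rewrite Rmult_comm; apply Rmult_le_compat_r;
    [apply Rlt_le, Rinv_0_lt_compat; lra|].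
  apply Rabs_le; split.
  - assert (h1 := RInt_sub_ssum_le k V p kc).
    specialize (h1 ltac:(intros i u hi hu; specialize (hV i u hi hu); apply Rabs_le_between in hV; lra)).
    lra.
  - assert (h1 := ssum_sub_RInt_le k V p kc).
    specialize (h1 ltac:(intros i u hi hu; specialize (hV i u hi hu); apply Rabs_le_between in hV; lra)).
    lra.
Qed.

Definition bsum (a : R) (p : nat) (t : R) : R := ssum (fun i => bfun a t (INR i)) p.

Lemma bsum_decr (a : R) (p : nat) (s t : R) : (1 <= p)%nat -> 0 <= s < t ->
  bsum a p t < bsum a p s.
Proof.
  intros hp hst; apply ssum_lt; [easy|intros i hi].
  assert (hi0 : 0 < INR i) by (apply lt_0_INR; lia).
  rewrite (bfun_diff a s t) by lra.
  assert (0 < rpow (INR i) a * (bfun a s (INR i) * bfun a t (INR i))); [|nra].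
  apply Rmult_lt_0_compat; [now apply rpow_gt0|].
  apply Rmult_lt_0_compat; apply bfun_pos; lra.
Qed.

Lemma continuous_bfun_t (a x t : R) : 0 <= t -> continuous (fun t => bfun a t x) t.
Proof. intros ht; unfold bfun; apply cont_inv; [cont|apply Rgt_not_eq, den_pos, ht]. Qed.

Lemma lambda_frac (a t : R) (i : nat) : 0 <= t -> (1 <= i)%nat ->
  lambda a i / (lambda a i + t) = bfun a t (INR i).
Proof.
  intros ht hi; unfold lambda, bfun; rewrite Rpower_Ropp.
  rewrite rpow_pos by (apply lt_0_INR; lia).
  assert (h := Rpower_pos (INR i) a); field; split; nz.
Qed.

Lemma tau_p_spec (a : R) (p k : nat) : 0 < a -> (1 <= k < p)%nat ->
  0 < tau_p a p k /\ bsum a p (tau_p a p k) = INR k.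
Proof.
  intros ha hk.
  assert (h : 0 < tau_p a p k /\
    sum_n_m (fun i => lambda a i / (lambda a i + tau_p a p k)) 1 p = INR k).
  { apply (solution_spec (fun t => 0 < t /\
      sum_n_m (fun i => lambda a i / (lambda a i + t)) 1 p = INR k)).
    assert (hp0 : 0 < INR p) by (apply lt_0_INR; lia).
    assert (hk1 : 1 <= INR k) by (change 1 with (INR 1); apply le_INR; lia).
    assert (hkp : INR k < INR p) by (apply lt_INR; lia).
    assert (e0 : bsum a p 0 = INR p).
    { unfold bsum; rewrite (ssum_ext _ (fun _ => 1)), ssum_const; [ring|].
      intros; unfold bfun; field; lra. }
    (* At [t = 0] every term is 1 and the sum is [p], above [k]; at [t = p] every term is at most 1
       / p, so the sum is at most 1, hence at most [k]. *)
    destruct (IVT_dec (bsum a p) 0 (INR p) (INR k)) as [t [ht e]].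
    - lra.
    - intros t ht; apply continuous_ssum; intros; apply continuous_bfun_t; lra.
    - split; [|lra].
      apply Rle_trans with (ssum (fun _ => / INR p) p);
        [|rewrite ssum_const, Rinv_r; lra].
      apply ssum_le; intros i hi; apply Rinv_le_contravar; [lra|].
      assert (1 <= rpow (INR i) a); [|nra].
      rewrite <- (rpow_1_l a); apply rpow_le; [lra|].
      change 1 with (INR 1); apply le_INR; lia.
    - assert (t <> 0) by (intros ->; lra).
      exists t; split; [lra|].
      rewrite <- e; apply ssum_ext; intros; apply lambda_frac; [lra|lia]. }
  destruct h as [h0 h]; split; [easy|].
  rewrite <- h; symmetry; apply ssum_ext; intros; apply lambda_frac; [lra|lia].
Qed.

Lemma gamma_p_eq (a : R) (p k : nat) : 0 < a -> (1 <= k < p)%nat ->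
  gamma_p a p k = / INR k * ssum (fun i => bfun a (tau_p a p k) (INR i) ^ 2) p.
Proof.
  intros ha hk; destruct (tau_p_spec a p k ha hk) as [h _].
  unfold gamma_p; f_equal; apply ssum_ext; intros i hi.
  rewrite <- lambda_frac by (lra || lia); unfold Rdiv; rewrite Rpow_mult_distr, pow_inv; easy.
Qed.

(** The factor tau_S / (lambda + tau_S) is 1 - b_S, so the eigenvalues disappear. The first term is
    the bias, which keeps one factor tau_S; the rest is the variance part, proportional to
    [sigma2]. *)
Lemma W2SG_p_eq (a sigma2 : R) (p n m : nat) :
  0 < a -> (1 <= n < p)%nat -> (1 <= m < p)%nat ->
  let tS := tau_p a p m in
  let bS := fun i => bfun a tS (INR i) in
  let bT := fun i => bfun a (tau_p a p n) (INR i) in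
  W2SG_p a sigma2 p n m =
  - (tS / (1 - gamma_p a p m) * ssum (fun i => (1 - bS i) * bS i * bT i) p)
  + sigma2 / (INR n * (1 - gamma_p a p n)) *
    (2 * ssum (fun i => (1 - bS i) * bT i ^ 2) p
     - / (1 - gamma_p a p m) * ssum (fun i => (1 - bS i) ^ 2 * bT i ^ 2) p).
Proof.
  intros ha hn hm tS bS bT; unfold W2SG_p; fold tS.
  destruct (tau_p_spec a p m ha hm) as [h1 _].
  destruct (tau_p_spec a p n ha hn) as [h2 _]; fold tS in h1.
  set (tT := tau_p a p n) in *.
  assert (E : forall i, (1 <= i <= p)%nat ->
    0 < lambda a i /\ bS i = lambda a i / (lambda a i + tS) /\
    bT i = lambda a i / (lambda a i + tT)).
  { intros i hi; split; [apply Rpower_pos|]; unfold bS, bT.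
    rewrite !lambda_frac by (lra || lia); easy. }
  assert (e1 : tS * ssum (fun i => lambda a i ^ 2 / ((lambda a i + tS) ^ 2 * (lambda a i + tT))) p
     = ssum (fun i => (1 - bS i) * bS i * bT i) p).
  { rewrite <- ssum_scal; apply ssum_ext; intros i hi; destruct (E i hi) as (hl & -> & ->).
    field; lra. }
  assert (e2 : tS * ssum (fun i => lambda a i ^ 2 / ((lambda a i + tS) * (lambda a i + tT) ^ 2)) p
     = ssum (fun i => (1 - bS i) * bT i ^ 2) p).
  { rewrite <- ssum_scal; apply ssum_ext; intros i hi; destruct (E i hi) as (hl & -> & ->).
    field; lra. }
  assert (e3 : tS ^ 2 * ssum (fun i => lambda a i ^ 2 / ((lambda a i + tS) ^ 2 * (lambda a i + tT) ^ 2)) p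
     = ssum (fun i => (1 - bS i) ^ 2 * bT i ^ 2) p).
  { rewrite <- ssum_scal; apply ssum_ext; intros i hi; destruct (E i hi) as (hl & -> & ->).
    field; lra. }
  rewrite <- e1, <- e2, <- e3; unfold ssum, Rdiv; cbv zeta.
  rewrite !Rinv_mult; ring.
Qed.

(** * Limits of rescaled sums with varying parameters *)

Lemma is_lim_seq_eps (u : nat -> R) (l : R) :
  is_lim_seq u l <-> forall e, 0 < e -> eventually (fun n => Rabs (u n - l) < e).
Proof.
  split.
  - intros h e he; apply is_lim_seq_spec in h; exact (h (mkposreal e he)).
  - intros h; apply is_lim_seq_spec; intros e; apply h, cond_pos.
Qed.

Lemma is_lim_seq_continuous_comp (f : R -> R) (u : nat -> R) (l : R) :
  continuous f l -> is_lim_seq u l -> is_lim_seq (fun n => f (u n)) (f l).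
Proof. intros hf hu; apply (filterlim_comp _ _ _ u f _ _ _ hu hf). Qed.

Lemma is_lim_seq_Rabs_0 (u v : nat -> R) :
  eventually (fun n => Rabs (u n) <= v n) -> is_lim_seq v 0 -> is_lim_seq u 0.
Proof.
  intros h hv; apply is_lim_seq_eps; intros e he.
  apply is_lim_seq_eps with (e := e) in hv; [|easy].
  generalize (filter_and _ _ h hv); apply filter_imp; intros n [h1 h2].
  rewrite Rminus_0_r in *; apply Rabs_def2 in h2; lra.
Qed.

Lemma is_lim_seq_inv_INR : is_lim_seq (fun p => / INR p) 0.
Proof. apply (is_lim_seq_inv _ p_infty); [apply is_lim_seq_INR|discriminate]. Qed.

Lemma bfun_lip_y (a s x z : R) : 0 < a -> 0 <= s -> 0 <= x <= z ->
  Rabs (bfun a s x - bfun a s z) <= s * (rpow z a - rpow x a).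
Proof.
  intros ha hs hxz.
  assert (hy := rpow_le a x z ltac:(lra) ltac:(lra)).
  assert (e : bfun a s x - bfun a s z
     = s * (rpow z a - rpow x a) * (bfun a s x * bfun a s z)).
  { unfold bfun; field; split; apply Rgt_not_eq, den_pos, hs. }
  assert (h1 := bfun_pos a s x hs); assert (h2 := bfun_pos a s z hs).
  assert (h3 := bfun_le1 a s x hs); assert (h4 := bfun_le1 a s z hs).
  rewrite e, Rabs_pos_eq.
  - assert (0 <= s * (rpow z a - rpow x a)) by (apply Rmult_le_pos; lra).
    assert (bfun a s x * bfun a s z <= 1) by nra.
    assert (0 < bfun a s x * bfun a s z) by pos; nra.
  - apply Rmult_le_pos; [apply Rmult_le_pos; lra|apply Rlt_le; pos].
Qed.

Definition lipschitz2 (L : R) (G : R -> R -> R) : Prop :=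
  forall u v u' v', 0 <= u <= 1 -> 0 <= v <= 1 -> 0 <= u' <= 1 -> 0 <= v' <= 1 ->
  Rabs (G u v - G u' v') <= L * (Rabs (u - u') + Rabs (v - v')).

(** Two errors are separated: moving the parameters [sp p], [tp p] to their limits costs the
    Lipschitz constant times the displacement, uniformly in the index, and [riemann_sum] handles the
    fixed parameters. *)
Lemma riemann_limit (a L s t : R) (G : R -> R -> R) (sp tp : nat -> R) :
  0 < a -> 0 <= L -> lipschitz2 L G -> 0 <= s -> 0 <= t ->
  (forall x, continuous (fun x => G (bfun a s x) (bfun a t x)) x) ->
  eventually (fun p => 0 <= sp p) -> eventually (fun p => 0 <= tp p) ->
  is_lim_seq sp s -> is_lim_seq tp t ->
  is_lim_seq (fun p => / INR p *
      ssum (fun i => G (bfun a (sp p) (INR i / INR p)) (bfun a (tp p) (INR i / INR p))) p)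
    (RInt (fun x => G (bfun a s x) (bfun a t x)) 0 1).
Proof.
  intros ha hL hG hs ht hc hsp htp ls lt.
  set (I := RInt _ _ _).
  apply is_lim_seq_ext with
    (fun p => I + (/ INR p *
      ssum (fun i => G (bfun a (sp p) (INR i / INR p)) (bfun a (tp p) (INR i / INR p))) p - I));
    [intros; ring|].
  replace (Finite I) with (Finite (I + 0)) by (f_equal; ring).
  apply is_lim_seq_plus'; [apply is_lim_seq_const|].
  apply is_lim_seq_Rabs_0 with
    (fun p => L * (Rabs (sp p - s) + Rabs (tp p - t)) + (L * (s + t)) * / INR p).
  - generalize (filter_and _ _ hsp htp).
    intros h; destruct h as [N h]; exists (S N); intros p hp.
    destruct (h p ltac:(lia)) as [hs' ht'].
    assert (hp0 : 0 < INR p) by (apply lt_0_INR; lia).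
    assert (R0 : Rabs (/ INR p * ssum (fun i => G (bfun a s (INR i / INR p)) (bfun a t (INR i / INR p))) p - I)
      <= L * (s + t) / INR p).
    { apply (riemann_sum a (L * (s + t)) (fun x => G (bfun a s x) (bfun a t x)));
        [easy|apply Rmult_le_pos; lra|lia|easy|].
      intros x z hx hz.
      assert (b0 : forall r w, 0 <= r -> 0 <= bfun a r w <= 1)
        by (intros; split; [now apply Rlt_le, bfun_pos|now apply bfun_le1]).
      eapply Rle_trans; [apply hG; apply b0; lra|].
      rewrite Rmult_assoc; apply Rmult_le_compat_l; [easy|].
      rewrite Rmult_plus_distr_r; apply Rplus_le_compat; apply bfun_lip_y; lra. }
    assert (R1 : Rabs (/ INR p *
      ssum (fun i => G (bfun a (sp p) (INR i / INR p)) (bfun a (tp p) (INR i / INR p))) p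
      - / INR p * ssum (fun i => G (bfun a s (INR i / INR p)) (bfun a t (INR i / INR p))) p)
      <= L * (Rabs (sp p - s) + Rabs (tp p - t))).
    { rewrite <- Rmult_minus_distr_l, <- ssum_minus, Rabs_mult, Rabs_pos_eq
        by (apply Rlt_le, Rinv_0_lt_compat; lra).
      apply Rmult_le_reg_l with (INR p); [easy|].
      rewrite <- Rmult_assoc, Rinv_r, Rmult_1_l by lra.
      eapply Rle_trans; [apply ssum_abs|].
      rewrite <- ssum_const; apply ssum_le; intros i hi.
      assert (b0 : forall r w, 0 <= r -> 0 <= bfun a r w <= 1)
        by (intros; split; [now apply Rlt_le, bfun_pos|now apply bfun_le1]).
      eapply Rle_trans; [apply hG; apply b0; lra|].
      apply Rmult_le_compat_l; [easy|].
      assert (INR i / INR p <= 1).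
      { apply (Rle_div_l _ 1); [easy|]; rewrite Rmult_1_l; apply le_INR; lia. }
      apply Rplus_le_compat; apply bfun_lip; lra. }
    match goal with |- Rabs (?A - I) <= _ =>
      replace (A - I) with (A - / INR p * ssum (fun i => G (bfun a s (INR i / INR p)) (bfun a t (INR i / INR p))) p
        + (/ INR p * ssum (fun i => G (bfun a s (INR i / INR p)) (bfun a t (INR i / INR p))) p - I)) by ring end.
    eapply Rle_trans; [apply Rabs_triang|]; unfold Rdiv in R0; lra.
  - replace 0 with (L * (0 + 0) + L * (s + t) * 0) by ring.
    assert (Z : forall u l, is_lim_seq u (Finite l) -> is_lim_seq (fun p => Rabs (u p - l)) 0).
    { intros u l h; rewrite <- Rabs_R0; apply (is_lim_seq_abs (fun p => u p - l) 0).
      replace 0 with (l - l) by ring; apply is_lim_seq_minus'; [easy|apply is_lim_seq_const]. }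
    apply is_lim_seq_plus'; apply (is_lim_seq_scal_l _ _ (Finite _)).
    + apply is_lim_seq_plus'; now apply Z.
    + apply is_lim_seq_inv_INR.
Qed.

Lemma bfun_rescale (a t x q : R) : 0 < q -> 0 <= x ->
  bfun a t x = bfun a (t * rpow q a) (x / q).
Proof.
  intros hq hx; unfold bfun; f_equal; f_equal.
  replace x with (q * (x / q)) at 1 by (field; lra).
  rewrite rpow_mult_l; [ring|lra|apply Rdiv_le_0_compat; lra].
Qed.

(** Under the substitution i = p x the parameter tau becomes tau p^a; this is the quantity that
    converges, to the solution of F(s) = lim k / p. *)
Definition stau (a : R) (p k : nat) : R := tau_p a p k * rpow (INR p) a.

Lemma bfun_stau (a : R) (p k i : nat) : (1 <= p)%nat ->
  bfun a (tau_p a p k) (INR i) = bfun a (stau a p k) (INR i / INR p).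
Proof. intros hp; apply bfun_rescale; [apply lt_0_INR; lia|apply pos_INR]. Qed.

(** The root is trapped by monotonicity: at [s - d] and [s + d] the Riemann sums converge to values
    of [F] strictly on either side of [F a s], while at the root they reproduce k / p. *)
Lemma stau_limit (a s : R) (k : nat -> nat) :
  0 < a -> 0 < s -> eventually (fun p => (1 <= k p < p)%nat) ->
  is_lim_seq (fun p => INR (k p) / INR p) (F a s) ->
  is_lim_seq (fun p => stau a p (k p)) s.
Proof.
  intros ha hs hk hl.
  assert (Fp : forall r, 0 <= r -> is_lim_seq (fun p => / INR p *
      ssum (fun i => bfun a r (INR i / INR p)) p) (F a r)).
  { intros r hr.
    apply (riemann_limit a 1 r r (fun u _ => u) (fun _ => r) (fun _ => r)); try easy; try lra.
    - intros u v u' v' _ _ _ _; assert (h := Rabs_pos (v - v')); lra.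
    - intros; contb.
    - now exists 0%nat.
    - now exists 0%nat.
    - apply is_lim_seq_const.
    - apply is_lim_seq_const. }
  assert (Mono : forall p r q, (1 <= p)%nat -> 0 <= r <= q ->
     ssum (fun i => bfun a q (INR i / INR p)) p <= ssum (fun i => bfun a r (INR i / INR p)) p).
  { intros p r q hp hrq; apply ssum_le; intros i hi.
    apply Rinv_le_contravar; [apply den_pos; lra|].
    assert (h := rpow_ge0 (INR i / INR p) a); nra. }
  assert (Eq : eventually (fun p => 0 < stau a p (k p) /\ INR (k p) / INR p =
     / INR p * ssum (fun i => bfun a (stau a p (k p)) (INR i / INR p)) p)).
  { revert hk; apply filter_imp; intros p hp.
    destruct (tau_p_spec a p (k p) ha hp) as [h1 h2]; split.
    - apply Rmult_lt_0_compat; [easy|apply rpow_gt0, lt_0_INR; lia].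
    - rewrite <- h2; unfold bsum, Rdiv; rewrite Rmult_comm; f_equal.
      apply ssum_ext; intros; apply bfun_stau; lia. }
  assert (P1 : eventually (fun p => (1 <= p)%nat)) by (exists 1%nat; easy).
  assert (Sep : forall r, 0 <= r -> F a r <> F a s ->
    eventually (fun p => Rabs (/ INR p * ssum (fun i => bfun a r (INR i / INR p)) p
      - INR (k p) / INR p - (F a r - F a s)) < Rabs (F a r - F a s))).
  { intros r hr hne.
    assert (h := is_lim_seq_minus' _ _ _ _ (Fp r hr) hl).
    apply is_lim_seq_eps with (e := Rabs (F a r - F a s)) in h; [easy|].
    apply Rabs_pos_lt; lra. }
  apply is_lim_seq_eps; intros e he.
  set (d := Rmin e s / 2).
  assert (hd : 0 < d <= e / 2 /\ d <= s / 2).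
  { unfold d; assert (h1 := Rmin_l e s); assert (h2 := Rmin_r e s).
    assert (h3 : 0 < Rmin e s) by (apply Rmin_pos; lra); lra. }
  assert (F1 := F_decr a (s - d) s ha ltac:(lra)).
  assert (F2 := F_decr a s (s + d) ha ltac:(lra)).
  assert (S1 := Sep (s - d) ltac:(lra) ltac:(lra)).
  assert (S2 := Sep (s + d) ltac:(lra) ltac:(lra)).
  generalize (filter_and _ _ (filter_and _ _ S1 S2) (filter_and _ _ P1 Eq)).
  apply filter_imp; intros p [[h1 h2] [hp [h3 h4]]].
  rewrite h4 in h1, h2.
  rewrite (Rabs_pos_eq (F a (s - d) - F a s)) in h1 by lra.
  rewrite (Rabs_left1 (F a (s + d) - F a s)) in h2 by lra.
  apply Rabs_def2 in h1; apply Rabs_def2 in h2.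
  assert (hp0 : 0 < / INR p) by (apply Rinv_0_lt_compat, lt_0_INR; lia).
  apply Rabs_def1.
  - assert (stau a p (k p) < s + d); [|lra].
    apply Rnot_le_lt; intros hle.
    assert (hm := Mono p (s + d) (stau a p (k p)) hp ltac:(lra)); nra.
  - assert (s - d < stau a p (k p)); [|lra].
    apply Rnot_le_lt; intros hle.
    assert (hm := Mono p (stau a p (k p)) (s - d) hp ltac:(lra)); nra.
Qed.

Lemma ratio_inv_limit (k : nat -> nat) (phi : R) :
  1 < phi -> eventually (fun p => (1 <= k p)%nat) ->
  is_lim_seq (fun p => INR p / INR (k p)) phi ->
  is_lim_seq (fun p => INR (k p) / INR p) (/ phi) /\
  eventually (fun p => (1 <= k p < p)%nat).
Proof.
  intros hphi hk hl.
  assert (P1 : eventually (fun p => (1 <= p)%nat)) by (exists 1%nat; easy).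
  assert (K := filter_and _ _ hk P1); split.
  - apply is_lim_seq_ext_loc with (fun p => / (INR p / INR (k p))).
    + revert K; apply filter_imp; intros p [h1 h2].
      assert (0 < INR p) by (apply lt_0_INR; lia).
      assert (0 < INR (k p)) by (apply lt_0_INR; lia).
      field; lra.
    + apply (is_lim_seq_inv _ phi hl); intros h; injection h; lra.
  - apply is_lim_seq_eps with (e := phi - 1) in hl; [|lra].
    generalize (filter_and _ _ K hl); apply filter_imp; intros p [[h1 h2] h3].
    split; [easy|]; apply INR_lt.
    assert (0 < INR (k p)) by (apply lt_0_INR; lia).
    apply Rabs_def2 in h3.
    assert (1 < INR p / INR (k p)) by lra.
    apply (Rlt_div_r 1) in H0; lra.
Qed.

Lemma gamma_p_limit (a phi : R) (k : nat -> nat) :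
  0 < a -> 1 < phi -> eventually (fun p => (1 <= k p)%nat) ->
  is_lim_seq (fun p => INR p / INR (k p)) phi ->
  is_lim_seq (fun p => gamma_p a p (k p)) (gamma_T a phi).
Proof.
  intros ha hphi hk hl.
  destruct (ratio_inv_limit k phi hphi hk hl) as [hl' hk'].
  destruct (s_T_spec a phi ha hphi) as [hs hF].
  assert (st := stau_limit a _ k ha hs hk' ltac:(rewrite hF; easy)).
  assert (pos' : eventually (fun p => 0 <= stau a p (k p))).
  { revert hk'; apply filter_imp; intros p hp.
    apply Rmult_le_pos; [apply Rlt_le, tau_p_spec; easy|apply rpow_ge0]. }
  unfold gamma_T; rewrite F2_bfun.
  apply is_lim_seq_ext_loc with (fun p => INR p / INR (k p) * (/ INR p *
     ssum (fun i => bfun a (stau a p (k p)) (INR i / INR p) ^ 2) p)).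
  - revert hk'; apply filter_imp; intros p hp.
    assert (0 < INR p) by (apply lt_0_INR; lia).
    assert (0 < INR (k p)) by (apply lt_0_INR; lia).
    rewrite gamma_p_eq by easy.
    rewrite (ssum_ext (fun i => bfun a (tau_p a p (k p)) (INR i) ^ 2)
      (fun i => bfun a (stau a p (k p)) (INR i / INR p) ^ 2)); [field; lra|].
    intros; rewrite bfun_stau by lia; easy.
  - apply is_lim_seq_mult'; [easy|].
    apply (riemann_limit a 2 (s_T a phi) (s_T a phi) (fun u _ => u ^ 2)
      (fun p => stau a p (k p)) (fun p => stau a p (k p))); try easy; try lra.
    + intros u v u' v' h1 _ h2 _.
      replace (u ^ 2 - u' ^ 2) with ((u + u') * (u - u')) by ring.
      rewrite Rabs_mult, (Rabs_pos_eq (u + u')) by lra.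
      assert (h3 := Rabs_pos (u - u')); assert (h4 := Rabs_pos (v - v')); nra.
    + intros; contb.
Qed.

(** * The proportional limit *)

Definition N1 (a t s : R) : R := RInt (fun x => rpow x a * (bfun a s x * bfun a t x ^ 2)) 0 1.
Definition A1 (a t s : R) : R := RInt (fun x => rpow x a * (bfun a s x ^ 2 * bfun a t x ^ 2)) 0 1.
(** Minus the derivative of [N1] in [s]. *)
Definition A2 (a t s : R) : R := RInt (fun x => rpow x a ^ 2 * (bfun a s x ^ 2 * bfun a t x ^ 2)) 0 1.
(* [Jext] extends [J] continuously to [s = 0]. *)
Definition Jext (a t s : R) : R := 2 * N1 a t s - F a s / Fd a s * A2 a t s.

Lemma N1_split (a t s : R) : 0 < a -> 0 <= t -> 0 <= s ->
  N1 a t s = A1 a t s + s * A2 a t s.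
Proof.
  intros; unfold N1, A1, A2.
  rewrite <- RInt_scal_R, <- RInt_plus_R by (apply ex_RInt_cont; contb).
  apply RInt_ext; intros x _; toR.
  assert (e := bfun_eq a s x ltac:(lra)).
  transitivity (rpow x a * (bfun a s x * bfun a t x ^ 2) * (bfun a s x + s * rpow x a * bfun a s x));
    [rewrite e; ring|ring].
Qed.

Lemma A_1_eq (a phin s : R) : A a phin 1 s = A1 a (s_T a phin) s.
Proof.
  unfold A, A1; apply RInt_ext; intros x _; toR; unfold bfun, Rdiv.
  now rewrite Rmult_1_l, Rinv_mult, !pow_inv.
Qed.

Lemma A_2_eq (a phin s : R) : A a phin 2 s = A2 a (s_T a phin) s.
Proof.
  unfold A, A2; apply RInt_ext; intros x _; toR; unfold bfun, Rdiv.
  now rewrite rpow_double, Rinv_mult, !pow_inv.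
Qed.

(** Since 1 / (1 - gamma) = F / (s Fd), the factor [s] in front of the second integral cancels, and
    N1 = A1 + s A2 collects the rest. *)
Lemma J_eq (a phin s : R) : 0 < a -> 1 < phin -> 0 < s ->
  J a phin s = Jext a (s_T a phin) s.
Proof.
  intros ha hp hs; destruct (s_T_spec a phin ha hp) as [ht _].
  unfold J, Jext; rewrite A_1_eq, A_2_eq, one_sub_gamma, N1_split by lra.
  assert (h1 := F_gt0 a s ha ltac:(lra)); assert (h2 := Fd_gt0 a s ha ltac:(lra)).
  field; lra.
Qed.

(** The right-hand side is the form in which the variance sums of [W2SG_p_eq] converge; it becomes
    [s * J] through 1 - b = s x^a b. *)
Lemma sJ_eq (a phin s : R) : 0 < a -> 1 < phin -> 0 < s ->
  s * J a phin s =
  2 * RInt (fun x => (1 - bfun a s x) * bfun a (s_T a phin) x ^ 2) 0 1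
  - / (1 - gamma a s) * RInt (fun x => (1 - bfun a s x) ^ 2 * bfun a (s_T a phin) x ^ 2) 0 1.
Proof.
  intros ha hp hs; destruct (s_T_spec a phin ha hp) as [ht _].
  rewrite J_eq, one_sub_gamma by lra; unfold Jext.
  assert (h1 := F_gt0 a s ha ltac:(lra)); assert (h2 := Fd_gt0 a s ha ltac:(lra)).
  assert (e : forall x, 1 - bfun a s x = s * rpow x a * bfun a s x)
    by (intros x; assert (e := bfun_eq a s x ltac:(lra)); lra).
  assert (e1 : RInt (fun x => (1 - bfun a s x) * bfun a (s_T a phin) x ^ 2) 0 1
    = s * N1 a (s_T a phin) s).
  { unfold N1; rewrite <- RInt_scal_R by (apply ex_RInt_cont; contb).
    apply RInt_ext; intros x _; toR; rewrite e; ring. }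
  assert (e2 : RInt (fun x => (1 - bfun a s x) ^ 2 * bfun a (s_T a phin) x ^ 2) 0 1
    = s ^ 2 * A2 a (s_T a phin) s).
  { unfold A2; rewrite <- RInt_scal_R by (apply ex_RInt_cont; contb).
    apply RInt_ext; intros x _; toR; rewrite e; ring. }
  rewrite e1, e2; field; lra.
Qed.

Lemma Rpower_neg_lim (e : R) : 0 < e -> is_lim_seq (fun p => Rpower (INR p) (- e)) 0.
Proof.
  intros he.
  apply is_lim_seq_ext_loc with (fun p => rpow (/ INR p) e).
  - exists 1%nat; intros p hp; assert (0 < INR p) by (apply lt_0_INR; lia).
    rewrite rpow_pos by now apply Rinv_0_lt_compat.
    unfold Rpower; rewrite ln_Rinv by easy; f_equal; ring.
  - rewrite <- (rpow_nonpos 0 e) by lra.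
    apply (is_lim_seq_continuous_comp (fun u => rpow u e)); [now apply continuous_rpow|].
    apply is_lim_seq_inv_INR.
Qed.

Lemma proportional_limit (a sigma2 phin phim : R) (n m : nat -> nat) :
  1 < a -> 1 < phin -> teacher_sizes n phin -> 1 < phim -> student_sizes m phim ->
  is_lim_seq (fun p => W2SG_p a sigma2 p (n p) (m p))
    (sigma2 * phin / (1 - gamma_T a phin) *
      (s_T a phim * J a phin (s_T a phim))).
Proof.
  intros ha hn [hn1 hnl] hm [hm1 hml].
  assert (hm0 : eventually (fun p => (1 <= m p)%nat)).
  { apply is_lim_seq_spec in hm1; specialize (hm1 0); revert hm1; apply filter_imp.
    intros p h; destruct (m p); [simpl in h; lra|lia]. }
  assert (hn0 : eventually (fun p => (1 <= n p)%nat)) by (exists 0%nat; intros; apply hn1).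
  destruct (ratio_inv_limit n phin hn hn0 hnl) as [hnl' hnp].
  destruct (ratio_inv_limit m phim hm hm0 hml) as [hml' hmp].
  destruct (s_T_spec a phin ltac:(lra) hn) as [hT FT].
  destruct (s_T_spec a phim ltac:(lra) hm) as [hS FS].
  set (tT := s_T a phin) in *; set (tS := s_T a phim) in *.
  assert (sT := stau_limit a tT n ltac:(lra) hT hnp ltac:(rewrite FT; easy)).
  assert (sS := stau_limit a tS m ltac:(lra) hS hmp ltac:(rewrite FS; easy)).
  assert (pT : eventually (fun p => 0 <= stau a p (n p))).
  { revert hnp; apply filter_imp; intros p hp.
    apply Rmult_le_pos; [apply Rlt_le, tau_p_spec; easy || lra|apply rpow_ge0]. }
  assert (pS : eventually (fun p => 0 <= stau a p (m p))).
  { revert hmp; apply filter_imp; intros p hp.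
    apply Rmult_le_pos; [apply Rlt_le, tau_p_spec; easy || lra|apply rpow_ge0]. }
  assert (gT := gamma_p_limit a phin n ltac:(lra) hn hn0 hnl).
  assert (gS := gamma_p_limit a phim m ltac:(lra) hm hm0 hml).
  assert (gTb := gamma_T_bounds a phin ltac:(lra) hn).
  assert (gSb := gamma_T_bounds a phim ltac:(lra) hm).
  rewrite sJ_eq by lra; fold tT.
  replace (gamma a tS) with (gamma_T a phim) by (apply gamma_T_eq; lra).
  assert (L1 : is_lim_seq (fun p => / INR p *
     ssum (fun i => (1 - bfun a (stau a p (m p)) (INR i / INR p)) *
                    bfun a (stau a p (n p)) (INR i / INR p) ^ 2) p)
     (RInt (fun x => (1 - bfun a tS x) * bfun a tT x ^ 2) 0 1)).
  { apply (riemann_limit a 2 tS tT (fun u v => (1 - u) * v ^ 2)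
      (fun p => stau a p (m p)) (fun p => stau a p (n p))); try easy; try lra.
    - intros u v u' v' h1 h2 h3 h4.
      replace ((1 - u) * v ^ 2 - (1 - u') * v' ^ 2) with
        (- (v ^ 2 * (u - u')) + (1 - u') * (v + v') * (v - v')) by ring.
      eapply Rle_trans; [apply Rabs_triang|].
      rewrite Rabs_Ropp, !Rabs_mult, (Rabs_pos_eq (v ^ 2)), (Rabs_pos_eq (1 - u')),
        (Rabs_pos_eq (v + v')) by (try apply pow2_ge_0; lra).
      assert (h5 := Rabs_pos (u - u')); assert (h6 := Rabs_pos (v - v')).
      assert (v ^ 2 <= 1) by (simpl; nra).
      assert ((1 - u') * (v + v') <= 2) by nra; nra.
    - intros; contb. }
  assert (L2 : is_lim_seq (fun p => / INR p *
     ssum (fun i => (1 - bfun a (stau a p (m p)) (INR i / INR p)) ^ 2 *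
                    bfun a (stau a p (n p)) (INR i / INR p) ^ 2) p)
     (RInt (fun x => (1 - bfun a tS x) ^ 2 * bfun a tT x ^ 2) 0 1)).
  { apply (riemann_limit a 2 tS tT (fun u v => (1 - u) ^ 2 * v ^ 2)
      (fun p => stau a p (m p)) (fun p => stau a p (n p))); try easy; try lra.
    - intros u v u' v' h1 h2 h3 h4.
      replace ((1 - u) ^ 2 * v ^ 2 - (1 - u') ^ 2 * v' ^ 2) with
        (- (v ^ 2 * (2 - u - u') * (u - u')) + (1 - u') ^ 2 * (v + v') * (v - v')) by ring.
      eapply Rle_trans; [apply Rabs_triang|].
      rewrite Rabs_Ropp, !Rabs_mult, (Rabs_pos_eq (v ^ 2)), (Rabs_pos_eq ((1 - u') ^ 2)),
        (Rabs_pos_eq (v + v')), (Rabs_pos_eq (2 - u - u')) by (try apply pow2_ge_0; lra).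
      assert (h5 := Rabs_pos (u - u')); assert (h6 := Rabs_pos (v - v')).
      assert (0 <= v ^ 2 <= 1) by (simpl; nra).
      assert (0 <= (1 - u') ^ 2 <= 1) by (simpl; nra).
      assert (v ^ 2 * (2 - u - u') <= 2) by nra.
      assert ((1 - u') ^ 2 * (v + v') <= 2) by nra; nra.
    - intros; contb. }
  set (I1 := RInt (fun x => (1 - bfun a tS x) * bfun a tT x ^ 2) 0 1) in *.
  set (I2 := RInt (fun x => (1 - bfun a tS x) ^ 2 * bfun a tT x ^ 2) 0 1) in *.
  set (u1 := fun p => / INR p * ssum _ p) in L1.
  set (u2 := fun p => / INR p * ssum _ p) in L2.
  assert (gS' : is_lim_seq (fun p => / (1 - gamma_p a p (m p))) (/ (1 - gamma_T a phim))).
  { apply (is_lim_seq_inv _ (Finite (1 - gamma_T a phim))).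
    - apply is_lim_seq_minus'; [apply is_lim_seq_const|easy].
    - intros h; injection h; lra. }
  assert (gT' : is_lim_seq (fun p => / (1 - gamma_p a p (n p))) (/ (1 - gamma_T a phin))).
  { apply (is_lim_seq_inv _ (Finite (1 - gamma_T a phin))).
    - apply is_lim_seq_minus'; [apply is_lim_seq_const|easy].
    - intros h; injection h; lra. }
  set (bias := fun p => tau_p a p (m p) / (1 - gamma_p a p (m p)) *
     ssum (fun i => (1 - bfun a (tau_p a p (m p)) (INR i)) * bfun a (tau_p a p (m p)) (INR i)
        * bfun a (tau_p a p (n p)) (INR i)) p).
  (* tau_S is of order p^(-a) while the sum has [p] terms at most 1, so the bias is O(p^(1 - a)),
     which vanishes since [a > 1]. *)
  assert (B0 : is_lim_seq bias 0).
  { apply is_lim_seq_Rabs_0 with (fun p => stau a p (m p) * Rabs (/ (1 - gamma_p a p (m p))) *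
       Rpower (INR p) (- (a - 1))).
    - revert hmp; generalize hnp; intros [K hK] [K' hK']; exists (S (K + K')); intros p hp.
      specialize (hK p ltac:(lia)); specialize (hK' p ltac:(lia)).
      assert (hp0 : 0 < INR p) by (apply lt_0_INR; lia).
      destruct (tau_p_spec a p (m p) ltac:(lra) hK') as [h1 _].
      destruct (tau_p_spec a p (n p) ltac:(lra) hK) as [h2 _].
      unfold bias, Rdiv, stau; rewrite !Rabs_mult, (Rabs_pos_eq (tau_p a p (m p))) by lra.
      assert (hsum : Rabs (ssum (fun i => (1 - bfun a (tau_p a p (m p)) (INR i)) *
          bfun a (tau_p a p (m p)) (INR i) * bfun a (tau_p a p (n p)) (INR i)) p) <= INR p * 1).
      { eapply Rle_trans; [apply ssum_abs|]; rewrite <- ssum_const; apply ssum_le; intros i _.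
        assert (b1 := bfun_pos a (tau_p a p (m p)) (INR i) ltac:(lra)).
        assert (b2 := bfun_le1 a (tau_p a p (m p)) (INR i) ltac:(lra)).
        assert (b3 := bfun_pos a (tau_p a p (n p)) (INR i) ltac:(lra)).
        assert (b4 := bfun_le1 a (tau_p a p (n p)) (INR i) ltac:(lra)).
        rewrite Rabs_pos_eq by (apply Rmult_le_pos; [apply Rmult_le_pos|]; lra).
        assert ((1 - bfun a (tau_p a p (m p)) (INR i)) * bfun a (tau_p a p (m p)) (INR i) <= 1) by nra.
        assert (0 <= (1 - bfun a (tau_p a p (m p)) (INR i)) * bfun a (tau_p a p (m p)) (INR i)) by nra.
        nra. }
      assert (e : rpow (INR p) a * Rpower (INR p) (- (a - 1)) = INR p).
      { rewrite rpow_pos, <- Rpower_plus by easy.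
        replace (a + - (a - 1)) with 1 by ring; now apply Rpower_1. }
      replace (tau_p a p (m p) * rpow (INR p) a * Rabs (/ (1 - gamma_p a p (m p))) *
        Rpower (INR p) (- (a - 1))) with (tau_p a p (m p) * Rabs (/ (1 - gamma_p a p (m p))) * (INR p * 1)).
      + apply Rmult_le_compat_l; [|easy].
        apply Rmult_le_pos; [lra|apply Rabs_pos].
      + rewrite <- e at 1; ring.
    - replace (Finite 0) with (Finite (tS * Rabs (/ (1 - gamma_T a phim)) * 0)) by (f_equal; ring).
      apply is_lim_seq_mult'; [apply is_lim_seq_mult'; [easy|]|apply Rpower_neg_lim; lra].
      now apply (is_lim_seq_abs _ (Finite _)). }
  (* Writing 1 / n as (p / n)(1 / p) turns the variance sums into Riemann means and supplies the
     factor [phin]. *)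
  apply is_lim_seq_ext_loc with (fun p => - bias p + sigma2 * (INR p / INR (n p)) *
     / (1 - gamma_p a p (n p)) * (2 * u1 p - / (1 - gamma_p a p (m p)) * u2 p)).
  - revert hmp; generalize hnp; intros [K hK] [K' hK']; exists (S (K + K')); intros p hp.
    specialize (hK p ltac:(lia)); specialize (hK' p ltac:(lia)).
    assert (hp0 : 0 < INR p) by (apply lt_0_INR; lia).
    assert (hn0' : 0 < INR (n p)) by (apply lt_0_INR; lia).
    rewrite W2SG_p_eq by (easy || lra); cbv zeta; fold (bias p).
    unfold u1, u2.
    rewrite (ssum_ext (fun i => (1 - bfun a (tau_p a p (m p)) (INR i)) * _)
      (fun i => (1 - bfun a (stau a p (m p)) (INR i / INR p)) *
                    bfun a (stau a p (n p)) (INR i / INR p) ^ 2))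
      by (intros; rewrite !bfun_stau by lia; easy).
    rewrite (ssum_ext (fun i => (1 - bfun a (tau_p a p (m p)) (INR i)) ^ 2 * _)
      (fun i => (1 - bfun a (stau a p (m p)) (INR i / INR p)) ^ 2 *
                    bfun a (stau a p (n p)) (INR i / INR p) ^ 2))
      by (intros; rewrite !bfun_stau by lia; easy).
    unfold Rdiv; rewrite Rinv_mult.
    generalize (/ INR (n p)) (/ (1 - gamma_p a p (n p))) (/ (1 - gamma_p a p (m p))).
    intros; field; lra.
  - replace (Finite (sigma2 * phin / (1 - gamma_T a phin) * (2 * I1 - / (1 - gamma_T a phim) * I2)))
      with (Finite (- 0 + sigma2 * phin * / (1 - gamma_T a phin) * (2 * I1 - / (1 - gamma_T a phim) * I2)))
      by (f_equal; unfold Rdiv; ring).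
    apply is_lim_seq_plus'.
    + exact (proj1 (is_lim_seq_opp bias 0) B0).
    + repeat apply is_lim_seq_mult'; try apply is_lim_seq_const; try easy.
      apply is_lim_seq_minus'; apply is_lim_seq_mult'; try apply is_lim_seq_const; easy.
Qed.

(** * Positive gain for alpha <= 2 *)

Lemma RInt_pos_point (f : R -> R) (x0 : R) :
  (forall x, continuous f x) -> (forall x, 0 < x < 1 -> 0 <= f x) ->
  0 < x0 < 1 -> 0 < f x0 -> 0 < RInt f 0 1.
Proof.
  intros hc h0 hx hf.
  assert (hl : locally x0 (fun x => f x0 / 2 < f x)).
  { apply (hc x0); exists (mkposreal (f x0 / 2) ltac:(lra)); intros y hy.
    unfold ball in hy; simpl in hy; unfold AbsRing_ball, abs, minus, plus, opp in hy; simpl in hy.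
    apply Rabs_def2 in hy; lra. }
  destruct hl as [d hd].
  set (r := Rmin (d / 2) (Rmin (x0 / 2) ((1 - x0) / 2))).
  assert (hr : 0 < r) by (unfold r; repeat apply Rmin_pos; try lra; assert (h := cond_pos d); lra).
  assert (r1 : r <= d / 2) by apply Rmin_l.
  assert (r2 : r <= x0 / 2) by (eapply Rle_trans; [apply Rmin_r|apply Rmin_l]).
  assert (r3 : r <= (1 - x0) / 2) by (eapply Rle_trans; [apply Rmin_r|apply Rmin_r]).
  rewrite (RInt_Chasles_R f 0 (x0 - r) 1), (RInt_Chasles_R f (x0 - r) (x0 + r) 1)
    by now apply ex_RInt_cont.
  assert (0 <= RInt f 0 (x0 - r)).
  { apply RInt_ge_0; [lra|now apply ex_RInt_cont|intros; apply h0; lra]. }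
  assert (0 <= RInt f (x0 + r) 1).
  { apply RInt_ge_0; [lra|now apply ex_RInt_cont|intros; apply h0; lra]. }
  assert (0 < RInt f (x0 - r) (x0 + r)); [|lra].
  apply RInt_gt_0; [lra| |intros; apply hc].
  intros x hx'; assert (f x0 / 2 < f x); [|lra].
  apply hd; unfold ball; simpl; unfold AbsRing_ball, abs, minus, plus, opp; simpl.
  assert (hd0 := cond_pos d); apply Rabs_def1; lra.
Qed.

Definition B2 (a s : R) : R := RInt (fun x => rpow x a ^ 2 * bfun a s x ^ 2) 0 1.

(* A weight that decreases in [x] moves the mean of [rpow x a] down: compare both sides at the
   point where [rpow x a] crosses its unweighted mean. *)
Lemma chebyshev (a t s : R) : 0 < a -> 0 < t -> 0 <= s ->
  A2 a t s * Fd a s < A1 a t s * B2 a s.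
Proof.
  intros ha ht hs.
  assert (hF := Fd_gt0 a s ha hs).
  (* The mean of x^a under the weight x^a b_s^2, so that x^a - c integrates to 0 against that
     weight; [wc] is the value of b_t^2 where x^a = c. *)
  set (c := B2 a s / Fd a s).
  assert (hc : 0 <= c).
  { apply Rle_mult_inv_pos; [|easy]; apply RInt_ge_0; [lra|apply ex_RInt_cont; contb|].
    intros; apply Rmult_le_pos; apply pow2_ge_0. }
  set (wc := / (1 + t * c) ^ 2).
  set (f := fun x => rpow x a * bfun a s x ^ 2 * ((rpow x a - c) * (wc - bfun a t x ^ 2))).
  assert (htc : 0 <= t * c) by (apply Rmult_le_pos; lra).
  assert (ef : forall x, f x = rpow x a * bfun a s x ^ 2 * ((rpow x a - c) ^ 2 *
     (t * (2 + t * (rpow x a + c)) * (wc * bfun a t x ^ 2)))).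
  { intros x; unfold f, wc, bfun; assert (h1 := den_pos a t x ltac:(lra)).
    assert (h2 := den_pos a s x hs); field; repeat split; lra. }
  assert (wpos : 0 < wc) by (apply Rinv_0_lt_compat, pow_lt; lra).
  assert (fac : forall x, 0 < t * (2 + t * (rpow x a + c)) * (wc * bfun a t x ^ 2)).
  { intros x; assert (h := rpow_ge0 x a).
    apply Rmult_lt_0_compat; [|apply Rmult_lt_0_compat; [easy|apply pow_lt, bfun_pos; lra]].
    apply Rmult_lt_0_compat; [easy|].
    assert (0 <= t * (rpow x a + c)) by (apply Rmult_le_pos; lra); lra. }
  assert (f0 : forall x, 0 <= f x).
  { intros x; rewrite ef; apply Rmult_le_pos.
    { apply Rmult_le_pos; [apply rpow_ge0|apply pow2_ge_0]. }
    apply Rmult_le_pos; [apply pow2_ge_0|apply Rlt_le, fac]. }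
  assert (fp : forall x, 0 < x -> rpow x a <> c -> 0 < f x).
  { intros x hx hne; rewrite ef; apply Rmult_lt_0_compat.
    - apply Rmult_lt_0_compat; [now apply rpow_gt0|apply pow_lt, bfun_pos, hs].
    - apply Rmult_lt_0_compat; [|apply fac].
      rewrite <- Rsqr_pow2; apply Rsqr_pos_lt; lra. }
  assert (fc : forall x, continuous f x) by (intros; unfold f; contb).
  assert (hI : 0 < RInt f 0 1).
  { destruct (Req_dec (rpow (1/2) a) c) as [e|e].
    - apply RInt_pos_point with (1/4); try easy; try lra.
      apply fp; [lra|]; assert (h := rpow_lt a (1/4) (1/2) ha ltac:(lra)); lra.
    - apply RInt_pos_point with (1/2); try easy; try lra; apply fp; lra. }
  assert (E : RInt f 0 1 = wc * (B2 a s - c * Fd a s) - (A2 a t s - c * A1 a t s)).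
  { unfold B2, Fd, A2, A1.
    rewrite <- (RInt_scal_R (fun x => rpow x a * bfun a s x ^ 2)),
      <- (RInt_scal_R (fun x => rpow x a * (bfun a s x ^ 2 * bfun a t x ^ 2))),
      <- !RInt_minus_R, <- RInt_scal_R, <- RInt_minus_R by (apply ex_RInt_cont; contb).
    apply RInt_ext; intros x _; toR; unfold f; ring. }
  assert (c1 : c * Fd a s = B2 a s) by (unfold c; field; lra).
  rewrite E, c1 in hI.
  apply Rmult_lt_reg_r with (/ Fd a s); [now apply Rinv_0_lt_compat|].
  replace (A2 a t s * Fd a s * / Fd a s) with (A2 a t s) by (field; lra).
  replace (A1 a t s * B2 a s * / Fd a s) with (c * A1 a t s) by (unfold c; field; lra).
  lra.
Qed.

Lemma B2_eq (a s : R) : 0 < a -> 0 <= s -> s ^ 2 * B2 a s = 1 - F a s - s * Fd a s.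
Proof.
  intros ha hs; assert (h := F_sub_F2 a s ha hs).
  assert (e : s ^ 2 * B2 a s = 1 - 2 * F a s + RInt (fun x => bfun a s x ^ 2) 0 1); [|lra].
  transitivity (RInt (fun x => 1 - 2 * bfun a s x + bfun a s x ^ 2) 0 1).
  2: { rewrite RInt_plus_R, RInt_minus_R, RInt_scal_R, RInt_const_R, F_bfun
         by (apply ex_RInt_cont; contb).
       ring. }
  unfold B2; rewrite <- RInt_scal_R by (apply ex_RInt_cont; contb).
  apply RInt_ext; intros x _; toR.
  assert (e := bfun_eq a s x hs).
  transitivity ((s * rpow x a * bfun a s x) ^ 2); [ring|].
  replace (s * rpow x a * bfun a s x) with (1 - bfun a s x) by lra; ring.
Qed.

Lemma A1_gt0 (a t s : R) : 0 < a -> 0 <= t -> 0 <= s -> 0 < A1 a t s.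
Proof.
  intros; apply RInt_pos01; [contb|intros].
  apply Rmult_lt_0_compat; [apply rpow_gt0; lra|].
  apply Rmult_lt_0_compat; apply pow_lt, bfun_pos; lra.
Qed.

Lemma A2_gt0 (a t s : R) : 0 < a -> 0 <= t -> 0 <= s -> 0 < A2 a t s.
Proof.
  intros; apply RInt_pos01; [contb|intros].
  apply Rmult_lt_0_compat; [apply pow_lt, rpow_gt0; lra|].
  apply Rmult_lt_0_compat; apply pow_lt, bfun_pos; lra.
Qed.

(* From the tangent of [u => 1/(1 + s u)] at the mean [1/(a+1)] of [x^a]. *)
Lemma F_jensen (a s : R) : 0 < a -> 0 <= s -> / (1 + s / (a + 1)) <= F a s.
Proof.
  intros ha hs.
  set (mu := / (a + 1)).
  assert (hmu : 0 < mu) by (apply Rinv_0_lt_compat; lra).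
  assert (hd : 0 < 1 + s * mu) by (assert (0 <= s * mu) by (apply Rmult_le_pos; lra); lra).
  replace (s / (a + 1)) with (s * mu) by (unfold mu; field; lra).
  assert (e : RInt (fun x => / (1 + s * mu) + - (s / (1 + s * mu) ^ 2) * (rpow x a - mu)) 0 1
     = / (1 + s * mu)).
  { rewrite RInt_plus_R, RInt_scal_R, RInt_minus_R, !RInt_const_R, RInt_rpow by
      (lra || apply ex_RInt_cont; cont).
    rewrite rpow_1_l; unfold mu; toR; field; repeat split; lra. }
  rewrite <- e, F_bfun; apply RInt_le01; [cont|contb|].
  intros x hx; unfold bfun; assert (hd' := den_pos a s x hs).
  set (y := rpow x a) in *.
  apply Rminus_le.
  replace (_ - _) with (- (s ^ 2 * (y - mu) ^ 2 / ((1 + s * mu) ^ 2 * (1 + s * y)))) by (field; lra).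
  assert (0 <= s ^ 2 * (y - mu) ^ 2 / ((1 + s * mu) ^ 2 * (1 + s * y))); [|lra].
  apply Rle_mult_inv_pos; [apply Rmult_le_pos; apply pow2_ge_0|].
  apply Rmult_lt_0_compat; [now apply pow_lt|easy].
Qed.

(** With b = 1 / (1 + s) and D = s Fd, [F_parts] gives a D = F - b, whence Pq = a (D (2 - F) - F (1
    - F)). The bracket equals 2 D^2 - (F - 2 D)(1 - F - D), the quantity whose sign decides
    [Jext_pos_le2]. *)
Definition Pq (a s : R) : R :=
  (a - 1) * F a s ^ 2 + (2 - a + / (1 + s)) * F a s - 2 * / (1 + s).

Lemma is_derive_Pq (a s : R) : 0 < a -> 0 < s ->
  is_derive (Pq a) s (2 * (a - 1) * F a s * (- Fd a s) + (2 - a + / (1 + s)) * (- Fd a s)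
    - (/ (1 + s)) ^ 2 * F a s + 2 * (/ (1 + s)) ^ 2).
Proof.
  intros ha hs; unfold Pq; evar_last.
  - apply is_derive_Reals.
    apply derivable_pt_lim_minus; [apply derivable_pt_lim_plus|].
    + apply derivable_pt_lim_scal, (derivable_pt_lim_comp (F a) (fun u => u ^ 2)).
      * apply is_derive_Reals, is_derive_F; lra.
      * apply (derivable_pt_lim_pow _ 2).
    + apply (derivable_pt_lim_mult (fun s => 2 - a + / (1 + s)) (F a)).
      * apply (derivable_pt_lim_plus (fun _ => 2 - a) (fun s => / (1 + s)));
          [apply derivable_pt_lim_const|].
        apply is_derive_Reals; auto_derive; [lra|reflexivity].
      * apply is_derive_Reals, is_derive_F; lra.
    + apply derivable_pt_lim_scal, is_derive_Reals; auto_derive; [lra|reflexivity].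
  - simpl; field; lra.
Qed.

(* [s^(2/a) * Pq a s] is increasing and vanishes at [0]. *)
Lemma Pq_ge0 (a s : R) : 1 < a <= 2 -> 0 < s -> 0 <= Pq a s.
Proof.
  intros ha hs; apply Rnot_lt_le; intros hneg.
  set (dP := fun s => 2 * (a - 1) * F a s * (- Fd a s) + (2 - a + / (1 + s)) * (- Fd a s)
    - (/ (1 + s)) ^ 2 * F a s + 2 * (/ (1 + s)) ^ 2).
  assert (key : forall r, 0 < r -> 0 <= a * r * dP r + 2 * Pq a r).
  { intros r hr; assert (J := F_jensen a r ltac:(lra) ltac:(lra)).
    assert (P := F_parts a r ltac:(lra) ltac:(lra)).
    set (b := / (1 + r)) in *; set (f := F a r) in *; set (g := Fd a r) in *.
    assert (hb : 0 < b < 1).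
    { split; [apply Rinv_0_lt_compat; lra|]. unfold b; rewrite <- Rinv_1.
      apply Rinv_lt_contravar; lra. }
    assert (rb : r * b = 1 - b) by (unfold b; field; lra).
    assert (J' : (a + 1) * b <= f * (1 + a * b)).
    { assert (1 + r / (a + 1) = (1 + a * b) / ((a + 1) * b)) by (unfold b; field; lra).
      rewrite H, Rinv_div in J; apply Rmult_le_compat_r with (r := 1 + a * b) in J; [|nra].
      replace ((a + 1) * b / (1 + a * b) * (1 + a * b)) with ((a + 1) * b) in J by (field; nra).
      easy. }
    (* Eliminating [Fd] by [F_parts] cancels the terms quadratic in [F]; the result is linear in [F]
       with nonnegative slope, so the Jensen bound [J'] can be inserted. *)
    assert (E : a * r * dP r + 2 * Pq a r
      = f * (2 - a + (a - 1) * b + a * b ^ 2) - b * (2 - a + (2 * a - 1) * b)).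
    { unfold dP, Pq; fold b; fold f; fold g.
      transitivity (- (2 * (a - 1) * f + (2 - a + b)) * (a * r * g) + (r * b) * (a * b * (2 - f))
        + 2 * ((a - 1) * f ^ 2 + (2 - a + b) * f - 2 * b)); [ring|].
      rewrite <- P, rb; ring. }
    rewrite E.
    assert (h : 0 <= (1 + a * b) * (f * (2 - a + (a - 1) * b + a * b ^ 2) - b * (2 - a + (2 * a - 1) * b))).
    { assert (0 <= 2 - a + (a - 1) * b + a * b ^ 2) by nra.
      assert ((a + 1) * b * (2 - a + (a - 1) * b + a * b ^ 2) <=
         f * (1 + a * b) * (2 - a + (a - 1) * b + a * b ^ 2)) by (apply Rmult_le_compat_r; easy).
      (* What remains once [F] is replaced by its Jensen bound; it is nonnegative because
         [a <= 2]. *)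
      assert (0 <= b * (a * (2 - a) * (1 - b) ^ 2)).
      { apply Rmult_le_pos; [lra|]; apply Rmult_le_pos; [nra|apply pow2_ge_0]. }
      nra. }
    apply Rmult_le_reg_l with (1 + a * b); [nra|]; lra. }
  set (W := fun s => Rpower s (2 / a) * Pq a s).
  assert (dW : forall r, 0 < r -> is_derive W r
     (Rpower r (2 / a - 1) * ((a * r * dP r + 2 * Pq a r) / a))).
  { intros r hr; unfold W; evar_last.
    - apply is_derive_Reals, derivable_pt_lim_mult.
      + now apply derivable_pt_lim_power.
      + apply is_derive_Reals, is_derive_Pq; lra.
    - simpl; unfold dP; generalize (/ (1 + r)); intros b.
      replace (Rpower r (2 / a)) with (Rpower r (2 / a - 1) * r).
      + field; lra.
      + rewrite <- (Rpower_1 r hr) at 2; rewrite <- Rpower_plus; f_equal; ring. }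
  assert (mono : forall r, 0 < r < s -> W r <= W s).
  { intros r hr.
    destruct (MVT_gen W r s (fun r => Rpower r (2 / a - 1) * ((a * r * dP r + 2 * Pq a r) / a)))
      as [c [hc e]].
    - rewrite Rmin_left, Rmax_right by lra; intros; apply dW; lra.
    - rewrite Rmin_left, Rmax_right by lra; intros; apply continuity_pt_filterlim.
      apply (ex_derive_continuous (K:=R_AbsRing) (V:=R_NormedModule)).
      eexists; apply dW; lra.
    - rewrite Rmin_left, Rmax_right in hc by lra.
      assert (0 <= Rpower c (2 / a - 1) * ((a * c * dP c + 2 * Pq a c) / a)); [|nra].
      apply Rmult_le_pos; [apply Rlt_le, Rpower_pos|].
      apply Rle_mult_inv_pos; [apply key; lra|lra]. }
  assert (hWs : 0 < - W s).
  { unfold W; assert (h := Rpower_pos s (2 / a)); nra. }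
  (* Near 0, [Pq] is at least -4 and r^(2/a) is tiny, so W(r) exceeds the negative number W(s),
     against monotonicity. *)
  destruct (rpow_small (2 / a) (- W s / 4)) as [d [hd h]]; [apply Rdiv_lt_0_compat; lra|lra|].
  set (r := Rmin d s / 2).
  assert (hr : 0 < r < s /\ r < d).
  { unfold r; assert (0 < Rmin d s) by (apply Rmin_pos; lra).
    assert (h1 := Rmin_l d s); assert (h2 := Rmin_r d s); lra. }
  assert (m := mono r ltac:(lra)).
  assert (hp := h r ltac:(lra)); rewrite rpow_pos in hp by lra.
  assert (hP : - 4 <= Pq a r).
  { unfold Pq; assert (f0 := F_gt0 a r ltac:(lra) ltac:(lra)).
    assert (f1 := F_lt1 a r ltac:(lra) ltac:(lra)).
    assert (hb : 0 < / (1 + r) < 1).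
    { split; [apply Rinv_0_lt_compat; lra|]; rewrite <- Rinv_1 at 2.
      apply Rinv_lt_contravar; lra. }
    assert (0 <= (a - 1) * F a r ^ 2) by (apply Rmult_le_pos; [lra|apply pow2_ge_0]).
    assert (0 <= (2 - a + / (1 + r)) * F a r) by (apply Rmult_le_pos; lra); lra. }
  unfold W in m at 1; assert (hq := Rpower_pos r (2 / a)); nra.
Qed.

(** Only the case F > 2 s Fd is in doubt. There [chebyshev] bounds [A2] by [A1], [B2_eq] makes the
    bound explicit, and the coefficient of [A1] that remains is nonnegative by [Pq_ge0]. *)
Lemma Jext_pos_le2 (a t s : R) : 1 < a <= 2 -> 0 < t -> 0 < s -> 0 < Jext a t s.
Proof.
  intros ha ht hs; unfold Jext; rewrite N1_split by lra.
  assert (C := chebyshev a t s ltac:(lra) ht ltac:(lra)).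
  assert (f0 := F_gt0 a s ltac:(lra) ltac:(lra)).
  assert (g0 := Fd_gt0 a s ltac:(lra) ltac:(lra)).
  assert (a1 := A1_gt0 a t s ltac:(lra) ltac:(lra) ltac:(lra)).
  assert (a2 := A2_gt0 a t s ltac:(lra) ltac:(lra) ltac:(lra)).
  assert (Q := Pq_ge0 a s ha hs); unfold Pq in Q.
  assert (P := F_parts a s ltac:(lra) ltac:(lra)).
  assert (B := B2_eq a s ltac:(lra) ltac:(lra)).
  set (f := F a s) in *; set (g := Fd a s) in *; set (b := / (1 + s)) in *.
  set (D := s * g) in *.
  assert (P' : a * D = f - b) by (unfold D; lra).
  assert (hD : f * (1 - f) <= D * (2 - f)).
  { apply Rmult_le_reg_l with a; [lra|]; replace (a * (D * (2 - f))) with ((a * D) * (2 - f)) by ring.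
    rewrite P'; nra. }
  apply Rmult_lt_reg_r with g; [easy|]; rewrite Rmult_0_l.
  replace ((2 * (A1 a t s + s * A2 a t s) - f / g * A2 a t s) * g)
    with (2 * g * A1 a t s + (2 * D - f) * A2 a t s) by (unfold D; field; lra).
  destruct (Rle_dec f (2 * D)) as [h|h].
  - assert (0 <= (2 * D - f) * A2 a t s) by (apply Rmult_le_pos; lra).
    assert (0 < g * A1 a t s) by (apply Rmult_lt_0_compat; easy); lra.
  - apply Rmult_lt_reg_r with (s ^ 2 * g); [apply Rmult_lt_0_compat; [now apply pow_lt|easy]|].
    rewrite Rmult_0_l.
    assert (C' : (f - 2 * D) * (A2 a t s * g) * s ^ 2 < (f - 2 * D) * A1 a t s * (1 - f - D)).
    { rewrite <- B; apply Rmult_lt_compat_l with (r := (f - 2 * D) * s ^ 2) in C.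
      - lra.
      - apply Rmult_lt_0_compat; [lra|now apply pow_lt]. }
    assert (K : 0 <= A1 a t s * (2 * D ^ 2 - (f - 2 * D) * (1 - f - D))).
    { apply Rmult_le_pos; [lra|]; nra. }
    replace (2 * D ^ 2) with (2 * g * g * s ^ 2) in K by (unfold D; ring).
    lra.
Qed.

(** * An integral representation of F^2 *)

Lemma continuous_slice_1 (h : R -> R -> R) (x v : R) :
  continuity_2d_pt h x v -> continuous (fun u => h u v) x.
Proof.
  intros hc; apply continuity_pt_filterlim; intros e he.
  destruct (hc (mkposreal e he)) as [d hd]; exists d; split; [apply cond_pos|].
  intros u [_ hu]; apply hd; [exact hu|rewrite Rminus_diag, Rabs_R0; apply cond_pos].
Qed.

Lemma continuous_slice_2 (h : R -> R -> R) (x v : R) :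
  continuity_2d_pt h x v -> continuous (h x) v.
Proof.
  intros hc; apply continuity_pt_filterlim; intros e he.
  destruct (hc (mkposreal e he)) as [d hd]; exists d; split; [apply cond_pos|].
  intros u [_ hu]; apply hd; [rewrite Rminus_diag, Rabs_R0; apply cond_pos|exact hu].
Qed.

Lemma continuous_RInt_param (h : R -> R -> R) (a b v : R) : a <= b ->
  (forall x v, continuity_2d_pt h x v) -> continuous (fun v => RInt (fun x => h x v) a b) v.
Proof.
  intros hab hc; apply continuity_pt_filterlim; intros e he.
  assert (he' : 0 < e / (b - a + 1)) by (apply Rdiv_lt_0_compat; lra).
  destruct (uniform_continuity_2d_1d h a b v (fun x _ => hc x v) (mkposreal _ he')) as [d hd].
  exists d; split; [apply cond_pos|]; intros u [_ hu]; simpl in hu; unfold R_dist in hu.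
  unfold R_met; simpl; unfold R_dist.
  assert (cs : forall w, forall x, continuous (fun x => h x w) x)
    by (intros; now apply continuous_slice_1).
  rewrite <- RInt_minus_R by now apply ex_RInt_cont.
  apply Rle_lt_trans with ((b - a) * (e / (b - a + 1))).
  - apply abs_RInt_le_const; [easy|apply ex_RInt_cont; intros; apply cont_minus; apply cs|].
    intros x hx; apply Rlt_le, (hd x v x u); try easy.
    + assert (h0 := cond_pos d); lra.
    + apply Rabs_def2 in hu; lra.
    + rewrite Rminus_diag, Rabs_R0; apply cond_pos.
  - replace e with ((b - a + 1) * (e / (b - a + 1))) at 2 by (field; lra); nra.
Qed.

Lemma is_RInt_cont (f : R -> R) (a b : R) : (forall x, continuous f x) ->
  is_RInt f a b (RInt f a b).
Proof. intros hf; exact (RInt_correct f a b (ex_RInt_cont f a b hf)). Qed.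

Lemma is_derive_RInt_cont (f : R -> R) (c x : R) : (forall x, continuous f x) ->
  is_derive (fun X => RInt f c X) x (f x).
Proof.
  intros hf; apply (is_derive_RInt f _ c x); [|apply hf].
  exists (mkposreal 1 Rlt_0_1); intros w _; now apply is_RInt_cont.
Qed.

(** Both sides, as functions of the upper limit [b], have the same derivative and vanish at [a]. *)
Lemma fubini (h : R -> R -> R) (a b c d : R) : a <= b -> c <= d ->
  (forall x v, continuity_2d_pt h x v) ->
  RInt (fun x => RInt (fun v => h x v) c d) a b = RInt (fun v => RInt (fun x => h x v) a b) c d.
Proof.
  intros hab hcd hc.
  assert (cs1 : forall w x, continuous (fun x => h x w) x) by (intros; now apply continuous_slice_1).
  assert (cs2 : forall x w, continuous (h x) w) by (intros; now apply continuous_slice_2).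
  assert (hc' : forall x v, continuity_2d_pt (fun v x => h x v) x v).
  { intros x v e; destruct (hc v x e) as [r hr]; exists r; intros; now apply hr. }
  assert (dD : forall v u, is_derive (fun X => RInt (fun x => h x v) a X) u (h u v)).
  { intros v u; apply (is_derive_RInt_cont (fun x => h x v)), cs1. }
  assert (dG : forall X, a <= X -> is_derive (fun X => RInt (fun v => RInt (fun x => h x v) a X) c d) X
     (RInt (fun v => h X v) c d)).
  { intros X hX; evar_last.
    - apply is_derive_RInt_param.
      + exists (mkposreal 1 Rlt_0_1); intros y _ t _; eexists; apply dD.
      + intros t _; apply continuity_2d_pt_ext with h; [|apply hc].
        intros x y; symmetry; apply is_derive_unique, dD.
      + exists (mkposreal 1 Rlt_0_1); intros y _; apply ex_RInt_cont; intros v.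
        destruct (Rle_dec a y); [now apply continuous_RInt_param|].
        apply continuous_ext with (fun v => - RInt (fun x => h x v) y a).
        * intros w; exact (opp_RInt_swap (fun x => h x w) y a (ex_RInt_cont _ _ _ (cs1 w))).
        * apply cont_opp, continuous_RInt_param; [lra|easy].
    - apply RInt_ext; intros v _; apply is_derive_unique, dD. }
  assert (dH : forall X, is_derive (fun X => RInt (fun x => RInt (fun v => h x v) c d) a X) X
     (RInt (fun v => h X v) c d)).
  { intros X; apply (is_derive_RInt_cont (fun x => RInt (fun v => h x v) c d)).
    intros; now apply (continuous_RInt_param (fun v x => h x v)). }
  set (D := fun X => RInt (fun x => RInt (fun v => h x v) c d) a X
                   - RInt (fun v => RInt (fun x => h x v) a X) c d).
  assert (dD0 : forall X, a <= X -> is_derive D X 0).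
  { intros X hX; evar_last.
    - apply (is_derive_minus (fun X => RInt (fun x => RInt (fun v => h x v) c d) a X)
        (fun X => RInt (fun v => RInt (fun x => h x v) a X) c d) X _ _ (dH X) (dG X hX)).
    - apply Rminus_diag. }
  destruct (MVT_gen D a b (fun _ => 0)) as [z [_ hz]].
  - rewrite Rmin_left by easy; intros; apply dD0; lra.
  - rewrite Rmin_left by easy; intros; apply continuity_pt_filterlim.
    apply (ex_derive_continuous (K:=R_AbsRing) (V:=R_NormedModule)); eexists; apply dD0; lra.
  - assert (D a = 0).
    { unfold D; rewrite (RInt_ext (fun v => RInt (fun x => h x v) a a) (fun _ => 0)).
      - rewrite RInt_const_R, Rmult_0_r, Rminus_0_r; exact (RInt_point a _).
      - intros v _; exact (RInt_point a _). }
    unfold D in hz, H; lra.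
Qed.

Lemma continuous_continuity_pt (f : R -> R) (x : R) : continuous f x -> continuity_pt f x.
Proof. intros h; now apply continuity_pt_filterlim. Qed.

Lemma continuity_2d_bfun_mult (a s x v : R) : 0 < a -> 0 <= s ->
  continuity_2d_pt (fun x v => bfun a s (x * v)) x v.
Proof.
  intros ha hs; apply (continuity_1d_2d_pt_comp (bfun a s) (fun x v => x * v)).
  - apply continuous_continuity_pt; contb.
  - apply (continuity_2d_pt_mult (fun x _ => x) (fun _ v => v));
      [apply continuity_2d_pt_id1|apply continuity_2d_pt_id2].
Qed.

(** F^2 is twice the integral of b(x) b(u) over the triangle u < x. The substitution u = x v, with
    Jacobian [x], maps the triangle to the unit square, and [Eint] is the integral over [x] at fixed
    [v]. *)
Definition Eint (a s v : R) : R := RInt (fun x => x * bfun a s x * bfun a s (x * v)) 0 1.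

Lemma continuity_2d_Eint (a s x v : R) : 0 < a -> 0 <= s ->
  continuity_2d_pt (fun x v => x * bfun a s x * bfun a s (x * v)) x v.
Proof.
  intros ha hs.
  apply (continuity_2d_pt_mult (fun x _ => x * bfun a s x) (fun x v => bfun a s (x * v))).
  - apply (continuity_1d_2d_pt_comp (fun x => x * bfun a s x) (fun x _ => x)).
    + apply continuous_continuity_pt; contb.
    + apply continuity_2d_pt_id1.
  - now apply continuity_2d_bfun_mult.
Qed.

Lemma continuous_Eint (a s v : R) : 0 < a -> 0 <= s -> continuous (Eint a s) v.
Proof.
  intros; unfold Eint; apply (continuous_RInt_param (fun x v => x * bfun a s x * bfun a s (x * v))).
  - lra.
  - intros; now apply continuity_2d_Eint.
Qed.

Lemma Eint_bounds (a s v : R) : 0 < a -> 0 <= s -> 0 <= Eint a s v <= 1.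
Proof.
  intros ha hs; unfold Eint.
  assert (hc : forall x, continuous (fun x => x * bfun a s x * bfun a s (x * v)) x)
    by (intros; apply (continuous_slice_1 (fun x v => x * bfun a s x * bfun a s (x * v)));
        now apply continuity_2d_Eint).
  assert (b : forall x, 0 <= x <= 1 -> 0 <= x * bfun a s x * bfun a s (x * v) <= 1).
  { intros x hx; assert (h1 := bfun_pos a s x hs); assert (h2 := bfun_le1 a s x hs).
    assert (h3 := bfun_pos a s (x * v) hs); assert (h4 := bfun_le1 a s (x * v) hs).
    assert (0 <= x * bfun a s x <= 1) by nra; nra. }
  split.
  - apply RInt_ge_0; [lra|now apply ex_RInt_cont|intros; apply b; lra].
  - apply Rabs_le_between, RInt_abs01; [easy|].
    intros x hx; specialize (b x hx); rewrite Rabs_pos_eq; lra.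
Qed.

Lemma F_sqr (a s : R) : 0 < a -> 0 <= s -> F a s ^ 2 = 2 * RInt (Eint a s) 0 1.
Proof.
  intros ha hs.
  assert (hb : forall x, continuous (bfun a s) x) by (intros; contb).
  assert (e : RInt (fun x => 2 * (bfun a s x * RInt (bfun a s) 0 x)) 0 1 = F a s ^ 2).
  { rewrite (RInt_ftc (fun x => RInt (bfun a s) 0 x ^ 2)).
    - rewrite RInt_point, <- F_bfun; unfold zero; simpl; toR; ring.
    - intros x; evar_last.
      + apply (is_derive_pow (fun x => RInt (bfun a s) 0 x) 2 x (bfun a s x)).
        now apply is_derive_RInt_cont.
      + simpl; ring.
    - intros x; apply cont_mult; [cont|]; apply cont_mult; [apply hb|].
      apply (ex_derive_continuous (K:=R_AbsRing) (V:=R_NormedModule)).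
      eexists; now apply is_derive_RInt_cont. }
  rewrite <- e, RInt_scal_R.
  - f_equal; unfold Eint; rewrite <- (fubini (fun x v => x * bfun a s x * bfun a s (x * v)));
      [|lra|lra|intros; now apply continuity_2d_Eint].
    apply RInt_ext; intros x hx; rewrite Rmin_left, Rmax_right in hx by lra; toR.
    assert (hs' : x * RInt (fun v => bfun a s (x * v)) 0 1 = RInt (bfun a s) (x * 0) (x * 1))
      by (apply RInt_scale, ex_RInt_cont, hb).
    rewrite Rmult_0_r, Rmult_1_r in hs'; rewrite <- hs'.
    assert (hc : forall v, continuous (fun v => bfun a s (x * v)) v)
      by (intros; apply (continuous_slice_2 (fun x v => bfun a s (x * v)));
          now apply continuity_2d_bfun_mult).
    rewrite RInt_scal_R by now apply ex_RInt_cont.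
    ring.
  - apply ex_RInt_cont; intros x; apply cont_mult; [apply hb|].
    apply (ex_derive_continuous (K:=R_AbsRing) (V:=R_NormedModule)).
    eexists; now apply is_derive_RInt_cont.
Qed.

(* Coefficients of the partial fraction expansion of [bfun a s x * bfun a s (x * v)]. Integrating
   it over [v] gives [F^2 = 2 * RInt (fun x => x * bfun a s x * k x) 0 1] with
   [k x = RInt (kq a) 0 1 + RInt (kd a) 0 x]. *)
Definition kd (a v : R) : R := rpow v (a - 2) / (1 - rpow v a).
Definition kq (a v : R) : R := (1 - rpow v (a - 2)) / (1 - rpow v a).

(** The product splits because (1 - v^a) b(x) b(x v) = b(x) - v^a b(x v). Rescaling the second
    integral to [0, v] turns v^a into v^(a - 2), and cutting [0, 1] at [v] leaves two nonnegative
    coefficients. *)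
Lemma Eint_split (a s v : R) : 2 < a -> 0 <= s -> 0 <= v < 1 ->
  Eint a s v = kq a v * RInt (fun x => x * bfun a s x) 0 1
             + kd a v * RInt (fun x => x * bfun a s x) v 1.
Proof.
  intros ha hs hv.
  assert (hb : forall x, continuous (bfun a s) x) by (intros; contb).
  assert (hxb : forall x, continuous (fun x => x * bfun a s x) x) by (intros; contb).
  assert (hc : forall x, continuous (fun x => bfun a s (x * v)) x)
    by (intros; apply (continuous_slice_1 (fun x v => bfun a s (x * v)));
        apply continuity_2d_bfun_mult; lra).
  assert (hV := rpow_lt1 a v ltac:(lra) ltac:(lra)).
  assert (e1 : (1 - rpow v a) * Eint a s v = RInt (fun x => x * bfun a s x) 0 1
     - rpow v a * RInt (fun x => x * bfun a s (x * v)) 0 1).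
  { unfold Eint; rewrite <- !RInt_scal_R, <- RInt_minus_R.
    - apply RInt_ext; intros x hx; rewrite Rmin_left, Rmax_right in hx by lra; toR.
      unfold bfun; rewrite rpow_mult_l by lra.
      assert (h1 := rpow_ge0 x a); assert (h2 := rpow_ge0 v a).
      assert (h3 : 0 <= s * rpow x a) by pos.
      assert (h4 : 0 <= s * (rpow x a * rpow v a)) by pos.
      field; lra.
    - apply ex_RInt_cont; cont.
    - apply ex_RInt_cont; cont.
    - apply ex_RInt_cont; cont.
    - apply ex_RInt_cont; intros; apply (continuous_slice_1 (fun x v => x * bfun a s x * bfun a s (x * v))).
      apply continuity_2d_Eint; lra. }
  assert (e2 : rpow v a * RInt (fun x => x * bfun a s (x * v)) 0 1
     = rpow v (a - 2) * RInt (fun x => x * bfun a s x) 0 v).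
  { replace (rpow v a) with (rpow v (a - 2) * (v * v)).
    - assert (h : v * RInt (fun x => (v * x) * bfun a s (v * x)) 0 1
        = RInt (fun x => x * bfun a s x) (v * 0) (v * 1))
        by (apply (RInt_scale (fun x => x * bfun a s x)), ex_RInt_cont, hxb).
      rewrite Rmult_0_r, Rmult_1_r in h; rewrite <- h, Rmult_assoc; f_equal.
      rewrite Rmult_assoc; f_equal.
      rewrite <- RInt_scal_R by (apply ex_RInt_cont; cont).
      apply RInt_ext; intros x _; toR; rewrite (Rmult_comm x v); ring.
    - rewrite Rmult_comm, Rmult_assoc, !rpow_S by lra; f_equal; ring. }
  rewrite e2 in e1.
  rewrite (RInt_Chasles_R _ 0 v 1) in e1 |- * by now apply ex_RInt_cont.
  unfold kq, kd; apply Rmult_eq_reg_l with (1 - rpow v a); [|lra].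
  rewrite e1; field; lra.
Qed.

Lemma kd_ge0 (a v : R) : 0 < a -> v < 1 -> 0 <= kd a v.
Proof.
  intros ha hv; assert (h := rpow_lt1 a v ha hv).
  apply Rle_mult_inv_pos; [apply rpow_ge0|lra].
Qed.

Lemma rpow_le_exp (x b c : R) : b <= c -> x <= 1 -> rpow x c <= rpow x b.
Proof.
  intros hbc hx; destruct (Rle_dec x 0) as [h|h].
  - rewrite !rpow_nonpos by easy; lra.
  - replace c with (b + (c - b)) by ring; rewrite rpow_plus.
    assert (h1 := rpow_ge0 x b); assert (h2 := rpow_le1 (c - b) x ltac:(lra) hx); nra.
Qed.

Lemma kq_bounds (a v : R) : 2 < a -> v < 1 -> 0 <= kq a v <= 1.
Proof.
  intros ha hv; assert (h := rpow_lt1 a v ltac:(lra) hv).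
  assert (h1 := rpow_le1 (a - 2) v ltac:(lra) ltac:(lra)).
  assert (h2 := rpow_le_exp v (a - 2) a ltac:(lra) ltac:(lra)); unfold kq; split.
  - apply Rle_mult_inv_pos; lra.
  - apply (Rle_div_l _ 1); lra.
Qed.

Lemma continuous_kd (a v : R) : 2 < a -> v < 1 -> continuous (kd a) v.
Proof.
  intros ha hv; assert (h := rpow_lt1 a v ltac:(lra) hv).
  unfold kd; cont; lra.
Qed.

Lemma continuous_kq (a v : R) : 2 < a -> v < 1 -> continuous (kq a) v.
Proof.
  intros ha hv; assert (h := rpow_lt1 a v ltac:(lra) hv).
  unfold kq; cont; lra.
Qed.

Lemma ex_RInt_cont_loc (f : R -> R) (a b : R) :
  (forall x, Rmin a b <= x <= Rmax a b -> continuous f x) -> ex_RInt f a b.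
Proof. intros h; now apply (@ex_RInt_continuous R_CompleteNormedModule). Qed.

Lemma ex_RInt_lt1 (f : R -> R) (u v : R) : u < 1 -> v < 1 ->
  (forall x, x < 1 -> continuous f x) -> ex_RInt f u v.
Proof.
  intros hu hv h; apply ex_RInt_cont_loc; intros x hx; apply h.
  assert (Rmax u v < 1) by now apply Rmax_lub_lt. lra.
Qed.

Definition Lam (a x : R) : R := RInt (kd a) 0 x.

Lemma is_derive_Lam (a x : R) : 2 < a -> x < 1 -> is_derive (Lam a) x (kd a x).
Proof.
  intros ha hx; apply (is_derive_RInt (kd a) _ 0 x); [|now apply continuous_kd].
  exists (mkposreal (1 - x) ltac:(lra)); intros w hw.
  unfold ball in hw; simpl in hw; unfold AbsRing_ball, abs, minus, plus, opp in hw; simpl in hw.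
  apply Rabs_def2 in hw.
  apply (RInt_correct (kd a) 0 w), ex_RInt_lt1; [lra|lra|intros; now apply continuous_kd].
Qed.

Lemma continuous_Lam (a x : R) : 2 < a -> x < 1 -> continuous (Lam a) x.
Proof.
  intros; apply (ex_derive_continuous (K:=R_AbsRing) (V:=R_NormedModule)).
  eexists; now apply is_derive_Lam.
Qed.

Lemma Lam_incr (a x z : R) : 2 < a -> x <= z < 1 -> Lam a x <= Lam a z.
Proof.
  intros ha hxz; unfold Lam.
  rewrite (RInt_Chasles_R (kd a) 0 x z) by (apply ex_RInt_lt1; try lra; intros; now apply continuous_kd).
  assert (0 <= RInt (kd a) x z); [|lra].
  apply RInt_ge_0; [lra|apply ex_RInt_lt1; try lra; intros; now apply continuous_kd|].
  intros; apply kd_ge0; lra.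
Qed.

Lemma Lam_ge0 (a x : R) : 2 < a -> 0 <= x < 1 -> 0 <= Lam a x.
Proof.
  intros ha hx; replace 0 with (Lam a 0) by exact (RInt_point 0 (kd a)).
  now apply Lam_incr.
Qed.

Lemma Aq_step (a r r' : R) : 2 < a -> 0 <= r <= r' -> r' < 1 ->
  RInt (kq a) 0 r <= RInt (kq a) 0 r' <= RInt (kq a) 0 r + (r' - r).
Proof.
  intros ha hr hr'.
  assert (ex : forall u v, u < 1 -> v < 1 -> ex_RInt (kq a) u v)
    by (intros; apply ex_RInt_lt1; try easy; intros; now apply continuous_kq).
  rewrite (RInt_Chasles_R (kq a) 0 r r') by (apply ex; lra).
  assert (0 <= RInt (kq a) r r').
  { apply RInt_ge_0; [lra|apply ex; lra|intros; apply kq_bounds; lra]. }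
  assert (RInt (kq a) r r' <= RInt (fun _ => 1) r r').
  { apply RInt_le; [lra|apply ex; lra|apply ex_RInt_cont; cont|intros; apply kq_bounds; lra]. }
  rewrite RInt_const_R in H0; lra.
Qed.

(* The value of [RInt (kq a) 0 1], kept as a supremum since [kq a 1 = 0 / 0]. *)
Lemma KA_exists (a : R) : 2 < a -> exists A', 0 < A' /\
  forall r, 0 <= r < 1 -> RInt (kq a) 0 r <= A' <= RInt (kq a) 0 r + (1 - r).
Proof.
  intros ha.
  destruct (completeness (fun y => exists r, 0 <= r < 1 /\ y = RInt (kq a) 0 r)) as [A' [h1 h2]].
  - exists 1; intros y [r [hr ->]].
    assert (h := Aq_step a 0 r ha ltac:(lra) ltac:(lra)).
    assert (e : RInt (kq a) 0 0 = 0) by exact (RInt_point 0 (kq a)); lra.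
  - exists (RInt (kq a) 0 0); exists 0; lra.
  - exists A'.
    assert (key : forall r, 0 <= r < 1 -> RInt (kq a) 0 r <= A' <= RInt (kq a) 0 r + (1 - r)).
    { intros r hr; split; [apply h1; now exists r|].
      apply h2; intros y [r' [hr' ->]]; destruct (Rle_dec r r') as [h|h].
      - assert (h' := Aq_step a r r' ha ltac:(lra) ltac:(lra)); lra.
      - assert (h' := Aq_step a r' r ha ltac:(lra) ltac:(lra)); lra. }
    split; [|easy].
    apply Rlt_le_trans with (RInt (kq a) 0 (1/2)); [|apply key; lra].
    apply RInt_gt_0; [lra| |intros; apply continuous_kq; lra].
    intros x hx; unfold kq; apply Rdiv_lt_0_compat.
    + assert (h := rpow_lt1 (a - 2) x ltac:(lra) ltac:(lra)); lra.
    + assert (h := rpow_lt1 a x ltac:(lra) ltac:(lra)); lra.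
Qed.

Definition kk (A' a x : R) : R := A' + Lam a x.
(** [Lam] grows logarithmically at 1, so the kernel is frozen beyond [r] to stay continuous on
    [0, 1]; [mu] at g = b_s is then F^2 up to O(1 - r). *)
Definition kr (A' a r x : R) : R := kk A' a (Rmin x r).
Definition mu (A' a r : R) (g : R -> R) : R := 2 * RInt (fun x => x * g x * kr A' a r x) 0 1.

Lemma continuous_Rmin (r x : R) : continuous (fun x => Rmin x r) x.
Proof.
  apply continuity_pt_filterlim; intros e he; exists e; split; [easy|].
  intros y [_ hy]; unfold R_met in *; simpl in *; unfold R_dist in *.
  revert hy; unfold Rmin; repeat destruct Rle_dec; intros hy; apply Rabs_def2 in hy;
    apply Rabs_def1; lra.
Qed.

Lemma continuous_kr (A' a r x : R) : 2 < a -> r < 1 -> continuous (kr A' a r) x.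
Proof.
  intros ha hr; unfold kr.
  apply (continuous_comp (fun x => Rmin x r) (kk A' a)); [apply continuous_Rmin|].
  unfold kk; apply cont_plus; [apply continuous_const|apply continuous_Lam; [easy|]].
  assert (h := Rmin_r x r); lra.
Qed.

(** Integration by parts against the tail integral of x g(x), the derivative of the kernel being
    [kd] on [0, r] and 0 beyond. The result has the shape of [Eint_split] integrated over [v]. *)
Lemma mu_parts (A' a r : R) (g : R -> R) : 2 < a -> 0 <= r < 1 -> (forall x, continuous g x) ->
  RInt (fun x => x * g x * kr A' a r x) 0 1 =
  A' * RInt (fun x => x * g x) 0 1 + RInt (fun v => kd a v * RInt (fun x => x * g x) v 1) 0 r.
Proof.
  intros ha hr hg.
  set (G := fun x => x * g x).
  assert (hG : forall x, continuous G x) by (intros; unfold G; cont).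
  assert (hk : forall x, continuous (kr A' a r) x) by (intros; apply continuous_kr; lra).
  assert (dT : forall v, is_derive (fun v => RInt G v 1) v (- G v)).
  { intros v; apply is_derive_ext with (fun v => - RInt G 1 v).
    - intros w; exact (opp_RInt_swap G 1 w (ex_RInt_cont _ _ _ hG)).
    - apply (is_derive_opp (fun v => RInt G 1 v) v (G v)), is_derive_RInt_cont, hG. }
  assert (cT : forall v, continuous (fun v => RInt G v 1) v).
  { intros; apply (ex_derive_continuous (K:=R_AbsRing) (V:=R_NormedModule)); eexists; apply dT. }
  assert (e : RInt (fun v => kd a v * RInt G v 1 - kk A' a v * G v) 0 r
     = kk A' a r * RInt G r 1 - A' * RInt G 0 1).
  { transitivity (kk A' a r * RInt G r 1 - kk A' a 0 * RInt G 0 1).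
    2: { unfold kk at 2; unfold Lam; assert (e0 : RInt (kd a) 0 0 = 0) by exact (RInt_point 0 (kd a)).
         rewrite e0; toR; ring. }
    apply is_RInt_unique.
    apply (is_RInt_derive (fun v => kk A' a v * RInt G v 1) _ 0 r).
    - rewrite Rmin_left, Rmax_right by lra; intros v hv; evar_last.
      + apply (is_derive_mult (kk A' a) (fun v => RInt G v 1)); [|apply dT|intros; apply Rmult_comm].
        apply (is_derive_plus (fun _ => A') (Lam a)); [apply is_derive_Reals, derivable_pt_lim_const|].
        apply is_derive_Lam; lra.
      + unfold plus, mult; simpl; ring.
    - rewrite Rmin_left, Rmax_right by lra; intros v hv.
      apply cont_minus; apply cont_mult; try easy.
      + apply continuous_kd; lra.
      + unfold kk; apply cont_plus; [apply continuous_const|apply continuous_Lam; lra]. }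
  rewrite RInt_minus_R in e.
  2: { apply ex_RInt_lt1; try lra; intros; apply cont_mult; [now apply continuous_kd|easy]. }
  2: { apply ex_RInt_lt1; try lra; intros; apply cont_mult; [|easy].
       unfold kk; apply cont_plus; [apply continuous_const|now apply continuous_Lam]. }
  rewrite (RInt_Chasles_R _ 0 r 1) by (apply ex_RInt_cont; intros; apply cont_mult; easy).
  assert (e1 : RInt (fun x => x * g x * kr A' a r x) 0 r = RInt (fun v => kk A' a v * G v) 0 r).
  { apply RInt_ext; intros x hx; rewrite Rmin_left, Rmax_right in hx by lra; toR.
    unfold kr; rewrite Rmin_left by lra; unfold G; ring. }
  assert (e2 : RInt (fun x => x * g x * kr A' a r x) r 1 = kk A' a r * RInt G r 1).
  { rewrite <- RInt_scal_R by now apply ex_RInt_cont.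
    apply RInt_ext; intros x hx; rewrite Rmin_left, Rmax_right in hx by lra; toR.
    unfold kr; rewrite Rmin_right by lra; unfold G; ring. }
  rewrite e1, e2; unfold G in *; lra.
Qed.

(** By [mu_parts] and [Eint_split] the two sides differ only by the integral of [Eint] over [r, 1]
    and the missing part of the integral of [kq], each of size at most 1 - r before the factor 2. *)
Lemma mu_bfun (A' a r s : R) : 2 < a -> 0 <= r < 1 -> 0 <= s ->
  RInt (kq a) 0 r <= A' <= RInt (kq a) 0 r + (1 - r) ->
  Rabs (mu A' a r (bfun a s) - F a s ^ 2) <= 4 * (1 - r).
Proof.
  intros ha hr hs hA.
  assert (hb : forall x, continuous (bfun a s) x) by (intros; contb).
  unfold mu; rewrite mu_parts by easy; rewrite F_sqr by lra.
  set (G := fun x => x * bfun a s x).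
  assert (hG : forall x, continuous G x) by (intros; unfold G; cont).
  assert (cE : forall v, continuous (Eint a s) v) by (intros; apply continuous_Eint; lra).
  assert (cT : forall v, continuous (fun v => RInt G v 1) v).
  { intros; apply continuous_ext with (fun v => - RInt G 1 v).
    - intros w; exact (opp_RInt_swap G 1 w (ex_RInt_cont _ _ _ hG)).
    - apply cont_opp, (ex_derive_continuous (K:=R_AbsRing) (V:=R_NormedModule)).
      eexists; now apply is_derive_RInt_cont. }
  assert (e : RInt (Eint a s) 0 r = RInt (kq a) 0 r * RInt G 0 1
      + RInt (fun v => kd a v * RInt G v 1) 0 r).
  { rewrite Rmult_comm, <- RInt_scal_R, <- RInt_plus_R.
    - apply RInt_ext; intros v hv; rewrite Rmin_left, Rmax_right in hv by lra; toR.
      rewrite Eint_split by lra; unfold G; ring.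
    - apply ex_RInt_lt1; try lra; intros; apply cont_mult; [apply continuous_const|now apply continuous_kq].
    - apply ex_RInt_lt1; try lra; intros; apply cont_mult; [now apply continuous_kd|apply cT].
    - apply ex_RInt_lt1; try lra; intros; now apply continuous_kq. }
  rewrite (RInt_Chasles_R (Eint a s) 0 r 1) by now apply ex_RInt_cont.
  assert (hT : 0 <= RInt G 0 1 <= 1).
  { split.
    - apply RInt_ge_0; [lra|now apply ex_RInt_cont|].
      intros; apply Rmult_le_pos; [lra|apply Rlt_le, bfun_pos; lra].
    - apply Rabs_le_between, RInt_abs01; [easy|]; intros x hx.
      assert (h1 := bfun_pos a s x hs); assert (h2 := bfun_le1 a s x hs).
      unfold G; rewrite Rabs_pos_eq by (apply Rmult_le_pos; lra); nra. }
  assert (hE : 0 <= RInt (Eint a s) r 1 <= 1 - r).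
  { split.
    - apply RInt_ge_0; [lra|now apply ex_RInt_cont|intros; apply Eint_bounds; lra].
    - replace (1 - r) with ((1 - r) * 1) by ring; rewrite <- RInt_const_R.
      apply RInt_le; [lra|now apply ex_RInt_cont|apply ex_RInt_cont; cont|].
      intros; apply Eint_bounds; lra. }
  apply Rabs_le; rewrite e; fold G; nra.
Qed.

Lemma kr_ge0 (A' a r x : R) : 2 < a -> 0 <= A' -> 0 <= r < 1 -> 0 <= x -> 0 <= kr A' a r x.
Proof.
  intros ha hA hr hx; unfold kr, kk.
  assert (0 <= Lam a (Rmin x r)); [|lra].
  apply Lam_ge0; [easy|]; split; [apply Rmin_glb; lra|assert (h := Rmin_r x r); lra].
Qed.

(* Differentiating [mu (bfun a s) = F a s ^ 2] in [s], with [rho] as step and [1 - r = rho^2]. *)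
Lemma mu_deriv (A' a rho s : R) : 2 < a -> 0 < rho < 1 -> 0 <= s -> 0 <= A' ->
  (forall r, 0 <= r < 1 -> RInt (kq a) 0 r <= A' <= RInt (kq a) 0 r + (1 - r)) ->
  Rabs (mu A' a (1 - rho ^ 2) (fun x => rpow x a * bfun a s x ^ 2) - 2 * F a s * Fd a s)
    <= 16 * rho.
Proof.
  intros ha hrho hs hA0 hA.
  set (r := 1 - rho ^ 2).
  assert (hr : 0 <= r < 1) by (unfold r; simpl; nra).
  assert (m0 := mu_bfun A' a r s ha hr hs (hA r hr)).
  assert (m1 := mu_bfun A' a r (s + rho) ha hr ltac:(lra) (hA r hr)).
  assert (T := F_taylor a s (s + rho) ltac:(lra) hs ltac:(lra)).
  assert (L := F_lip a s (s + rho) ltac:(lra) hs ltac:(lra)).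
  replace (s + rho - s) with rho in T, L by ring.
  rewrite (Rabs_pos_eq rho) in L by lra.
  assert (hk : forall x, continuous (kr A' a r) x) by (intros; apply continuous_kr; lra).
  set (rest := mu A' a r (fun x => rpow x a ^ 2 * bfun a s x ^ 2 * bfun a (s + rho) x)).
  (* From the exact expansion b_{s + rho} = b_s - rho x^a b_s^2 + rho^2 x^(2 a) b_s^2 b_{s + rho}.
     The truncation errors are O(rho^2), so they remain O(rho) after division by the step. *)
  assert (E : mu A' a r (bfun a (s + rho)) = mu A' a r (bfun a s)
     - rho * mu A' a r (fun x => rpow x a * bfun a s x ^ 2) + rho ^ 2 * rest).
  { unfold rest, mu.
    transitivity (2 * (RInt (fun x => x * bfun a s x * kr A' a r x) 0 1
      - rho * RInt (fun x => x * (rpow x a * bfun a s x ^ 2) * kr A' a r x) 0 1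
      + rho ^ 2 * RInt (fun x => x * (rpow x a ^ 2 * bfun a s x ^ 2 * bfun a (s + rho) x) * kr A' a r x) 0 1));
      [|ring].
    f_equal; rewrite <- !RInt_scal_R, <- RInt_minus_R, <- RInt_plus_R by (apply ex_RInt_cont; contb).
    apply RInt_ext; intros x _; toR.
    unfold bfun; assert (h1 := den_pos a s x hs); assert (h2 := den_pos a (s + rho) x ltac:(lra)).
    field; lra. }
  assert (hrest : 0 <= rest <= mu A' a r (bfun a s)).
  { unfold rest, mu.
    assert (b : forall x, 0 < x < 1 -> 0 <= x * (rpow x a ^ 2 * bfun a s x ^ 2 * bfun a (s + rho) x) * kr A' a r x
       <= x * bfun a s x * kr A' a r x).
    { intros x hx; assert (h1 := bfun_pos a s x hs); assert (h2 := bfun_le1 a s x hs).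
      assert (h3 := bfun_pos a (s + rho) x ltac:(lra)); assert (h4 := bfun_le1 a (s + rho) x ltac:(lra)).
      assert (h5 := rpow_ge0 x a); assert (h6 := rpow_le1 a x ltac:(lra) ltac:(lra)).
      assert (h7 := kr_ge0 A' a r x ha hA0 hr ltac:(lra)).
      assert (0 <= rpow x a ^ 2 <= 1) by (simpl; nra).
      assert (0 <= rpow x a ^ 2 * bfun a s x <= 1) by nra.
      assert (0 <= rpow x a ^ 2 * bfun a s x * bfun a (s + rho) x <= 1) by nra.
      replace (x * (rpow x a ^ 2 * bfun a s x ^ 2 * bfun a (s + rho) x) * kr A' a r x) with
        (rpow x a ^ 2 * bfun a s x * bfun a (s + rho) x * (x * bfun a s x * kr A' a r x)) by ring.
      assert (0 <= x * bfun a s x * kr A' a r x) by (apply Rmult_le_pos; [apply Rmult_le_pos|]; lra).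
      nra. }
    split.
    - apply Rmult_le_pos; [lra|]; apply RInt_ge_0; [lra|apply ex_RInt_cont; contb|apply b].
    - apply Rmult_le_compat_l; [lra|]; apply RInt_le01; [contb|contb|apply b]. }
  set (M := mu A' a r (fun x => rpow x a * bfun a s x ^ 2)) in *.
  assert (f0 := F_gt0 a s ltac:(lra) hs).
  assert (f1 : F a s <= 1).
  { destruct (Req_dec s 0) as [->|h]; [rewrite F_0; lra|apply Rlt_le, F_lt1; lra]. }
  replace (1 - r) with (rho ^ 2) in m0, m1 by (unfold r; ring).
  assert (q0 : 0 < rho ^ 2 < 1) by (simpl; nra).
  apply Rabs_le_between in m0; apply Rabs_le_between in m1.
  assert (K : Rabs (rho * (M - 2 * F a s * Fd a s)) <= rho * (16 * rho)).
  { set (f := F a s) in *; set (f' := F a (s + rho)) in *; set (g := Fd a s) in *.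
    assert (Q : Rabs (f' ^ 2 - f ^ 2 + 2 * f * (rho * g)) <= 3 * rho ^ 2).
    { replace (f' ^ 2 - f ^ 2 + 2 * f * (rho * g)) with ((f' - f) ^ 2 + 2 * f * (f' - f + rho * g)) by ring.
      eapply Rle_trans; [apply Rabs_triang|].
      rewrite Rabs_mult, (Rabs_pos_eq (2 * f)), (Rabs_pos_eq ((f' - f) ^ 2)) by
        (try apply pow2_ge_0; lra).
      assert ((f' - f) ^ 2 <= rho ^ 2) by (apply Rabs_le_between in L; simpl; nra).
      assert (0 <= Rabs (f' - f + rho * g)) by apply Rabs_pos; nra. }
    apply Rabs_le_between in Q; apply Rabs_le.
    assert (f ^ 2 <= 1) by (simpl; nra).
    assert (rest <= 5) by lra.
    assert (0 <= rho ^ 2 * rest <= 5 * rho ^ 2) by nra.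
    replace (rho * (16 * rho)) with (16 * rho ^ 2) by ring.
    lra. }
  rewrite Rabs_mult, Rabs_pos_eq in K by lra.
  apply Rmult_le_reg_l in K; lra.
Qed.

(** * Uniqueness of the zero of J *)

Lemma incr_of_derive (f df : R -> R) (a b : R) : a <= b ->
  (forall x, a <= x <= b -> is_derive f x (df x)) ->
  (forall x, a <= x <= b -> 0 <= df x) -> f a <= f b.
Proof.
  intros hab hd hp; destruct (MVT_gen f a b df) as [c [hc e]].
  - rewrite Rmin_left, Rmax_right by easy; intros; apply hd; lra.
  - rewrite Rmin_left, Rmax_right by easy; intros; apply continuous_continuity_pt.
    apply (ex_derive_continuous (K:=R_AbsRing) (V:=R_NormedModule)); eexists; apply hd; lra.
  - rewrite Rmin_left, Rmax_right in hc by easy; specialize (hp c hc); nra.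
Qed.

Lemma mvt_pos (f df : R -> R) (a b : R) : a < b ->
  (forall x, a <= x <= b -> is_derive f x (df x)) -> f a < f b ->
  exists c, a <= c <= b /\ 0 < df c.
Proof.
  intros hab hd hf; destruct (MVT_gen f a b df) as [c [hc e]].
  - rewrite Rmin_left, Rmax_right by lra; intros; apply hd; lra.
  - rewrite Rmin_left, Rmax_right by lra; intros; apply continuous_continuity_pt.
    apply (ex_derive_continuous (K:=R_AbsRing) (V:=R_NormedModule)); eexists; apply hd; lra.
  - rewrite Rmin_left, Rmax_right in hc by lra; exists c; split; [easy|]; nra.
Qed.

(** This is x Lam'(x), by [Zf_kd]; it enters the derivative of [Uf] through the factor [kk]. *)
Definition Zf (a x : R) : R := rpow x (a - 1) / (1 - rpow x a).

Lemma is_derive_Zf (a x : R) : 2 < a -> 0 < x < 1 ->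
  is_derive (Zf a) x ((a - 1) * kd a x + a * rpow x (a - 1) ^ 2 / (1 - rpow x a) ^ 2).
Proof.
  intros ha hx; assert (h := rpow_lt1 a x ltac:(lra) ltac:(lra)).
  unfold Zf; evar_last.
  - apply (is_derive_div (fun x => rpow x (a - 1)) (fun x => 1 - rpow x a)); [| |lra].
    + apply is_derive_rpow; lra.
    + apply (is_derive_minus (fun _ => 1) (fun x => rpow x a)).
      * apply is_derive_Reals, derivable_pt_lim_const.
      * apply is_derive_rpow; lra.
  - unfold minus, plus, opp, zero, kd; simpl.
    replace (a - 1 - 1) with (a - 2) by ring; field; lra.
Qed.

Lemma Zf_kd (a x : R) : 0 <= x -> Zf a x = x * kd a x.
Proof.
  intros hx; unfold Zf, kd, Rdiv; rewrite <- Rmult_assoc, rpow_S by easy.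
  f_equal; f_equal; ring.
Qed.

(* [Uf] is, up to the factor [2 c], the quotient of the kernels of [F^2] and of [N1];
   the sign of its derivative is that of the nondecreasing function [Br]. *)
Definition Uf (A' a t x : R) : R := rpow x (1 - a) * (1 + t * rpow x a) ^ 2 * kk A' a x.
Definition Br (A' a t x : R) : R :=
  (1 - a) * A' + (Zf a x - (a - 1) * Lam a x)
  + (2 * (t * rpow x a) + (1 + a) * (t * rpow x a) ^ 2) * kk A' a x
  + (2 * (t * rpow x a) + (t * rpow x a) ^ 2) * Zf a x.

Lemma is_derive_Uf (A' a t x : R) : 2 < a -> 0 < x < 1 ->
  is_derive (Uf A' a t) x (rpow x (- a) * Br A' a t x).
Proof.
  intros ha hx; unfold Uf; evar_last.
  - apply is_derive_Reals.
    apply (derivable_pt_lim_mult (fun x => rpow x (1 - a) * (1 + t * rpow x a) ^ 2) (kk A' a)).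
    + apply (derivable_pt_lim_mult (fun x => rpow x (1 - a)) (fun x => (1 + t * rpow x a) ^ 2)).
      * apply is_derive_Reals, is_derive_rpow_pos; lra.
      * apply (derivable_pt_lim_comp (fun x => 1 + t * rpow x a) (fun u => u ^ 2)).
        -- apply derivable_pt_lim_plus; [apply derivable_pt_lim_const|].
           apply derivable_pt_lim_scal, is_derive_Reals, is_derive_rpow; lra.
        -- apply (derivable_pt_lim_pow _ 2).
    + apply (derivable_pt_lim_plus (fun _ => A') (Lam a)); [apply derivable_pt_lim_const|].
      apply is_derive_Reals, is_derive_Lam; lra.
  - unfold Br, kk; rewrite Zf_kd by lra; simpl.
    assert (e1 : rpow x (1 - a) = x * rpow x (- a)) by (rewrite rpow_S by lra; f_equal; ring).
    assert (e2 : rpow x (1 - a - 1) = rpow x (- a)) by (f_equal; ring).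
    assert (e3 : x * rpow x (a - 1) = rpow x a) by (rewrite rpow_S by lra; f_equal; ring).
    rewrite e1, e2.
    transitivity (rpow x (- a) * (((1 - a) * ((1 + t * rpow x a) * ((1 + t * rpow x a) * 1))
      + 2 * (1 + t * rpow x a) * t * a * (x * rpow x (a - 1))) * (A' + Lam a x)
      + (1 + t * rpow x a) ^ 2 * (x * kd a x))).
    + ring.
    + rewrite e3; ring.
Qed.

(** Apart from the constant, every term is a product of nonnegative nondecreasing functions, except
    Zf - (a - 1) Lam; there the [kd] parts of the derivative cancel and a x^(2 a - 2) / (1 - x^a)^2
    is left. *)
Lemma Br_incr (A' a t x z : R) : 2 < a -> 0 <= t -> 0 <= A' -> 0 < x <= z -> z < 1 ->
  Br A' a t x <= Br A' a t z.
Proof.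
  intros ha ht hA hxz hz.
  assert (h1 : Zf a x - (a - 1) * Lam a x <= Zf a z - (a - 1) * Lam a z).
  { apply (incr_of_derive (fun x => Zf a x - (a - 1) * Lam a x)
      (fun x => a * rpow x (a - 1) ^ 2 / (1 - rpow x a) ^ 2)); [lra| |].
    - intros w hw; evar_last.
      + apply (is_derive_minus (Zf a) (fun x => (a - 1) * Lam a x)).
        * apply is_derive_Zf; lra.
        * apply (is_derive_scal (Lam a)), is_derive_Lam; lra.
      + unfold minus, plus, opp; simpl; ring.
    - intros w hw; assert (h := rpow_lt1 a w ltac:(lra) ltac:(lra)).
      apply Rle_mult_inv_pos; [apply Rmult_le_pos; [lra|apply pow2_ge_0]|apply pow_lt; lra]. }
  assert (h2 : Zf a x <= Zf a z).
  { apply (incr_of_derive (Zf a)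
      (fun x => (a - 1) * kd a x + a * rpow x (a - 1) ^ 2 / (1 - rpow x a) ^ 2)); [lra| |].
    - intros w hw; apply is_derive_Zf; lra.
    - intros w hw; assert (h := rpow_lt1 a w ltac:(lra) ltac:(lra)).
      assert (h' := kd_ge0 a w ltac:(lra) ltac:(lra)).
      apply Rplus_le_le_0_compat; [apply Rmult_le_pos; lra|].
      apply Rle_mult_inv_pos; [apply Rmult_le_pos; [lra|apply pow2_ge_0]|apply pow_lt; lra]. }
  assert (h3 := Lam_incr a x z ha ltac:(lra)).
  assert (h4 := Lam_ge0 a x ha ltac:(lra)).
  assert (h5 : 0 <= Zf a x).
  { rewrite Zf_kd by lra; apply Rmult_le_pos; [lra|apply kd_ge0; lra]. }
  assert (h6 := rpow_le a x z ltac:(lra) ltac:(lra)); assert (h7 := rpow_ge0 x a).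
  unfold Br, kk; set (y := t * rpow x a); set (y' := t * rpow z a).
  assert (0 <= y <= y') by (unfold y, y'; split; nra).
  assert (y ^ 2 <= y' ^ 2) by (simpl; nra).
  assert (0 <= y ^ 2) by apply pow2_ge_0.
  assert ((2 * y + (1 + a) * y ^ 2) * (A' + Lam a x) <= (2 * y' + (1 + a) * y' ^ 2) * (A' + Lam a z)).
  { apply Rmult_le_compat; nra. }
  assert ((2 * y + y ^ 2) * Zf a x <= (2 * y' + y' ^ 2) * Zf a z).
  { apply Rmult_le_compat; nra. }
  lra.
Qed.

(** An interior value above both ends would force a positive derivative before it and a negative one
    after it, so [Br] would decrease. *)
Lemma Uf_quasiconvex (A' a t x z w : R) : 2 < a -> 0 <= t -> 0 <= A' -> 0 < x < z -> z < w < 1 ->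
  Uf A' a t z <= Rmax (Uf A' a t x) (Uf A' a t w).
Proof.
  intros ha ht hA hxz hw; apply Rnot_lt_le; intros h.
  assert (h1 := Rle_lt_trans _ _ _ (Rmax_l _ _) h).
  assert (h2 := Rle_lt_trans _ _ _ (Rmax_r _ _) h).
  destruct (mvt_pos (Uf A' a t) (fun x => rpow x (- a) * Br A' a t x) x z) as [c1 [hc1 p1]];
    [lra|intros; apply is_derive_Uf; lra|easy|].
  destruct (mvt_pos (fun x => - Uf A' a t x) (fun x => - (rpow x (- a) * Br A' a t x)) z w)
    as [c2 [hc2 p2]]; [lra| |lra|].
  { intros y hy; apply (is_derive_opp (Uf A' a t)), is_derive_Uf; lra. }
  assert (B := Br_incr A' a t c1 c2 ha ht hA ltac:(lra) ltac:(lra)).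
  assert (q1 := rpow_gt0 c1 (- a) ltac:(lra)); assert (q2 := rpow_gt0 c2 (- a) ltac:(lra)).
  assert (0 < Br A' a t c1) by nra.
  assert (Br A' a t c2 < 0) by nra.
  lra.
Qed.

(** By convexity 1 - x^a <= a (1 - x), so [kd] dominates k / (1 - x) on [1/2, 1) and Lam + k ln(1 -
    x) increases there. The point [x] makes -k ln(1 - x) equal to |B| + 1 + k ln 2, the last term
    offsetting the starting value at 1/2. *)
Lemma Lam_unbounded (a B : R) : 2 < a -> exists x, 0 < x < 1 /\ B < Lam a x.
Proof.
  intros ha.
  set (k := rpow (1/2) (a - 2) / a).
  assert (hk : 0 < k) by (apply Rdiv_lt_0_compat; [apply rpow_gt0; lra|lra]).
  set (x := 1 - exp (- ((Rabs B + 1) / k)) / 2).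
  assert (hq : 0 < (Rabs B + 1) / k) by (apply Rdiv_lt_0_compat; [assert (h := Rabs_pos B); lra|easy]).
  assert (he : 0 < exp (- ((Rabs B + 1) / k)) < 1).
  { split; [apply exp_pos|].
    assert (h := exp_increasing (- ((Rabs B + 1) / k)) 0 ltac:(lra)); rewrite exp_0 in h; easy. }
  assert (hx : 1/2 < x < 1) by (unfold x; lra).
  exists x; split; [lra|].
  assert (m : Lam a (1/2) + k * ln (1 - 1/2) <= Lam a x + k * ln (1 - x)).
  { apply (incr_of_derive (fun x => Lam a x + k * ln (1 - x)) (fun x => kd a x - k / (1 - x))); [lra| |].
    - intros w hw; evar_last.
      + apply (is_derive_plus (Lam a) (fun x => k * ln (1 - x))); [apply is_derive_Lam; lra|].
        apply is_derive_Reals, derivable_pt_lim_scal, is_derive_Reals.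
        auto_derive; [lra|reflexivity].
      + unfold plus; simpl; field; lra.
    - intros w hw.
      assert (h := rpow_lt1 a w ltac:(lra) ltac:(lra)).
      assert (hb : 1 - rpow w a <= a * (1 - w)).
      { assert (M : a * w - rpow w a <= a * 1 - rpow 1 a); [|rewrite rpow_1_l in M; lra].
        apply (incr_of_derive (fun w => a * w - rpow w a) (fun w => a - a * rpow w (a - 1))); [lra| |].
        - intros u hu; apply (is_derive_minus (fun w => a * w) (fun w => rpow w a));
            [|apply is_derive_rpow; lra].
          apply is_derive_Reals; evar_last; [apply derivable_pt_lim_scal, derivable_pt_lim_id|ring].
        - intros u hu; assert (h' := rpow_le1 (a - 1) u ltac:(lra) ltac:(lra)); nra. }
      assert (hm := rpow_le (a - 2) (1/2) w ltac:(lra) ltac:(lra)).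
      assert (k / (1 - w) <= kd a w); [|lra].
      unfold kd; apply Rmult_le_reg_r with ((1 - w) * (1 - rpow w a)); [apply Rmult_lt_0_compat; lra|].
      replace (k / (1 - w) * ((1 - w) * (1 - rpow w a))) with (k * (1 - rpow w a)) by (field; lra).
      replace (rpow w (a - 2) / (1 - rpow w a) * ((1 - w) * (1 - rpow w a)))
        with (rpow w (a - 2) * (1 - w)) by (field; lra).
      apply Rle_trans with (k * (a * (1 - w))); [apply Rmult_le_compat_l; lra|].
      replace (k * (a * (1 - w))) with (rpow (1/2) (a - 2) * (1 - w)) by (unfold k; field; lra).
      apply Rmult_le_compat_r; lra. }
  assert (l0 := Lam_ge0 a (1/2) ha ltac:(lra)).
  replace (1 - x) with (exp (- ((Rabs B + 1) / k)) * / 2) in m by (unfold x; lra).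
  replace (1 - 1 / 2) with (/ 2) in m by lra.
  rewrite ln_mult, ln_exp in m by lra.
  replace (k * (- ((Rabs B + 1) / k) + ln (/ 2))) with (- (Rabs B + 1) + k * ln (/ 2)) in m
    by (field; lra).
  assert (h := Rle_abs B); lra.
Qed.

Lemma RInt_pos_point_gen (f : R -> R) (a b x0 : R) :
  (forall x, continuous f x) -> (forall x, a < x < b -> 0 <= f x) ->
  a < x0 < b -> 0 < f x0 -> 0 < RInt f a b.
Proof.
  intros hc h0 hx hf.
  set (g := fun x => f ((b - a) * x + a)).
  assert (hg : forall x, continuous g x).
  { intros; unfold g; apply (continuous_comp (fun x => (b - a) * x + a) f); [cont|apply hc]. }
  assert (e : (b - a) * RInt g 0 1 = RInt f a b).
  { transitivity (RInt (fun x => f (x + a)) 0 (b - a)).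
    - unfold g.
      assert (h := RInt_scale (fun x => f (x + a)) (b - a) 0 1).
      rewrite Rmult_0_r, Rmult_1_r in h; apply h; apply ex_RInt_cont; intros.
      apply (continuous_comp (fun x => x + a) f); [cont|apply hc].
    - assert (h := RInt_comp_lin f 1 a 0 (b - a)).
      assert (e1 : 1 * 0 + a = a) by ring; assert (e2 : 1 * (b - a) + a = b) by ring.
      rewrite e1, e2 in h; rewrite <- h by now apply ex_RInt_cont.
      apply RInt_ext; intros x _; unfold scal; simpl; unfold mult; simpl.
      rewrite Rmult_1_l; f_equal; ring. }
  rewrite <- e; apply Rmult_lt_0_compat; [lra|].
  apply RInt_pos_point with ((x0 - a) / (b - a)); [easy| | |].
  - intros x hx'; apply h0; split; nra.
  - split; [apply Rdiv_lt_0_compat; lra|].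
    apply (Rlt_div_l _ 1); lra.
  - unfold g; replace ((b - a) * ((x0 - a) / (b - a)) + a) with x0 by (field; lra); easy.
Qed.

(** The kernel of [N1], scaled so that N1(s) is 2 c times the integral of x b_s(x) kb(x); it is thus
    compared directly with the kernel [kk] of F^2. *)
Definition kb (c a t x : R) : R := rpow x (a - 1) * bfun a t x ^ 2 / (2 * c).

Lemma continuous_kb (c a t x : R) : 1 < a -> 0 <= t -> 0 < c -> continuous (kb c a t) x.
Proof. intros; unfold kb; contb; lra. Qed.

Lemma kb_le (c a t x : R) : 1 < a -> 0 <= t -> 0 < c -> x <= 1 -> kb c a t x <= / (2 * c).
Proof.
  intros ha ht hc hx; unfold kb, Rdiv; rewrite <- (Rmult_1_l (/ (2 * c))) at 2.
  apply Rmult_le_compat_r; [apply Rlt_le, Rinv_0_lt_compat; lra|].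
  assert (h1 := bfun_pos a t x ht); assert (h2 := bfun_le1 a t x ht).
  assert (h3 := rpow_ge0 x (a - 1)); assert (h4 := rpow_le1 (a - 1) x ltac:(lra) hx).
  assert (0 <= bfun a t x ^ 2 <= 1) by (simpl; nra); nra.
Qed.

Lemma kk_sub_kb (A' c a t x : R) : 0 <= t -> 0 < c -> 0 < x ->
  kk A' a x - kb c a t x = (Uf A' a t x - / (2 * c)) * (rpow x (a - 1) * bfun a t x ^ 2).
Proof.
  intros ht hc hx; unfold Uf, kb.
  assert (e : rpow x (1 - a) * rpow x (a - 1) = 1).
  { rewrite <- rpow_plus; replace (1 - a + (a - 1)) with 0 by ring.
    rewrite rpow_pos, Rpower_O; lra. }
  assert (e2 : (1 + t * rpow x a) ^ 2 * bfun a t x ^ 2 = 1).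
  { unfold bfun; assert (h := den_pos a t x ht); field; lra. }
  transitivity (kk A' a x * (rpow x (1 - a) * rpow x (a - 1)) * ((1 + t * rpow x a) ^ 2 * bfun a t x ^ 2)
    - rpow x (a - 1) * bfun a t x ^ 2 / (2 * c)); [rewrite e, e2; ring|field; lra].
Qed.

Lemma IVT_zero (f : R -> R) (a b : R) : a <= b ->
  (forall x, a <= x <= b -> continuous f x) -> f b <= 0 <= f a ->
  exists x, a <= x <= b /\ f x = 0.
Proof. intros; now apply IVT_dec. Qed.

(* Quasi-convexity of the quotient of the two kernels. *)
Lemma kernel_signs (A' c a t xm : R) : 2 < a -> 0 <= t -> 0 < c -> 0 < A' ->
  0 < xm < 1 -> kk A' a xm < kb c a t xm ->
  exists x1 x2, 0 < x1 < xm /\ xm < x2 < 1 /\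
    (forall x, 0 < x <= x1 -> kb c a t x <= kk A' a x) /\
    (forall x, x1 <= x <= x2 -> kk A' a x <= kb c a t x) /\
    (forall x, x2 <= x < 1 -> kb c a t x <= kk A' a x).
Proof.
  intros ha ht hc hA hm hneg.
  set (D := fun x => kk A' a x - kb c a t x).
  assert (Dc : forall x, x < 1 -> continuous D x).
  { intros x hx; unfold D, kk; apply cont_minus; [apply cont_plus|apply continuous_kb; lra].
    - apply continuous_const.
    - apply continuous_Lam; lra. }
  assert (D0 : 0 < D 0).
  { unfold D, kk, kb; assert (e : Lam a 0 = 0) by exact (RInt_point 0 (kd a)).
    rewrite e, (rpow_nonpos 0) by lra; unfold Rdiv; rewrite !Rmult_0_l; lra. }
  (* [kk] exceeds [kb] at 0, where [kb] vanishes, and near 1, where [kk] is unbounded and [kb] is at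
     most 1 / (2 c); at [xm] the order is reversed, so there is a crossing on each side. *)
  destruct (Lam_unbounded a (/ (2 * c)) ha) as [z [hz hL]].
  set (z' := Rmax z ((xm + 1) / 2)).
  assert (hz' : z <= z' /\ xm < z' < 1).
  { unfold z'; split; [apply Rmax_l|split].
    - eapply Rlt_le_trans; [|apply Rmax_r]; lra.
    - apply Rmax_lub_lt; lra. }
  assert (D1 : 0 < D z').
  { unfold D, kk; assert (h1 := kb_le c a t z' ltac:(lra) ht hc ltac:(lra)).
    assert (h2 := Lam_incr a z z' ha ltac:(lra)); lra. }
  destruct (IVT_zero D 0 xm) as [x1 [h1 e1]]; [lra|intros; apply Dc; lra|unfold D at 1; lra|].
  destruct (IVT_zero (fun x => - D x) xm z') as [x2 [h2 e2]];
    [lra|intros; apply cont_opp, Dc; lra|unfold D at 2; lra|].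
  assert (x1 <> 0) by (intros h; rewrite h in e1; lra).
  assert (x1 <> xm) by (intros h; rewrite h in e1; unfold D in e1; lra).
  assert (x2 <> xm) by (intros h; rewrite h in e2; unfold D in e2; lra).
  exists x1, x2; split; [lra|]; split; [lra|].
  set (k0 := / (2 * c)).
  assert (W : forall x, 0 < x -> 0 < rpow x (a - 1) * bfun a t x ^ 2).
  { intros; apply Rmult_lt_0_compat; [now apply rpow_gt0|now apply pow_lt, bfun_pos]. }
  assert (eq : forall x, 0 < x -> D x = (Uf A' a t x - k0) * (rpow x (a - 1) * bfun a t x ^ 2))
    by (intros; unfold D; now apply kk_sub_kb).
  assert (U1 : Uf A' a t x1 = k0).
  { rewrite eq in e1 by lra; apply Rmult_integral in e1; assert (h := W x1 ltac:(lra)); lra. }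
  assert (U2 : Uf A' a t x2 = k0).
  { assert (e2' : D x2 = 0) by lra.
    rewrite eq in e2' by lra; apply Rmult_integral in e2'; assert (h := W x2 ltac:(lra)); lra. }
  assert (Um : Uf A' a t xm < k0).
  { assert (h : D xm < 0) by (unfold D; lra).
    rewrite eq in h by lra; assert (h' := W xm ltac:(lra)); nra. }
  assert (Qc := Uf_quasiconvex A' a t).
  assert (Dge : forall x, 0 < x -> k0 <= Uf A' a t x -> kb c a t x <= kk A' a x).
  { intros x hx h; assert (e := eq x hx); unfold D in e; assert (h' := W x hx); nra. }
  assert (Dle : forall x, 0 < x -> Uf A' a t x <= k0 -> kk A' a x <= kb c a t x).
  { intros x hx h; assert (e := eq x hx); unfold D in e; assert (h' := W x hx); nra. }
  split; [|split].
  (* Were [Uf] below its crossing value at some x < x1, quasi-convexity on x < x1 < xm would put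
     Uf(x1) below it too. The third case is symmetric. *)
  - intros x hx; apply Dge; [lra|].
    destruct (Req_dec x x1) as [->|hne]; [lra|].
    specialize (Qc x x1 xm ha ht ltac:(lra) ltac:(lra) ltac:(lra)).
    apply Rnot_lt_le; intros h.
    assert (Rmax (Uf A' a t x) (Uf A' a t xm) < k0) by now apply Rmax_lub_lt. lra.
  - intros x hx; apply Dle; [lra|].
    destruct (Req_dec x x1) as [->|hne]; [lra|].
    destruct (Req_dec x x2) as [->|hne']; [lra|].
    specialize (Qc x1 x x2 ha ht ltac:(lra) ltac:(lra) ltac:(lra)).
    rewrite U1, U2, Rmax_left in Qc; lra.
  - intros x hx; apply Dge; [lra|].
    destruct (Req_dec x x2) as [->|hne]; [lra|].
    specialize (Qc xm x2 x ha ht ltac:(lra) ltac:(lra) ltac:(lra)).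
    apply Rnot_lt_le; intros h.
    assert (Rmax (Uf A' a t xm) (Uf A' a t x) < k0) by now apply Rmax_lub_lt. lra.
Qed.

(** The functional [L] is applied to both sides of the expansion of (1 + s y1)(1 + s y2) b_s at
    [s0]. Only the quadratic term contributes, up to truncation errors that vanish with [rho], and
    its contribution is strictly negative. *)
Lemma Jext_zero_strict_max (a t s0 s : R) : 2 < a -> 0 < t -> 0 < s0 -> 0 < s -> s <> s0 ->
  Jext a t s0 = 0 -> N1 a t s * F a s0 ^ 2 < N1 a t s0 * F a s ^ 2.
Proof.
  intros ha ht hs0 hs hne HJ.
  destruct (KA_exists a ha) as [A' [hA0 hA]].
  assert (f0 := F_gt0 a s0 ltac:(lra) ltac:(lra)).
  assert (g0 := Fd_gt0 a s0 ltac:(lra) ltac:(lra)).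
  set (c := N1 a t s0 / F a s0 ^ 2).
  assert (hN : 0 < N1 a t s0).
  { rewrite N1_split by lra.
    assert (h1 := A1_gt0 a t s0 ltac:(lra) ltac:(lra) ltac:(lra)).
    assert (h2 := A2_gt0 a t s0 ltac:(lra) ltac:(lra) ltac:(lra)).
    assert (0 < s0 * A2 a t s0) by now apply Rmult_lt_0_compat. lra. }
  assert (hc : 0 < c) by (apply Rdiv_lt_0_compat; [easy|now apply pow_lt]).
  assert (c1 : N1 a t s0 = c * F a s0 ^ 2) by (unfold c; field; lra).
  (* Vanishing of [Jext] at [s0] says that N1 - c F^2, whose derivative is 2 c F Fd - A2, is
     stationary there. *)
  assert (c2 : A2 a t s0 = c * (2 * F a s0 * Fd a s0)).
  { unfold Jext in HJ; apply Rmult_eq_reg_l with (F a s0 / Fd a s0).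
    - replace (F a s0 / Fd a s0 * A2 a t s0) with (2 * N1 a t s0) by lra.
      rewrite c1; field; lra.
    - apply Rgt_not_eq, Rdiv_lt_0_compat; easy. }
  assert (hkr : forall r, r < 1 -> forall x, continuous (kr A' a r) x)
    by (intros; now apply continuous_kr).
  assert (hkb : forall x, continuous (kb c a t) x) by (intros; apply continuous_kb; lra).
  set (L := fun r g => RInt (fun x => rpow x a * (g x * bfun a t x ^ 2)) 0 1 - c * mu A' a r g).
  assert (eL : forall r g, r < 1 -> (forall x, continuous g x) ->
    L r g = - (2 * c) * RInt (fun x => x * g x * (kr A' a r x - kb c a t x)) 0 1).
  { intros r g hr hg; specialize (hkr r hr); unfold L, mu.
    transitivity (RInt (fun x => rpow x a * (g x * bfun a t x ^ 2)) 0 1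
       - (2 * c) * RInt (fun x => x * g x * kr A' a r x) 0 1); [ring|].
    rewrite <- !RInt_scal_R, <- RInt_minus_R by (apply ex_RInt_cont; contb).
    apply RInt_ext; intros x hx; rewrite Rmin_left, Rmax_right in hx by lra; toR.
    unfold kb; replace (rpow x a) with (x * rpow x (a - 1)) by (rewrite rpow_S by lra; f_equal; ring).
    field; lra. }
  assert (Lb : forall r q, 0 <= r < 1 -> 0 <= q ->
    Rabs (L r (bfun a q) - (N1 a t q - c * F a q ^ 2)) <= 4 * c * (1 - r)).
  { intros r q hr hq; assert (m := mu_bfun A' a r q ha hr hq (hA r hr)).
    unfold L; fold (N1 a t q).
    replace (N1 a t q - c * mu A' a r (bfun a q) - (N1 a t q - c * F a q ^ 2))
      with (- (c * (mu A' a r (bfun a q) - F a q ^ 2))) by ring.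
    rewrite Rabs_Ropp, Rabs_mult, Rabs_pos_eq by lra; nra. }
  destruct (Lam_unbounded a (/ (2 * c)) ha) as [z0 [hz0 hL0]].
  assert (big : forall r x, z0 <= r < 1 -> r <= x <= 1 -> kb c a t x <= kr A' a r x).
  { intros r x hr hx; unfold kr, kk; rewrite Rmin_right by lra.
    assert (h1 := kb_le c a t x ltac:(lra) ltac:(lra) hc ltac:(lra)).
    assert (h2 := Lam_incr a z0 r ha ltac:(lra)); lra. }
  assert (small : forall r x, x <= r -> kr A' a r x = kk A' a x)
    by (intros r x hx; unfold kr; now rewrite Rmin_left).
  assert (hb0 : forall x, continuous (bfun a s0) x) by (intros; contb).
  assert (hbs : forall x, continuous (bfun a s) x) by (intros; contb).
  destruct (Classical_Prop.classic (exists xm, 0 < xm < 1 /\ kk A' a xm < kb c a t xm)) as [[xm [hxm hneg]]|hno].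
  (* Without a reversal the kernel difference is nonnegative, and positive near 0, so [L] at b_{s0}
     is negative by an amount independent of [r]; yet it tends to 0 with 1 - r. *)
  2: { exfalso.
    assert (hno' : forall x, 0 < x < 1 -> kb c a t x <= kk A' a x).
    { intros x hx; apply Rnot_lt_le; intros h; apply hno; now exists x. }
    assert (ker : forall r x, z0 <= r < 1 -> 0 < x < 1 -> 0 <= kr A' a r x - kb c a t x).
    { intros r x hr hx; destruct (Rle_dec x r) as [h|h].
      - rewrite small by easy; specialize (hno' x hx); lra.
      - specialize (big r x hr ltac:(lra)); lra. }
    set (eta := RInt (fun x => x * bfun a s0 x * (kr A' a z0 x - kb c a t x)) 0 z0).
    assert (heta : 0 < eta).
    { destruct (rpow_small (a - 1) (A' * c)) as [d [hd hsm]]; [lra|now apply Rmult_lt_0_compat|].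
      set (x0 := Rmin d z0 / 2).
      assert (hx0 : 0 < x0 < z0 /\ x0 < d).
      { assert (0 < Rmin d z0) by (apply Rmin_pos; lra).
        assert (h1 := Rmin_l d z0); assert (h2 := Rmin_r d z0); unfold x0; lra. }
      apply RInt_pos_point_gen with x0; [| |lra|].
      - intros; apply cont_mult; [cont|]; apply cont_minus; [now apply hkr|apply hkb].
      - intros x hx; apply Rmult_le_pos; [|apply ker; lra].
        apply Rmult_le_pos; [lra|apply Rlt_le, bfun_pos; lra].
      - apply Rmult_lt_0_compat; [apply Rmult_lt_0_compat; [lra|apply bfun_pos; lra]|].
        rewrite small by lra; unfold kk.
        assert (h1 := Lam_ge0 a x0 ha ltac:(lra)); assert (h2 := hsm x0 ltac:(lra)).
        assert (kb c a t x0 < A'); [|lra].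
        unfold kb; apply Rlt_div_l; [lra|].
        assert (h3 := bfun_pos a t x0 ltac:(lra)); assert (h4 := bfun_le1 a t x0 ltac:(lra)).
        assert (h5 := rpow_ge0 x0 (a - 1)).
        assert (bfun a t x0 ^ 2 <= 1) by (simpl; nra).
        assert (0 <= bfun a t x0 ^ 2) by apply pow2_ge_0.
        assert (rpow x0 (a - 1) * bfun a t x0 ^ 2 <= rpow x0 (a - 1)) by nra.
        assert (0 < A' * c) by now apply Rmult_lt_0_compat. lra. }
    set (r := Rmax z0 (1 - eta / 4)).
    assert (hr : z0 <= r < 1).
    { unfold r; split; [apply Rmax_l|apply Rmax_lub_lt; lra]. }
    assert (hr' : 1 - r <= eta / 4) by (assert (h := Rmax_r z0 (1 - eta / 4)); unfold r; lra).
    assert (l := Lb r s0 ltac:(lra) ltac:(lra)); rewrite eL in l by (easy || lra).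
    rewrite c1, Rminus_diag, Rminus_0_r in l; apply Rabs_le_between in l.
    assert (eta <= RInt (fun x => x * bfun a s0 x * (kr A' a r x - kb c a t x)) 0 1).
    { rewrite (RInt_Chasles_R _ 0 z0 1) by (apply ex_RInt_cont; intros; apply cont_mult;
        [cont|]; apply cont_minus; [now apply hkr|apply hkb]).
      assert (e : RInt (fun x => x * bfun a s0 x * (kr A' a r x - kb c a t x)) 0 z0 = eta).
      { apply RInt_ext; intros x hx; rewrite Rmin_left, Rmax_right in hx by lra.
        rewrite !small by lra; easy. }
      rewrite e; assert (0 <= RInt (fun x => x * bfun a s0 x * (kr A' a r x - kb c a t x)) z0 1); [|lra].
      apply RInt_ge_0; [lra| |].
      - apply ex_RInt_cont; intros; apply cont_mult; [cont|]; apply cont_minus; [now apply hkr|apply hkb].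
      - intros x hx; apply Rmult_le_pos; [|apply ker; lra].
        apply Rmult_le_pos; [lra|apply Rlt_le, bfun_pos; lra]. }
    nra. }
  destruct (kernel_signs A' c a t xm ha ltac:(lra) hc hA0 hxm hneg)
    as [x1 [x2 [hx1 [hx2 [S1 [S2 S3]]]]]].
  set (y1 := rpow x1 a); set (y2 := rpow x2 a).
  assert (hy1 := rpow_ge0 x1 a); assert (hy2 := rpow_ge0 x2 a); fold y1 in hy1; fold y2 in hy2.
  (* The quadratic remainder of the expansion at [s0], divided by h^2. It changes sign at x1 and x2,
     in step with the kernel difference. *)
  set (w := fun x => (rpow x a - y1) * (rpow x a - y2) * (bfun a s0 x ^ 2 * bfun a s x)).
  assert (hw : forall x, continuous w x) by (intros; unfold w; cont).
  assert (hq : forall x, 0 < bfun a s0 x ^ 2 * bfun a s x).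
  { intros; apply Rmult_lt_0_compat; [apply pow_lt|]; apply bfun_pos; lra. }
  assert (wout : forall x, 0 < x <= x1 \/ x2 <= x -> 0 <= w x).
  { intros x hx; unfold w; apply Rmult_le_pos; [|apply Rlt_le, hq].
    destruct hx as [h|h].
    - assert (h1 := rpow_le a x x1 ltac:(lra) ltac:(lra)).
      assert (h2 := rpow_le a x x2 ltac:(lra) ltac:(lra)); fold y1 in h1; fold y2 in h2; nra.
    - assert (h1 := rpow_le a x1 x ltac:(lra) ltac:(lra)).
      assert (h2 := rpow_le a x2 x ltac:(lra) ltac:(lra)); fold y1 in h1; fold y2 in h2; nra. }
  assert (win : forall x, x1 <= x <= x2 -> w x <= 0).
  { intros x hx; unfold w.
    assert (h1 := rpow_le a x1 x ltac:(lra) ltac:(lra)).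
    assert (h2 := rpow_le a x x2 ltac:(lra) ltac:(lra)); fold y1 in h1; fold y2 in h2.
    assert (h3 := hq x); assert ((rpow x a - y1) * (rpow x a - y2) <= 0) by nra; nra. }
  set (zr := Rmax z0 x2).
  assert (hzr : z0 <= zr /\ x2 <= zr < 1).
  { unfold zr; split; [apply Rmax_l|split; [apply Rmax_r|apply Rmax_lub_lt; lra]]. }
  assert (ker : forall r x, zr <= r < 1 -> 0 < x < 1 -> 0 <= x * w x * (kr A' a r x - kb c a t x)).
  { intros r x hr hx.
    destruct (Rle_dec x x1) as [h1|h1]; [|destruct (Rle_dec x x2) as [h2|h2]].
    - apply Rmult_le_pos; [apply Rmult_le_pos; [lra|apply wout; lra]|].
      rewrite small by lra; specialize (S1 x ltac:(lra)); lra.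
    - rewrite small by lra; specialize (S2 x ltac:(lra)); specialize (win x ltac:(lra)).
      assert (0 <= x * (- w x)) by (apply Rmult_le_pos; lra); nra.
    - apply Rmult_le_pos; [apply Rmult_le_pos; [lra|apply wout; lra]|].
      destruct (Rle_dec x r) as [h3|h3].
      + rewrite small by lra; specialize (S3 x ltac:(lra)); lra.
      + specialize (big r x ltac:(lra) ltac:(lra)); lra. }
  assert (cw : forall r, r < 1 -> forall x, continuous (fun x => x * w x * (kr A' a r x - kb c a t x)) x).
  { intros r hr x; apply cont_mult; [cont|]; apply cont_minus; [now apply hkr|apply hkb]. }
  set (eta := RInt (fun x => x * w x * (kr A' a zr x - kb c a t x)) x1 x2).
  assert (heta : 0 < eta).
  { apply RInt_pos_point_gen with xm; [apply cw; lra| |lra|].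
    - intros x hx; apply ker; lra.
    - rewrite small by lra.
      assert (w xm < 0).
      { unfold w.
        assert (h1 := rpow_lt a x1 xm ltac:(lra) ltac:(lra)).
        assert (h2 := rpow_lt a xm x2 ltac:(lra) ltac:(lra)); fold y1 in h1; fold y2 in h2.
        assert (h3 := hq xm); assert ((rpow xm a - y1) * (rpow xm a - y2) < 0) by nra; nra. }
      assert (0 < xm * - w xm) by (apply Rmult_lt_0_compat; lra); nra. }
  assert (Lw : forall r, zr <= r < 1 -> L r w <= - (2 * c) * eta).
  { intros r hr; rewrite eL by (easy || lra).
    assert (eta <= RInt (fun x => x * w x * (kr A' a r x - kb c a t x)) 0 1); [|nra].
    rewrite (RInt_Chasles_R _ 0 x1 1), (RInt_Chasles_R _ x1 x2 1) by (apply ex_RInt_cont, cw; lra).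
    assert (e : RInt (fun x => x * w x * (kr A' a r x - kb c a t x)) x1 x2 = eta).
    { apply RInt_ext; intros x hx; rewrite Rmin_left, Rmax_right in hx by lra.
      rewrite !small by lra; easy. }
    assert (0 <= RInt (fun x => x * w x * (kr A' a r x - kb c a t x)) 0 x1).
    { apply RInt_ge_0; [lra|apply ex_RInt_cont, cw; lra|intros; apply ker; lra]. }
    assert (0 <= RInt (fun x => x * w x * (kr A' a r x - kb c a t x)) x2 1).
    { apply RInt_ge_0; [lra|apply ex_RInt_cont, cw; lra|intros; apply ker; lra]. }
    lra. }
  (* Second-order Taylor expansion of [(1 + s y1) (1 + s y2) / (1 + s y)] at [s0] *)
  set (h := s - s0).
  set (tau0 := (1 + s0 * y1) * (1 + s0 * y2)).
  set (tau1 := y1 + y2 + 2 * s0 * y1 * y2).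
  set (taus := (1 + s * y1) * (1 + s * y2)).
  set (d0 := fun x => rpow x a * bfun a s0 x ^ 2).
  assert (hd0 : forall x, continuous d0 x) by (intros; unfold d0; cont).
  assert (Tay : forall r, r < 1 ->
    taus * L r (bfun a s) = (tau0 + h * tau1) * L r (bfun a s0) - h * tau0 * L r d0 + h ^ 2 * L r w).
  { intros r hr; rewrite !eL by easy.
    set (k := fun x => kr A' a r x - kb c a t x).
    assert (hk : forall x, continuous k x)
      by (intros; unfold k; apply cont_minus; [now apply hkr|apply hkb]).
    transitivity (- (2 * c) * (taus * RInt (fun x => x * bfun a s x * k x) 0 1)); [unfold k; ring|].
    transitivity (- (2 * c) * ((tau0 + h * tau1) * RInt (fun x => x * bfun a s0 x * k x) 0 1
       - h * tau0 * RInt (fun x => x * d0 x * k x) 0 1 + h ^ 2 * RInt (fun x => x * w x * k x) 0 1));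
      [|unfold k; ring].
    f_equal; rewrite <- !RInt_scal_R, <- RInt_minus_R, <- RInt_plus_R by (apply ex_RInt_cont; cont).
    apply RInt_ext; intros x _; toR.
    unfold taus, tau0, tau1, h, d0, w, bfun.
    assert (p1 := den_pos a s x ltac:(lra)); assert (p2 := den_pos a s0 x ltac:(lra)).
    field; lra. }
  assert (hh : 0 < h ^ 2).
  { unfold h; rewrite <- Rsqr_pow2; apply Rsqr_pos_lt; lra. }
  assert (ht0 : 1 <= tau0).
  { unfold tau0; assert (0 <= s0 * y1) by (apply Rmult_le_pos; lra).
    assert (0 <= s0 * y2) by (apply Rmult_le_pos; lra); nra. }
  assert (hts : 1 <= taus).
  { unfold taus; assert (0 <= s * y1) by (apply Rmult_le_pos; lra).
    assert (0 <= s * y2) by (apply Rmult_le_pos; lra); nra. }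
  (* [M * rho] bounds the three errors of the truncated identity; [rho] makes it at most h^2 c eta,
     half of the gain 2 c eta h^2. *)
  set (M := 4 * c * Rabs (tau0 + h * tau1) + 16 * c * Rabs (h * tau0) + 4 * c * taus).
  assert (hM : 0 < M).
  { unfold M; assert (q1 := Rabs_pos (tau0 + h * tau1)); assert (q2 := Rabs_pos (h * tau0)).
    assert (0 < c * taus) by (apply Rmult_lt_0_compat; lra).
    assert (0 <= c * Rabs (tau0 + h * tau1)) by (apply Rmult_le_pos; lra).
    assert (0 <= c * Rabs (h * tau0)) by (apply Rmult_le_pos; lra); lra. }
  set (rho := Rmin (Rmin (1 / 2) (1 - zr)) (h ^ 2 * (c * eta) / M)).
  assert (hce : 0 < c * eta) by now apply Rmult_lt_0_compat.
  assert (hrho : 0 < rho <= 1 / 2 /\ rho <= 1 - zr /\ M * rho <= h ^ 2 * (c * eta)).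
  { unfold rho.
    assert (0 < h ^ 2 * (c * eta) / M) by (apply Rdiv_lt_0_compat; [apply Rmult_lt_0_compat|]; easy).
    repeat split.
    - repeat apply Rmin_pos; lra.
    - eapply Rle_trans; [apply Rmin_l|apply Rmin_l].
    - eapply Rle_trans; [apply Rmin_l|apply Rmin_r].
    - apply Rle_trans with (M * (h ^ 2 * (c * eta) / M)).
      + apply Rmult_le_compat_l; [lra|apply Rmin_r].
      + right; field; lra. }
  set (r := 1 - rho ^ 2).
  assert (hr : zr <= r < 1 /\ 0 <= r) by (unfold r; simpl; split; [split|]; nra).
  assert (l0 := Lb r s0 ltac:(lra) ltac:(lra)).
  rewrite c1, Rminus_diag, Rminus_0_r in l0.
  assert (ls := Lb r s ltac:(lra) ltac:(lra)).
  assert (ld : Rabs (L r d0) <= 16 * c * rho).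
  { assert (m := mu_deriv A' a rho s0 ha ltac:(lra) ltac:(lra) ltac:(lra) hA); fold r in m.
    unfold L.
    assert (e : RInt (fun x => rpow x a * (d0 x * bfun a t x ^ 2)) 0 1 = A2 a t s0).
    { unfold A2; apply RInt_ext; intros; unfold d0; toR; ring. }
    rewrite e, c2, <- Rmult_minus_distr_l, Rabs_mult, Rabs_pos_eq by lra.
    rewrite Rabs_minus_sym; fold d0 in m; nra. }
  assert (lw := Lw r ltac:(lra)).
  assert (T := Tay r ltac:(lra)).
  replace (1 - r) with (rho ^ 2) in l0, ls by (unfold r; ring).
  assert (hr2 : 0 <= rho ^ 2 <= rho) by (simpl; nra).
  assert (b1 : (tau0 + h * tau1) * L r (bfun a s0) <= 4 * c * Rabs (tau0 + h * tau1) * rho).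
  { eapply Rle_trans; [apply Rle_abs|]; rewrite Rabs_mult.
    assert (q := Rabs_pos (tau0 + h * tau1)).
    assert (Rabs (L r (bfun a s0)) <= 4 * c * rho) by nra; nra. }
  assert (b2 : - (h * tau0 * L r d0) <= 16 * c * Rabs (h * tau0) * rho).
  { eapply Rle_trans; [apply Rle_abs|]; rewrite Rabs_Ropp, Rabs_mult.
    assert (q := Rabs_pos (h * tau0)); nra. }
  apply Rabs_le_between in ls.
  assert (b3 : taus * (N1 a t s - c * F a s ^ 2) <= taus * L r (bfun a s) + 4 * c * taus * rho).
  { assert (N1 a t s - c * F a s ^ 2 <= L r (bfun a s) + 4 * c * rho) by nra; nra. }
  assert (fin : taus * (N1 a t s - c * F a s ^ 2) < 0).
  { assert (h ^ 2 * L r w <= h ^ 2 * (- (2 * c) * eta)) by (apply Rmult_le_compat_l; lra).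
    assert (M * rho = 4 * c * Rabs (tau0 + h * tau1) * rho + 16 * c * Rabs (h * tau0) * rho
       + 4 * c * taus * rho) by (unfold M; ring).
    assert (0 < h ^ 2 * (c * eta)) by (apply Rmult_lt_0_compat; easy).
    replace (h ^ 2 * (- (2 * c) * eta)) with (- 2 * (h ^ 2 * (c * eta))) in H by ring.
    lra. }
  assert (N1 a t s < c * F a s ^ 2) by nra.
  apply Rmult_lt_compat_r with (r := F a s0 ^ 2) in H; [|now apply pow_lt].
  replace (c * F a s ^ 2 * F a s0 ^ 2) with (N1 a t s0 * F a s ^ 2) in H by (rewrite c1; ring).
  easy.
Qed.

(* [Jext] cleared of its denominator. *)
Definition Hj (a t s : R) : R := 2 * N1 a t s * Fd a s - F a s * A2 a t s.

Lemma Hj_eq (a t s : R) : 0 < a -> 0 <= s -> Hj a t s = Fd a s * Jext a t s.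
Proof.
  intros ha hs; assert (h := Fd_gt0 a s ha hs); unfold Hj, Jext; field; lra.
Qed.

Lemma RInt_lip01 (f g : R -> R) (M : R) :
  (forall x, continuous f x) -> (forall x, continuous g x) ->
  (forall x, 0 <= x <= 1 -> Rabs (f x - g x) <= M) -> Rabs (RInt f 0 1 - RInt g 0 1) <= M.
Proof.
  intros hf hg h; rewrite <- RInt_minus_R by now apply ex_RInt_cont.
  apply RInt_abs01; [cont|easy].
Qed.

Lemma lip_weight (w b b' d : R) : 0 <= w <= 1 -> 0 <= b <= 1 -> 0 <= b' <= 1 ->
  Rabs (b - b') <= d -> Rabs (w * b - w * b') <= d /\ Rabs (w * b ^ 2 - w * b' ^ 2) <= 2 * d.
Proof.
  intros hw hb hb' hd.
  replace (w * b - w * b') with (w * (b - b')) by ring.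
  replace (w * b ^ 2 - w * b' ^ 2) with (w * (b + b') * (b - b')) by ring.
  rewrite !Rabs_mult, (Rabs_pos_eq w), (Rabs_pos_eq (b + b')) by lra.
  assert (h := Rabs_pos (b - b')); assert (0 <= w * (b + b') <= 2) by nra; split; nra.
Qed.

(** All factors lie in [0, 1] and the four differences contribute 2, 4, 1 and 2. The bound includes
    [s = 0], the point from which positivity is propagated. *)
Lemma Hj_lip (a t s s' : R) : 1 < a -> 0 <= t -> 0 <= s -> 0 <= s' ->
  Rabs (Hj a t s' - Hj a t s) <= 9 * Rabs (s' - s).
Proof.
  intros ha ht hs hs'.
  assert (b : forall q x, 0 <= q -> 0 <= bfun a q x <= 1)
    by (intros; split; [now apply Rlt_le, bfun_pos|now apply bfun_le1]).
  assert (y01 : forall x, 0 <= x <= 1 -> 0 <= rpow x a <= 1)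
    by (intros; split; [apply rpow_ge0|apply rpow_le1; lra]).
  assert (l : forall x, 0 <= x <= 1 -> Rabs (bfun a s' x - bfun a s x) <= Rabs (s' - s))
    by (intros; apply bfun_lip; lra).
  assert (wt : forall x, 0 <= x <= 1 -> 0 <= rpow x a * bfun a t x ^ 2 <= 1).
  { intros x hx; specialize (b t x ht); specialize (y01 x hx).
    assert (0 <= bfun a t x ^ 2 <= 1) by (simpl; nra); nra. }
  assert (wt2 : forall x, 0 <= x <= 1 -> 0 <= rpow x a ^ 2 * bfun a t x ^ 2 <= 1).
  { intros x hx; specialize (wt x hx); specialize (y01 x hx).
    replace (rpow x a ^ 2 * bfun a t x ^ 2) with (rpow x a * (rpow x a * bfun a t x ^ 2)) by ring; nra. }
  assert (dF := F_lip a s s' ltac:(lra) hs hs').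
  assert (dFd : Rabs (Fd a s' - Fd a s) <= 2 * Rabs (s' - s)).
  { apply RInt_lip01; [contb|contb|]; intros x hx; apply lip_weight; auto. }
  assert (dN : Rabs (N1 a t s' - N1 a t s) <= Rabs (s' - s)).
  { apply RInt_lip01; [contb|contb|]; intros x hx.
    replace (rpow x a * (bfun a s' x * bfun a t x ^ 2) - rpow x a * (bfun a s x * bfun a t x ^ 2))
      with (rpow x a * bfun a t x ^ 2 * bfun a s' x - rpow x a * bfun a t x ^ 2 * bfun a s x) by ring.
    apply lip_weight; auto. }
  assert (dA : Rabs (A2 a t s' - A2 a t s) <= 2 * Rabs (s' - s)).
  { apply RInt_lip01; [contb|contb|]; intros x hx.
    replace (rpow x a ^ 2 * (bfun a s' x ^ 2 * bfun a t x ^ 2) - rpow x a ^ 2 * (bfun a s x ^ 2 * bfun a t x ^ 2))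
      with (rpow x a ^ 2 * bfun a t x ^ 2 * bfun a s' x ^ 2 - rpow x a ^ 2 * bfun a t x ^ 2 * bfun a s x ^ 2) by ring.
    apply lip_weight; auto. }
  assert (bd : forall f, (forall x, continuous f x) -> (forall x, 0 <= x <= 1 -> 0 <= f x <= 1) ->
     0 <= RInt f 0 1 <= 1).
  { intros f hf h; split.
    - apply RInt_ge_0; [lra|now apply ex_RInt_cont|intros; apply h; lra].
    - apply Rabs_le_between, RInt_abs01; [easy|]; intros x hx; specialize (h x hx).
      rewrite Rabs_pos_eq; lra. }
  assert (bN : 0 <= N1 a t s <= 1).
  { apply bd; [contb|]; intros x hx; specialize (wt x hx); specialize (b s x hs).
    replace (rpow x a * (bfun a s x * bfun a t x ^ 2)) with (rpow x a * bfun a t x ^ 2 * bfun a s x) by ring.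
    nra. }
  assert (bFd : 0 <= Fd a s' <= 1) by (split; [apply Rlt_le, Fd_gt0|apply Fd_le1]; lra).
  assert (bF : 0 <= F a s <= 1) by (apply bd; [intros; apply cont_bfun; lra|intros; now apply b]).
  assert (bA : 0 <= A2 a t s' <= 1).
  { apply bd; [contb|]; intros x hx; specialize (wt2 x hx); specialize (b s' x hs').
    replace (rpow x a ^ 2 * (bfun a s' x ^ 2 * bfun a t x ^ 2)) with
      (rpow x a ^ 2 * bfun a t x ^ 2 * (bfun a s' x ^ 2)) by ring.
    assert (0 <= bfun a s' x ^ 2 <= 1) by (simpl; nra); nra. }
  unfold Hj.
  replace (2 * N1 a t s' * Fd a s' - F a s' * A2 a t s' - (2 * N1 a t s * Fd a s - F a s * A2 a t s))
    with (2 * Fd a s' * (N1 a t s' - N1 a t s) + 2 * N1 a t s * (Fd a s' - Fd a s)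
          - (A2 a t s' * (F a s' - F a s) + F a s * (A2 a t s' - A2 a t s))) by ring.
  assert (T : forall w u d k, 0 <= w <= k -> Rabs u <= d -> - (k * d) <= w * u <= k * d).
  { intros w u d k hw hu; apply Rabs_le_between; rewrite Rabs_mult, Rabs_pos_eq by lra.
    assert (h := Rabs_pos u); nra. }
  assert (t1 := T (2 * Fd a s') _ _ 2 ltac:(lra) dN).
  assert (t2 := T (2 * N1 a t s) _ _ 2 ltac:(lra) dFd).
  assert (t3 := T (A2 a t s') _ _ 1 ltac:(lra) dF).
  assert (t4 := T (F a s) _ _ 1 ltac:(lra) dA).
  apply Rabs_le; lra.
Qed.

Lemma continuous_lip_pos (f : R -> R) (C x : R) : 0 < x -> 0 < C ->
  (forall y, 0 < y -> Rabs (f y - f x) <= C * Rabs (y - x)) -> continuous f x.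
Proof.
  intros hx hC h; apply continuity_pt_filterlim; intros e he.
  exists (Rmin x (e / C)); split; [apply Rmin_pos; [easy|now apply Rdiv_lt_0_compat]|].
  intros y [_ hy]; unfold R_met in *; simpl in *; unfold R_dist in *.
  assert (h1 := Rlt_le_trans _ _ _ hy (Rmin_l _ _)).
  assert (h2 := Rlt_le_trans _ _ _ hy (Rmin_r _ _)).
  eapply Rle_lt_trans; [apply h; apply Rabs_def2 in h1; lra|].
  apply (Rlt_div_r _ _ C) in h2; [lra|easy].
Qed.

Lemma continuous_Hj (a t s : R) : 1 < a -> 0 <= t -> 0 < s -> continuous (Hj a t) s.
Proof.
  intros; apply continuous_lip_pos with 9; [easy|lra|].
  intros; apply Hj_lip; lra.
Qed.

(** At [s = 0] the weights are pure powers, with Fd = 1 / (a + 1) and B2 = 1 / (2 a + 1), so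
    [chebyshev] gives A2 < A1 (a + 1) / (2 a + 1). This bound is at most 2 A1 / (a + 1) exactly when
    a^2 - 2 a - 1 <= 0. *)
Lemma Hj_0_pos (a t : R) : 1 < a <= 1 + sqrt 2 -> 0 < t -> 0 < Hj a t 0.
Proof.
  intros ha ht.
  assert (b0 : forall x, bfun a 0 x = 1) by (intros; unfold bfun; field; lra).
  assert (e1 : Fd a 0 = / (a + 1)).
  { unfold Fd; rewrite (RInt_ext _ (fun x => rpow x a)) by (intros; rewrite b0; toR; ring).
    rewrite RInt_rpow, rpow_1_l by lra; field; lra. }
  assert (e2 : B2 a 0 = / (2 * a + 1)).
  { unfold B2; rewrite (RInt_ext _ (fun x => rpow x (2 * a)))
      by (intros; rewrite b0, rpow_double; toR; ring).
    rewrite RInt_rpow, rpow_1_l by lra; field; lra. }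
  assert (C := chebyshev a t 0 ltac:(lra) ht ltac:(lra)); rewrite e1, e2 in C.
  assert (a1 := A1_gt0 a t 0 ltac:(lra) ltac:(lra) ltac:(lra)).
  unfold Hj; rewrite F_0, e1, N1_split, Rmult_0_l, Rplus_0_r, Rmult_1_l by lra.
  assert (hq : (a + 1) ^ 2 <= 2 * (2 * a + 1)).
  { assert (hs := sqrt_sqrt 2 ltac:(lra)).
    assert (0 <= (1 + sqrt 2 - a) * (a - 1 + sqrt 2)).
    { apply Rmult_le_pos; [lra|assert (h := sqrt_pos 2); lra]. }
    nra. }
  apply Rmult_lt_reg_r with (/ (a + 1)); [apply Rinv_0_lt_compat; lra|].
  rewrite Rmult_0_l, Rmult_minus_distr_r.
  assert (A1 a t 0 * / (2 * a + 1) <= 2 * A1 a t 0 * / (a + 1) * / (a + 1)); [|lra].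
  apply Rmult_le_reg_r with ((2 * a + 1) * (a + 1) ^ 2);
    [apply Rmult_lt_0_compat; [lra|apply pow_lt; lra]|].
  replace (A1 a t 0 * / (2 * a + 1) * ((2 * a + 1) * (a + 1) ^ 2)) with (A1 a t 0 * (a + 1) ^ 2)
    by (field; lra).
  replace (2 * A1 a t 0 * / (a + 1) * / (a + 1) * ((2 * a + 1) * (a + 1) ^ 2))
    with (A1 a t 0 * (2 * (2 * a + 1))) by (field; lra).
  apply Rmult_le_compat_l; lra.
Qed.

(** [F_parts] gives F / Fd > a s, hence s Jext <= 2 s A1 - (a - 2) s^2 A2. The first term is at most
    2 F, which tends to 0, while s^2 A2 stays above a positive constant. *)
Lemma Jext_neg_large (a t : R) : 2 < a -> 0 < t ->
  exists S, 0 < S /\ forall s, S <= s -> Jext a t s < 0.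
Proof.
  intros ha ht.
  set (h := rpow (1/2) a).
  assert (hh : 0 < h) by (apply rpow_gt0; lra).
  (* From x in [1/2, 1] alone, [A2] is at least ka / (1 + s)^2; and s / (1 + s) >= 1/2 for
     [s >= 1]. *)
  set (ka := / 2 * (h ^ 2 * (/ (1 + t)) ^ 2)).
  assert (hka : 0 < ka) by (unfold ka; pos).
  destruct (F_small a ((a - 2) * ka / 8)) as [S [hS hF]]; [lra|pos; apply Rmult_lt_0_compat; lra|].
  exists (Rmax 1 S); split; [assert (q := Rmax_l 1 S); lra|].
  intros s hs; assert (q1 := Rmax_l 1 S); assert (q2 := Rmax_r 1 S).
  assert (f1 := hF s ltac:(lra)).
  assert (f0 := F_gt0 a s ltac:(lra) ltac:(lra)).
  assert (g0 := Fd_gt0 a s ltac:(lra) ltac:(lra)).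
  assert (P := F_parts a s ltac:(lra) ltac:(lra)).
  assert (a2 := A2_gt0 a t s ltac:(lra) ltac:(lra) ltac:(lra)).
  assert (hb : 0 < / (1 + s)) by (apply Rinv_0_lt_compat; lra).
  assert (FF : a * s < F a s / Fd a s) by (apply (Rlt_div_r _ _ (Fd a s)); lra).
  assert (U1 : s * A1 a t s <= F a s).
  { rewrite F_bfun; unfold A1; rewrite <- RInt_scal_R by (apply ex_RInt_cont; contb).
    apply RInt_le01; [contb|contb|]; intros x hx.
    assert (e := bfun_eq a s x ltac:(lra)).
    assert (h1 := bfun_pos a s x ltac:(lra)); assert (h2 := bfun_pos a t x ltac:(lra)).
    assert (h3 := bfun_le1 a t x ltac:(lra)).
    assert (0 <= bfun a t x ^ 2 <= 1) by (simpl; nra).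
    assert (0 <= s * rpow x a * bfun a s x <= 1).
    { split; [apply Rmult_le_pos; [pos|lra]|lra]. }
    replace (s * (rpow x a * (bfun a s x ^ 2 * bfun a t x ^ 2))) with
      ((s * rpow x a * bfun a s x) * bfun a t x ^ 2 * bfun a s x) by ring.
    assert (0 <= s * rpow x a * bfun a s x * bfun a t x ^ 2 <= 1) by nra; nra. }
  assert (U2 : ka * (/ (1 + s)) ^ 2 <= A2 a t s).
  { unfold A2; rewrite (RInt_Chasles_R _ 0 (1/2) 1) by (apply ex_RInt_cont; contb).
    assert (0 <= RInt (fun x => rpow x a ^ 2 * (bfun a s x ^ 2 * bfun a t x ^ 2)) 0 (1/2)).
    { apply RInt_ge_0; [lra|apply ex_RInt_cont; contb|intros].
      apply Rmult_le_pos; [|apply Rmult_le_pos]; apply pow2_ge_0. }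
    assert (RInt (fun _ => h ^ 2 * ((/ (1 + s)) ^ 2 * (/ (1 + t)) ^ 2)) (1/2) 1 <=
      RInt (fun x => rpow x a ^ 2 * (bfun a s x ^ 2 * bfun a t x ^ 2)) (1/2) 1).
    { apply RInt_le; [lra|apply ex_RInt_cont; cont|apply ex_RInt_cont; contb|].
      intros x hx; assert (h1 := rpow_le a (1/2) x ltac:(lra) ltac:(lra)); fold h in h1.
      assert (h2 := rpow_le1 a x ltac:(lra) ltac:(lra)).
      assert (L : forall q, 0 < q -> / (1 + q) <= bfun a q x).
      { intros q hq; apply Rinv_le_contravar; [apply den_pos; lra|nra]. }
      apply Rmult_le_compat.
      - apply pow2_ge_0.
      - apply Rmult_le_pos; apply pow2_ge_0.
      - apply pow_incr; lra.
      - apply Rmult_le_compat; try apply pow2_ge_0; apply pow_incr; split; try (apply L; lra).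
        + lra.
        + apply Rlt_le, Rinv_0_lt_compat; lra. }
    rewrite RInt_const_R in H0; unfold ka; lra. }
  unfold Jext; rewrite N1_split by lra.
  assert (s * (2 * (A1 a t s + s * A2 a t s) - F a s / Fd a s * A2 a t s) < 0); [|nra].
  assert (F a s / Fd a s * A2 a t s >= a * s * A2 a t s) by nra.
  assert (V : ka / 4 <= s * s * A2 a t s).
  { apply Rle_trans with (s * s * (ka * (/ (1 + s)) ^ 2)).
    - replace (s * s * (ka * (/ (1 + s)) ^ 2)) with (ka * (s * / (1 + s)) ^ 2) by ring.
      assert (/ 2 <= s * / (1 + s)).
      { apply (Rle_div_r _ s (1 + s)); lra. }
      assert (/ 4 <= (s * / (1 + s)) ^ 2) by (simpl; nra); nra.
    - apply Rmult_le_compat_l; [nra|easy]. }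
  assert ((a - 2) * (ka / 4) <= (a - 2) * (s * s * A2 a t s)) by (apply Rmult_le_compat_l; lra).
  assert (s * (F a s / Fd a s * A2 a t s) >= s * (a * s * A2 a t s)) by nra.
  nra.
Qed.

Lemma Jext_sign_change (a t : R) : 2 < a <= 1 + sqrt 2 -> 0 < t ->
  exists sc, 0 < sc /\ Jext a t sc = 0 /\
    (forall s, 0 < s < sc -> 0 < Jext a t s) /\ (forall s, sc < s -> Jext a t s < 0).
Proof.
  intros ha ht.
  assert (H0 := Hj_0_pos a t ltac:(lra) ht).
  (* Any divisor above the Lipschitz constant 9 keeps [Hj] positive on (0, d]. *)
  set (d := Hj a t 0 / 10).
  assert (hd : forall s, 0 < s <= d -> 0 < Hj a t s).
  { intros s hs; assert (l := Hj_lip a t 0 s ltac:(lra) ltac:(lra) ltac:(lra) ltac:(lra)).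
    rewrite Rminus_0_r, (Rabs_pos_eq s) in l by lra.
    apply Rabs_le_between in l; unfold d in hs; lra. }
  assert (hd0 : 0 < d) by (unfold d; lra).
  assert (sg : forall s, 0 <= s -> (0 < Hj a t s <-> 0 < Jext a t s) /\ (Hj a t s < 0 <-> Jext a t s < 0)
      /\ (Hj a t s = 0 <-> Jext a t s = 0)).
  { intros s hs; rewrite Hj_eq by lra; assert (g := Fd_gt0 a s ltac:(lra) hs).
    repeat split; intros; nra. }
  destruct (Jext_neg_large a t) as [S [hS hneg]]; [lra|easy|].
  set (S' := Rmax S d).
  destruct (IVT_zero (Hj a t) d S') as [sc [hsc e]].
  - apply Rmax_r.
  - intros; apply continuous_Hj; lra.
  - split; [apply Rlt_le, sg; [|apply hneg]|apply Rlt_le, hd; lra].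
    + unfold S'; assert (q := Rmax_r S d); lra.
    + apply Rmax_l.
  (* Two distinct zeros would each be a strict global maximum point of N1 / F^2, giving opposite
     strict inequalities. *)
  - assert (uniq : forall s, 0 < s -> Jext a t s = 0 -> s = sc).
    { intros s hs h; destruct (Req_dec s sc) as [|hne]; [easy|exfalso].
      assert (hc : Jext a t sc = 0) by (apply sg; lra).
      assert (h1 := Jext_zero_strict_max a t sc s ltac:(lra) ht ltac:(lra) hs hne hc).
      assert (h2 := Jext_zero_strict_max a t s sc ltac:(lra) ht hs ltac:(lra) ltac:(lra) h).
      lra. }
    exists sc; split; [lra|]; split; [apply sg; lra|]; split.
    + intros s hs; apply sg; [lra|]; apply Rnot_le_lt; intros hle.
      destruct (Rle_dec s d) as [h|h]; [assert (h' := hd s ltac:(lra)); lra|].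
      destruct (IVT_zero (Hj a t) d s) as [z [hz ez]]; [lra|intros; apply continuous_Hj; lra| |].
      * split; [easy|apply Rlt_le, hd; lra].
      * assert (z = sc); [|lra].
        apply uniq; [lra|apply sg; lra].
    + intros s hs; apply sg; [lra|]; apply Rnot_le_lt; intros hle.
      set (T := Rmax S s).
      assert (hT : S <= T /\ s <= T) by (split; [apply Rmax_l|apply Rmax_r]).
      destruct (IVT_zero (Hj a t) s T) as [z [hz ez]]; [lra|intros; apply continuous_Hj; lra| |].
      * split; [|lra]; apply Rlt_le, sg; [lra|apply hneg; lra].
      * assert (z = sc); [|lra].
        apply uniq; [lra|apply sg; lra].
Qed.

(** Every ratio is realised by some sequence of sample sizes, so [critical_ratio] is never vacuous
    at a ratio; the uniqueness of the critical ratio rests on this. *)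
Lemma floor_sizes (phim : R) : 1 < phim -> exists m : nat -> nat, student_sizes m phim.
Proof.
  intros hp; exists (fun p => Z.to_nat (up (INR p / phim))).
  set (m := fun p => Z.to_nat (up (INR p / phim))).
  assert (b : forall p, INR p / phim < INR (m p) <= INR p / phim + 1).
  { intros p; unfold m; assert (h := archimed (INR p / phim)).
    assert (0 <= INR p / phim) by (apply Rle_mult_inv_pos; [apply pos_INR|lra]).
    rewrite (INR_IZR_INZ (Z.to_nat _)), Z2Nat.id; [lra|apply le_IZR; lra]. }
  assert (l1 : is_lim_seq (fun p => INR p / phim) p_infty).
  { apply is_lim_seq_ext with (fun p => / phim * INR p); [intros; unfold Rdiv; ring|].
    assert (h := is_lim_seq_scal_l INR (/ phim) p_infty is_lim_seq_INR).
    assert (hp' : 0 < / phim) by (apply Rinv_0_lt_compat; lra).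
    replace p_infty with (Rbar_mult (/ phim) p_infty); [easy|].
    simpl; case Rle_dec; intros; [|lra]; case Rle_lt_or_eq_dec; intros; [easy|lra]. }
  split.
  - apply is_lim_seq_le_p_loc with (fun p => INR p / phim); [|easy].
    exists 0%nat; intros p _; apply Rlt_le, b.
  - assert (l2 : is_lim_seq (fun p => INR (m p) / INR p) (/ phim)).
    { apply is_lim_seq_ext with (fun p => / phim + (INR (m p) / INR p - / phim)); [intros; ring|].
      replace (Finite (/ phim)) with (Finite (/ phim + 0)) by (f_equal; ring).
      apply is_lim_seq_plus'; [apply is_lim_seq_const|].
      apply is_lim_seq_Rabs_0 with (fun p => / INR p); [|apply is_lim_seq_inv_INR].
      exists 1%nat; intros p hp1; specialize (b p).
      assert (h0 : 0 < INR p) by (apply lt_0_INR; lia).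
      replace (INR (m p) / INR p - / phim) with ((INR (m p) - INR p / phim) * / INR p) by (field; lra).
      assert (0 < / INR p) by now apply Rinv_0_lt_compat.
      rewrite Rabs_mult, !Rabs_pos_eq by lra; nra. }
    apply is_lim_seq_ext with (fun p => / (INR (m p) / INR p)).
    + intros p; unfold Rdiv; rewrite Rinv_mult, Rinv_inv; ring.
    + rewrite <- (Rinv_inv phim); apply (is_lim_seq_inv _ (Finite (/ phim))); [easy|].
      intros h; injection h; apply Rinv_neq_0_compat; lra.
Qed.

(** * The statements for the proportional regime *)

Lemma scale_pos (a sigma2 phin phim : R) : 1 < a -> 0 < sigma2 -> 1 < phin -> 1 < phim ->
  forall v, (0 < sigma2 * phin / (1 - gamma_T a phin) * (s_T a phim * v) <-> 0 < v).
Proof.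
  intros ha hs hn hm v.
  assert (g := gamma_T_bounds a phin ltac:(lra) hn).
  destruct (s_T_spec a phim ltac:(lra) hm) as [h _].
  assert (0 < sigma2 * phin / (1 - gamma_T a phin) * s_T a phim).
  { apply Rmult_lt_0_compat; [apply Rdiv_lt_0_compat; [apply Rmult_lt_0_compat|]; lra|easy]. }
  rewrite <- Rmult_assoc; split; intros; [nra|now apply Rmult_lt_0_compat].
Qed.

Lemma proportional_gain_pos (alpha phin : R) : 1 < alpha <= 2 -> 1 < phin ->
  forall (sigma2 : R) (n m : nat -> nat) (phim : R),
    0 < sigma2 -> teacher_sizes n phin -> 1 < phim -> student_sizes m phim ->
    exists L : R, is_lim_seq (fun p => W2SG_p alpha sigma2 p (n p) (m p)) L /\ 0 < L.
Proof.
  intros ha hn sigma2 n m phim hs ht hm hst.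
  eexists; split; [apply (proportional_limit alpha sigma2 phin phim); easy || lra|].
  apply scale_pos; try lra.
  destruct (s_T_spec alpha phim ltac:(lra) hm) as [h _].
  rewrite J_eq by lra; apply Jext_pos_le2; [easy|apply s_T_spec; lra|easy].
Qed.

Lemma proportional_critical (alpha phin : R) : 2 < alpha <= 1 + sqrt 2 -> 1 < phin ->
  forall sigma2 : R, 0 < sigma2 ->
  exists phi_crit : R,
    1 < phi_crit /\
    (exists s_crit : R,
      unique (fun s => 0 < s /\ J alpha phin s = 0) s_crit /\
      phi_crit = / F alpha s_crit) /\
    (forall n : nat -> nat, teacher_sizes n phin ->
      unique (critical_ratio alpha sigma2 n) phi_crit).
Proof.
  intros ha hn sigma2 hs.
  destruct (s_T_spec alpha phin ltac:(lra) hn) as [hT _].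
  destruct (Jext_sign_change alpha (s_T alpha phin) ha hT) as [sc [hsc [e0 [hpos hneg]]]].
  assert (f0 := F_gt0 alpha sc ltac:(lra) ltac:(lra)).
  assert (f1 := F_lt1 alpha sc ltac:(lra) ltac:(lra)).
  assert (hphi : 1 < / F alpha sc) by (rewrite <- Rinv_1 at 1; apply Rinv_lt_contravar; lra).
  exists (/ F alpha sc); split; [easy|]; split.
  - exists sc; split; [|reflexivity]; split.
    + split; [easy|rewrite J_eq; lra].
    + intros s [h e]; rewrite J_eq in e by lra.
      destruct (Rtotal_order s sc) as [h'|[h'|h']]; [|easy|].
      * assert (q := hpos s ltac:(lra)); lra.
      * assert (q := hneg s ltac:(lra)); lra.
  - intros n ht.
    assert (sgn : forall phim, 1 < phim -> (0 < J alpha phin (s_T alpha phim) <-> phim < / F alpha sc)).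
    { intros phim hm; destruct (s_T_spec alpha phim ltac:(lra) hm) as [h1 h2].
      rewrite J_eq by lra.
      destruct (Rtotal_order (s_T alpha phim) sc) as [h|[h|h]].
      - assert (q := hpos _ (conj h1 h)); split; [intros _|easy].
        assert (d := F_decr alpha (s_T alpha phim) sc ltac:(lra) ltac:(lra)).
        rewrite <- (Rinv_inv phim), <- h2; apply Rinv_lt_contravar; [apply Rmult_lt_0_compat; lra|easy].
      - rewrite h, e0; rewrite h in h2; split; [lra|].
        rewrite h2, Rinv_inv; lra.
      - assert (q := hneg _ h); split; [lra|intros h'].
        assert (d := F_decr alpha sc (s_T alpha phim) ltac:(lra) ltac:(lra)).
        rewrite h2 in d; apply Rinv_lt_contravar in d; [rewrite Rinv_inv in d; lra|].
        apply Rmult_lt_0_compat; [apply Rinv_0_lt_compat; lra|easy]. }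
    assert (cr : critical_ratio alpha sigma2 n (/ F alpha sc)).
    { split; [easy|]; intros m phim hm hst.
      eexists; exists (/ phim); split; [apply (proportional_limit alpha sigma2 phin phim); easy || lra|].
      destruct hst as [h1 h2]; split.
      - apply ratio_inv_limit; [easy| |easy].
        apply is_lim_seq_spec in h1; specialize (h1 0); revert h1; apply filter_imp.
        intros p h; destruct (m p); [simpl in h; lra|lia].
      - rewrite scale_pos, sgn by lra; split; [easy|].
        rewrite Rinv_inv; split; intros h.
        + apply Rinv_lt_contravar in h; [rewrite Rinv_inv in h; easy|].
          apply Rmult_lt_0_compat; lra.
        + apply Rinv_lt_contravar in h; [rewrite Rinv_inv in h; easy|].
          apply Rmult_lt_0_compat; [easy|apply Rinv_0_lt_compat; lra]. }
    split; [easy|]; intros c [hc1 hc2].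
    (* Along a common sequence the limit [L] is the same for both candidates, so they separate the
       same ratios; testing at the smaller candidate excludes a strict inequality. *)
    assert (sep : forall phim, 1 < phim -> (phim < / F alpha sc <-> phim < c)).
    { intros phim hm; destruct (floor_sizes phim hm) as [m hst].
      destruct cr as [_ cr].
      destruct (cr m phim hm hst) as [L [r [l1 [_ [i1 _]]]]].
      destruct (hc2 m phim hm hst) as [L' [r' [l2 [_ [i2 _]]]]].
      assert (e : Finite L = Finite L').
      { rewrite <- (is_lim_seq_unique _ _ l1); apply is_lim_seq_unique, l2. }
      injection e as e; subst L'; tauto. }
    destruct (Rtotal_order (/ F alpha sc) c) as [h|[h|h]]; [|easy|].
    + apply sep in h; lra.
    + apply sep in h; lra.
Qed.

(** * Power-law series *)

Lemma is_series_ssum (f : nat -> R) (l : R) :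
  is_series (fun k => f (S k)) l <-> is_lim_seq (ssum f) l.
Proof.
  assert (e : forall n, sum_n (fun k => f (S k)) n = ssum f (S n)).
  { intros n; unfold sum_n, ssum; apply (sum_n_m_S f 0 n). }
  split; intros h.
  - apply is_lim_seq_incr_1, is_lim_seq_ext with (sum_n (fun k => f (S k))); [exact e|exact h].
  - apply is_lim_seq_incr_1 in h; apply is_lim_seq_ext with (2 := h); intros; now rewrite e.
Qed.

Lemma ex_series_bounded (f : nat -> R) (M : R) : (forall k, 0 <= f (S k)) ->
  (forall p, ssum f p <= M) -> ex_series (fun k => f (S k)).
Proof.
  intros h0 hM.
  destruct (ex_finite_lim_seq_incr (ssum f) M) as [l hl]; [|easy|].
  - intros n; rewrite ssum_S; specialize (h0 n); lra.
  - exists l; now apply is_series_ssum.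
Qed.

Lemma Series_ge0 (f : nat -> R) : (forall k, 0 <= f k) -> ex_series f -> 0 <= Series f.
Proof.
  intros h0 hf; replace 0 with (Series (fun k => 0 * f k)) by (rewrite Series_scal_l; ring).
  apply Series_le; [|easy]; intros k; specialize (h0 k); lra.
Qed.

Lemma Series_gt0 (f : nat -> R) : (forall k, 0 <= f k) -> 0 < f 0%nat -> ex_series f -> 0 < Series f.
Proof.
  intros h0 h hf; rewrite Series_incr_1 by easy.
  assert (0 <= Series (fun k => f (S k))); [|lra].
  apply Series_ge0; [easy|]; now apply (ex_series_incr_1 f).
Qed.

Lemma Series_limit_le (f : nat -> R) (M : R) : ex_series (fun k => f (S k)) ->
  (forall p, ssum f p <= M) -> Series (fun k => f (S k)) <= M.
Proof.
  intros hf hM; apply Series_correct, is_series_ssum in hf.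
  assert (h := is_lim_seq_le (ssum f) (fun _ => M) _ _ hM hf (is_lim_seq_const M)).
  exact h.
Qed.

Lemma ssum_le_Series (f : nat -> R) (p : nat) : (forall k, 0 <= f (S k)) ->
  ex_series (fun k => f (S k)) -> ssum f p <= Series (fun k => f (S k)).
Proof.
  intros h0 hf; apply Series_correct, is_series_ssum in hf.
  apply (is_lim_seq_incr_compare _ _ hf).
  intros n; rewrite ssum_S; specialize (h0 n); lra.
Qed.

(** Truncation at [X] of the integral that defines [C_alpha]. *)
Definition Iint (a X : R) : R := RInt (bfun a 1) 0 X.

Lemma Iint_incr (a X Y : R) : 0 < a -> X <= Y -> Iint a X <= Iint a Y.
Proof.
  intros ha h; unfold Iint; rewrite (RInt_Chasles_R _ 0 X Y) by (apply ex_RInt_cont; contb).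
  assert (0 <= RInt (bfun a 1) X Y); [|lra].
  apply RInt_ge_0; [easy|apply ex_RInt_cont; contb|intros; apply Rlt_le, bfun_pos; lra].
Qed.

Lemma Iint_bounded (a X : R) : 1 < a -> Iint a X <= 1 + / (a - 1).
Proof.
  intros ha; apply Rle_trans with (Iint a (Rmax 1 X)); [apply Iint_incr; [lra|apply Rmax_r]|].
  set (Y := Rmax 1 X); assert (hY : 1 <= Y) by apply Rmax_l.
  unfold Iint; rewrite (RInt_Chasles_R _ 0 1 Y) by (apply ex_RInt_cont; contb).
  assert (h1 : RInt (bfun a 1) 0 1 <= 1).
  { apply Rabs_le_between, RInt_abs01; [contb|]; intros x hx.
    assert (h := bfun_pos a 1 x ltac:(lra)); assert (h' := bfun_le1 a 1 x ltac:(lra)).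
    rewrite Rabs_pos_eq; lra. }
  assert (e : is_RInt (fun x => rpow x (- a)) 1 Y
     (minus (- / (a - 1) * rpow Y (1 - a)) (- / (a - 1) * rpow 1 (1 - a)))).
  { apply (is_RInt_derive (fun x => - / (a - 1) * rpow x (1 - a))).
    - rewrite Rmin_left, Rmax_right by easy; intros x hx; evar_last.
      + apply (is_derive_scal (fun x => rpow x (1 - a))), is_derive_rpow_pos; lra.
      + change (- / (a - 1) * ((1 - a) * rpow x (1 - a - 1)) = rpow x (- a)).
        replace (1 - a - 1) with (- a) by ring; field; lra.
    - rewrite Rmin_left, Rmax_right by easy; intros x hx.
      apply (ex_derive_continuous (K:=R_AbsRing) (V:=R_NormedModule)); eexists.
      apply is_derive_rpow_pos; lra. }
  assert (h2 : RInt (bfun a 1) 1 Y <= RInt (fun x => rpow x (- a)) 1 Y).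
  { apply RInt_le; [easy|apply ex_RInt_cont; contb|eexists; apply e|].
    intros x hx; unfold bfun; rewrite Rmult_1_l.
    assert (h := rpow_gt0 x a ltac:(lra)).
    replace (rpow x (- a)) with (/ rpow x a).
    - apply Rinv_le_contravar; lra.
    - rewrite !rpow_pos by lra; now rewrite Rpower_Ropp. }
  rewrite (is_RInt_unique _ _ _ _ e) in h2.
  unfold minus, plus, opp in h2; simpl in h2; rewrite rpow_1_l in h2.
  assert (h3 := rpow_ge0 Y (1 - a)).
  assert (0 < / (a - 1)) by (apply Rinv_0_lt_compat; lra).
  assert (0 <= / (a - 1) * rpow Y (1 - a)) by (apply Rmult_le_pos; lra).
  lra.
Qed.

Lemma Iint_limit (a : R) : 1 < a -> exists C, 0 < C /\ (forall X, Iint a X <= C) /\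
  (forall e, 0 < e -> exists X0, forall X, X0 <= X -> C - e < Iint a X) .
Proof.
  intros ha.
  destruct (completeness (fun y => exists X, y = Iint a X)) as [C [h1 h2]].
  - exists (1 + / (a - 1)); intros y [X ->]; now apply Iint_bounded.
  - now exists (Iint a 0), 0.
  - exists C; split; [|split].
    + apply Rlt_le_trans with (Iint a 1); [apply (F_gt0 a 1); lra|apply h1; now exists 1].
    + intros X; apply h1; now exists X.
    + intros e he.
      destruct (Classical_Prop.classic (exists X0, C - e < Iint a X0)) as [[X0 h]|h].
      * exists X0; intros X hX; eapply Rlt_le_trans; [apply h|]; apply Iint_incr; lra.
      * exfalso; assert (C <= C - e); [|lra].
        apply h2; intros y [X ->]; apply Rnot_lt_le; intros h'; apply h; now exists X.
Qed.

Lemma C_alpha_spec (a : R) : 1 < a -> 0 < C_alpha a /\ (forall X, Iint a X <= C_alpha a) /\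
  (forall e, 0 < e -> exists X0, forall X, X0 <= X -> C_alpha a - e < Iint a X).
Proof.
  intros ha; destruct (Iint_limit a ha) as [C [hC [h1 h2]]].
  assert (e : C_alpha a = C); [|now rewrite e].
  unfold C_alpha; apply is_RInt_gen_unique.
  intros P [e hP].
  destruct (h2 e (cond_pos e)) as [X0 h].
  apply (Filter_prod _ _ _ (fun x => x = 0) (fun X => X0 < X)); [reflexivity|now exists X0|].
  intros x X -> hX; exists (Iint a X); split.
  - apply is_RInt_ext with (bfun a 1); [intros; unfold bfun; now rewrite Rmult_1_l|].
    apply is_RInt_cont; contb.
  - apply hP; unfold ball; simpl; unfold AbsRing_ball, abs, minus, plus, opp; simpl.
    specialize (h X ltac:(lra)); specialize (h1 X); assert (h0 := cond_pos e).
    apply Rabs_def1; lra.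
Qed.

Lemma RInt_bfun_scale (a t X : R) : 0 < a -> 0 < t -> 0 <= X ->
  RInt (bfun a t) 0 X = rpow t (- / a) * Iint a (rpow t (/ a) * X).
Proof.
  intros ha ht hX; unfold Iint.
  set (u := rpow t (/ a)); assert (hu : 0 < u) by now apply rpow_gt0.
  assert (hi : rpow t (- / a) * u = 1).
  { unfold u; rewrite <- rpow_plus, Rplus_opp_l, rpow_pos, Rpower_O; lra. }
  assert (hua : rpow u a = t).
  { unfold u; rewrite (rpow_pos _ a) by now apply rpow_gt0.
    rewrite rpow_pos, Rpower_mult, Rinv_l, Rpower_1; lra. }
  assert (h := RInt_scale (bfun a 1) u 0 X); rewrite Rmult_0_r in h.
  rewrite <- h by (apply ex_RInt_cont; contb).
  rewrite <- Rmult_assoc, hi, Rmult_1_l; apply RInt_ext; intros x hx.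
  rewrite Rmin_left, Rmax_right in hx by easy.
  unfold bfun; rewrite rpow_mult_l, hua by lra; toR; f_equal; ring.
Qed.

Lemma bfun_decr_x (a t x z : R) : 0 < a -> 0 <= t -> x <= z -> bfun a t z <= bfun a t x.
Proof.
  intros ha ht h; apply Rinv_le_contravar; [now apply den_pos|].
  assert (h' := rpow_le a x z ltac:(lra) h); nra.
Qed.

Lemma bsum_le (a t : R) (p : nat) : 1 < a -> 0 < t ->
  bsum a p t <= rpow t (- / a) * C_alpha a.
Proof.
  intros ha ht.
  assert (h := ssum_sub_RInt_le (bfun a t) (fun _ => 0) p ltac:(contb)).
  rewrite RInt_bfun_scale in h by (try apply pos_INR; lra).
  destruct (C_alpha_spec a ha) as [_ [h1 _]].
  specialize (h1 (rpow t (/ a) * INR p)).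
  assert (h2 : ssum (fun i => bfun a t (INR i)) p
     - rpow t (- / a) * Iint a (rpow t (/ a) * INR p) <= 0 - 0).
  { apply h; intros i u hi hu.
    assert (q := bfun_decr_x a t u (INR (S i)) ltac:(lra) ltac:(lra) ltac:(lra)); lra. }
  assert (h3 := rpow_ge0 t (- / a)); unfold bsum; nra.
Qed.

(** For a decreasing summand the loss against the integral telescopes to b(0) - b(p), which is at
    most 1. *)
Lemma bsum_ge (a t : R) (p : nat) : 1 < a -> 0 < t ->
  rpow t (- / a) * Iint a (rpow t (/ a) * INR p) - 1 <= bsum a p t.
Proof.
  intros ha ht.
  assert (h := RInt_sub_ssum_le (bfun a t) (fun i => - bfun a t (INR i)) p ltac:(contb)).
  rewrite RInt_bfun_scale in h by (try apply pos_INR; lra).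
  assert (b0 := bfun_le1 a t (INR 0) ltac:(lra)); assert (bp := bfun_pos a t (INR p) ltac:(lra)).
  assert (h2 : rpow t (- / a) * Iint a (rpow t (/ a) * INR p) - ssum (fun i => bfun a t (INR i)) p
    <= - bfun a t (INR p) - - bfun a t (INR 0)).
  { apply h; intros i u hi hu.
    assert (q := bfun_decr_x a t (INR i) u ltac:(lra) ltac:(lra) ltac:(lra)); lra. }
  unfold bsum; lra.
Qed.

(** At t = tau_m these are m, m gamma_m and m eta_m for j = 1, 2, 3. Derivatives are taken in [t],
    where the series are explicit. *)
Definition Sj (a : R) (j : nat) (t : R) : R := Series (fun k => bfun a t (INR (S k)) ^ j).

Lemma ex_series_bfun (a t : R) : 1 < a -> 0 < t -> ex_series (fun k => bfun a t (INR (S k))).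
Proof.
  intros ha ht; apply (ex_series_bounded (fun i => bfun a t (INR i)) (rpow t (- / a) * C_alpha a)).
  - intros; apply Rlt_le, bfun_pos; lra.
  - intros; now apply bsum_le.
Qed.

Lemma ex_series_dom (f g : nat -> R) (M : R) : (forall k, Rabs (f k) <= M * g k) ->
  ex_series g -> ex_series f.
Proof.
  intros h hg; apply (ex_series_le f (fun k => M * g k)); [exact h|].
  apply (ex_series_scal_l M g hg).
Qed.

Lemma bfun_pow_le (a t x : R) (j : nat) : 0 <= t -> 0 <= bfun a t x ^ (S j) <= bfun a t x.
Proof.
  intros ht; assert (h1 := bfun_pos a t x ht); assert (h2 := bfun_le1 a t x ht).
  assert (0 <= bfun a t x ^ j) by (apply pow_le; lra).
  assert (bfun a t x ^ j <= 1) by (rewrite <- (pow1 j); apply pow_incr; lra).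
  simpl; nra.
Qed.

Lemma ex_series_bfun_pow (a t : R) (j : nat) : 1 < a -> 0 < t ->
  ex_series (fun k => bfun a t (INR (S k)) ^ (S j)).
Proof.
  intros ha ht; apply ex_series_dom with (fun k => bfun a t (INR (S k))) 1; [|now apply ex_series_bfun].
  intros k; assert (h := bfun_pow_le a t (INR (S k)) j ltac:(lra)); rewrite Rabs_pos_eq; lra.
Qed.

Lemma Sj_gt0 (a t : R) (j : nat) : 1 < a -> 0 < t -> 0 < Sj a (S j) t.
Proof.
  intros ha ht; apply Series_gt0; [| |now apply ex_series_bfun_pow].
  - intros; apply bfun_pow_le; lra.
  - apply pow_lt, bfun_pos; lra.
Qed.

Lemma Sj_decr (a t : R) (j : nat) : 1 < a -> 0 < t -> Sj a (S (S j)) t < Sj a (S j) t.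
Proof.
  intros ha ht; apply Rlt_0_minus; unfold Sj.
  rewrite <- Series_minus by now apply ex_series_bfun_pow.
  assert (e : forall k, bfun a t (INR (S k)) ^ S j - bfun a t (INR (S k)) ^ S (S j)
     = bfun a t (INR (S k)) ^ S j * (1 - bfun a t (INR (S k)))) by (intros; simpl; ring).
  assert (hp : forall k, 0 < bfun a t (INR (S k)) ^ S j * (1 - bfun a t (INR (S k)))).
  { intros k; apply Rmult_lt_0_compat; [apply pow_lt, bfun_pos; lra|].
    assert (h := bfun_lt1 a t (INR (S k)) ht (lt_0_INR _ (Nat.lt_0_succ k))); lra. }
  apply Series_gt0.
  - intros k; rewrite e; now apply Rlt_le.
  - rewrite e; apply hp.
  - apply (ex_series_minus (fun k => bfun a t (INR (S k)) ^ S j) (fun k => bfun a t (INR (S k)) ^ S (S j)));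
      now apply ex_series_bfun_pow.
Qed.

Lemma S1_le (a t : R) : 1 < a -> 0 < t -> Sj a 1 t <= rpow t (- / a) * C_alpha a.
Proof.
  intros ha ht.
  apply (Series_limit_le (fun i => bfun a t (INR i) ^ 1)); [now apply ex_series_bfun_pow|].
  intros p; rewrite (ssum_ext _ (fun i => bfun a t (INR i))) by (intros; ring).
  now apply bsum_le.
Qed.

Lemma bsum_le_S1 (a t : R) (p : nat) : 1 < a -> 0 < t -> bsum a p t <= Sj a 1 t.
Proof.
  intros ha ht; unfold bsum; rewrite (ssum_ext _ (fun i => bfun a t (INR i) ^ 1)) by (intros; ring).
  apply (ssum_le_Series (fun i => bfun a t (INR i) ^ 1)); [|now apply ex_series_bfun_pow].
  intros; apply bfun_pow_le; lra.
Qed.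

Lemma INR_unbounded_mult (u X : R) : 0 < u -> exists p, X <= u * INR p.
Proof.
  intros hu; destruct (INR_archimed u X hu) as [n hn]; exists n; lra.
Qed.

Lemma S1_ge (a t : R) : 1 < a -> 0 < t -> rpow t (- / a) * C_alpha a - 1 <= Sj a 1 t.
Proof.
  intros ha ht; apply Rnot_lt_le; intros hlt.
  destruct (C_alpha_spec a ha) as [_ [_ h]].
  assert (hq : 0 < rpow t (- / a)) by now apply rpow_gt0.
  set (e := (rpow t (- / a) * C_alpha a - 1 - Sj a 1 t) / rpow t (- / a)).
  destruct (h e) as [X0 hX]; [apply Rdiv_lt_0_compat; lra|].
  destruct (INR_unbounded_mult (rpow t (/ a)) X0) as [p hp]; [now apply rpow_gt0|].
  specialize (hX _ hp).
  assert (h1 := bsum_ge a t p ha ht); assert (h2 := bsum_le_S1 a t p ha ht).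
  assert (rpow t (- / a) * (C_alpha a - e) < rpow t (- / a) * Iint a (rpow t (/ a) * INR p))
    by now apply Rmult_lt_compat_l.
  assert (rpow t (- / a) * (C_alpha a - e) = 1 + Sj a 1 t) by (unfold e; field; lra).
  lra.
Qed.

Lemma t_y_b (a t x : R) : 0 < t -> 0 <= rpow x a * bfun a t x <= / t.
Proof.
  intros ht; assert (e := bfun_eq a t x ltac:(lra)); assert (h := bfun_pos a t x ltac:(lra)).
  assert (h' := rpow_ge0 x a); split; [pos|].
  apply Rmult_le_reg_l with t; [easy|]; rewrite Rinv_r by lra; lra.
Qed.

(** Termwise differentiation: a quadratic remainder with a common summable majorant [g] is summed
    and passed to [is_derive_quad]. *)
Lemma is_derive_series_quad (f : R -> nat -> R) (l g : nat -> R) (t C : R) :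
  0 < t -> 0 <= C -> ex_series g -> ex_series l -> (forall k, 0 <= g k) ->
  (forall t', t / 2 < t' -> ex_series (f t')) ->
  (forall t' k, t / 2 < t' -> Rabs (f t' k - f t k - (t' - t) * l k) <= C * (t' - t) ^ 2 * g k) ->
  is_derive (fun t => Series (f t)) t (Series l).
Proof.
  intros ht hC hg hl g0 hf h.
  apply is_derive_quad with (C * Series g); [easy| |].
  - apply Rmult_le_pos; [easy|now apply Series_ge0].
  - intros t' ht'.
    assert (ft := hf t ltac:(lra)); assert (ft' := hf t' ht').
    rewrite <- Series_scal_l, <- !Series_minus; try easy.
    + assert (hx : ex_series (fun k => Rabs (f t' k - f t k - (t' - t) * l k))).
      { apply ex_series_dom with g (C * (t' - t) ^ 2); [|easy].
        intros k; rewrite Rabs_Rabsolu; now apply h. }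
      eapply Rle_trans; [now apply Series_Rabs|].
      replace (C * Series g * (t' - t) ^ 2) with (C * (t' - t) ^ 2 * Series g) by ring.
      rewrite <- Series_scal_l; apply Series_le; [|now apply (ex_series_scal_l _ g)].
      intros k; split; [apply Rabs_pos|now apply h].
    + now apply (ex_series_minus (f t') (f t)).
    + now apply (ex_series_scal_l (t' - t) l).
Qed.

Lemma bfun_decr_t (a s t x : R) : 0 <= s <= t -> bfun a t x <= bfun a s x.
Proof.
  intros h; apply Rinv_le_contravar; [apply den_pos; lra|].
  assert (h' := rpow_ge0 x a); nra.
Qed.

(** Each term satisfies t b' = -(b - b^2). The remainder is (t' - t)^2 (x^a b_t)^2 b_{t'}, where x^a
    b_t <= 1 / t and b_{t'} is dominated by the summable b_{t/2}. *)
Lemma is_derive_S1 (a t : R) : 1 < a -> 0 < t ->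
  is_derive (Sj a 1) t (- (Sj a 1 t - Sj a 2 t) / t).
Proof.
  intros ha ht.
  set (l := fun k => - / t * (bfun a t (INR (S k)) ^ 1 - bfun a t (INR (S k)) ^ 2)).
  assert (e : Series l = - (Sj a 1 t - Sj a 2 t) / t).
  { unfold l; rewrite Series_scal_l, Series_minus by (now apply ex_series_bfun_pow).
    unfold Sj; field; lra. }
  rewrite <- e; apply (is_derive_series_quad (fun t k => bfun a t (INR (S k)) ^ 1) l
    (fun k => bfun a (t / 2) (INR (S k))) t (/ t * / t)); try easy.
  - pos.
  - apply ex_series_bfun; lra.
  - apply (ex_series_scal_l (- / t) (fun k => bfun a t (INR (S k)) ^ 1 - bfun a t (INR (S k)) ^ 2)),
      (ex_series_minus (fun k => bfun a t (INR (S k)) ^ 1) (fun k => bfun a t (INR (S k)) ^ 2));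
      now apply ex_series_bfun_pow.
  - intros; apply Rlt_le, bfun_pos; lra.
  - intros t' ht'; apply ex_series_bfun_pow; lra.
  - intros t' k ht'; unfold l; set (x := INR (S k)).
    assert (h1 := den_pos a t x ltac:(lra)); assert (h2 := den_pos a t' x ltac:(lra)).
    assert (e1 : bfun a t' x ^ 1 - bfun a t x ^ 1 - (t' - t) * (- / t * (bfun a t x ^ 1 - bfun a t x ^ 2))
      = (t' - t) ^ 2 * ((rpow x a * bfun a t x) * (rpow x a * bfun a t x) * bfun a t' x))
      by (unfold bfun; field; lra).
    rewrite e1.
    assert (h3 := t_y_b a t x ht); assert (h4 := bfun_pos a t' x ltac:(lra)).
    assert (h5 := bfun_decr_t a (t / 2) t' x ltac:(lra)).
    assert (h6 : 0 <= (t' - t) ^ 2) by apply pow2_ge_0.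
    assert (h7 : 0 <= rpow x a * bfun a t x * (rpow x a * bfun a t x) <= / t * / t).
    { split; [apply Rmult_le_pos; lra|apply Rmult_le_compat; lra]. }
    rewrite Rabs_pos_eq by (apply Rmult_le_pos; [easy|apply Rmult_le_pos; lra]).
    replace (/ t * / t * (t' - t) ^ 2 * bfun a (t / 2) x)
      with ((t' - t) ^ 2 * ((/ t * / t) * bfun a (t / 2) x)) by ring.
    apply Rmult_le_compat_l; [easy|].
    apply Rmult_le_compat; lra.
Qed.

Lemma is_derive_S2 (a t : R) : 1 < a -> 0 < t ->
  is_derive (Sj a 2) t (- (2 * (Sj a 2 t - Sj a 3 t)) / t).
Proof.
  intros ha ht.
  set (l := fun k => - (2 / t) * (bfun a t (INR (S k)) ^ 2 - bfun a t (INR (S k)) ^ 3)).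
  assert (e : Series l = - (2 * (Sj a 2 t - Sj a 3 t)) / t).
  { unfold l; rewrite Series_scal_l, Series_minus by (now apply ex_series_bfun_pow).
    unfold Sj; field; lra. }
  rewrite <- e; apply (is_derive_series_quad (fun t k => bfun a t (INR (S k)) ^ 2) l
    (fun k => bfun a (t / 2) (INR (S k))) t (3 * (/ t * / t))); try easy.
  - pos.
  - apply ex_series_bfun; lra.
  - apply (ex_series_scal_l (- (2 / t)) (fun k => bfun a t (INR (S k)) ^ 2 - bfun a t (INR (S k)) ^ 3)),
      (ex_series_minus (fun k => bfun a t (INR (S k)) ^ 2) (fun k => bfun a t (INR (S k)) ^ 3));
      now apply ex_series_bfun_pow.
  - intros; apply Rlt_le, bfun_pos; lra.
  - intros t' ht'; apply ex_series_bfun_pow; lra.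
  - intros t' k ht'; unfold l; set (x := INR (S k)).
    assert (h1 := den_pos a t x ltac:(lra)); assert (h2 := den_pos a t' x ltac:(lra)).
    assert (e1 : bfun a t' x ^ 2 - bfun a t x ^ 2 - (t' - t) * (- (2 / t) * (bfun a t x ^ 2 - bfun a t x ^ 3))
      = (t' - t) ^ 2 * ((rpow x a * bfun a t x) * (rpow x a * bfun a t x)
          * ((2 * bfun a t x + bfun a t' x) * bfun a t' x)))
      by (unfold bfun; field; lra).
    rewrite e1.
    assert (h3 := t_y_b a t x ht); assert (h4 := bfun_pos a t' x ltac:(lra)).
    assert (h5 := bfun_decr_t a (t / 2) t' x ltac:(lra)).
    assert (h8 := bfun_pos a t x ltac:(lra)); assert (h9 := bfun_le1 a t x ltac:(lra)).
    assert (h10 := bfun_le1 a t' x ltac:(lra)).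
    assert (h6 : 0 <= (t' - t) ^ 2) by apply pow2_ge_0.
    assert (h7 : 0 <= rpow x a * bfun a t x * (rpow x a * bfun a t x) <= / t * / t).
    { split; [apply Rmult_le_pos; lra|apply Rmult_le_compat; lra]. }
    assert (h11 : 0 <= (2 * bfun a t x + bfun a t' x) * bfun a t' x <= 3 * bfun a (t / 2) x).
    { split; [apply Rmult_le_pos; lra|apply Rmult_le_compat; lra]. }
    rewrite Rabs_pos_eq by (apply Rmult_le_pos; [easy|apply Rmult_le_pos; lra]).
    replace (3 * (/ t * / t) * (t' - t) ^ 2 * bfun a (t / 2) x)
      with ((t' - t) ^ 2 * ((/ t * / t) * (3 * bfun a (t / 2) x))) by ring.
    apply Rmult_le_compat_l; [easy|].
    apply Rmult_le_compat; lra.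
Qed.

(** * The parametrisation of m by tau *)

Lemma a_term_bfun (a t : R) (k : nat) : a_term a t k = bfun a t (INR (S k)).
Proof. unfold a_term, bfun; rewrite rpow_pos by apply lt_0_INR, Nat.lt_0_succ; reflexivity. Qed.

Lemma Sj_bfun_1 (a t : R) : Sj a 1 t = Series (fun k => bfun a t (INR (S k))).
Proof. apply Series_ext; intros; ring. Qed.

Lemma S1_decr (a s t : R) : 1 < a -> 0 < s < t -> Sj a 1 t < Sj a 1 s.
Proof.
  intros ha h.
  destruct (MVT_gen (Sj a 1) s t (fun t => - (Sj a 1 t - Sj a 2 t) / t)) as [c [hc e]].
  - rewrite Rmin_left, Rmax_right by lra; intros; apply is_derive_S1; lra.
  - rewrite Rmin_left, Rmax_right by lra; intros; apply continuous_continuity_pt.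
    apply (ex_derive_continuous (K:=R_AbsRing) (V:=R_NormedModule)); eexists.
    apply is_derive_S1; lra.
  - rewrite Rmin_left, Rmax_right in hc by lra.
    assert (d := Sj_decr a c 0 ha ltac:(lra)).
    assert (0 < (Sj a 1 c - Sj a 2 c) / c) by (apply Rdiv_lt_0_compat; lra).
    replace (- (Sj a 1 c - Sj a 2 c) / c) with (- ((Sj a 1 c - Sj a 2 c) / c)) in e by (field; lra).
    nra.
Qed.

Lemma continuous_Sj1 (a t : R) : 1 < a -> 0 < t -> continuous (Sj a 1) t.
Proof.
  intros; apply (ex_derive_continuous (K:=R_AbsRing) (V:=R_NormedModule)); eexists.
  now apply is_derive_S1.
Qed.

Lemma continuous_Sj2 (a t : R) : 1 < a -> 0 < t -> continuous (Sj a 2) t.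
Proof.
  intros; apply (ex_derive_continuous (K:=R_AbsRing) (V:=R_NormedModule)); eexists.
  now apply is_derive_S2.
Qed.

Lemma rpow_inv_exp (a v : R) : 0 < a -> 0 < v -> rpow (rpow v (- a)) (- / a) = v.
Proof.
  intros ha hv; rewrite (rpow_pos _ (- / a)) by now apply rpow_gt0.
  rewrite rpow_pos, Rpower_mult by easy.
  replace (- a * - / a) with 1 by (field; lra); now apply Rpower_1.
Qed.

Lemma rpow_neg_lt (b x y : R) : 0 < b -> 0 < x < y -> rpow y (- b) < rpow x (- b).
Proof.
  intros hb h; rewrite !rpow_pos, !Rpower_Ropp by lra; apply Rinv_lt_contravar.
  - apply Rmult_lt_0_compat; apply Rpower_pos.
  - apply Rlt_Rpower_l; lra.
Qed.

Lemma rpow_neg_le (b x y : R) : 0 < b -> 0 < x <= y -> rpow y (- b) <= rpow x (- b).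
Proof.
  intros hb h; destruct (Req_dec x y) as [->|]; [lra|].
  apply Rlt_le, rpow_neg_lt; lra.
Qed.

Lemma S1_surj (a m : R) : 1 < a -> 0 < m -> exists t, 0 < t /\ Sj a 1 t = m.
Proof.
  intros ha hm; destruct (C_alpha_spec a ha) as [hC _].
  (* Chosen so that t^(-1/a) C_alpha equals m + 1 at [t0] and m at [t1]; the bounds [S1_ge] and
     [S1_le], one unit apart, then put the series above m at [t0] and below it at [t1]. *)
  set (t0 := rpow ((m + 1) / C_alpha a) (- a)); set (t1 := rpow (m / C_alpha a) (- a)).
  assert (p0 : 0 < (m + 1) / C_alpha a) by (apply Rdiv_lt_0_compat; lra).
  assert (p1 : 0 < m / C_alpha a) by (apply Rdiv_lt_0_compat; lra).
  assert (h0 : 0 < t0) by now apply rpow_gt0.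
  assert (h1 : 0 < t1) by now apply rpow_gt0.
  assert (h01 : t0 < t1).
  { apply rpow_neg_lt; [lra|]; split; [easy|].
    apply Rmult_lt_compat_r; [now apply Rinv_0_lt_compat|lra]. }
  assert (b0 := S1_ge a t0 ha h0); assert (b1 := S1_le a t1 ha h1).
  unfold t0 at 1 in b0; unfold t1 at 2 in b1; rewrite rpow_inv_exp in b0, b1 by lra.
  replace ((m + 1) / C_alpha a * C_alpha a) with (m + 1) in b0 by (field; lra).
  replace (m / C_alpha a * C_alpha a) with m in b1 by (field; lra).
  destruct (IVT_dec (Sj a 1) t0 t1 m) as [t [ht e]]; [lra|intros; apply continuous_Sj1; lra|lra|].
  exists t; split; [lra|easy].
Qed.

Lemma tau_spec (a m : R) : 1 < a -> 0 < m -> 0 < tau a m /\ Sj a 1 (tau a m) = m.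
Proof.
  intros ha hm.
  assert (h : 0 < tau a m /\ is_series (a_term a (tau a m)) m).
  { apply (solution_spec (fun t => 0 < t /\ is_series (a_term a t) m)).
    destruct (S1_surj a m ha hm) as [t [ht e]]; exists t; split; [easy|].
    rewrite <- e, Sj_bfun_1.
    apply is_series_ext with (fun k => bfun a t (INR (S k))); [intros; now rewrite a_term_bfun|].
    now apply Series_correct, ex_series_bfun. }
  destruct h as [h1 h2]; split; [easy|].
  apply is_series_unique in h2; transitivity (Series (a_term a (tau a m))); [|exact h2].
  rewrite Sj_bfun_1; apply Series_ext; intros; symmetry; apply a_term_bfun.
Qed.

Lemma tau_unique (a t : R) : 1 < a -> 0 < t -> tau a (Sj a 1 t) = t.
Proof.
  intros ha ht; destruct (tau_spec a (Sj a 1 t) ha) as [h e]; [now apply Sj_gt0|].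
  destruct (Rtotal_order (tau a (Sj a 1 t)) t) as [q|[q|q]]; [|easy|].
  - assert (d := S1_decr a _ t ha (conj h q)); lra.
  - assert (d := S1_decr a t _ ha (conj ht q)); lra.
Qed.

Lemma tau_decr (a m m' : R) : 1 < a -> 0 < m < m' -> tau a m' < tau a m.
Proof.
  intros ha h; destruct (tau_spec a m ha) as [h1 e1]; [lra|].
  destruct (tau_spec a m' ha) as [h2 e2]; [lra|].
  apply Rnot_le_lt; intros hle; destruct (Req_dec (tau a m) (tau a m')) as [q|q].
  - rewrite q in e1; lra.
  - assert (d := S1_decr a (tau a m) (tau a m') ha ltac:(lra)); lra.
Qed.

Lemma gamma_m_eq (a m : R) : gamma_m a m = Sj a 2 (tau a m) / m.
Proof.
  unfold gamma_m, Sj, Rdiv; rewrite Rmult_comm; f_equal; apply Series_ext; intros k.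
  rewrite a_term_bfun; reflexivity.
Qed.

Lemma eta_m_eq (a m : R) : eta_m a m = Sj a 3 (tau a m) / m.
Proof.
  unfold eta_m, Sj, Rdiv; rewrite Rmult_comm; f_equal; apply Series_ext; intros.
  now rewrite a_term_bfun.
Qed.

Lemma gamma_m_bounds (a m : R) : 1 < a -> 0 < m -> 0 < gamma_m a m < 1.
Proof.
  intros ha hm; rewrite gamma_m_eq; destruct (tau_spec a m ha hm) as [h e].
  assert (h1 := Sj_gt0 a (tau a m) 1 ha h); assert (h2 := Sj_decr a (tau a m) 0 ha h).
  split; [now apply Rdiv_lt_0_compat|apply Rlt_div_l; lra].
Qed.

Lemma q_m_lt1 (a m : R) : 1 < a -> 0 < m -> q_m a m < 1.
Proof.
  intros ha hm; assert (h := gamma_m_bounds a m ha hm); unfold q_m.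
  apply Rlt_div_l; lra.
Qed.

Lemma q_m_alt (a m : R) : 1 < a -> 0 < m -> q_m a m = 2 - / (1 - gamma_m a m).
Proof. intros ha hm; assert (h := gamma_m_bounds a m ha hm); unfold q_m; field; lra. Qed.

(* Splitting the unimodal [b - b^2] at [b = 1/2] into two monotone pieces of height [1/4]. *)
Lemma ssum_b_b2 (a t : R) (p : nat) : 1 < a -> 0 < t ->
  Rabs (ssum (fun i => bfun a t (INR i) - bfun a t (INR i) ^ 2) p
    - RInt (fun x => bfun a t x - bfun a t x ^ 2) 0 (INR p)) <= / 4.
Proof.
  intros ha ht.
  set (psi := fun b => b - b ^ 2).
  assert (dec : forall b, psi b = psi (Rmax b (/ 2)) + psi (Rmin b (/ 2)) - / 4).
  { intros b; unfold psi, Rmax, Rmin; destruct Rle_dec; field. }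
  assert (m1 : forall b b', b' <= b -> psi (Rmax b (/ 2)) <= psi (Rmax b' (/ 2))).
  { intros b b' h; unfold psi, Rmax; repeat destruct Rle_dec; nra. }
  assert (m2 : forall b b', b' <= b -> psi (Rmin b' (/ 2)) <= psi (Rmin b (/ 2))).
  { intros b b' h; unfold psi, Rmin; repeat destruct Rle_dec; nra. }
  assert (hb : forall x z, x <= z -> bfun a t z <= bfun a t x) by (intros; apply bfun_decr_x; lra).
  assert (b01 : forall x, 0 < bfun a t x <= 1)
    by (intros; split; [apply bfun_pos|apply bfun_le1]; lra).
  set (k := fun x => bfun a t x - bfun a t x ^ 2).
  assert (kc : forall x, continuous k x) by (intros; unfold k; contb).
  assert (ek : forall x, k x = psi (Rmax (bfun a t x) (/ 2)) + psi (Rmin (bfun a t x) (/ 2)) - / 4)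
    by (intros; unfold k; apply dec).
  assert (top : forall b, 0 < b <= 1 -> 0 <= psi (Rmax b (/ 2)) <= / 4).
  { intros b h; unfold psi, Rmax; destruct Rle_dec; nra. }
  assert (top' : forall b, 0 < b <= 1 -> 0 <= psi (Rmin b (/ 2)) <= / 4).
  { intros b h; unfold psi, Rmin; destruct Rle_dec; nra. }
  assert (U := ssum_sub_RInt_le k (fun i => psi (Rmax (bfun a t (INR i)) (/ 2))) p kc).
  assert (V := RInt_sub_ssum_le k (fun i => - psi (Rmin (bfun a t (INR i)) (/ 2))) p kc).
  cbv beta in U, V.
  assert (U' := U ltac:(intros i u hi hu; rewrite !ek;
    assert (q1 := m2 _ _ (hb u (INR (S i)) ltac:(lra)));
    assert (q2 := m1 _ _ (hb (INR i) u ltac:(lra))); lra)).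
  assert (V' := V ltac:(intros i u hi hu; rewrite !ek;
    assert (q1 := m1 _ _ (hb u (INR (S i)) ltac:(lra)));
    assert (q2 := m2 _ _ (hb (INR i) u ltac:(lra))); lra)).
  assert (t0 := top _ (b01 (INR 0))); assert (t1 := top _ (b01 (INR p))).
  assert (t2 := top' _ (b01 (INR 0))); assert (t3 := top' _ (b01 (INR p))).
  change (Rabs (ssum (fun i => k (INR i)) p - RInt k 0 (INR p)) <= / 4).
  apply Rabs_le; lra.
Qed.

(** Integration by parts through the derivative of x b(x); this relation is why 1 - gamma_m tends to
    1 / a. *)
Lemma RInt_b_b2 (a t X : R) : 1 < a -> 0 < t -> 0 <= X ->
  a * RInt (fun x => bfun a t x - bfun a t x ^ 2) 0 X = RInt (bfun a t) 0 X - X * bfun a t X.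
Proof.
  intros ha ht hX.
  assert (h : RInt (fun x => bfun a t x - a * (bfun a t x - bfun a t x ^ 2)) 0 X = X * bfun a t X).
  { rewrite (RInt_ftc (fun x => x * bfun a t x)); [toR; ring| |intros; contb].
    intros x; unfold bfun; evar_last.
    - apply (is_derive_mult (fun x => x) (fun x => / (1 + t * rpow x a))).
      + apply is_derive_id.
      + apply is_derive_inv; [|apply Rgt_not_eq, den_pos; lra].
        apply (is_derive_plus (fun _ => 1) (fun x => t * rpow x a)).
        * apply is_derive_Reals, derivable_pt_lim_const.
        * apply (is_derive_scal (fun u => rpow u a)), is_derive_rpow; lra.
      + intros; apply Rmult_comm.
    - unfold plus, mult, one, scal; simpl; unfold mult; simpl.
      assert (hd := den_pos a t x ltac:(lra)).
      assert (e : x * rpow x (a - 1) = rpow x a).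
      { destruct (Rle_dec x 0).
        - rewrite !rpow_nonpos by easy; ring.
        - rewrite rpow_S by lra; f_equal; ring. }
      rewrite <- e in *; field; lra. }
  rewrite RInt_minus_R, RInt_scal_R in h by (apply ex_RInt_cont; contb); lra.
Qed.

Lemma b_b2_ge0 (a t x : R) : 0 <= t -> 0 <= bfun a t x - bfun a t x ^ 2.
Proof. intros ht; assert (h := bfun_pow_le a t x 1 ht); lra. Qed.

Lemma S1_sub_S2_series (a t : R) : 1 < a -> 0 < t ->
  Sj a 1 t - Sj a 2 t = Series (fun k => bfun a t (INR (S k)) - bfun a t (INR (S k)) ^ 2).
Proof.
  intros ha ht; rewrite Series_minus, Sj_bfun_1; [reflexivity|now apply ex_series_bfun|].
  now apply ex_series_bfun_pow.
Qed.

Lemma ex_series_b_b2 (a t : R) : 1 < a -> 0 < t ->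
  ex_series (fun k => bfun a t (INR (S k)) - bfun a t (INR (S k)) ^ 2).
Proof.
  intros ha ht; apply (ex_series_minus (fun k => bfun a t (INR (S k)))
    (fun k => bfun a t (INR (S k)) ^ 2)); [now apply ex_series_bfun|now apply ex_series_bfun_pow].
Qed.

Lemma S1_sub_S2_le (a t : R) : 1 < a -> 0 < t ->
  a * (Sj a 1 t - Sj a 2 t) <= rpow t (- / a) * C_alpha a + a / 4.
Proof.
  intros ha ht.
  assert (Sj a 1 t - Sj a 2 t <= (rpow t (- / a) * C_alpha a + a / 4) / a).
  2: { apply (Rmult_le_compat_l a) in H; [|lra].
       replace (a * ((rpow t (- / a) * C_alpha a + a / 4) / a))
         with (rpow t (- / a) * C_alpha a + a / 4) in H by (field; lra); easy. }
  rewrite S1_sub_S2_series by easy.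
  apply (Series_limit_le (fun i => bfun a t (INR i) - bfun a t (INR i) ^ 2)).
  - now apply ex_series_b_b2.
  - intros p; apply Rmult_le_reg_l with a; [lra|].
    replace (a * ((rpow t (- / a) * C_alpha a + a / 4) / a))
      with (rpow t (- / a) * C_alpha a + a / 4) by (field; lra).
    assert (h1 := ssum_b_b2 a t p ha ht).
    assert (h2 := RInt_b_b2 a t (INR p) ha ht (pos_INR p)).
    rewrite RInt_bfun_scale in h2 by (try apply pos_INR; lra).
    destruct (C_alpha_spec a ha) as [_ [h3 _]]; specialize (h3 (rpow t (/ a) * INR p)).
    assert (h4 := rpow_ge0 t (- / a)).
    assert (h5 := bfun_pos a t (INR p) ltac:(lra)); assert (h6 := pos_INR p).
    assert (0 <= INR p * bfun a t (INR p)) by (apply Rmult_le_pos; lra).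
    apply Rabs_le_between in h1.
    assert (rpow t (- / a) * Iint a (rpow t (/ a) * INR p) <= rpow t (- / a) * C_alpha a)
      by now apply Rmult_le_compat_l.
    set (R0 := RInt (fun x => bfun a t x - bfun a t x ^ 2) 0 (INR p)) in *.
    assert (a * ssum (fun i => bfun a t (INR i) - bfun a t (INR i) ^ 2) p <= a * (R0 + / 4))
      by (apply Rmult_le_compat_l; lra).
    lra.
Qed.

Lemma INR_bfun_small (a t e : R) : 1 < a -> 0 < t -> 0 < e ->
  eventually (fun p => INR p * bfun a t (INR p) < e).
Proof.
  intros ha ht he.
  assert (l := Rpower_neg_lim (a - 1) ltac:(lra)).
  apply is_lim_seq_eps with (e := e * t) in l; [|now apply Rmult_lt_0_compat].
  destruct l as [N h]; exists (S N); intros p hp; specialize (h p ltac:(lia)).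
  assert (hp0 : 0 < INR p) by (apply lt_0_INR; lia).
  rewrite Rminus_0_r in h; apply Rabs_def2 in h; destruct h as [h _].
  assert (hb := t_y_b a t (INR p) ht).
  assert (e1 : INR p * Rpower (INR p) (a - 1) = rpow (INR p) a).
  { rewrite rpow_pos by easy; rewrite <- (Rpower_1 (INR p)) at 1 by easy.
    rewrite <- Rpower_plus; f_equal; ring. }
  assert (e2 : Rpower (INR p) (a - 1) * Rpower (INR p) (- (a - 1)) = 1).
  { rewrite <- Rpower_plus, Rplus_opp_r; now apply Rpower_O. }
  assert (q := Rpower_pos (INR p) (- (a - 1))).
  replace (INR p * bfun a t (INR p)) with
    (rpow (INR p) a * bfun a t (INR p) * Rpower (INR p) (- (a - 1))).
  - apply Rle_lt_trans with (/ t * Rpower (INR p) (- (a - 1))).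
    + apply Rmult_le_compat_r; lra.
    + apply Rmult_lt_reg_l with t; [easy|]; rewrite <- Rmult_assoc, Rinv_r; lra.
  - rewrite <- e1.
    transitivity (INR p * bfun a t (INR p) * (Rpower (INR p) (a - 1) * Rpower (INR p) (- (a - 1))));
      [ring|rewrite e2; ring].
Qed.

Lemma S1_sub_S2_ge (a t : R) : 1 < a -> 0 < t ->
  rpow t (- / a) * C_alpha a - a / 4 <= a * (Sj a 1 t - Sj a 2 t).
Proof.
  intros ha ht; apply Rnot_lt_le; intros hlt.
  set (gap := rpow t (- / a) * C_alpha a - a / 4 - a * (Sj a 1 t - Sj a 2 t)).
  destruct (C_alpha_spec a ha) as [_ [_ h]].
  assert (hq : 0 < rpow t (- / a)) by now apply rpow_gt0.
  destruct (h (gap / 2 / rpow t (- / a))) as [X0 hX];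
    [apply Rdiv_lt_0_compat; [unfold gap; lra|easy]|].
  destruct (INR_bfun_small a t (gap / 2) ha ht ltac:(unfold gap; lra)) as [N hN].
  destruct (INR_unbounded_mult (rpow t (/ a)) X0) as [p0 hp0]; [now apply rpow_gt0|].
  set (p := (N + p0)%nat).
  specialize (hN p ltac:(lia)).
  assert (hp : X0 <= rpow t (/ a) * INR p).
  { eapply Rle_trans; [apply hp0|]; apply Rmult_le_compat_l; [apply rpow_ge0|].
    apply le_INR; lia. }
  specialize (hX _ hp).
  assert (h1 := ssum_b_b2 a t p ha ht).
  assert (h2 := RInt_b_b2 a t (INR p) ha ht (pos_INR p)).
  rewrite RInt_bfun_scale in h2 by (try apply pos_INR; lra).
  assert (h3 : ssum (fun i => bfun a t (INR i) - bfun a t (INR i) ^ 2) p <= Sj a 1 t - Sj a 2 t).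
  { rewrite S1_sub_S2_series by easy.
    apply (ssum_le_Series (fun i => bfun a t (INR i) - bfun a t (INR i) ^ 2)).
    - intros; apply b_b2_ge0; lra.
    - now apply ex_series_b_b2. }
  apply Rabs_le_between in h1.
  assert (h4 : rpow t (- / a) * C_alpha a - gap / 2 < rpow t (- / a) * Iint a (rpow t (/ a) * INR p)).
  { replace (rpow t (- / a) * C_alpha a - gap / 2) with
      (rpow t (- / a) * (C_alpha a - gap / 2 / rpow t (- / a))) by (field; lra).
    now apply Rmult_lt_compat_l. }
  set (R0 := RInt (fun x => bfun a t x - bfun a t x ^ 2) 0 (INR p)) in *.
  assert (a * (R0 - / 4) <= a * (Sj a 1 t - Sj a 2 t)) by (apply Rmult_le_compat_l; lra).
  unfold gap in *; lra.
Qed.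

(** Integrating the derivative of x b^2 shows that 2 a times the integral of b^2 - b^3 is the
    integral of b^2 minus X b(X)^2. Passing between sums and integrals costs at most 1 for each of
    the two functions, hence the constants 2 a and 1. *)
Lemma S2_sub_S3_le (a t : R) : 1 < a -> 0 < t ->
  2 * a * (Sj a 2 t - Sj a 3 t) <= Sj a 2 t + 1 + 2 * a.
Proof.
  intros ha ht.
  assert (hb : forall x z, x <= z -> bfun a t z <= bfun a t x) by (intros; apply bfun_decr_x; lra).
  assert (b01 : forall x, 0 < bfun a t x <= 1)
    by (intros; split; [apply bfun_pos|apply bfun_le1]; lra).
  assert (fin : forall p, 2 * a * ssum (fun i => bfun a t (INR i) ^ 2 - bfun a t (INR i) ^ 3) p
     <= Sj a 2 t + 1 + 2 * a).
  { intros p.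
    set (k := fun x => bfun a t x ^ 2 - bfun a t x ^ 3).
    assert (kc : forall x, continuous k x) by (intros; unfold k; contb).
    (* b^2 - b^3 is not monotone in [b], but over each unit interval it rises by at most the drop of
       [b], and these drops telescope. *)
    assert (h1 : ssum (fun i => k (INR i)) p - RInt k 0 (INR p)
      <= - bfun a t (INR p) - - bfun a t (INR 0)).
    { apply (ssum_sub_RInt_le k (fun i => - bfun a t (INR i))); [easy|].
      intros i u hi hu; unfold k.
      assert (q1 := hb (INR i) u ltac:(lra)); assert (q2 := hb u (INR (S i)) ltac:(lra)).
      assert (r1 := b01 u); assert (r2 := b01 (INR (S i))); assert (r3 := b01 (INR i)).
      set (x := bfun a t u) in *; set (y := bfun a t (INR (S i))) in *.
      assert (e : y ^ 2 - y ^ 3 - (x ^ 2 - x ^ 3) = (x - y) * (x ^ 2 + x * y + y ^ 2 - x - y)) by ring.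
      rewrite e; assert (x ^ 2 + x * y + y ^ 2 - x - y <= 1) by (simpl; nra). nra. }
    assert (h2 : 2 * a * RInt k 0 (INR p) = RInt (fun x => bfun a t x ^ 2) 0 (INR p)
      - INR p * bfun a t (INR p) ^ 2).
    { assert (h : RInt (fun x => bfun a t x ^ 2 - 2 * a * k x) 0 (INR p) = INR p * bfun a t (INR p) ^ 2).
      { rewrite (RInt_ftc (fun x => x * bfun a t x ^ 2)); [toR; ring| |intros; contb].
        intros x; unfold k, bfun; evar_last.
        - apply (is_derive_mult (fun x => x) (fun x => (/ (1 + t * rpow x a)) ^ 2)).
          + apply is_derive_id.
          + apply (is_derive_pow (fun x => / (1 + t * rpow x a)) 2).
            apply is_derive_inv; [|apply Rgt_not_eq, den_pos; lra].
            apply (is_derive_plus (fun _ => 1) (fun x => t * rpow x a)).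
            * apply is_derive_Reals, derivable_pt_lim_const.
            * apply (is_derive_scal (fun u => rpow u a)), is_derive_rpow; lra.
          + intros; apply Rmult_comm.
        - unfold plus, mult, one, scal; simpl; unfold mult; simpl.
          assert (hd := den_pos a t x ltac:(lra)).
          assert (e : x * rpow x (a - 1) = rpow x a).
          { destruct (Rle_dec x 0).
            - rewrite !rpow_nonpos by easy; ring.
            - rewrite rpow_S by lra; f_equal; ring. }
          rewrite <- e in *; field; lra. }
      rewrite RInt_minus_R, RInt_scal_R in h by (apply ex_RInt_cont; contb); lra. }
    assert (h3 : RInt (fun x => bfun a t x ^ 2) 0 (INR p) - ssum (fun i => bfun a t (INR i) ^ 2) p
      <= - bfun a t (INR p) ^ 2 - - bfun a t (INR 0) ^ 2).
    { apply (RInt_sub_ssum_le (fun x => bfun a t x ^ 2) (fun i => - bfun a t (INR i) ^ 2)); [contb|].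
      intros i u hi hu.
      assert (q1 := hb (INR i) u ltac:(lra)); assert (r1 := b01 u); assert (r3 := b01 (INR i)).
      assert (bfun a t u ^ 2 <= bfun a t (INR i) ^ 2) by (apply pow_incr; lra); lra. }
    assert (h4 : ssum (fun i => bfun a t (INR i) ^ 2) p <= Sj a 2 t).
    { apply (ssum_le_Series (fun i => bfun a t (INR i) ^ 2)); [|now apply ex_series_bfun_pow].
      intros; apply pow2_ge_0. }
    assert (r0 := b01 (INR 0)); assert (r1 := b01 (INR p)).
    assert (q : forall b, 0 < b <= 1 -> b ^ 2 <= 1) by (intros; simpl; nra).
    assert (q0 := q _ r0).
    assert (0 <= bfun a t (INR p) ^ 2) by apply pow2_ge_0.
    assert (0 <= INR p * bfun a t (INR p) ^ 2) by (apply Rmult_le_pos; [apply pos_INR|easy]).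
    assert (2 * a * ssum (fun i => k (INR i)) p <= 2 * a * (RInt k 0 (INR p) + 1))
      by (apply Rmult_le_compat_l; lra).
    change (2 * a * ssum (fun i => k (INR i)) p <= Sj a 2 t + 1 + 2 * a); lra. }
  assert (ex : ex_series (fun k => bfun a t (INR (S k)) ^ 2 - bfun a t (INR (S k)) ^ 3)).
  { apply (ex_series_minus (fun k => bfun a t (INR (S k)) ^ 2) (fun k => bfun a t (INR (S k)) ^ 3));
      now apply ex_series_bfun_pow. }
  unfold Sj at 1 2; rewrite <- Series_minus by now apply ex_series_bfun_pow.
  apply Rmult_le_reg_l with (/ (2 * a)); [apply Rinv_0_lt_compat; lra|].
  rewrite <- Rmult_assoc, Rinv_l, Rmult_1_l by lra.
  apply (Series_limit_le (fun i => bfun a t (INR i) ^ 2 - bfun a t (INR i) ^ 3)); [easy|].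
  intros p; apply Rmult_le_reg_l with (2 * a); [lra|].
  rewrite <- Rmult_assoc, Rinv_r, Rmult_1_l by lra; apply fin.
Qed.

(** Both a m (1 - gamma_m) and m are within a / 4 and 1, respectively, of C_alpha tau^(-1/a); their
    difference is at most a / 4 + 1. *)
Lemma one_sub_gamma_m (a m : R) : 1 < a -> 0 < m ->
  Rabs (a * (1 - gamma_m a m) - 1) <= (a / 4 + 1) / m.
Proof.
  intros ha hm; destruct (tau_spec a m ha hm) as [h e].
  assert (u := S1_sub_S2_le a _ ha h); assert (v := S1_sub_S2_ge a _ ha h).
  assert (x := S1_le a _ ha h); assert (y := S1_ge a _ ha h).
  rewrite gamma_m_eq; set (s2 := Sj a 2 (tau a m)) in *; rewrite e in *.
  replace (a * (1 - s2 / m) - 1) with ((a * (m - s2) - m) / m) by (field; lra).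
  unfold Rdiv at 1; rewrite Rabs_mult, (Rabs_pos_eq (/ m)) by (apply Rlt_le, Rinv_0_lt_compat; lra).
  apply Rmult_le_compat_r; [apply Rlt_le, Rinv_0_lt_compat; lra|].
  apply Rabs_le; lra.
Qed.

(** * The fixed-sample limit *)

Lemma is_lim_seq_ssum (u : nat -> nat -> R) (w : nat -> R) (N : nat) :
  (forall i, (1 <= i)%nat -> is_lim_seq (fun p => u p i) (w i)) ->
  is_lim_seq (fun p => ssum (u p) N) (ssum w N).
Proof.
  intros h; induction N as [|N IH].
  - rewrite ssum_0; apply is_lim_seq_ext with (fun _ => 0); [intros; now rewrite ssum_0|].
    apply is_lim_seq_const.
  - rewrite ssum_S; apply is_lim_seq_ext with (fun p => ssum (u p) N + u p (S N));
      [intros; now rewrite ssum_S|].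
    apply is_lim_seq_plus'; [exact IH|apply h; lia].
Qed.

Lemma ssum_tail_le (u M : nat -> R) (N p : nat) : (N <= p)%nat ->
  (forall i, (1 <= i)%nat -> Rabs (u i) <= M i) ->
  Rabs (ssum u p - ssum u N) <= ssum M p - ssum M N.
Proof.
  intros hp h; induction hp as [|p hp IH].
  - rewrite !Rminus_diag, Rabs_R0; lra.
  - rewrite !ssum_S; replace (ssum u p + u (S p) - ssum u N) with (ssum u p - ssum u N + u (S p)) by ring.
    eapply Rle_trans; [apply Rabs_triang|]; specialize (h (S p) ltac:(lia)); lra.
Qed.

(** Dominated convergence for sums whose length grows with the parameter: a fixed number of terms
    converges, and the rest is bounded by the tail of the majorant. *)
Lemma tannery (u : nat -> nat -> R) (w M : nat -> R) :
  (forall i, (1 <= i)%nat -> is_lim_seq (fun p => u p i) (w i)) ->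
  eventually (fun p => forall i, (1 <= i)%nat -> Rabs (u p i) <= M i) ->
  ex_series (fun k => M (S k)) ->
  is_lim_seq (fun p => ssum (u p) p) (Series (fun k => w (S k))).
Proof.
  intros hl hM hs.
  assert (hw : forall i, (1 <= i)%nat -> Rabs (w i) <= M i).
  { intros i hi.
    apply (is_lim_seq_le_loc (fun p => Rabs (u p i)) (fun _ => M i) (Rabs (w i)) (M i)).
    - revert hM; apply filter_imp; intros p h; now apply h.
    - apply (is_lim_seq_abs _ (Finite _)); now apply hl.
    - apply is_lim_seq_const. }
  assert (ew : ex_series (fun k => w (S k))).
  { apply ex_series_dom with (fun k => M (S k)) 1; [|easy].
    intros k; rewrite Rmult_1_l; apply hw; lia. }
  assert (lM := proj1 (is_series_ssum M _) (Series_correct _ hs)).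
  assert (lw := proj1 (is_series_ssum w _) (Series_correct _ ew)).
  set (W := Series (fun k => w (S k))) in *; set (Z := Series (fun k => M (S k))) in *.
  assert (M0 : forall i, (1 <= i)%nat -> 0 <= M i)
    by (intros i hi; eapply Rle_trans; [apply Rabs_pos|now apply hw]).
  assert (MZ : forall p, ssum M p <= Z).
  { intros p; apply ssum_le_Series; [intros; apply M0; lia|easy]. }
  apply is_lim_seq_eps; intros e he.
  assert (lM' := lM); apply is_lim_seq_eps with (e := e / 4) in lM'; [|lra].
  destruct lM' as [N hN]; specialize (hN N (Nat.le_refl N)); apply Rabs_def2 in hN.
  assert (lu := is_lim_seq_ssum u w N hl).
  apply is_lim_seq_eps with (e := e / 4) in lu; [|lra].
  assert (tw : Rabs (W - ssum w N) <= e / 4).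
  { apply (is_lim_seq_le_loc (fun p => Rabs (ssum w p - ssum w N)) (fun _ => e / 4)
      (Rabs (W - ssum w N)) (e / 4)).
    - exists N; intros p hp; assert (h := ssum_tail_le w M N p hp hw); assert (h' := MZ p); lra.
    - apply (is_lim_seq_abs _ (Finite _)); apply is_lim_seq_minus'; [easy|apply is_lim_seq_const].
    - apply is_lim_seq_const. }
  assert (hN' : eventually (fun p => (N <= p)%nat)) by (exists N; easy).
  generalize (filter_and _ _ hN' (filter_and _ _ hM lu)); apply filter_imp.
  intros p [hp [h1 h2]].
  assert (h := ssum_tail_le (u p) M N p hp h1); assert (h' := MZ p).
  replace (ssum (u p) p - W) with
    ((ssum (u p) p - ssum (u p) N) + ((ssum (u p) N - ssum w N) + - (W - ssum w N))) by ring.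
  eapply Rle_lt_trans; [apply Rabs_triang|].
  assert (k := Rabs_triang (ssum (u p) N - ssum w N) (- (W - ssum w N))).
  rewrite Rabs_Ropp in k; lra.
Qed.

(** Finite sums lie below the series, so tau_p <= tau. Just below tau the series exceeds [m], hence
    so do long finite sums, which pushes tau_p above [t - d]. *)
Lemma tau_p_limit (a : R) (m : nat) : 1 < a -> (1 <= m)%nat ->
  is_lim_seq (fun p => tau_p a p m) (tau a (INR m)).
Proof.
  intros ha hm.
  assert (hm0 : 0 < INR m) by (apply lt_0_INR; lia).
  destruct (tau_spec a (INR m) ha hm0) as [ht e].
  set (t := tau a (INR m)) in *.
  apply is_lim_seq_eps; intros eps he.
  set (d := Rmin eps t / 2).
  assert (hd : 0 < d <= eps / 2 /\ d <= t / 2).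
  { unfold d; assert (h1 := Rmin_l eps t); assert (h2 := Rmin_r eps t).
    assert (h3 : 0 < Rmin eps t) by (apply Rmin_pos; lra); lra. }
  assert (hgt := S1_decr a (t - d) t ha ltac:(lra)).
  assert (l : is_lim_seq (ssum (fun i => bfun a (t - d) (INR i))) (Sj a 1 (t - d))).
  { apply is_series_ssum; rewrite Sj_bfun_1; apply Series_correct, ex_series_bfun; lra. }
  apply is_lim_seq_eps with (e := Sj a 1 (t - d) - INR m) in l; [|lra].
  assert (hN' : eventually (fun p => (m < p)%nat)) by (exists (S m); easy).
  generalize (filter_and _ _ hN' l); apply filter_imp; intros p [hp h].
  destruct (tau_p_spec a p m ltac:(lra) ltac:(lia)) as [h1 h2].
  apply Rabs_def2 in h; fold (bsum a p (t - d)) in h.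
  assert (up : tau_p a p m <= t).
  { apply Rnot_lt_le; intros hlt.
    assert (h3 := bsum_decr a p t (tau_p a p m) ltac:(lia) ltac:(lra)).
    assert (h4 := bsum_le_S1 a t p ha ht); lra. }
  assert (lo : t - d < tau_p a p m).
  { apply Rnot_le_lt; intros hle.
    destruct (Req_dec (tau_p a p m) (t - d)) as [q|q]; [rewrite q in h2; lra|].
    assert (h3 := bsum_decr a p (tau_p a p m) (t - d) ltac:(lia) ltac:(lra)); lra. }
  apply Rabs_def1; lra.
Qed.

Lemma bfun_0_l (a x : R) : bfun a 0 x = 1.
Proof. unfold bfun; field; lra. Qed.

(** Here tau_T tends to 0, so b_T tends to 1 at each index. The bias sum tends to m (1 - gamma_m),
    which cancels the denominator and leaves - m tau_m; in the variance part only the factor 1 / (1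
    - gamma_m) still involves the student. *)
Lemma fixed_limit (a sigma2 phin : R) (n : nat -> nat) (m : nat) :
  1 < a -> 1 < phin -> teacher_sizes n phin -> (1 <= m)%nat ->
  is_lim_seq (fun p => W2SG_p a sigma2 p (n p) m) (G_m a phin sigma2 (INR m)).
Proof.
  intros ha hn [hn1 hnl] hm.
  assert (hm0 : 0 < INR m) by (apply lt_0_INR; lia).
  assert (hn0 : eventually (fun p => (1 <= n p)%nat)) by (exists 0%nat; intros; apply hn1).
  destruct (ratio_inv_limit n phin hn hn0 hnl) as [hnl' hnp].
  destruct (s_T_spec a phin ltac:(lra) hn) as [hT FT].
  assert (sT := stau_limit a _ n ltac:(lra) hT hnp ltac:(rewrite FT; easy)).
  assert (gT := gamma_p_limit a phin n ltac:(lra) hn hn0 hnl).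
  assert (gTb := gamma_T_bounds a phin ltac:(lra) hn).
  destruct (tau_spec a (INR m) ha hm0) as [ht et].
  assert (lS := tau_p_limit a m ha hm).
  assert (gmb := gamma_m_bounds a (INR m) ha hm0).
  set (t := tau a (INR m)) in *.
  assert (hmp : eventually (fun p => (1 <= m < p)%nat)) by (exists (S m); intros; lia).
  assert (lT : is_lim_seq (fun p => tau_p a p (n p)) 0).
  { apply is_lim_seq_ext_loc with (fun p => stau a p (n p) * Rpower (INR p) (- a)).
    - exists 1%nat; intros p hp; unfold stau; rewrite rpow_pos by (apply lt_0_INR; lia).
      rewrite Rmult_assoc, <- Rpower_plus, Rplus_opp_r, Rpower_O by (apply lt_0_INR; lia); ring.
    - replace (Finite 0) with (Finite (s_T a phin * 0)) by (f_equal; ring).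
      apply is_lim_seq_mult'; [easy|apply Rpower_neg_lim; lra]. }
  set (bS := fun p i => bfun a (tau_p a p m) (INR i)).
  set (bT := fun p i => bfun a (tau_p a p (n p)) (INR i)).
  assert (lbS : forall i, is_lim_seq (fun p => bS p i) (bfun a t (INR i))).
  { intros i; apply (is_lim_seq_continuous_comp (fun t => bfun a t (INR i))); [|easy].
    apply continuous_bfun_t; lra. }
  assert (lbT : forall i, is_lim_seq (fun p => bT p i) 1).
  { intros i; rewrite <- (bfun_0_l a (INR i)).
    apply (is_lim_seq_continuous_comp (fun t => bfun a t (INR i))); [|easy].
    apply continuous_bfun_t; lra. }
  assert (good : eventually (fun p => (1 <= m < p)%nat /\ (1 <= n p < p)%nat /\ t / 2 < tau_p a p m)).
  { apply is_lim_seq_eps with (e := t / 2) in lS; [|lra].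
    generalize (filter_and _ _ hmp (filter_and _ _ hnp lS)); apply filter_imp.
    intros p [h1 [h2 h3]]; apply Rabs_def2 in h3; repeat split; try easy; lra. }
  assert (bnd : forall p, (1 <= m < p)%nat -> (1 <= n p < p)%nat -> forall i,
     0 < bS p i <= 1 /\ 0 < bT p i <= 1).
  { intros p h1 h2 i.
    destruct (tau_p_spec a p m ltac:(lra) h1) as [q1 _].
    destruct (tau_p_spec a p (n p) ltac:(lra) h2) as [q2 _].
    unfold bS, bT; repeat split; try apply bfun_pos; try apply bfun_le1; lra. }
  assert (L1 : is_lim_seq (fun p => ssum (fun i => (1 - bS p i) * bS p i * bT p i) p)
     (INR m * (1 - gamma_m a (INR m)))).
  { replace (INR m * (1 - gamma_m a (INR m))) with
      (Series (fun k => (1 - bfun a t (INR (S k))) * bfun a t (INR (S k)) * 1)).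
    - apply (tannery (fun p i => (1 - bS p i) * bS p i * bT p i)
        (fun i => (1 - bfun a t (INR i)) * bfun a t (INR i) * 1) (fun i => bfun a (t / 2) (INR i))).
      + intros i _; repeat apply is_lim_seq_mult'; try easy.
        apply is_lim_seq_minus'; [apply is_lim_seq_const|easy].
      + revert good; apply filter_imp; intros p [h1 [h2 h3]] i _.
        destruct (bnd p h1 h2 i) as [b1 b2].
        assert (b3 : bS p i <= bfun a (t / 2) (INR i)) by (apply bfun_decr_t; lra).
        rewrite Rabs_pos_eq by (apply Rmult_le_pos; [apply Rmult_le_pos|]; lra).
        assert (0 <= (1 - bS p i) * bS p i <= bS p i) by nra; nra.
      + apply ex_series_bfun; lra.
    - rewrite gamma_m_eq; fold t; rewrite <- et.
      rewrite (Series_ext _ (fun k => bfun a t (INR (S k)) - bfun a t (INR (S k)) ^ 2)) by (intros; ring).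
      rewrite <- S1_sub_S2_series by easy; rewrite et; field; lra. }
  assert (L2 : is_lim_seq (fun p => gamma_p a p m) (gamma_m a (INR m))).
  { apply is_lim_seq_ext_loc with (fun p => / INR m * ssum (fun i => bS p i ^ 2) p).
    - revert hmp; apply filter_imp; intros p hp; now rewrite gamma_p_eq by (easy || lra).
    - rewrite gamma_m_eq; fold t; unfold Rdiv; rewrite Rmult_comm.
      apply is_lim_seq_mult'; [apply is_lim_seq_const|].
      apply (tannery (fun p i => bS p i ^ 2) (fun i => bfun a t (INR i) ^ 2)
        (fun i => bfun a (t / 2) (INR i))).
      + intros i _; apply (is_lim_seq_continuous_comp (fun u => u ^ 2)); [cont|easy].
      + revert good; apply filter_imp; intros p [h1 [h2 h3]] i _.
        destruct (bnd p h1 h2 i) as [b1 b2].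
        assert (b3 : bS p i <= bfun a (t / 2) (INR i)) by (apply bfun_decr_t; lra).
        rewrite Rabs_pos_eq by apply pow2_ge_0; simpl; nra.
      + apply ex_series_bfun; lra. }
  assert (ln : is_lim_seq (fun p => / INR (n p)) 0).
  { apply is_lim_seq_ext_loc with (fun p => INR p / INR (n p) * / INR p).
    - exists 1%nat; intros p hp; assert (0 < INR p) by (apply lt_0_INR; lia).
      assert (0 < INR (n p)) by (apply lt_0_INR; specialize (hn1 p); lia); field; lra.
    - replace (Finite 0) with (Finite (phin * 0)) by (f_equal; ring).
      apply is_lim_seq_mult'; [easy|apply is_lim_seq_inv_INR]. }
  (* Replacing 1 - b_S by 1 changes the sum by at most twice the sum of b_S, which equals 2 m by the
     definition of tau_S and is negligible against [n]. *)
  assert (near : forall w : nat -> nat -> R,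
     eventually (fun p => forall i, Rabs (w p i - bT p i ^ 2) <= 2 * bS p i) ->
     is_lim_seq (fun p => / INR (n p) * ssum (w p) p) (gamma_T a phin)).
  { intros w hw.
    apply is_lim_seq_ext with (fun p => gamma_p a p (n p) +
      (/ INR (n p) * ssum (w p) p - gamma_p a p (n p))); [intros; ring|].
    replace (Finite (gamma_T a phin)) with (Finite (gamma_T a phin + 0)) by (f_equal; ring).
    apply is_lim_seq_plus'; [easy|].
    apply is_lim_seq_Rabs_0 with (fun p => 2 * INR m * / INR (n p)).
    - generalize (filter_and _ _ hw good); apply filter_imp; intros p [h [h1 [h2 h3]]].
      rewrite gamma_p_eq by (easy || lra); fold (bT p).
      rewrite <- Rmult_minus_distr_l, <- ssum_minus, Rabs_mult, Rmult_comm.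
      assert (0 < / INR (n p)) by (apply Rinv_0_lt_compat, lt_0_INR; lia).
      rewrite (Rabs_pos_eq (/ INR (n p))) by lra.
      apply Rmult_le_compat_r; [lra|].
      destruct (tau_p_spec a p m ltac:(lra) h1) as [_ q].
      rewrite <- q; unfold bsum; rewrite <- ssum_scal.
      eapply Rle_trans; [apply ssum_abs|]; apply ssum_le; intros i _; apply h.
    - replace (Finite 0) with (Finite (2 * INR m * 0)) by (f_equal; ring).
      apply is_lim_seq_mult'; [apply is_lim_seq_const|easy]. }
  assert (L3 : is_lim_seq (fun p => / INR (n p) * ssum (fun i => (1 - bS p i) * bT p i ^ 2) p)
     (gamma_T a phin)).
  { apply (near (fun p i => (1 - bS p i) * bT p i ^ 2)).
    revert good; apply filter_imp; intros p [h1 [h2 h3]] i; destruct (bnd p h1 h2 i) as [b1 b2].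
    replace ((1 - bS p i) * bT p i ^ 2 - bT p i ^ 2) with (- (bS p i * bT p i ^ 2)) by ring.
    assert (0 <= bT p i ^ 2 <= 1) by (simpl; nra).
    rewrite Rabs_Ropp, Rabs_pos_eq by (apply Rmult_le_pos; lra); nra. }
  assert (L4 : is_lim_seq (fun p => / INR (n p) * ssum (fun i => (1 - bS p i) ^ 2 * bT p i ^ 2) p)
     (gamma_T a phin)).
  { apply (near (fun p i => (1 - bS p i) ^ 2 * bT p i ^ 2)).
    revert good; apply filter_imp; intros p [h1 [h2 h3]] i; destruct (bnd p h1 h2 i) as [b1 b2].
    replace ((1 - bS p i) ^ 2 * bT p i ^ 2 - bT p i ^ 2)
      with (- (bS p i * (2 - bS p i) * bT p i ^ 2)) by ring.
    assert (0 <= bT p i ^ 2 <= 1) by (simpl; nra).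
    assert (0 <= bS p i * (2 - bS p i) <= 2 * bS p i) by nra.
    rewrite Rabs_Ropp, Rabs_pos_eq by (apply Rmult_le_pos; lra); nra. }
  set (V3 := fun p => / INR (n p) * ssum (fun i => (1 - bS p i) * bT p i ^ 2) p) in L3.
  set (V4 := fun p => / INR (n p) * ssum (fun i => (1 - bS p i) ^ 2 * bT p i ^ 2) p) in L4.
  set (V1 := fun p => ssum (fun i => (1 - bS p i) * bS p i * bT p i) p) in L1.
  assert (gS' : is_lim_seq (fun p => / (1 - gamma_p a p m)) (/ (1 - gamma_m a (INR m)))).
  { apply (is_lim_seq_inv _ (Finite (1 - gamma_m a (INR m)))).
    - apply is_lim_seq_minus'; [apply is_lim_seq_const|easy].
    - intros h; injection h; lra. }
  assert (gT' : is_lim_seq (fun p => / (1 - gamma_p a p (n p))) (/ (1 - gamma_T a phin))).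
  { apply (is_lim_seq_inv _ (Finite (1 - gamma_T a phin))).
    - apply is_lim_seq_minus'; [apply is_lim_seq_const|easy].
    - intros h; injection h; lra. }
  apply is_lim_seq_ext_loc with (fun p => -1 * (tau_p a p m * / (1 - gamma_p a p m) * V1 p)
     + sigma2 * / (1 - gamma_p a p (n p)) * (2 * V3 p - / (1 - gamma_p a p m) * V4 p)).
  - revert good; apply filter_imp; intros p [h1 [h2 h3]].
    rewrite W2SG_p_eq by (easy || lra); cbv zeta.
    unfold V1, V3, V4, bS, bT, Rdiv; rewrite Rinv_mult; ring.
  - replace (G_m a phin sigma2 (INR m)) with
      (-1 * (t * / (1 - gamma_m a (INR m)) * (INR m * (1 - gamma_m a (INR m))))
       + sigma2 * / (1 - gamma_T a phin) * (2 * gamma_T a phin - / (1 - gamma_m a (INR m)) * gamma_T a phin)).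
    + apply is_lim_seq_plus'; repeat apply is_lim_seq_mult'; try apply is_lim_seq_const; try easy.
      apply is_lim_seq_minus'; apply is_lim_seq_mult'; try apply is_lim_seq_const; easy.
    + unfold G_m; rewrite q_m_alt by easy; unfold c_T; fold t; field; lra.
Qed.

(** * Nonpositive gain for alpha > 2 *)

(* The right-hand side increases with [m], and equality holds at [m = 2]. *)
Lemma safe_ratio (a m : R) : 2 < a <= 5 / 2 -> 2 <= m -> 0 < (2 - a) * m + 2 + a / 2 ->
  (12 + a) / (3 * (4 - a)) * Rpower 3 (- a) <=
  m * (m + 1 + a / 4) / ((2 - a) * m + 2 + a / 2) * Rpower (m + 1) (- a).
Proof.
  intros ha hm hQ.
  set (l := fun m => ln m + ln (m + 1 + a / 4) - ln ((2 - a) * m + 2 + a / 2) - a * ln (m + 1)).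
  assert (Q0 : forall x, 2 <= x <= m -> 0 < (2 - a) * x + 2 + a / 2) by (intros; nra).
  assert (hl : l 2 <= l m).
  { apply (incr_of_derive l (fun x => / x + / (x + 1 + a / 4) - (2 - a) / ((2 - a) * x + 2 + a / 2)
      - a / (x + 1))); [easy| |].
    - intros x hx; specialize (Q0 x hx); unfold l; auto_derive; [repeat split; lra|field; repeat split; lra].
    - intros x hx; specialize (Q0 x hx).
      (* The term a / (x + 1) is split into (a - 2) / (x + 1) and 2 / (x + 1), each dominated
         separately. The number 3 bounds the linear denominator, which is at most 6 - 3 a / 2 for x
         >= 2. *)
      assert (h1 : (a - 2) / 3 <= - ((2 - a) / ((2 - a) * x + 2 + a / 2))).
      { replace (- ((2 - a) / ((2 - a) * x + 2 + a / 2))) with ((a - 2) / ((2 - a) * x + 2 + a / 2))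
          by (field; lra).
        apply Rmult_le_compat_l; [lra|]; apply Rinv_le_contravar; [easy|nra]. }
      assert (h2 : (a - 2) / (x + 1) <= (a - 2) / 3).
      { apply Rmult_le_compat_l; [lra|]; apply Rinv_le_contravar; lra. }
      assert (h3 : 0 <= / x + / (x + 1 + a / 4) - 2 / (x + 1)).
      { replace (/ x + / (x + 1 + a / 4) - 2 / (x + 1)) with
          ((x * (x + 1) - (x - 1) * (x + 1 + a / 4)) / (x * (x + 1) * (x + 1 + a / 4))) by (field; lra).
        apply Rle_mult_inv_pos; [nra|repeat apply Rmult_lt_0_compat; lra]. }
      unfold Rdiv in *; nra. }
  assert (ex : forall x, 2 <= x <= m -> exp (l x) =
    x * (x + 1 + a / 4) / ((2 - a) * x + 2 + a / 2) * Rpower (x + 1) (- a)).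
  { intros x hx; specialize (Q0 x hx); unfold l, Rpower.
    replace (ln x + ln (x + 1 + a / 4) - ln ((2 - a) * x + 2 + a / 2) - a * ln (x + 1)) with
      (ln x + ln (x + 1 + a / 4) + - ln ((2 - a) * x + 2 + a / 2) + - a * ln (x + 1)) by ring.
    rewrite !exp_plus, exp_Ropp, !exp_ln by lra; reflexivity. }
  rewrite <- ex by lra.
  replace ((12 + a) / (3 * (4 - a)) * Rpower 3 (- a)) with (exp (l 2)).
  - destruct hl as [hl|hl]; [apply Rlt_le, exp_increasing, hl|rewrite hl; lra].
  - rewrite ex by lra; replace (2 + 1) with 3 by ring; f_equal; field; lra.
Qed.

(** For [m = 1] this is the definition of [sigma_c2]. For [m >= 2] the bounds tau_m >= (C_alpha / (m
    + 1))^a and q_m <= Q / D reduce the claim, where Q > 0, to an explicit function of [m] that is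
    least at [m = 2]; its value there is the second entry of the minimum. *)
Lemma safe_gain (a phin sigma2 : R) (m : nat) : 2 < a <= 5 / 2 -> 1 < phin ->
  0 < sigma2 -> sigma2 <= sigma_safe2 a phin -> (1 <= m)%nat ->
  G_m a phin sigma2 (INR m) <= 0.
Proof.
  intros ha hn hs hsafe hm.
  assert (hc := c_T_pos a phin ltac:(lra) hn).
  assert (s1 := Rle_trans _ _ _ hsafe (Rmin_l _ _)).
  assert (s2 := Rle_trans _ _ _ hsafe (Rmin_r _ _)).
  unfold G_m; destruct (Nat.eq_dec m 1) as [->|hm2].
  - simpl INR; destruct (tau_spec a 1 ltac:(lra) Rlt_0_1) as [ht _].
    unfold sigma_c2 in s1.
    (* Read off from 0 < sigma2 <= [sigma_c2]: if q_1 were 0, [sigma_c2] would be 0 because [/ 0] is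
       0, and a negative q_1 would make it negative. *)
    assert (hq : 0 < q_m a 1).
    { apply Rnot_le_lt; intros hq; destruct (Req_dec (q_m a 1) 0) as [e|e].
      - rewrite e, Rmult_0_r in s1; unfold Rdiv in s1; rewrite Rinv_0 in s1; lra.
      - assert (h : c_T a phin * q_m a 1 < 0) by nra.
        apply Rinv_lt_0_compat in h; unfold Rdiv in s1; nra. }
    assert (hcq : 0 < c_T a phin * q_m a 1) by now apply Rmult_lt_0_compat.
    apply (Rmult_le_compat_r (c_T a phin * q_m a 1)) in s1; [|lra].
    replace (tau a 1 / (c_T a phin * q_m a 1) * (c_T a phin * q_m a 1)) with (tau a 1) in s1
      by (field; lra).
    lra.
  - assert (hM : 2 <= INR m) by (change 2 with (INR 2); apply le_INR; lia).
    set (M := INR m) in *; clearbody M; clear hm hm2 m s1 hsafe.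
    destruct (C_alpha_spec a ltac:(lra)) as [hC _].
    destruct (tau_spec a M ltac:(lra) ltac:(lra)) as [ht e].
    assert (g := gamma_m_bounds a M ltac:(lra) ltac:(lra)).
    assert (b1 := S1_ge a (tau a M) ltac:(lra) ht).
    assert (b2 := S1_sub_S2_le a (tau a M) ltac:(lra) ht).
    rewrite e in b1, b2.
    assert (e2 : Sj a 2 (tau a M) = M * gamma_m a M) by (rewrite gamma_m_eq; field; lra).
    rewrite e2 in b2.
    set (t := tau a M) in *; set (gm := gamma_m a M) in *; set (C := C_alpha a) in *.
    set (D := M + 1 + a / 4).
    assert (hq : q_m a M <= ((2 - a) * M + 2 + a / 2) / D).
    { rewrite q_m_alt by lra; fold gm.
      assert (a * M / D <= / (1 - gm)); [|replace (((2 - a) * M + 2 + a / 2) / D) with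
        (2 - a * M / D) by (unfold D; field; lra); lra].
      apply Rmult_le_reg_r with ((1 - gm) * D); [apply Rmult_lt_0_compat; unfold D; lra|].
      replace (a * M / D * ((1 - gm) * D)) with (a * (M - M * gm)) by (unfold D; field; lra).
      replace (/ (1 - gm) * ((1 - gm) * D)) with D by (field; lra).
      unfold D; lra. }
    assert (hD : 0 < D) by (unfold D; lra).
    set (Q := (2 - a) * M + 2 + a / 2) in *.
    assert (hsc : 0 < sigma2 * c_T a phin) by now apply Rmult_lt_0_compat.
    (* If [Q <= 0] then q_m <= 0, and both terms of [G_m] are nonpositive. *)
    destruct (Rle_dec Q 0) as [hQ|hQ].
    { assert (Q / D <= 0) by (apply Rle_div_l; lra).
      assert (q_m a M <= 0) by lra.
      assert (0 <= M * t) by (apply Rmult_le_pos; lra); nra. }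
    assert (tl : rpow C a * Rpower (M + 1) (- a) <= t).
    { assert (h1 : rpow t (- / a) <= (M + 1) / C) by (apply Rle_div_r; lra).
      assert (h2 := rpow_gt0 t (- / a) ht).
      assert (h3 := rpow_neg_le a (rpow t (- / a)) ((M + 1) / C) ltac:(lra) (conj h2 h1)).
      replace (rpow (rpow t (- / a)) (- a)) with t in h3.
      - eapply Rle_trans; [|exact h3]; right.
        assert (0 < (M + 1) / C) by (apply Rdiv_lt_0_compat; lra).
        rewrite !rpow_pos by easy.
        rewrite (Rpower_Ropp ((M + 1) / C)), Rpower_Ropp.
        unfold Rdiv; rewrite <- Rpower_mult_distr by (try apply Rinv_0_lt_compat; lra).
        assert (e3 : Rpower (/ C) a = / Rpower C a).
        { rewrite <- Rpower_Ropp; unfold Rpower; rewrite ln_Rinv by easy; f_equal; ring. }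
        rewrite e3, Rinv_mult, Rinv_inv; ring.
      - rewrite (rpow_pos _ (- a)) by easy; rewrite rpow_pos, Rpower_mult by easy.
        replace (- / a * - a) with 1 by (field; lra); now rewrite Rpower_1. }
    assert (R0 := safe_ratio a M ha hM ltac:(unfold Q in hQ; lra)); fold Q in R0; fold D in R0.
    assert (hCa : 0 < rpow C a) by now apply rpow_gt0.
    assert (s3 : sigma2 * c_T a phin <= rpow C a * ((12 + a) / (3 * (4 - a)) * Rpower 3 (- a))).
    { apply (Rmult_le_compat_r (c_T a phin)) in s2; [|lra].
      eapply Rle_trans; [exact s2|]; right.
      rewrite rpow_pos, Rpower_Ropp by easy; fold C.
      rewrite (Rpower_plus a 1), Rpower_1 by lra.
      assert (h := Rpower_pos 3 a); field; repeat split; lra. }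
    assert (q_m a M * (sigma2 * c_T a phin) <= Q / D * (sigma2 * c_T a phin))
      by (apply Rmult_le_compat_r; lra).
    assert (hQD : 0 < Q / D) by (apply Rdiv_lt_0_compat; lra).
    assert (Q / D * (sigma2 * c_T a phin) <= Q / D * (rpow C a * ((12 + a) / (3 * (4 - a)) * Rpower 3 (- a))))
      by (apply Rmult_le_compat_l; lra).
    assert (Q / D * (rpow C a * ((12 + a) / (3 * (4 - a)) * Rpower 3 (- a))) <=
      Q / D * (rpow C a * (M * D / Q * Rpower (M + 1) (- a)))).
    { apply Rmult_le_compat_l; [lra|]; apply Rmult_le_compat_l; lra. }
    replace (Q / D * (rpow C a * (M * D / Q * Rpower (M + 1) (- a)))) with
      (M * (rpow C a * Rpower (M + 1) (- a))) in H1 by (field; lra).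
    assert (M * (rpow C a * Rpower (M + 1) (- a)) <= M * t) by (apply Rmult_le_compat_l; lra).
    lra.
Qed.

(** * The closed form of C_alpha *)

Lemma sin_add_INR_PI (x : R) (k : nat) : sin (x + INR k * PI) = (-1) ^ k * sin x.
Proof.
  induction k as [|k IH]; [simpl; rewrite Rmult_0_l, Rplus_0_r; ring|].
  rewrite S_INR; replace (x + (INR k + 1) * PI) with (x + INR k * PI + PI) by ring.
  rewrite neg_sin, IH; simpl; ring.
Qed.

Lemma pow_m1_sqr (k : nat) : (-1) ^ k * (-1) ^ k = 1.
Proof. rewrite <- Rpow_mult_distr; replace (-1 * -1) with 1 by ring; apply pow1. Qed.

Lemma sin_sub_INR_PI (x : R) (k : nat) : sin (x - INR k * PI) = (-1) ^ k * sin x.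
Proof.
  assert (h := sin_add_INR_PI (x - INR k * PI) k).
  replace (x - INR k * PI + INR k * PI) with x in h by ring.
  rewrite h, <- Rmult_assoc, pow_m1_sqr; ring.
Qed.

Lemma RInt_ssum (f : nat -> R -> R) (a b : R) (N : nat) :
  (forall i, (1 <= i)%nat -> ex_RInt (f i) a b) ->
  ex_RInt (fun x => ssum (fun i => f i x) N) a b /\
  RInt (fun x => ssum (fun i => f i x) N) a b = ssum (fun i => RInt (f i) a b) N.
Proof.
  intros h; induction N as [|N [IH1 IH2]].
  - split.
    + apply ex_RInt_ext with (fun _ => 0); [intros; now rewrite ssum_0|apply ex_RInt_const].
    + rewrite ssum_0, (RInt_ext _ (fun _ => 0)) by (intros; now rewrite ssum_0).
      rewrite RInt_const_R; toR; ring.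
  - assert (hN := h (S N) ltac:(lia)); split.
    + apply ex_RInt_ext with (fun x => ssum (fun i => f i x) N + f (S N) x);
        [intros; now rewrite ssum_S|].
      apply (ex_RInt_plus (fun x => ssum (fun i => f i x) N) (f (S N))); easy.
    + rewrite ssum_S, (RInt_ext _ (fun x => ssum (fun i => f i x) N + f (S N) x))
        by (intros; now rewrite ssum_S).
      rewrite RInt_plus_R by easy; rewrite IH2; reflexivity.
Qed.

Definition dirichlet (N : nat) (x : R) : R := / 2 + ssum (fun k => cos (INR k * x)) N.

Lemma dirichlet_eq (N : nat) (x : R) : 2 * sin (x / 2) * dirichlet N x = sin ((INR N + / 2) * x).
Proof.
  unfold dirichlet; induction N as [|N IH].
  - rewrite ssum_0; simpl INR; replace ((0 + / 2) * x) with (x / 2) by field; field.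
  - rewrite ssum_S, <- Rplus_assoc, Rmult_plus_distr_l, IH, S_INR.
    replace ((INR N + / 2) * x) with ((INR N + 1) * x - x / 2) by field.
    replace ((INR N + 1 + / 2) * x) with ((INR N + 1) * x + x / 2) by field.
    rewrite sin_minus, sin_plus; ring.
Qed.

Lemma cont_cos (f : R -> R) (x : R) : continuous f x -> continuous (fun x => cos (f x)) x.
Proof.
  intros h; apply (continuous_comp f cos); [easy|].
  apply continuity_pt_filterlim, continuity_cos.
Qed.

Lemma cont_sin (f : R -> R) (x : R) : continuous f x -> continuous (fun x => sin (f x)) x.
Proof.
  intros h; apply (continuous_comp f sin); [easy|].
  apply continuity_pt_filterlim, continuity_sin.
Qed.

Ltac contt := intros; repeat first [cont1 | match goal with
  | |- continuous (fun x => cos (@?f x)) _ => apply (cont_cos f)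
  | |- continuous (fun x => sin (@?f x)) _ => apply (cont_sin f)
  | |- continuous (Rmult ?c) ?x => change (continuous (fun y => c * y) x) end].

(** Partial sum of the expansion of pi / sin(pi z) in simple fractions. *)
Definition csc_sum (z : R) (N : nat) : R :=
  / z + ssum (fun k => (-1) ^ k * (/ (z + INR k) + / (z - INR k))) N.

Lemma INR_ge1 (k : nat) : (1 <= k)%nat -> 1 <= INR k.
Proof. intros h; change 1 with (INR 1); now apply le_INR. Qed.

(** The factor 1 - cos(z x) vanishes at 0, where the Dirichlet kernel concentrates, and its cosine
    coefficients on [0, PI] are the simple fractions of [csc_sum]. *)
Lemma RInt_dirichlet (z : R) (N : nat) : 0 < z < 1 ->
  RInt (fun x => (1 - cos (z * x)) * dirichlet N x) 0 PI = PI / 2 - sin (PI * z) / 2 * csc_sum z N.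
Proof.
  intros hz.
  assert (e0 : RInt (fun x => / 2 * (1 - cos (z * x))) 0 PI = PI / 2 - sin (PI * z) / 2 * / z).
  { rewrite (RInt_ftc (fun x => / 2 * (x - sin (z * x) / z))).
    - rewrite Rmult_0_r, sin_0, (Rmult_comm z PI); toR; field; lra.
    - intros x; auto_derive; [lra|field; lra].
    - contt. }
  assert (ek : forall k, (1 <= k)%nat -> RInt (fun x => cos (INR k * x) * (1 - cos (z * x))) 0 PI
     = - (sin (PI * z) / 2) * ((-1) ^ k * (/ (z + INR k) + / (z - INR k)))).
  { intros k hk; assert (h1 := INR_ge1 k hk).
    rewrite (RInt_ftc (fun x => sin (INR k * x) / INR k
      - / 2 * (sin ((z + INR k) * x) / (z + INR k) + sin ((z - INR k) * x) / (z - INR k)))).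
    - replace (INR k * PI) with (0 + INR k * PI) by ring.
      replace ((z + INR k) * PI) with (PI * z + INR k * PI) by ring.
      replace ((z - INR k) * PI) with (PI * z - INR k * PI) by ring.
      rewrite !sin_add_INR_PI, sin_sub_INR_PI, !Rmult_0_r, sin_0; toR; field; lra.
    - intros x; auto_derive; [repeat split; lra|].
      replace ((z + INR k) * x) with (z * x + INR k * x) by ring.
      replace ((z - INR k) * x) with (z * x - INR k * x) by ring.
      rewrite cos_plus, cos_minus; field; lra.
    - contt. }
  assert (exk : forall k, (1 <= k)%nat -> ex_RInt (fun x => cos (INR k * x) * (1 - cos (z * x))) 0 PI).
  { intros; apply ex_RInt_cont; contt. }
  destruct (RInt_ssum (fun k x => cos (INR k * x) * (1 - cos (z * x))) 0 PI N exk) as [h1 h2].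
  rewrite (RInt_ext _ (fun x => / 2 * (1 - cos (z * x)) +
     ssum (fun k => cos (INR k * x) * (1 - cos (z * x))) N)).
  - rewrite RInt_plus_R, e0, h2; [|apply ex_RInt_cont; contt|easy].
    rewrite (ssum_ext _ (fun k => - (sin (PI * z) / 2) * ((-1) ^ k * (/ (z + INR k) + / (z - INR k)))))
      by (intros; apply ek; lia).
    rewrite ssum_scal; unfold csc_sum; toR; ring.
  - intros x _; unfold dirichlet; toR.
    rewrite (ssum_ext (fun k => cos (INR k * x) * (1 - cos (z * x)))
      (fun k => (1 - cos (z * x)) * cos (INR k * x))) by (intros; ring).
    rewrite ssum_scal; ring.
Qed.

Lemma sin_ge_half (y : R) : 0 <= y <= 1 -> y / 2 <= sin y.
Proof.
  intros hy.
  assert (h : sin 0 - 0 / 2 <= sin y - y / 2); [|rewrite sin_0 in h; lra].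
  apply (incr_of_derive (fun y => sin y - y / 2) (fun y => cos y - / 2)); [lra| |].
  - intros x _; auto_derive; [easy|field].
  - intros x hx; assert (hp := PI2_3_2).
    assert (cos (PI / 3) <= cos x); [|rewrite cos_PI3 in H; lra].
    apply cos_decr_1; lra.
Qed.

Lemma one_sub_cos_le (u : R) : 0 <= u -> 0 <= 1 - cos u <= u ^ 2 / 2.
Proof.
  intros hu; split; [assert (h := COS_bound u); lra|].
  replace u with (2 * (u / 2)) at 1 by field; rewrite cos_2a_sin.
  destruct (Req_dec u 0) as [->|h0]; [unfold Rdiv; rewrite Rmult_0_l, sin_0; lra|].
  assert (h1 := sin_lt_x (u / 2) ltac:(lra)).
  assert (h2 : - (u / 2) < sin (u / 2)).
  { destruct (Rle_dec (u / 2) PI) as [h|h].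
    - assert (0 <= sin (u / 2)) by (apply sin_ge_0; lra); lra.
    - assert (q := SIN_bound (u / 2)); assert (r := PI2_3_2); lra. }
  nra.
Qed.

(** Near 0 the integrand is at most x in absolute value, since 1 - cos(z x) <= x^2 / 2 and the
    kernel is at most 1 / (2 sin(x / 2)) <= 2 / x. Away from 0 one integration by parts gains the
    factor 1 / (N + 1/2). *)
Lemma riemann_lebesgue_dirichlet (z : R) : 0 < z < 1 ->
  is_lim_seq (fun N => RInt (fun x => (1 - cos (z * x)) * dirichlet N x) 0 PI) 0.
Proof.
  intros hz; apply is_lim_seq_eps; intros e he.
  assert (hpi := PI2_3_2).
  set (d := Rmin 1 (e / 2)).
  assert (hd : 0 < d <= 1 /\ d <= e / 2).
  { unfold d; repeat split; [apply Rmin_pos; lra|apply Rmin_l|apply Rmin_r]. }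
  set (phi := fun x => (1 - cos (z * x)) / (2 * sin (x / 2))).
  set (dphi := fun x => (z * sin (z * x) * (2 * sin (x / 2)) - (1 - cos (z * x)) * cos (x / 2))
      / (2 * sin (x / 2)) ^ 2).
  assert (hsin : forall x, d <= x <= PI -> 0 < sin (x / 2)) by (intros; apply sin_gt_0; lra).
  assert (dp : forall x, d <= x <= PI -> is_derive phi x (dphi x)).
  { intros x hx; specialize (hsin x hx); unfold phi, dphi; auto_derive.
    - unfold Rdiv in *; repeat split; lra.
    - unfold Rdiv in *; field; lra. }
  assert (dc : forall x, d <= x <= PI -> continuous dphi x).
  { intros x hx; specialize (hsin x hx); unfold dphi.
    apply cont_div; [contt; lra|contt; lra|apply Rgt_not_eq, pow_lt; lra]. }
  set (K := Rabs (phi PI) + Rabs (phi d) + RInt (fun x => Rabs (dphi x)) d PI).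
  assert (exd : ex_RInt (fun x => Rabs (dphi x)) d PI).
  { apply ex_RInt_cont_loc; rewrite Rmin_left, Rmax_right by lra; intros x hx.
    apply (continuous_comp dphi Rabs); [now apply dc|apply continuous_Rabs]. }
  assert (part : forall N, Rabs (RInt (fun x => (1 - cos (z * x)) * dirichlet N x) d PI)
     <= K / (INR N + / 2)).
  { intros N; set (M := INR N + / 2); assert (hM : 0 < M) by (unfold M; assert (h := pos_INR N); lra).
    assert (e1 : RInt (fun x => (1 - cos (z * x)) * dirichlet N x) d PI
       = RInt (fun x => phi x * sin (M * x)) d PI).
    { apply RInt_ext; rewrite Rmin_left, Rmax_right by lra; intros x hx.
      specialize (hsin x ltac:(lra)); unfold M; rewrite <- dirichlet_eq; unfold phi; toR; field; lra. }
    assert (ca : forall x, d <= x <= PI -> continuous (fun x => dphi x * cos (M * x)) x).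
    { intros x hx; apply cont_mult; [now apply dc|contt]. }
    assert (cb : forall x, d <= x <= PI -> continuous (fun x => phi x * sin (M * x)) x).
    { intros x hx; apply cont_mult; [|contt].
      apply (ex_derive_continuous (K:=R_AbsRing) (V:=R_NormedModule)); eexists; now apply dp. }
    assert (exa : ex_RInt (fun x => dphi x * cos (M * x)) d PI)
      by (apply ex_RInt_cont_loc; rewrite Rmin_left, Rmax_right by lra; exact ca).
    assert (exb : ex_RInt (fun x => phi x * sin (M * x)) d PI)
      by (apply ex_RInt_cont_loc; rewrite Rmin_left, Rmax_right by lra; exact cb).
    assert (e2 : RInt (fun x => dphi x * cos (M * x) - M * (phi x * sin (M * x))) d PI
       = phi PI * cos (M * PI) - phi d * cos (M * d)).
    { apply is_RInt_unique, (is_RInt_derive (fun x => phi x * cos (M * x))).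
      - rewrite Rmin_left, Rmax_right by lra; intros x hx; evar_last.
        + apply (is_derive_mult phi (fun x => cos (M * x)));
            [now apply dp| |intros; apply Rmult_comm].
          instantiate (1 := - M * sin (M * x)); auto_derive; [easy|ring].
        + unfold plus, mult; simpl; ring.
      - rewrite Rmin_left, Rmax_right by lra; intros x hx; apply cont_minus; [now apply ca|].
        apply cont_mult; [apply continuous_const|now apply cb]. }
    rewrite RInt_minus_R in e2; [|easy|apply (ex_RInt_scal (V := R_NormedModule) _ d PI M exb)].
    rewrite RInt_scal_R in e2 by easy.
    rewrite e1.
    assert (e3 : M * RInt (fun x => phi x * sin (M * x)) d PI =
      RInt (fun x => dphi x * cos (M * x)) d PI + - (phi PI * cos (M * PI)) + phi d * cos (M * d)) by lra.
    apply Rle_div_r; [easy|].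
    assert (e4 : forall v, Rabs v * M = Rabs (M * v))
      by (intros; rewrite Rabs_mult, (Rabs_pos_eq M) by lra; ring).
    rewrite e4, e3.
    assert (cb1 : forall u v, Rabs (v * cos u) <= Rabs v).
    { intros u v; rewrite Rabs_mult; assert (q := COS_bound u).
      assert (Rabs (cos u) <= 1) by (apply Rabs_le; lra).
      assert (r := Rabs_pos v); nra. }
    assert (b3 : Rabs (RInt (fun x => dphi x * cos (M * x)) d PI) <= RInt (fun x => Rabs (dphi x)) d PI).
    { eapply Rle_trans; [apply abs_RInt_le; [lra|easy]|].
      apply RInt_le; [lra| |easy|intros; apply cb1].
      apply ex_RInt_cont_loc; rewrite Rmin_left, Rmax_right by lra; intros x hx.
      apply (continuous_comp (fun x => dphi x * cos (M * x)) Rabs); [now apply ca|apply continuous_Rabs]. }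
    eapply Rle_trans; [apply Rabs_triang|].
    assert (q := Rabs_triang (RInt (fun x => dphi x * cos (M * x)) d PI) (- (phi PI * cos (M * PI)))).
    rewrite Rabs_Ropp in q.
    assert (q1 := cb1 (M * PI) (phi PI)); assert (q2 := cb1 (M * d) (phi d)); unfold K; lra. }
  assert (cD : forall N x, continuous (fun x => (1 - cos (z * x)) * dirichlet N x) x).
  { intros N x; apply cont_mult; [contt|].
    unfold dirichlet; apply cont_plus; [apply continuous_const|].
    apply (continuous_ssum (fun k x => cos (INR k * x))); contt. }
  assert (near : forall N, Rabs (RInt (fun x => (1 - cos (z * x)) * dirichlet N x) 0 d) <= d * d).
  { intros N; replace (d * d) with ((d - 0) * d) by ring.
    apply abs_RInt_le_const; [lra|now apply ex_RInt_cont|].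
    intros x hx; destruct (Req_dec x 0) as [->|h0].
    - rewrite Rmult_0_r, cos_0, Rminus_diag, Rmult_0_l, Rabs_R0; lra.
    - assert (s1 := sin_ge_half (x / 2) ltac:(lra)).
      assert (s2 := one_sub_cos_le (z * x) ltac:(apply Rmult_le_pos; lra)).
      assert (s3 := dirichlet_eq N x); assert (s4 := SIN_bound ((INR N + / 2) * x)).
      rewrite Rabs_mult, (Rabs_pos_eq (1 - cos (z * x))) by lra.
      assert (s5 : 2 * sin (x / 2) * Rabs (dirichlet N x) <= 1).
      { rewrite <- (Rabs_pos_eq (2 * sin (x / 2))) by lra; rewrite <- Rabs_mult, s3.
        apply Rabs_le; lra. }
      assert (s6 := Rabs_pos (dirichlet N x)).
      assert (s7 : x / 2 * Rabs (dirichlet N x) <= 1) by nra.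
      assert ((z * x) ^ 2 <= x ^ 2) by (apply pow_incr; split; nra).
      apply Rle_trans with (x ^ 2 / 2 * Rabs (dirichlet N x)).
      + apply Rmult_le_compat_r; lra.
      + replace (x ^ 2 / 2 * Rabs (dirichlet N x)) with (x * (x / 2 * Rabs (dirichlet N x))) by field.
        nra. }
  assert (lK : is_lim_seq (fun N => K / (INR N + / 2)) 0).
  { replace (Finite 0) with (Finite (K * 0)) by (f_equal; ring).
    apply is_lim_seq_mult'; [apply is_lim_seq_const|].
    apply (is_lim_seq_inv _ p_infty); [|discriminate].
    apply (is_lim_seq_plus _ _ p_infty (/ 2) p_infty); [apply is_lim_seq_INR|apply is_lim_seq_const|reflexivity]. }
  apply is_lim_seq_eps with (e := e / 2) in lK; [|lra].
  revert lK; apply filter_imp; intros N hN.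
  rewrite Rminus_0_r in *; rewrite (RInt_Chasles_R _ 0 d PI) by (apply ex_RInt_cont, cD).
  eapply Rle_lt_trans; [apply Rabs_triang|].
  specialize (near N); specialize (part N); assert (q := Rle_abs (K / (INR N + / 2))).
  assert (d * d <= d) by nra; lra.
Qed.

Lemma csc_sum_limit (z : R) : 0 < z < 1 -> is_lim_seq (fun N => sin (PI * z) * csc_sum z N) PI.
Proof.
  intros hz; assert (h := riemann_lebesgue_dirichlet z hz).
  apply is_lim_seq_ext with (fun N => PI - 2 * RInt (fun x => (1 - cos (z * x)) * dirichlet N x) 0 PI).
  - intros N; rewrite RInt_dirichlet by easy; field.
  - replace (Finite PI) with (Finite (PI - 2 * 0)) by (f_equal; ring).
    apply is_lim_seq_minus'; [apply is_lim_seq_const|].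
    apply is_lim_seq_mult'; [apply is_lim_seq_const|easy].
Qed.

Lemma geometric_inv (y : R) (N : nat) : 0 <= y ->
  / (1 + y) = 1 + ssum (fun k => (-1) ^ k * y ^ k) N + (-1) ^ (S N) * (y ^ (S N) / (1 + y)).
Proof.
  intros hy; induction N as [|N IH].
  - rewrite ssum_0; simpl; field; lra.
  - rewrite IH, ssum_S; simpl; field; lra.
Qed.

Lemma rpow_pow (x b : R) (k : nat) : 0 < x -> rpow x b ^ k = rpow x (INR k * b).
Proof.
  intros hx; rewrite !rpow_pos by easy.
  rewrite <- Rpower_pow by apply Rpower_pos; rewrite Rpower_mult; f_equal; ring.
Qed.

Lemma pow_m1_abs (k : nat) : Rabs ((-1) ^ k) = 1.
Proof. apply pow_1_abs. Qed.

(** Finite geometric expansion of 1 / (1 + x^a), integrated term by term; the remainder is at most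
    the integral of x^(a (N + 1)). *)
Lemma RInt_0_1_alternating (a : R) (N : nat) : 1 < a ->
  Rabs (Iint a 1 - (1 + ssum (fun k => (-1) ^ k * / (a * INR k + 1)) N)) <= / (a * INR (S N) + 1).
Proof.
  intros ha.
  set (y := fun x => rpow x a).
  assert (cy : forall x, continuous y x) by (intros; unfold y; cont).
  assert (pw : forall k, (1 <= k)%nat -> RInt (fun x => y x ^ k) 0 1 = / (a * INR k + 1)).
  { intros k hk; assert (hk1 := INR_ge1 k hk).
    rewrite (RInt_ext _ (fun x => rpow x (INR k * a))).
    - rewrite RInt_rpow, rpow_1_l by nra; unfold Rdiv; rewrite Rmult_1_l; f_equal; ring.
    - intros x hx; rewrite Rmin_left, Rmax_right in hx by lra; unfold y; apply rpow_pow; lra. }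
  destruct (RInt_ssum (fun k x => (-1) ^ k * y x ^ k) 0 1 N) as [h1 h2].
  { intros; apply ex_RInt_cont; cont. }
  assert (cr : forall x, continuous (fun x => (-1) ^ S N * (y x ^ S N / (1 + y x))) x).
  { intros; apply cont_mult; [apply continuous_const|]; apply cont_div; cont.
    unfold y; apply Rgt_not_eq; assert (h := rpow_ge0 x a); lra. }
  assert (e : Iint a 1 = 1 + ssum (fun k => (-1) ^ k * / (a * INR k + 1)) N
     + RInt (fun x => (-1) ^ S N * (y x ^ S N / (1 + y x))) 0 1).
  { unfold Iint; rewrite (RInt_ext _ (fun x => 1 + ssum (fun k => (-1) ^ k * y x ^ k) N
       + (-1) ^ S N * (y x ^ S N / (1 + y x)))).
    - rewrite !RInt_plus_R, RInt_const_R, h2.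
      + rewrite (ssum_ext (fun i => RInt (fun x => (-1) ^ i * y x ^ i) 0 1)
          (fun k => (-1) ^ k * / (a * INR k + 1))).
        * toR; ring.
        * intros k hk; rewrite RInt_scal_R, pw by (lia || (apply ex_RInt_cont; cont)); easy.
      + apply ex_RInt_const.
      + easy.
      + apply (ex_RInt_plus (fun _ => 1) (fun x => ssum (fun k => (-1) ^ k * y x ^ k) N));
          [apply ex_RInt_const|easy].
      + now apply ex_RInt_cont.
    - intros x _; unfold bfun; rewrite Rmult_1_l; apply geometric_inv, rpow_ge0. }
  assert (sub : forall u v : R, u + v - u = v) by (intros; ring).
  rewrite e, sub.
  rewrite RInt_scal_R.
  2: { apply ex_RInt_cont; intros; apply cont_div; cont.
       unfold y; apply Rgt_not_eq; assert (h := rpow_ge0 x a); lra. }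
  rewrite Rabs_mult, pow_m1_abs, Rmult_1_l, <- pw by lia.
  assert (q : forall x, 0 <= y x ^ S N / (1 + y x) <= y x ^ S N).
  { intros x; unfold y; assert (h := rpow_ge0 x a).
    assert (h' : 0 <= rpow x a ^ S N) by now apply pow_le.
    split; [apply Rle_mult_inv_pos; lra|apply Rle_div_l; nra]. }
  assert (cq : forall x, continuous (fun x => y x ^ S N / (1 + y x)) x).
  { intros; apply cont_div; cont; unfold y; apply Rgt_not_eq; assert (h := rpow_ge0 x a); lra. }
  rewrite Rabs_pos_eq.
  - apply RInt_le01; [easy|cont|intros; apply q].
  - apply RInt_ge_0; [lra|now apply ex_RInt_cont|intros; apply q].
Qed.

Lemma RInt_neg_rpow (b X : R) : 1 < b -> 1 <= X ->
  is_RInt (fun x => rpow x (- b)) 1 X ((1 - rpow X (1 - b)) / (b - 1)).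
Proof.
  intros hb hX; evar_last.
  - apply (is_RInt_derive (fun x => - / (b - 1) * rpow x (1 - b)) (fun x => rpow x (- b))).
    + rewrite Rmin_left, Rmax_right by easy; intros x hx; evar_last.
      * apply (is_derive_scal (fun x => rpow x (1 - b))), is_derive_rpow_pos; lra.
      * change (- / (b - 1) * ((1 - b) * rpow x (1 - b - 1)) = rpow x (- b)).
        replace (1 - b - 1) with (- b) by ring; field; lra.
    + rewrite Rmin_left, Rmax_right by easy; intros x hx.
      apply (ex_derive_continuous (K:=R_AbsRing) (V:=R_NormedModule)); eexists.
      apply is_derive_rpow_pos; lra.
  - rewrite rpow_1_l; unfold minus, plus, opp; simpl; field; lra.
Qed.

(** Beyond 1 the expansion is in w = x^(-a): 1 / (1 + x^a) = 1 - 1 / (1 + w) has no constant term,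
    so every power that occurs is integrable at infinity. *)
Lemma RInt_1_X_alternating (a X : R) (N : nat) : 1 < a -> 1 <= X ->
  Rabs (RInt (bfun a 1) 1 X
    + ssum (fun k => (-1) ^ k * ((1 - rpow X (1 - a * INR k)) / (a * INR k - 1))) N)
  <= / (a * INR (S N) - 1).
Proof.
  intros ha hX.
  set (w := fun x => rpow x (- a)).
  assert (cw : forall x, 1 <= x <= X -> continuous w x).
  { intros x hx; apply (ex_derive_continuous (K:=R_AbsRing) (V:=R_NormedModule)); eexists.
    apply is_derive_rpow_pos; lra. }
  assert (akb : forall k, (1 <= k)%nat -> 1 < a * INR k)
    by (intros k hk; assert (h := INR_ge1 k hk); nra).
  assert (pw : forall k, (1 <= k)%nat ->
    is_RInt (fun x => w x ^ k) 1 X ((1 - rpow X (1 - a * INR k)) / (a * INR k - 1))).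
  { intros k hk; apply is_RInt_ext with (fun x => rpow x (- (a * INR k))).
    - intros x hx; rewrite Rmin_left, Rmax_right in hx by easy.
      unfold w; rewrite rpow_pow by lra; f_equal; ring.
    - apply RInt_neg_rpow; [now apply akb|easy]. }
  assert (exk : forall k, (1 <= k)%nat -> ex_RInt (fun x => w x ^ k) 1 X)
    by (intros k hk; eexists; now apply pw).
  destruct (RInt_ssum (fun k x => (-1) ^ k * w x ^ k) 1 X N) as [h1 h2].
  { intros k hk; apply (ex_RInt_scal (V := R_NormedModule) (fun x => w x ^ k)), exk, hk. }
  assert (cq : ex_RInt (fun x => w x ^ S N / (1 + w x)) 1 X).
  { apply ex_RInt_cont_loc; rewrite Rmin_left, Rmax_right by easy; intros x hx.
    apply cont_div; [apply cont_pow; now apply cw|apply cont_plus; [apply continuous_const|now apply cw]|].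
    unfold w; apply Rgt_not_eq; assert (h := rpow_ge0 x (- a)); lra. }
  assert (e : RInt (bfun a 1) 1 X =
    -1 * ssum (fun k => (-1) ^ k * ((1 - rpow X (1 - a * INR k)) / (a * INR k - 1))) N
    + (-1 * (-1) ^ S N) * RInt (fun x => w x ^ S N / (1 + w x)) 1 X).
  { rewrite (RInt_ext _ (fun x => -1 * ssum (fun k => (-1) ^ k * w x ^ k) N
       + (-1 * (-1) ^ S N) * (w x ^ S N / (1 + w x)))).
    - rewrite RInt_plus_R, !RInt_scal_R, h2; try easy.
      + f_equal; f_equal; apply ssum_ext; intros k hk.
        rewrite RInt_scal_R by (apply exk; lia); f_equal; apply is_RInt_unique, pw; lia.
      + apply (ex_RInt_scal (V := R_NormedModule) (fun x => ssum (fun k => (-1) ^ k * w x ^ k) N)), h1.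
      + apply (ex_RInt_scal (V := R_NormedModule) (fun x => w x ^ S N / (1 + w x))), cq.
    - intros x hx; rewrite Rmin_left, Rmax_right in hx by easy.
      assert (hw : 0 < w x) by (apply rpow_gt0; lra).
      assert (g := geometric_inv (w x) N ltac:(lra)).
      transitivity (1 - / (1 + w x)); [|toR; lra].
      unfold bfun; rewrite Rmult_1_l.
      assert (e1 : rpow x a * w x = 1).
      { unfold w; rewrite <- rpow_plus, Rplus_opp_r, rpow_pos, Rpower_O; lra. }
      assert (hy : 0 < rpow x a) by (apply rpow_gt0; lra).
      replace (w x) with (/ rpow x a) by (apply Rmult_eq_reg_l with (rpow x a); [rewrite e1; field|]; lra).
      toR; field; lra. }
  assert (sub : forall u v : R, -1 * u + v + u = v) by (intros; ring).
  rewrite e, sub.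
  rewrite !Rabs_mult, pow_m1_abs, (Rabs_left (-1)) by lra.
  replace (- -1 * 1) with 1 by ring; rewrite Rmult_1_l.
  assert (q : forall x, 0 < x -> 0 <= w x ^ S N / (1 + w x) <= w x ^ S N).
  { intros x hx; unfold w; assert (h := rpow_ge0 x (- a)).
    assert (h' : 0 <= rpow x (- a) ^ S N) by now apply pow_le.
    split; [apply Rle_mult_inv_pos; lra|apply Rle_div_l; nra]. }
  rewrite Rabs_pos_eq.
  - apply Rle_trans with (RInt (fun x => w x ^ S N) 1 X).
    + apply RInt_le; [easy|easy|apply exk; lia|intros; apply q; lra].
    + rewrite (is_RInt_unique _ _ _ _ (pw (S N) ltac:(lia))).
      assert (h := akb (S N) ltac:(lia)); assert (h' := rpow_ge0 X (1 - a * INR (S N))).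
      unfold Rdiv; rewrite <- (Rmult_1_l (/ (a * INR (S N) - 1))) at 2.
      apply Rmult_le_compat_r; [apply Rlt_le, Rinv_0_lt_compat; lra|lra].
  - apply RInt_ge_0; [easy|easy|intros; apply q; lra].
Qed.

(** The two expansions combine because 1 / (a k + 1) - 1 / (a k - 1) is 1 / a times the k-th pair of
    fractions in [csc_sum] at z = 1 / a. *)
Lemma C_alpha_csc_sum (a : R) (N : nat) : 1 < a ->
  Rabs (C_alpha a - / a * csc_sum (/ a) N) <= / (a * INR (S N) + 1) + / (a * INR (S N) - 1).
Proof.
  intros ha; destruct (C_alpha_spec a ha) as [hC [hle hlim]].
  set (S1 := 1 + ssum (fun k => (-1) ^ k * / (a * INR k + 1)) N).
  set (S2 := fun X => ssum (fun k => (-1) ^ k * ((1 - rpow X (1 - a * INR k)) / (a * INR k - 1))) N).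
  set (S2' := ssum (fun k => (-1) ^ k * ((1 - 0) / (a * INR k - 1))) N).
  assert (akb : forall k, (1 <= k)%nat -> 1 < a * INR k)
    by (intros k hk; assert (h := INR_ge1 k hk); nra).
  assert (b : forall X, 1 <= X ->
    Rabs (Iint a X - S1 + S2 X) <= / (a * INR (S N) + 1) + / (a * INR (S N) - 1)).
  { intros X hX; assert (h1 := RInt_0_1_alternating a N ha); assert (h2 := RInt_1_X_alternating a X N ha hX).
    unfold Iint at 1; rewrite (RInt_Chasles_R _ 0 1 X) by (apply ex_RInt_cont; contb).
    fold (Iint a 1); fold S1 in h1; fold (S2 X) in h2.
    replace (Iint a 1 + RInt (bfun a 1) 1 X - S1 + S2 X) with
      ((Iint a 1 - S1) + (RInt (bfun a 1) 1 X + S2 X)) by (toR; ring).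
    eapply Rle_trans; [apply Rabs_triang|]; lra. }
  assert (e : / a * csc_sum (/ a) N = S1 - S2').
  { unfold csc_sum, S1, S2'; rewrite Rmult_plus_distr_l, Rinv_inv, Rinv_l, <- ssum_scal by lra.
    assert (es : ssum (fun i => / a * ((-1) ^ i * (/ (/ a + INR i) + / (/ a - INR i)))) N
      = ssum (fun k => (-1) ^ k * / (a * INR k + 1)) N
        - ssum (fun k => (-1) ^ k * ((1 - 0) / (a * INR k - 1))) N); [|rewrite es; ring].
    rewrite <- ssum_minus; apply ssum_ext; intros k hk.
    assert (h := akb k ltac:(lia)).
    field; repeat split; try lra; nra. }
  rewrite e.
  apply (is_lim_seq_le_loc (fun p => Rabs (Iint a (INR p) - S1 + S2 (INR p)))
    (fun _ => / (a * INR (S N) + 1) + / (a * INR (S N) - 1))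
    (Rabs (C_alpha a - (S1 - S2'))) (/ (a * INR (S N) + 1) + / (a * INR (S N) - 1))).
  - exists 1%nat; intros p hp; apply b, INR_ge1, hp.
  - apply (is_lim_seq_abs _ (Finite _)).
    replace (C_alpha a - (S1 - S2')) with (C_alpha a - S1 + S2') by ring.
    apply is_lim_seq_plus'; [apply is_lim_seq_minus'; [|apply is_lim_seq_const]|].
    + apply is_lim_seq_eps; intros d hd; destruct (hlim d hd) as [X0 h].
      assert (hX : eventually (fun p => X0 <= INR p)).
      { destruct (INR_unbounded_mult 1 X0 Rlt_0_1) as [p0 hp0]; exists p0; intros p hp.
        apply le_INR in hp; lra. }
      revert hX; apply filter_imp; intros p hp; specialize (h _ hp); specialize (hle (INR p)).
      apply Rabs_def1; lra.
    + apply (is_lim_seq_ssum (fun p k => (-1) ^ k * ((1 - rpow (INR p) (1 - a * INR k)) / (a * INR k - 1)))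
        (fun k => (-1) ^ k * ((1 - 0) / (a * INR k - 1)))); intros k hk.
      apply is_lim_seq_mult'; [apply is_lim_seq_const|].
      apply is_lim_seq_mult'; [|apply is_lim_seq_const].
      apply is_lim_seq_minus'; [apply is_lim_seq_const|].
      assert (h := akb k hk).
      apply is_lim_seq_ext_loc with (fun p => Rpower (INR p) (- (a * INR k - 1))).
      * exists 1%nat; intros p hp; rewrite rpow_pos by (apply lt_0_INR; lia); f_equal; ring.
      * apply Rpower_neg_lim; lra.
  - apply is_lim_seq_const.
Qed.

Lemma C_alpha_csc (a : R) : 1 < a -> C_alpha a = PI / a * / sin (PI / a).
Proof.
  intros ha.
  assert (hz : 0 < / a < 1).
  { split; [apply Rinv_0_lt_compat; lra|rewrite <- Rinv_1; apply Rinv_lt_contravar; lra]. }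
  assert (l1 := csc_sum_limit (/ a) hz).
  assert (l2 : is_lim_seq (fun N => / a * csc_sum (/ a) N) (C_alpha a)).
  { apply is_lim_seq_ext with (fun N => C_alpha a + (/ a * csc_sum (/ a) N - C_alpha a)); [intros; ring|].
    replace (Finite (C_alpha a)) with (Finite (C_alpha a + 0)) by (f_equal; ring).
    apply is_lim_seq_plus'; [apply is_lim_seq_const|].
    apply is_lim_seq_Rabs_0 with (fun N => / (a * INR (S N) + 1) + / (a * INR (S N) - 1)).
    - exists 0%nat; intros N _; rewrite Rabs_minus_sym; now apply C_alpha_csc_sum.
    - replace (Finite 0) with (Finite (0 + 0)) by (f_equal; ring).
      assert (h : forall c, is_lim_seq (fun N => / (a * INR (S N) + c)) 0).
      { intros c; apply (is_lim_seq_inv _ p_infty); [|discriminate].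
        apply (is_lim_seq_plus _ _ p_infty c p_infty); [|apply is_lim_seq_const|reflexivity].
        apply (is_lim_seq_incr_1 (fun n => a * INR n)).
        apply is_lim_seq_le_p_loc with INR; [|apply is_lim_seq_INR].
        exists 0%nat; intros n _; assert (q := pos_INR n); nra. }
      apply is_lim_seq_plus'; [apply h|].
      apply is_lim_seq_ext with (fun N => / (a * INR (S N) + -1)); [intros; f_equal; ring|apply h]. }
  assert (l3 : is_lim_seq (fun N => sin (PI * / a) * csc_sum (/ a) N) (sin (PI * / a) * (a * C_alpha a))).
  { apply is_lim_seq_mult'; [apply is_lim_seq_const|].
    apply is_lim_seq_ext with (fun N => a * (/ a * csc_sum (/ a) N)); [intros; field; lra|].
    apply is_lim_seq_mult'; [apply is_lim_seq_const|easy]. }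
  assert (e : Finite PI = Finite (sin (PI * / a) * (a * C_alpha a))).
  { rewrite <- (is_lim_seq_unique _ _ l1); apply is_lim_seq_unique, l3. }
  injection e as e.
  assert (hpi := PI_RGT_0).
  assert (hs : 0 < sin (PI / a)).
  { apply sin_gt_0; [now apply Rdiv_lt_0_compat; lra|].
    apply Rlt_div_l; nra. }
  fold (PI / a) in e; apply Rmult_eq_reg_l with (a * sin (PI / a));
    [|apply Rgt_not_eq, Rmult_lt_0_compat; lra].
  transitivity PI; [rewrite e at 2; ring|field; lra].
Qed.

(** * The critical sample size *)

Lemma tau_1_gt1 (a : R) : 1 < a < 2 -> 1 < tau a 1.
Proof.
  intros ha; destruct (tau_spec a 1 ltac:(lra) Rlt_0_1) as [ht e].
  assert (h : 1 < Sj a 1 1).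
  { eapply Rlt_le_trans; [|apply (bsum_le_S1 a 1 13); lra].
    apply Rlt_le_trans with (ssum (fun i => / (1 + INR i * INR i)) 13).
    - rewrite !ssum_S, ssum_0; simpl INR; lra.
    - apply ssum_le; intros i hi; assert (h1 := INR_ge1 i ltac:(lia)).
      unfold bfun; rewrite Rmult_1_l; apply Rinv_le_contravar.
      + assert (h := rpow_ge0 (INR i) a); lra.
      + apply Rplus_le_compat_l; rewrite rpow_pos by lra.
        apply Rle_trans with (Rpower (INR i) 2); [apply Rle_Rpower; lra|].
        replace 2 with (1 + 1) by ring; rewrite Rpower_plus, Rpower_1; lra. }
  apply Rnot_le_lt; intros hle.
  destruct (Req_dec (tau a 1) 1) as [q|q]; [rewrite q in e; lra|].
  assert (d := S1_decr a (tau a 1) 1 ltac:(lra) ltac:(lra)); lra.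
Qed.

(** With tau_1 > 1 every term is at most 1 / (1 + tau_1) < 1/2, and the terms add up to 1, so the
    sum of their squares, gamma_1, is below 1/2. *)
Lemma q_1_pos (a : R) : 1 < a < 2 -> 0 < q_m a 1.
Proof.
  intros ha; assert (h := tau_1_gt1 a ha).
  destruct (tau_spec a 1 ltac:(lra) Rlt_0_1) as [ht e].
  assert (g := gamma_m_bounds a 1 ltac:(lra) Rlt_0_1).
  assert (hg : gamma_m a 1 < / 2).
  { rewrite gamma_m_eq; set (t := tau a 1) in *.
    assert (hb : / (1 + t) < / 2) by (apply Rinv_lt_contravar; lra).
    apply Rle_lt_trans with (/ (1 + t)); [|easy].
    replace (Sj a 2 t / 1) with (Sj a 2 t) by field.
    apply Rle_trans with (/ (1 + t) * Sj a 1 t); [|rewrite e; lra].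
    rewrite Sj_bfun_1, <- Series_scal_l.
    apply Series_le; [|apply (ex_series_scal_l (/ (1 + t)) (fun k => bfun a t (INR (S k)))),
      ex_series_bfun; lra].
    intros k; assert (b0 := bfun_pos a t (INR (S k)) ltac:(lra)).
    assert (b1 : bfun a t (INR (S k)) <= / (1 + t)).
    { apply Rinv_le_contravar; [lra|].
      assert (1 <= rpow (INR (S k)) a); [|nra].
      rewrite <- (rpow_1_l a); apply rpow_le; [lra|apply INR_ge1; lia]. }
    split; [apply pow2_ge_0|].
    rewrite <- Rsqr_pow2; apply Rmult_le_compat_r; lra. }
  unfold q_m; apply Rdiv_lt_0_compat; lra.
Qed.

(** * Limits as m tends to infinity *)

Lemma is_lim_p_infty (f : R -> R) (l : R) :
  (forall e, 0 < e -> exists M, forall m, M < m -> Rabs (f m - l) < e) -> is_lim f p_infty l.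
Proof. intros h; apply is_lim_spec; intros e; exact (h e (cond_pos e)). Qed.

Lemma tau_small (a e : R) : 1 < a -> 0 < e -> forall m, Sj a 1 e < m -> 0 < tau a m < e.
Proof.
  intros ha he m hm; assert (h := Sj_gt0 a e 0 ha he).
  split; [apply tau_spec; lra|].
  rewrite <- (tau_unique a e ha he); now apply tau_decr.
Qed.

Lemma m_root_tau_bounds (a m : R) : 1 < a -> 0 < m ->
  C_alpha a - rpow (tau a m) (/ a) <= m * rpow (tau a m) (/ a) <= C_alpha a.
Proof.
  intros ha hm; destruct (tau_spec a m ha hm) as [ht e].
  assert (u := S1_le a _ ha ht); assert (v := S1_ge a _ ha ht); rewrite e in u, v.
  set (r := rpow (tau a m) (/ a)); assert (hr : 0 < r) by now apply rpow_gt0.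
  assert (e1 : rpow (tau a m) (- / a) * r = 1).
  { unfold r; rewrite <- rpow_plus, Rplus_opp_l, rpow_pos, Rpower_O; lra. }
  set (r' := rpow (tau a m) (- / a)) in *.
  split.
  - apply (Rmult_le_compat_r r) in v; [|lra].
    replace ((r' * C_alpha a - 1) * r) with (r' * r * C_alpha a - r) in v by ring; rewrite e1 in v; lra.
  - apply (Rmult_le_compat_r r) in u; [|lra].
    replace (r' * C_alpha a * r) with (r' * r * C_alpha a) in u by ring; rewrite e1 in u; lra.
Qed.

Lemma lim_m_root_tau (a : R) : 1 < a -> is_lim (fun m => m * rpow (tau a m) (/ a)) p_infty (C_alpha a).
Proof.
  intros ha; apply is_lim_p_infty; intros e he.
  destruct (rpow_small (/ a) e) as [d [hd h]]; [apply Rinv_0_lt_compat; lra|easy|].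
  exists (Sj a 1 d); intros m hm.
  assert (h0 := Sj_gt0 a d 0 ha hd); destruct (tau_small a d ha hd m hm) as [t1 t2].
  assert (b := m_root_tau_bounds a m ha ltac:(lra)); specialize (h _ t2).
  apply Rabs_def1; lra.
Qed.

(** Split m tau as (m tau^(1/a)) tau^(1 - 1/a): a bounded factor times one that tends to 0 since
    [a > 1]. *)
Lemma lim_m_tau (a : R) : 1 < a -> is_lim (fun m => m * tau a m) p_infty 0.
Proof.
  intros ha; apply is_lim_p_infty; intros e he.
  destruct (C_alpha_spec a ha) as [hC _].
  assert (ia : / a < 1) by (rewrite <- Rinv_1; apply Rinv_lt_contravar; lra).
  destruct (rpow_small (1 - / a) (e / C_alpha a)) as [d [hd h]]; [lra|now apply Rdiv_lt_0_compat|].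
  exists (Sj a 1 d); intros m hm.
  assert (h0 := Sj_gt0 a d 0 ha hd); destruct (tau_small a d ha hd m hm) as [t1 t2].
  assert (b := m_root_tau_bounds a m ha ltac:(lra)); specialize (h _ t2).
  assert (e1 : tau a m = rpow (tau a m) (/ a) * rpow (tau a m) (1 - / a)).
  { rewrite <- rpow_plus; replace (/ a + (1 - / a)) with 1 by ring; rewrite rpow_1_r; lra. }
  rewrite Rminus_0_r, Rabs_pos_eq by (apply Rmult_le_pos; lra).
  rewrite e1, <- Rmult_assoc.
  apply Rle_lt_trans with (C_alpha a * rpow (tau a m) (1 - / a)).
  - apply Rmult_le_compat_r; [apply rpow_ge0|lra].
  - apply Rlt_div_r in h; [lra|easy].
Qed.

Lemma lim_q_m (a : R) : 1 < a -> is_lim (q_m a) p_infty (2 - a).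
Proof.
  intros ha.
  assert (l : is_lim (fun m => 1 - gamma_m a m) p_infty (/ a)).
  { apply is_lim_p_infty; intros e he; exists ((a / 4 + 1) / (a * e)); intros m hm.
    assert (hm0 : 0 < (a / 4 + 1) / (a * e)).
    { apply Rdiv_lt_0_compat; [lra|apply Rmult_lt_0_compat; lra]. }
    assert (h := one_sub_gamma_m a m ha ltac:(lra)).
    assert (h2 : (a / 4 + 1) / m < a * e).
    { apply Rlt_div_l; [lra|]; apply Rlt_div_l in hm; [lra|apply Rmult_lt_0_compat; lra]. }
    replace (1 - gamma_m a m - / a) with (/ a * (a * (1 - gamma_m a m) - 1)) by (field; lra).
    rewrite Rabs_mult, Rabs_pos_eq by (apply Rlt_le, Rinv_0_lt_compat; lra).
    apply Rmult_lt_reg_l with a; [lra|]; rewrite <- Rmult_assoc, Rinv_r; lra. }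
  apply is_lim_ext_loc with (fun m => 2 - / (1 - gamma_m a m)).
  - exists 0; intros m hm; symmetry; now apply q_m_alt.
  - replace (2 - a) with (2 - / / a) by (rewrite Rinv_inv; ring).
    apply (filterlim_comp _ _ _ (fun m => 1 - gamma_m a m) (fun x => 2 - / x) _ (locally (/ a))).
    + exact l.
    + assert (hc : continuous (fun x => 2 - / x) (/ a)); [|exact hc].
      assert (0 < / a) by (apply Rinv_0_lt_compat; lra); cont; lra.
Qed.

Lemma lim_G_m (a phin sigma2 : R) : 1 < a ->
  is_lim (G_m a phin sigma2) p_infty ((2 - a) * sigma2 * gamma_T a phin / (1 - gamma_T a phin)).
Proof.
  intros ha; unfold G_m, c_T.
  set (s := sigma2 * (gamma_T a phin / (1 - gamma_T a phin))).
  replace ((2 - a) * sigma2 * gamma_T a phin / (1 - gamma_T a phin)) with (- 0 + s * (2 - a))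
    by (unfold s, Rdiv; ring).
  apply is_lim_ext with (fun m => - (m * tau a m) + s * q_m a m); [intros; unfold s; ring|].
  apply (is_lim_plus _ _ _ (- 0) (s * (2 - a))).
  - apply (is_lim_opp _ _ 0), lim_m_tau, ha.
  - apply (is_lim_scal_l _ s _ (2 - a)), lim_q_m, ha.
  - reflexivity.
Qed.

(** [q_m] in the variable t = tau_m, where its continuity is visible. *)
Definition qf (a t : R) : R := (Sj a 1 t - 2 * Sj a 2 t) / (Sj a 1 t - Sj a 2 t).

Lemma q_m_qf (a m : R) : 1 < a -> 0 < m -> q_m a m = qf a (tau a m).
Proof.
  intros ha hm; destruct (tau_spec a m ha hm) as [ht e].
  assert (h := Sj_decr a (tau a m) 0 ha ht).
  unfold q_m, qf; rewrite gamma_m_eq, e in *; field; lra.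
Qed.

Lemma continuous_qf (a t : R) : 1 < a -> 0 < t -> continuous (qf a) t.
Proof.
  intros ha ht; assert (h := Sj_decr a t 0 ha ht); unfold qf.
  assert (c1 := continuous_Sj1 a t ha ht); assert (c2 := continuous_Sj2 a t ha ht).
  apply (cont_div (fun t => Sj a 1 t - 2 * Sj a 2 t)); [| |lra];
    [apply (cont_minus (Sj a 1)); [exact c1|]|now apply (cont_minus (Sj a 1))].
  apply (cont_mult (fun _ => 2)); [apply continuous_const|exact c2].
Qed.

(* Continuity in [m] is obtained by parametrising [m = Sj a 1 t]. *)
Lemma G_m_zero (a phin sigma2 m0 m1 : R) : 1 < a -> 0 < m0 <= m1 ->
  G_m a phin sigma2 m0 < 0 -> 0 < G_m a phin sigma2 m1 ->
  exists m, m0 < m /\ G_m a phin sigma2 m = 0.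
Proof.
  intros ha hm h0 h1.
  set (g := fun t => - (Sj a 1 t * t) + qf a t * sigma2 * c_T a phin).
  assert (eg : forall m, 0 < m -> G_m a phin sigma2 m = g (tau a m)).
  { intros m h; unfold G_m, g; rewrite q_m_qf by easy; destruct (tau_spec a m ha h) as [_ ->]; easy. }
  assert (gc : forall t, 0 < t -> continuous g t).
  { intros t ht; assert (c1 := continuous_Sj1 a t ha ht); assert (c2 := continuous_qf a t ha ht).
    apply (cont_plus (fun t => - (Sj a 1 t * t))); [apply cont_opp, (cont_mult (Sj a 1)); cont|].
    - exact c1.
    - apply (cont_mult (fun t => qf a t * sigma2)); [|apply continuous_const].
      apply (cont_mult (qf a)); [exact c2|apply continuous_const]. }
  assert (hne : m0 <> m1) by (intros ->; lra).
  destruct (tau_spec a m0 ha ltac:(lra)) as [t0 e0]; destruct (tau_spec a m1 ha ltac:(lra)) as [t1 e1].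
  assert (hd := tau_decr a m0 m1 ha ltac:(lra)).
  rewrite eg in h0, h1 by lra.
  destruct (IVT_zero g (tau a m1) (tau a m0)) as [t [ht e]]; [lra|intros; apply gc; lra|lra|].
  assert (t <> tau a m0) by (intros ->; lra).
  exists (Sj a 1 t); split.
  - rewrite <- e0 at 1; apply S1_decr; lra.
  - rewrite eg by (apply Sj_gt0; lra); rewrite tau_unique by lra; exact e.
Qed.

Lemma G_limit_pos (a phin sigma2 : R) : 1 < a < 2 -> 1 < phin -> 0 < sigma2 ->
  0 < (2 - a) * sigma2 * gamma_T a phin / (1 - gamma_T a phin).
Proof.
  intros ha hn hs; assert (g := gamma_T_bounds a phin ltac:(lra) hn).
  apply Rdiv_lt_0_compat; [|lra].
  apply Rmult_lt_0_compat; [apply Rmult_lt_0_compat|]; lra.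
Qed.

Lemma G_m_eventually_pos (a phin sigma2 m0 : R) : 1 < a < 2 -> 1 < phin -> 0 < sigma2 ->
  exists m1, m0 <= m1 /\ 0 < G_m a phin sigma2 m1.
Proof.
  intros ha hn hs; assert (g := gamma_T_bounds a phin ltac:(lra) hn).
  assert (l := lim_G_m a phin sigma2 ltac:(lra)); apply is_lim_spec in l.
  set (L := (2 - a) * sigma2 * gamma_T a phin / (1 - gamma_T a phin)) in *.
  assert (hL : 0 < L) by now apply G_limit_pos.
  destruct (l (mkposreal L hL)) as [M h]; simpl in h.
  exists (Rmax m0 (M + 1)); split; [apply Rmax_l|].
  assert (q := Rmax_r m0 (M + 1)); specialize (h (Rmax m0 (M + 1)) ltac:(lra)).
  apply Rabs_def2 in h; lra.
Qed.

(** In the variable t = tau_m, the derivative of t S_1(t) is S_2(t) > 0. *)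
Lemma m_tau_decr (a m m' : R) : 1 < a -> 0 < m <= m' -> m' * tau a m' <= m * tau a m.
Proof.
  intros ha h; destruct (Req_dec m m') as [->|hne]; [lra|].
  destruct (tau_spec a m ha ltac:(lra)) as [t0 e0]; destruct (tau_spec a m' ha ltac:(lra)) as [t1 e1].
  assert (hd := tau_decr a m m' ha ltac:(lra)).
  rewrite <- e0 at 1; rewrite <- e1 at 1; rewrite !(Rmult_comm (Sj _ _ _)).
  apply (incr_of_derive (fun t => t * Sj a 1 t) (fun t => Sj a 2 t)); [lra| |].
  - intros t ht; evar_last.
    + apply (is_derive_mult (fun t => t) (Sj a 1)); [apply is_derive_id|apply is_derive_S1; lra|].
      intros; apply Rmult_comm.
    + unfold plus, mult, one; simpl; field; lra.
  - intros t ht; apply Rlt_le, Sj_gt0; lra.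
Qed.

(** With delta = 1 - gamma, gamma^2 (2 - gamma) = gamma (1 - delta^2), and [S2_sub_S3_le] gives eta
    >= gamma (1 - 1 / (2 a)) - c2 / m. Hence K <= gamma (1 / (2 a) - delta^2) + c2 / m, a bound with
    limit -(a - 1)(2 - a) / (2 a^3), negative for 1 < a < 2. *)
Lemma admissible_exists (a : R) : 1 < a < 2 -> exists M, admissible_M a M.
Proof.
  intros ha.
  set (c1 := a / 4 + 1); set (c2 := (1 + 2 * a) / (2 * a)).
  (* [d1] keeps delta above 1/2 and 1 / (2 a) - delta^2 at most half its negative limit; [d2] keeps
     gamma above half its limit 1 - 1 / a; [d3], the absolute value of the product of these halves,
     absorbs c2 / m. *)
  set (d1 := (2 - a) / 8); set (d2 := (a - 1) / 2); set (d3 := (a - 1) * (2 - a) / (8 * a ^ 3)).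
  assert (p2 : 0 < c2) by (unfold c2; apply Rdiv_lt_0_compat; lra).
  assert (p3 : 0 < d3).
  { unfold d3; apply Rdiv_lt_0_compat; [apply Rmult_lt_0_compat; lra|].
    apply Rmult_lt_0_compat; [lra|apply pow_lt; lra]. }
  assert (q1 : 0 < c1 / d1) by (unfold c1, d1; apply Rdiv_lt_0_compat; lra).
  assert (q2 : 0 < c1 / d2) by (unfold c1, d2; apply Rdiv_lt_0_compat; lra).
  assert (q3 : 0 < c2 / d3) by (apply Rdiv_lt_0_compat; lra).
  exists (1 + c1 / d1 + c1 / d2 + c2 / d3); split; [lra|]; intros m hm.
  assert (hm0 : 0 < m) by lra.
  assert (r1 : c1 / m <= d1) by (apply Rle_div_l; [lra|]; assert (h : c1 / d1 <= m) by lra;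
    apply Rle_div_l in h; unfold d1 in *; lra).
  assert (r2 : c1 / m <= d2) by (apply Rle_div_l; [lra|]; assert (h : c1 / d2 <= m) by lra;
    apply Rle_div_l in h; unfold d2 in *; lra).
  assert (r3 : c2 / m < d3) by (apply Rlt_div_l; [lra|]; assert (h : c2 / d3 < m) by lra;
    apply Rlt_div_l in h; lra).
  assert (G := one_sub_gamma_m a m ltac:(lra) hm0); fold c1 in G.
  assert (g := gamma_m_bounds a m ltac:(lra) hm0).
  destruct (tau_spec a m ltac:(lra) hm0) as [ht e].
  assert (S3 := S2_sub_S3_le a (tau a m) ltac:(lra) ht).
  assert (E2 : Sj a 2 (tau a m) = m * gamma_m a m) by (rewrite gamma_m_eq; field; lra).
  assert (E3 : Sj a 3 (tau a m) = m * eta_m a m) by (rewrite eta_m_eq; field; lra).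
  rewrite E2, E3 in S3.
  set (gm := gamma_m a m) in *; set (et := eta_m a m) in *.
  apply Rabs_le_between in G.
  set (de := 1 - gm) in *.
  assert (ep : 0 < c1 / m) by (apply Rdiv_lt_0_compat; unfold c1; lra).
  set (eps := c1 / m) in *.
  assert (hde : (1 - eps) / a <= de <= (1 + eps) / a) by (split; [apply Rle_div_l|apply Rle_div_r]; lra).
  assert (hde2 : / 2 < de).
  { apply Rlt_le_trans with ((1 - eps) / a); [|easy]; apply Rlt_div_r; unfold d1 in r1; lra. }
  split.
  - unfold q_m; fold gm; apply Rdiv_lt_0_compat; unfold de in *; lra.
  - unfold K_m; fold gm; fold et.
    assert (het : gm * (1 - / (2 * a)) - c2 / m <= et).
    { apply Rmult_le_reg_l with (2 * a * m); [apply Rmult_lt_0_compat; lra|].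
      replace (2 * a * m * (gm * (1 - / (2 * a)) - c2 / m)) with
        (2 * a * (m * gm) - m * gm - (1 + 2 * a)) by (unfold c2; field; lra).
      lra. }
    assert (hsq : ((1 - eps) / a) ^ 2 <= de ^ 2).
    { apply pow_incr; split; [|easy]; apply Rle_mult_inv_pos; unfold d1 in r1; lra. }
    assert (hsq2 : (1 - 2 * eps) / a ^ 2 <= ((1 - eps) / a) ^ 2).
    { unfold Rdiv; rewrite Rpow_mult_distr, pow_inv.
      apply Rmult_le_compat_r; [apply Rlt_le, Rinv_0_lt_compat, pow_lt; lra|nra]. }
    assert (hbr : / (2 * a) - de ^ 2 <= - ((2 - a) / (4 * a ^ 2))).
    { apply Rle_trans with (/ (2 * a) - (1 - 2 * eps) / a ^ 2); [lra|].
      replace (/ (2 * a) - (1 - 2 * eps) / a ^ 2) with ((a - 2 + 4 * eps) / (2 * a ^ 2)) by (field; lra).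
      replace (- ((2 - a) / (4 * a ^ 2))) with ((- (2 - a) / 2) / (2 * a ^ 2)) by (field; lra).
      apply Rmult_le_compat_r; [apply Rlt_le, Rinv_0_lt_compat, Rmult_lt_0_compat;
        [lra|apply pow_lt; lra]|unfold d1 in r1; lra]. }
    assert (hgm : (a - 1) / (2 * a) <= gm).
    { assert (h : de <= (1 + eps) / a) by easy.
      assert ((1 + eps) / a <= 1 - (a - 1) / (2 * a)); [|unfold de in *; lra].
      replace (1 - (a - 1) / (2 * a)) with (((a + 1) / 2) / a) by (field; lra).
      apply Rmult_le_compat_r; [apply Rlt_le, Rinv_0_lt_compat; lra|unfold d2 in r2; lra]. }
    assert (h1 : gm * (/ (2 * a) - de ^ 2) <= - d3).
    { assert (0 < (2 - a) / (4 * a ^ 2)).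
      { apply Rdiv_lt_0_compat; [lra|apply Rmult_lt_0_compat; [lra|apply pow_lt; lra]]. }
      apply Rle_trans with (gm * - ((2 - a) / (4 * a ^ 2))); [apply Rmult_le_compat_l; lra|].
      replace (- d3) with ((a - 1) / (2 * a) * - ((2 - a) / (4 * a ^ 2))) by (unfold d3; field; lra).
      nra. }
    replace (gm ^ 2 * (2 - gm) - et) with
      (gm * (/ (2 * a) - de ^ 2) + (gm * (1 - / (2 * a)) - et)) by (unfold de; ring).
    lra.
Qed.

(** In t = tau_m the ratio is H(t), and H' has the sign of S_3 S_1^2 - S_2^2 (2 S_1 - S_2) = - m^3
    K_m > 0, where m = S_1(t). As [tau] decreases in [m], so does the ratio. *)
Lemma ratio_decr (a M m m' : R) : 1 < a -> admissible_M a M -> M <= m < m' ->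
  m' * tau a m' / q_m a m' < m * tau a m / q_m a m.
Proof.
  intros ha [hM adm] h.
  destruct (tau_spec a m ha ltac:(lra)) as [t0 e0]; destruct (tau_spec a m' ha ltac:(lra)) as [t1 e1].
  assert (hd := tau_decr a m m' ha ltac:(lra)).
  set (H := fun t => t * Sj a 1 t * (Sj a 1 t - Sj a 2 t) / (Sj a 1 t - 2 * Sj a 2 t)).
  assert (sg : forall t, 0 < t <= tau a m -> 0 < Sj a 1 t - 2 * Sj a 2 t /\
     0 < Sj a 3 t * Sj a 1 t ^ 2 - Sj a 2 t ^ 2 * (2 * Sj a 1 t - Sj a 2 t)).
  { intros t ht; set (x := Sj a 1 t).
    assert (hx : m <= x).
    { rewrite <- e0; unfold x; destruct (Req_dec t (tau a m)) as [->|]; [lra|].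
      apply Rlt_le, S1_decr; lra. }
    assert (ex : tau a x = t) by (apply tau_unique; lra).
    destruct (adm x ltac:(lra)) as [k1 k2].
    assert (s1 := Sj_decr a t 0 ha ltac:(lra)); fold x in s1.
    split.
    - rewrite q_m_qf in k1 by lra; unfold qf in k1; rewrite ex in k1; fold x in k1.
      apply Rnot_le_lt; intros hle.
      assert ((x - 2 * Sj a 2 t) / (x - Sj a 2 t) <= 0) by (apply Rle_div_l; lra); lra.
    - unfold K_m in k2; rewrite gamma_m_eq, eta_m_eq, ex in k2.
      apply Rmult_lt_compat_r with (r := x ^ 3) in k2; [|apply pow_lt; lra].
      replace (((Sj a 2 t / x) ^ 2 * (2 - Sj a 2 t / x) - Sj a 3 t / x) * x ^ 3) with
        (Sj a 2 t ^ 2 * (2 * x - Sj a 2 t) - Sj a 3 t * x ^ 2) in k2 by (field; lra).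
      lra. }
  set (dH := fun t => 2 * (Sj a 3 t * Sj a 1 t ^ 2 - Sj a 2 t ^ 2 * (2 * Sj a 1 t - Sj a 2 t))
     / (Sj a 1 t - 2 * Sj a 2 t) ^ 2).
  assert (der : forall t, 0 < t <= tau a m -> is_derive H t (dH t)).
  { intros t ht; destruct (sg t ht) as [b1 _]; unfold H.
    assert (d1 := is_derive_S1 a t ha ltac:(lra)); assert (d2 := is_derive_S2 a t ha ltac:(lra)).
    apply is_derive_Reals in d1; apply is_derive_Reals in d2.
    evar_last.
    - apply is_derive_Reals.
      apply (derivable_pt_lim_div (fun t => t * Sj a 1 t * (Sj a 1 t - Sj a 2 t))
        (fun t => Sj a 1 t - 2 * Sj a 2 t)).
      + apply (derivable_pt_lim_mult (fun t => t * Sj a 1 t) (fun t => Sj a 1 t - Sj a 2 t)).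
        * apply (derivable_pt_lim_mult (fun t => t) (Sj a 1)); [apply derivable_pt_lim_id|exact d1].
        * apply (derivable_pt_lim_minus (Sj a 1) (Sj a 2)); [exact d1|exact d2].
      + apply (derivable_pt_lim_minus (Sj a 1) (fun t => 2 * Sj a 2 t)); [exact d1|].
        apply (derivable_pt_lim_scal (Sj a 2)); exact d2.
      + lra.
    - unfold dH, Rsqr; field; lra. }
  assert (eH : forall m, M <= m -> 0 < m -> m * tau a m / q_m a m = H (tau a m)).
  { intros x hx hx0; destruct (tau_spec a x ha hx0) as [q1 q2].
    assert (s1 := Sj_decr a (tau a x) 0 ha q1); destruct (adm x hx) as [k1 _].
    rewrite q_m_qf in * by lra; unfold qf, H in *; rewrite q2 in *.
    assert (x - 2 * Sj a 2 (tau a x) <> 0).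
    { intros z; rewrite z in k1; unfold Rdiv in k1; rewrite Rmult_0_l in k1; lra. }
    field; lra. }
  rewrite !eH by lra.
  destruct (MVT_gen H (tau a m') (tau a m) dH) as [c [hc E]].
  - rewrite Rmin_left, Rmax_right by lra; intros; apply der; lra.
  - rewrite Rmin_left, Rmax_right by lra; intros; apply continuous_continuity_pt.
    apply (ex_derive_continuous (K:=R_AbsRing) (V:=R_NormedModule)); eexists; apply der; lra.
  - rewrite Rmin_left, Rmax_right in hc by lra.
    destruct (sg c ltac:(lra)) as [b1 b2].
    assert (0 < dH c) by (apply Rdiv_lt_0_compat; [lra|apply pow_lt; lra]).
    nra.
Qed.

(** Up to [M] the bounds q_m < 1 and m tau_m >= M tau_M > sigma^2 c_T suffice. This is the origin of
    the threshold M tau_M / c_T. *)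
Lemma G_m_neg_before (a phin sigma2 M m : R) : 1 < a -> 1 < phin -> 0 < m <= M ->
  0 < sigma2 < M * tau a M / c_T a phin -> G_m a phin sigma2 m < 0.
Proof.
  intros ha hn hm hs; assert (hc := c_T_pos a phin ltac:(lra) hn).
  assert (h1 := m_tau_decr a m M ha hm); assert (h2 := q_m_lt1 a m ha ltac:(lra)).
  destruct hs as [hs0 hs]; apply Rlt_div_r in hs; [|easy].
  assert (0 < sigma2 * c_T a phin) by now apply Rmult_lt_0_compat.
  unfold G_m; nra.
Qed.

Lemma G_m_sign_after (a phin sigma2 M m : R) : 1 < a -> admissible_M a M -> M <= m ->
  G_m a phin sigma2 m = q_m a m * (sigma2 * c_T a phin - m * tau a m / q_m a m) /\ 0 < q_m a m.
Proof.
  intros ha [hM adm] hm; destruct (adm m hm) as [k _]; split; [|easy].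
  unfold G_m; field; lra.
Qed.

(** Up to [M] there is no zero; beyond it the sign of [G_m] is that of sigma^2 c_T minus a strictly
    decreasing ratio, which changes at most once. *)
Lemma HP_zero (a phin M sigma2 : R) : 1 < a < 2 -> 1 < phin -> admissible_M a M ->
  0 < sigma2 < M * tau a M / c_T a phin ->
  exists m, unique (fun m => 1 < m /\ G_m a phin sigma2 m = 0) m /\
    forall m', m < m' -> 0 < G_m a phin sigma2 m'.
Proof.
  intros ha hn adm hs; assert (hM := proj1 adm).
  destruct (G_m_eventually_pos a phin sigma2 M ha hn ltac:(lra)) as [m1 [hm1 h1]].
  assert (h0 := G_m_neg_before a phin sigma2 M M ltac:(lra) hn ltac:(lra) hs).
  destruct (G_m_zero a phin sigma2 M m1 ltac:(lra) ltac:(lra) h0 h1) as [m [hm e]].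
  assert (after : forall m', m < m' -> 0 < G_m a phin sigma2 m').
  { intros m' h'.
    destruct (G_m_sign_after a phin sigma2 M m ltac:(lra) adm ltac:(lra)) as [E q].
    destruct (G_m_sign_after a phin sigma2 M m' ltac:(lra) adm ltac:(lra)) as [E' q'].
    assert (d := ratio_decr a M m m' ltac:(lra) adm ltac:(lra)).
    rewrite E in e; apply Rmult_integral in e; rewrite E'; apply Rmult_lt_0_compat; [easy|].
    destruct e; lra. }
  exists m; split; [|easy]; split; [split; [lra|easy]|].
  intros m' [h' e'].
  destruct (Rle_dec m' M) as [hle|hgt].
  - assert (h := G_m_neg_before a phin sigma2 M m' ltac:(lra) hn ltac:(lra) hs); lra.
  - destruct (Rtotal_order m m') as [h|[h|h]]; [|easy|].
    + specialize (after m' h); lra.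
    + destruct (G_m_sign_after a phin sigma2 M m ltac:(lra) adm ltac:(lra)) as [E q].
      destruct (G_m_sign_after a phin sigma2 M m' ltac:(lra) adm ltac:(lra)) as [E' q'].
      assert (d := ratio_decr a M m' m ltac:(lra) adm ltac:(lra)).
      rewrite E in e; rewrite E' in e'.
      apply Rmult_integral in e; apply Rmult_integral in e'; destruct e, e'; lra.
Qed.

(* On the zero set of [G_m] this is the ratio of [m] to its claimed equivalent. *)
Lemma lim_HP_ratio (a : R) : 1 < a < 2 ->
  is_lim (fun m => rpow (rpow (m * rpow (tau a m) (/ a) / C_alpha a) a * ((2 - a) / q_m a m)) (/ (a - 1)))
    p_infty 1.
Proof.
  intros ha; destruct (C_alpha_spec a ltac:(lra)) as [hC _].
  assert (comp : forall (f g : R -> R) (l : R), is_lim f p_infty l -> continuous g l ->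
    is_lim (fun m => g (f m)) p_infty (g l)).
  { intros f g l hf hg; exact (filterlim_comp _ _ _ f g _ _ _ hf hg). }
  assert (i0 : 0 < / (a - 1)) by (apply Rinv_0_lt_compat; lra).
  assert (l1 : is_lim (fun m => rpow (m * rpow (tau a m) (/ a) / C_alpha a) a) p_infty 1).
  { rewrite <- (rpow_1_l a); replace 1 with (C_alpha a / C_alpha a) by (field; lra).
    apply (comp (fun m => m * rpow (tau a m) (/ a)) (fun x => rpow (x / C_alpha a) a)).
    - apply lim_m_root_tau; lra.
    - cont; lra. }
  assert (l2 : is_lim (fun m => (2 - a) / q_m a m) p_infty 1).
  { replace 1 with ((2 - a) / (2 - a)) by (field; lra).
    apply (comp (q_m a) (fun x => (2 - a) / x)); [apply lim_q_m; lra|cont; lra]. }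
  replace (Finite 1) with (Finite (rpow 1 (/ (a - 1)))) by now rewrite rpow_1_l.
  apply (comp (fun m => rpow (m * rpow (tau a m) (/ a) / C_alpha a) a * ((2 - a) / q_m a m))
    (fun x => rpow x (/ (a - 1)))); [|cont].
  replace (Finite 1) with (Rbar_mult 1 1) by (simpl; f_equal; ring).
  now apply is_lim_mult.
Qed.

(** On the zero set m tau = q s with s = sigma^2 c_T, so (m tau^(1/a))^a = m^(a - 1) m tau = m^(a -
    1) q s; then q cancels, and the power 1 / (a - 1) isolates m. *)
Lemma HP_ratio_eq (a phin sigma2 m : R) : 1 < a < 2 -> 1 < phin -> 0 < sigma2 -> 0 < m ->
  0 < q_m a m -> G_m a phin sigma2 m = 0 ->
  rpow (rpow (m * rpow (tau a m) (/ a) / C_alpha a) a * ((2 - a) / q_m a m)) (/ (a - 1)) =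
  m / Rpower (c_alpha a * (1 - gamma_T a phin) / ((2 - a) * sigma2 * gamma_T a phin)) (/ (a - 1)).
Proof.
  intros ha hn hs hm hq e.
  destruct (C_alpha_spec a ltac:(lra)) as [hC _].
  destruct (tau_spec a m ltac:(lra) hm) as [ht _].
  assert (g := gamma_T_bounds a phin ltac:(lra) hn).
  set (s := sigma2 * c_T a phin).
  assert (hsp : 0 < s) by (apply Rmult_lt_0_compat; [easy|apply c_T_pos; lra]).
  assert (e1 : m * tau a m = q_m a m * s) by (unfold G_m in e; unfold s; lra).
  assert (ec : c_alpha a = Rpower (C_alpha a) a) by (unfold c_alpha; rewrite C_alpha_csc by lra; easy).
  assert (eb : c_alpha a * (1 - gamma_T a phin) / ((2 - a) * sigma2 * gamma_T a phin)
    = Rpower (C_alpha a) a / ((2 - a) * s)).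
  { rewrite ec; unfold s, c_T; field; lra. }
  rewrite eb.
  assert (hCa := Rpower_pos (C_alpha a) a).
  set (B := Rpower (C_alpha a) a / ((2 - a) * s)).
  assert (hB : 0 < B) by (apply Rdiv_lt_0_compat; [easy|apply Rmult_lt_0_compat; lra]).
  assert (ex : rpow (m * rpow (tau a m) (/ a) / C_alpha a) a * ((2 - a) / q_m a m)
     = Rpower m (a - 1) / B).
  { assert (hr : 0 < rpow (tau a m) (/ a)) by now apply rpow_gt0.
    unfold Rdiv at 1; rewrite !rpow_mult_l by
      (try apply Rmult_le_pos; try apply Rlt_le, Rinv_0_lt_compat; lra).
    rewrite (rpow_pos (rpow (tau a m) (/ a))) by easy.
    rewrite (rpow_pos (tau a m)), Rpower_mult by easy.
    replace (/ a * a) with 1 by (field; lra); rewrite Rpower_1 by easy.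
    assert (ei : rpow (/ C_alpha a) a = / Rpower (C_alpha a) a).
    { rewrite rpow_pos by now apply Rinv_0_lt_compat.
      rewrite <- Rpower_Ropp; unfold Rpower; rewrite ln_Rinv by easy; f_equal; ring. }
    assert (em : rpow m a = Rpower m (a - 1) * m).
    { rewrite rpow_pos by easy; rewrite <- (Rpower_1 m) at 3 by easy.
      rewrite <- Rpower_plus; f_equal; ring. }
    rewrite ei, em; replace (Rpower m (a - 1) * m * tau a m) with (Rpower m (a - 1) * (m * tau a m)) by ring.
    rewrite e1; unfold B; field; repeat split; lra. }
  rewrite ex.
  assert (hma := Rpower_pos m (a - 1)).
  rewrite rpow_pos by now apply Rdiv_lt_0_compat.
  unfold Rdiv; rewrite <- Rpower_mult_distr by (try apply Rinv_0_lt_compat; lra).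
  rewrite Rpower_mult, Rinv_r, Rpower_1 by lra; f_equal.
  rewrite <- Rpower_Ropp; unfold Rpower; rewrite ln_Rinv by easy; f_equal; ring.
Qed.

Lemma HP_threshold_admissible (a phin M : R) : 1 < a < 2 -> 1 < phin -> admissible_M a M ->
  HP_threshold a phin (M * tau a M / c_T a phin).
Proof.
  intros ha hn adm; assert (hM := proj1 adm).
  assert (hc := c_T_pos a phin ltac:(lra) hn).
  destruct (tau_spec a M ltac:(lra) ltac:(lra)) as [ht _].
  destruct (tau_spec a 1 ltac:(lra) Rlt_0_1) as [ht1 _].
  assert (q0 := q_1_pos a ha); assert (q1 := q_m_lt1 a 1 ltac:(lra) Rlt_0_1).
  assert (hmt : 0 < M * tau a M) by (apply Rmult_lt_0_compat; lra).
  split.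
  - split; [now apply Rdiv_lt_0_compat|].
    (* The threshold lies below [sigma_c2] because M tau_M <= tau_1 < tau_1 / q_1, using 0 < q_1 <
       1. *)
    assert (d := m_tau_decr a 1 M ltac:(lra) ltac:(lra)); rewrite Rmult_1_l in d.
    unfold sigma_c2; apply Rlt_div_l; [easy|].
    replace (tau a 1 / (c_T a phin * q_m a 1) * c_T a phin) with (tau a 1 / q_m a 1) by (field; lra).
    eapply Rle_lt_trans; [exact d|]; apply Rlt_div_r; [easy|nra].
  - set (P := fun sigma2 m => unique (fun m => 1 < m /\ G_m a phin sigma2 m = 0) m /\
      forall m', m < m' -> 0 < G_m a phin sigma2 m').
    (* One choice for each noise level; only its values on the interval from 0 to the threshold,
       where [P] is solvable, matter for the limit at 0. *)
    set (m_HP := fun sigma2 => solution (P sigma2)).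
    assert (spec : forall sigma2, 0 < sigma2 < M * tau a M / c_T a phin -> P sigma2 (m_HP sigma2)).
    { intros sigma2 hs; apply solution_spec; now apply (HP_zero a phin M). }
    clearbody m_HP; exists m_HP; split; [exact spec|].
    assert (after : forall sigma2, 0 < sigma2 < M * tau a M / c_T a phin -> M < m_HP sigma2).
    { intros sigma2 hs; apply Rnot_le_lt; intros hle.
      destruct (spec sigma2 hs) as [[[h1 h2] _] _].
      assert (h := G_m_neg_before a phin sigma2 M (m_HP sigma2) ltac:(lra) hn ltac:(lra) hs).
      lra. }
    (* For any bound B', a noise level below B' tau_{B'} / c_T makes [G_m] negative on (0, B'], so
       the zero lies beyond B'; the limit in [m] then transfers to a limit in [sigma2]. *)
    assert (linf : filterlim m_HP (at_right 0) (Rbar_locally' p_infty)).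
    { intros Q [B hB].
      set (B' := Rmax B M).
      assert (hB' : B <= B' /\ M <= B') by (split; [apply Rmax_l|apply Rmax_r]).
      destruct (tau_spec a B' ltac:(lra) ltac:(lra)) as [hb _].
      assert (hp : 0 < B' * tau a B' / c_T a phin).
      { apply Rdiv_lt_0_compat; [apply Rmult_lt_0_compat; lra|easy]. }
      exists (mkposreal _ hp); intros y hy hy0.
      unfold ball in hy; simpl in hy; unfold AbsRing_ball, abs, minus, plus, opp in hy; simpl in hy.
      apply Rabs_def2 in hy.
      assert (d := m_tau_decr a M B' ltac:(lra) ltac:(lra)).
      assert (hy1 : y < M * tau a M / c_T a phin).
      { apply Rlt_le_trans with (B' * tau a B' / c_T a phin); [lra|].
        apply Rmult_le_compat_r; [apply Rlt_le, Rinv_0_lt_compat; lra|easy]. }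
      apply hB; apply Rle_lt_trans with B'; [easy|].
      apply Rnot_le_lt; intros hle.
      assert (ha' := after y (conj hy0 hy1)).
      assert (h := G_m_neg_before a phin y B' (m_HP y) ltac:(lra) hn ltac:(lra) ltac:(split; lra)).
      destruct (spec y (conj hy0 hy1)) as [[[_ h2] _] _]; lra. }
    apply filterlim_ext_loc with (fun sigma2 =>
      (fun m => rpow (rpow (m * rpow (tau a m) (/ a) / C_alpha a) a * ((2 - a) / q_m a m)) (/ (a - 1)))
      (m_HP sigma2)).
    + assert (hp : 0 < M * tau a M / c_T a phin) by now apply Rdiv_lt_0_compat.
      exists (mkposreal _ hp); intros y hy hy0.
      unfold ball in hy; simpl in hy; unfold AbsRing_ball, abs, minus, plus, opp in hy; simpl in hy.
      apply Rabs_def2 in hy.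
      assert (hr : 0 < y < M * tau a M / c_T a phin) by lra.
      assert (ha' := after y hr); destruct (spec y hr) as [[[_ h2] _] _].
      apply HP_ratio_eq; try easy; try lra.
      apply (proj2 adm); lra.
    + exact (filterlim_comp _ _ _ m_HP _ _ _ _ linf (lim_HP_ratio a ha)).
Qed.

Lemma G_1_neg (a phin sigma2 : R) : 1 < a < 2 -> 1 < phin -> 0 < sigma2 ->
  sigma2 < sigma_c2 a phin -> G_m a phin sigma2 1 < 0.
Proof.
  intros ha hn hs h; assert (hc := c_T_pos a phin ltac:(lra) hn); assert (q0 := q_1_pos a ha).
  unfold sigma_c2 in h; apply Rlt_div_r in h; [|now apply Rmult_lt_0_compat].
  unfold G_m; lra.
Qed.

Theorem theorem4p4 (alpha phin : R)
    (halpha : 1 < alpha <= 5 / 2) (hphin : 1 < phin) :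
  (alpha <= 2 ->
     forall (sigma2 : R) (n m : nat -> nat) (phim : R),
       0 < sigma2 -> teacher_sizes n phin ->
       1 < phim -> student_sizes m phim ->
       exists L : R,
         is_lim_seq (fun p => W2SG_p alpha sigma2 p (n p) (m p)) L /\ 0 < L)
  /\
  (2 < alpha <= 1 + sqrt 2 ->
     forall sigma2 : R, 0 < sigma2 ->
     exists phi_crit : R,
       1 < phi_crit /\
       (exists s_crit : R,
          unique (fun s => 0 < s /\ J alpha phin s = 0) s_crit /\
          phi_crit = / F alpha s_crit) /\
       (forall n : nat -> nat, teacher_sizes n phin ->
          unique (critical_ratio alpha sigma2 n) phi_crit))
  /\
  (forall (sigma2 : R) (n : nat -> nat) (m : nat),
     0 < sigma2 -> teacher_sizes n phin -> (1 <= m)%nat ->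
     is_lim_seq (fun p => W2SG_p alpha sigma2 p (n p) m)
       (G_m alpha phin sigma2 (INR m)))
  /\
  (alpha < 2 ->
     (forall sigma2 : R, 0 < sigma2 ->
        (sigma2 < sigma_c2 alpha phin -> G_m alpha phin sigma2 1 < 0) /\
        is_lim (G_m alpha phin sigma2) p_infty
          ((2 - alpha) * sigma2 * gamma_T alpha phin
             / (1 - gamma_T alpha phin)) /\
        0 < (2 - alpha) * sigma2 * gamma_T alpha phin
              / (1 - gamma_T alpha phin) /\
        (sigma2 < sigma_c2 alpha phin ->
           exists m_star : R, 1 < m_star /\ G_m alpha phin sigma2 m_star = 0))
     /\
     (exists sigma02 : R, HP_threshold alpha phin sigma02)
     /\
     (exists M : R, admissible_M alpha M)
     /\
     (forall M : R, admissible_M alpha M ->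
        HP_threshold alpha phin (M * tau alpha M / c_T alpha phin)))
  /\
  (2 < alpha ->
     forall sigma2 : R, 0 < sigma2 -> sigma2 <= sigma_safe2 alpha phin ->
     forall m : nat, (1 <= m)%nat -> G_m alpha phin sigma2 (INR m) <= 0).
Proof.
  split; [intros ha; apply proportional_gain_pos; lra|].
  split; [intros ha; now apply proportional_critical|].
  split; [intros; apply fixed_limit; easy || lra|].
  split; [|intros; apply safe_gain; easy || lra].
  intros ha2; assert (ha : 1 < alpha < 2) by lra.
  split; [intros sigma2 hs; split; [|split; [|split]]|split; [|split]].
  - intros h; now apply G_1_neg.
  - apply lim_G_m; lra.
  - now apply G_limit_pos.
  - intros h; assert (h1 := G_1_neg alpha phin sigma2 ha hphin hs h).
    destruct (G_m_eventually_pos alpha phin sigma2 1 ha hphin hs) as [m1 [hm h2]].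
    now apply (G_m_zero alpha phin sigma2 1 m1 ltac:(lra) ltac:(lra)).
  - destruct (admissible_exists alpha ha) as [M adm].
    exists (M * tau alpha M / c_T alpha phin); now apply HP_threshold_admissible.
  - now apply admissible_exists.
  - intros M adm; now apply HP_threshold_admissible.
Qed.
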